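(* Let $h\colon[n]\to[n]$ be a Hessenberg function, $\lambda_1<\cdots<\lambda_n$ real numbers, $\Lambda=\operatorname{diag}(\lambda_1,\ldots,\lambda_n)$, and $T=T^n$. For the manifold $X_h$ of isospectral staircase matrices and the semisimple Hessenberg variety $Y_h$ the following hold. (1) The orbit spaces are homeomorphic, $X_h/T\cong Y_h/T$; moreover, the homeomorphism can be chosen to preserve the orbit type filtration. (2) The unlabeled GKM-graphs of the GKM-manifolds $X_h$ and $Y_h$ coincide (are isomorphic as graphs). (3) The equivariant cohomology rings are isomorphic as graded rings: $H^*_T(X_h;\mathbb{Z})\cong H^*_T(Y_h;\mathbb{Z})$. (4) The Betti numbers of $X_h$ and $Y_h$ coincide: $H^{2i}(X_h;\mathbb{Z})\cong H^{2i}(Y_h;\mathbb{Z})$ for all $i$.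
   Context: $[n]=\{1,\ldots,n\}$. A Hessenberg function is a function $h\colon[n]\to[n]$ with $h(i)\ge i$ for all $i$ and $h(i+1)\ge h(i)$ for $1\le i\le n-1$. $T^n$ is the compact torus of diagonal unitary $n\times n$ matrices. $M_h$ is the real vector space of Hermitian $n\times n$ matrices $A=(a_{ij})$ with $a_{ij}=0$ whenever $j>h(i)$ or $i>h(j)$; $M_\lambda$ is the set of Hermitian $n\times n$ matrices with spectrum $\{\lambda_1,\ldots,\lambda_n\}$; $X_h=M_h\cap M_\lambda$ is a smooth manifold, on which $T^n$ acts by conjugation $A\mapsto DAD^{-1}$. $\mathrm{Fl}_n$ is the variety of complete flags $V_\bullet=(V_0\subset V_1\subset\cdots\subset V_n)$ in $\mathbb{C}^n$, $\dim V_i=i$. $Y_h=\{V_\bullet\in\mathrm{Fl}_n\mid \Lambda V_i\subseteq V_{h(i)}\text{ for all } i\}$. It is a smooth variety, and $T^n$ acts on it via its standard action on $\mathbb{C}^n$. The orbit type filtration of the orbit space is the filtration by dimension of orbits: its $k$-th term consists of the orbits of dimension at most $k$. Both $X_h$ and $Y_h$ are GKM-manifolds with respect to these actions. In particular, they have finitely many fixed points and the union of all orbits of dimension at most one consists of the fixed points together with $T$-invariant 2-spheres, each joining two fixed points. The unlabeled GKM-graph has the fixed points as vertices, with an edge between two fixed points whenever they are joined by a $T$-invariant 2-sphere (consisting of orbits of dimension at most one). $H^*_T(X)=H^*(X\times_T ET)$ is Borel equivariant cohomology. *)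

(* Defs.v *)
From HB Require Import structures.
From mathcomp Require Import all_boot all_order all_algebra.
From mathcomp Require Import generic_quotient ring_quotient complex zify ring.
From mathcomp Require Import all_classical all_reals topology normedtype trigo.

Set Implicit Arguments.
Unset Strict Implicit.
Unset Printing Implicit Defensive.

Import Order.TTheory GRing.Theory Num.Theory.
Import numFieldNormedType.Exports.

Local Open Scope classical_set_scope.
Local Open Scope complex_scope.
Local Open Scope sesquilinear_scope.
Local Open Scope quotient_scope.
Local Open Scope ring_scope.

(* [R[i]] carries the topology of its norm. *)
HB.instance Definition _ (R : realType) := NormedModule.copy R[i] R[i]^o.

Definition homeomorphism (X Y : topologicalType) (f : X -> Y) : Prop :=
  continuous f /\ exists g : Y -> X, [/\ cancel f g, cancel g f & continuous g].

Definition std_simplex (R : realType) (k : nat) : set 'rV[R]_k.+1 :=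
  [set t | (forall i, 0 <= t ord0 i) /\ \sum_i t ord0 i = 1].
Arguments std_simplex : clear implicits.

Section StandardSimplex.
Variable R : realType.
Local Notation std_simplex := (std_simplex R).

Lemma push_subproof p q (f : 'I_p.+1 -> 'I_q.+1) (t : std_simplex p) :
  (\row_j \sum_(i | f i == j) val t ord0 i) \in std_simplex q.
Proof.
have [t0 t1] := set_mem (valP t); apply/mem_set; split.
  by move=> j; rewrite mxE sumr_ge0.
rewrite -[RHS]t1 [RHS](partition_big f xpredT) //=.
by apply: eq_bigr => j _; rewrite mxE.
Qed.

(* The affine map sending the [i]-th vertex to the [f i]-th vertex. *)
Definition push p q (f : 'I_p.+1 -> 'I_q.+1) (t : std_simplex p) :
  std_simplex q :=
  @exist _ (fun u => u \in std_simplex q) _ (push_subproof f t).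

Lemma push_comp p q r (g : 'I_q.+1 -> 'I_r.+1) (f : 'I_p.+1 -> 'I_q.+1) t :
  push g (push f t) = push (g \o f) t.
Proof.
apply/val_inj/rowP => j /=; rewrite !mxE.
under eq_bigr do rewrite mxE.
rewrite [RHS](partition_big f (fun i => g i == j)) //=.
apply: eq_bigr => i /eqP gi; apply: eq_bigl => k.
by case: eqP => [->|]; rewrite ?gi ?eqxx ?andbF.
Qed.

Lemma push_continuous p q (f : 'I_p.+1 -> 'I_q.+1) : continuous (push f).
Proof.
apply/continuousP => _ [B oB <-].
pose F (u : 'rV[R]_p.+1) : 'rV[R]_q.+1 := \row_j \sum_(i | f i == j) u ord0 i.
rewrite -[_ @^-1` _]/((F \o set_val) @^-1` B).
suff cF : continuous F.
  apply: open_comp => // t _.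
  by apply: continuous_comp; [exact: initial_continuous | exact: cF].
move=> t U [P tP PU].
have c j : continuous (fun u : 'rV[R]_p.+1 => \sum_(i | f i == j) u ord0 i).
  apply: continuous_big => [|i _]; first exact: add_continuous.
  exact: coord_continuous.
pose Q (j : 'I_q.+1) : set 'rV[R]_p.+1 :=
  [set u | P ord0 j (\sum_(i | f i == j) u ord0 i)].
have : nbhs t (fun u => forall j, Q j u).
  apply: (@filter_forall _ _ Q (nbhs t)) => j; apply: (c j t).
  by have := tP ord0 j; rewrite mxE.
apply: filterS => u Pu; apply: PU => i j; rewrite mxE (ord1 i); exact: Pu.
Qed.
HB.instance Definition _ p q f :=
  isContinuous.Build _ _ (push f) (@push_continuous p q f).

End StandardSimplex.

Section SingularCohomology.
Variables (R : realType) (X : topologicalType).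

Definition simplex k := continuousType (std_simplex R k) X.

Definition restr p q (f : 'I_p.+1 -> 'I_q.+1) (s : simplex q) : simplex p :=
  (s : std_simplex R q -> X) \o push f.

Lemma restr_comp p q r (g : 'I_q.+1 -> 'I_r.+1) (f : 'I_p.+1 -> 'I_q.+1) s :
  restr f (restr g s) = restr (g \o f) s.
Proof. by apply/continuousEP => t /=; rewrite push_comp. Qed.

Definition cochain k := simplex k -> int.
HB.instance Definition _ k := GRing.Zmodule.on (cochain k).

Definition coboundary k (a : cochain k) : cochain k.+1 :=
  fun s => \sum_(i < k.+2) (-1) ^+ i * a (restr (lift i) s).

Lemma coboundary_is_zmod k : zmod_morphism (@coboundary k).
Proof.
move=> a b; apply/funext => s.
transitivity (coboundary a s - coboundary b s) => //.
by rewrite -sumrB; apply: eq_bigr => i _; rewrite -mulrBr.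
Qed.
HB.instance Definition _ k :=
  GRing.isZmodMorphism.Build _ _ (@coboundary k) (@coboundary_is_zmod k).

(* The value on [s] of the cup product of [a] and [b] is [a] on the front      *)
(* [k]-face of [s] times [b] on its back [l]-face. Only [m = k + l] is         *)
(* meaningful; [m] is kept free because [k + l.+1] and [(k + l).+1] are not    *)
(* convertible.                                                                *)
Definition cup_cochain k l m (a : cochain k) (b : cochain l) : cochain m :=
  fun s => a (restr (fun i => inord i) s) *
           b (restr (fun i => inord (m - l + i)) s).
Arguments cup_cochain [k l] m a b s.

Lemma cup_cochainBl k l m (a a' : cochain k) (b : cochain l) :
  cup_cochain m (a - a') b = cup_cochain m a b - cup_cochain m a' b.
Proof. by apply/funext => s; rewrite /cup_cochain mulrBl. Qed.

Lemma cup_cochainBr k l m (a : cochain k) (b b' : cochain l) :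
  cup_cochain m a (b - b') = cup_cochain m a b - cup_cochain m a b'.
Proof. by apply/funext => s; rewrite /cup_cochain mulrBr. Qed.

Lemma coboundary_cup k l m (a : cochain k) (b : cochain l) s :
  m = (k + l)%N ->
  coboundary (cup_cochain m a b) s =
    cup_cochain m.+1 (coboundary a) b s +
    (-1) ^+ k * cup_cochain m.+1 a (coboundary b) s.
Proof.
move=> mE.
pose A i := a (restr (fun x : 'I_k.+1 => inord (bump i x)) s).
pose B j := b (restr (fun x : 'I_l.+1 => inord (k + bump j x)) s).
have vi p (x : 'I_p.+2) : inord x = x by exact: inord_val.
have -> : cup_cochain m.+1 (coboundary a) b s =
    (\sum_(i < k.+2) (-1) ^+ i * A i) * B 0%N.
  congr (_ * b (restr _ s)); last first.
    by apply/funext => x; congr inord; rewrite mE -addSn addnK addSnnS.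
  by apply: eq_bigr => i _; rewrite restr_comp.
have -> : cup_cochain m.+1 a (coboundary b) s =
    A k.+1 * \sum_(j < l.+2) (-1) ^+ j * B j.
  congr (a (restr _ s) * _).
    by apply/funext => x; congr inord; rewrite /bump leqNgt ltn_ord.
  apply: eq_bigr => j _; rewrite restr_comp; congr (_ * b (restr _ s)).
  by apply/funext => x /=; rewrite mE -addnS addnK.
have -> : coboundary (cup_cochain m a b) s =
    \sum_(i < k.+1) (-1) ^+ i * (A i * B 0%N) +
    \sum_(j < l.+1) (-1) ^+ (k.+1 + j) * (A k.+1 * B j.+1).
  pose G i := (-1) ^+ i * ((if (i <= k)%N then A i else A k.+1) *
                           B (i - k)%N).
  transitivity (\sum_(i < m.+2) G i).
    apply: eq_bigr => i _; rewrite /G /cup_cochain !restr_comp.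
    congr (_ * (_ * b (restr _ s))).
      case: ifPn => ik; congr (a (restr _ s)); apply/funext => x;
        apply/val_inj; have xk := ltn_ord x.
      - by rewrite /= !inordK // /bump; lia.
      - by rewrite /= !inordK // /bump; lia.
    apply/funext => x; apply/val_inj; have xl := ltn_ord x.
    by have := ltn_ord i; rewrite /= !inordK // /bump; lia.
  rewrite -(big_mkord xpredT G) (@big_cat_nat _ _ _ k.+1) //=; last by lia.
  congr (_ + _).
    rewrite big_mkord; apply: eq_bigr => i _.
    have ik : (i <= k)%N by rewrite -ltnS.
    by rewrite /G ik (eqP (_ : i - k == 0)%N) // subn_eq0.
  rewrite -{1}[k.+1]add0n big_addn (_ : m.+2 - k.+1 = l.+1)%N; last by lia.
  rewrite big_mkord; apply: eq_bigr => j _; rewrite /G [(j + k.+1)%N]addnC.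
  have -> : (k.+1 + j <= k)%N = false by lia.
  by have -> : (k.+1 + j - k = j.+1)%N by lia.
rewrite [\sum_(i < k.+2) _]big_ord_recr [\sum_(j < l.+2) _]big_ord_recl /=.
rewrite mulrDl !mulrDr.
rewrite -!addrA; congr (_ + _).
  by rewrite mulr_suml; apply: eq_bigr => i _; rewrite mulrA.
rewrite !mulr_sumr addrA [X in X + _](_ : _ = 0) ?add0r; last first.
  by rewrite expr0 mul1r exprS; ring.
apply: eq_bigr => j _; rewrite /bump leq0n add1n /= !exprS exprD; ring.
Qed.

Definition is_cocycle k : {pred cochain k} := [pred a | coboundary a == 0].
Lemma is_cocycle_zmod k : zmod_closed (@is_cocycle k).
Proof.
split=> [|a b /eqP a0 /eqP b0]; apply/eqP; first by rewrite raddf0.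
by rewrite raddfB /= a0 b0 subrr.
Qed.
HB.instance Definition _ k :=
  GRing.isZmodClosed.Build _ (@is_cocycle k) (@is_cocycle_zmod k).

Record cocycle k :=
  Cocycle { cocycle_val :> cochain k; _ : cocycle_val \in @is_cocycle k }.
HB.instance Definition _ k := [isSub for @cocycle_val k].
HB.instance Definition _ k := [Choice of cocycle k by <:].
HB.instance Definition _ k := [SubChoice_isSubZmodule of cocycle k by <:].

Definition is_coboundary k : {pred cocycle k} :=
  match k return {pred cocycle k} with
  | 0 => [pred z | z == 0]
  | k'.+1 => [pred z | `[< exists a : cochain k', val z = coboundary a >]]
  end.
Lemma is_coboundary_zmod k : zmod_closed (@is_coboundary k).
Proof.
case: k => [|k]; split=> [|x y].
- exact/eqP.
- by move=> /eqP -> /eqP ->; apply/eqP; rewrite subrr.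
- by apply/asboolP; exists 0; rewrite !raddf0.
move=> /asboolP[a xa] /asboolP[b yb]; apply/asboolP; exists (a - b).
by rewrite !raddfB /= xa yb.
Qed.
HB.instance Definition _ k :=
  GRing.isZmodClosed.Build _ (@is_coboundary k) (@is_coboundary_zmod k).

Definition cohomology k := Quotient.quot (@is_coboundary k).
HB.instance Definition _ k := GRing.Zmodule.on (cohomology k).

Lemma cup_cocycle_subproof k l (a : cocycle k) (b : cocycle l) :
  cup_cochain (k + l) a b \in @is_cocycle (k + l).
Proof.
case: a b => [a /= /eqP a0] [b /= /eqP b0]; apply/eqP.
apply/funext => s.
by rewrite coboundary_cup// a0 b0 /cup_cochain mulr0 mul0r mulr0.
Qed.
Definition cup_cocycle k l (a : cocycle k) (b : cocycle l) : cocycle (k + l) :=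
  Cocycle (cup_cocycle_subproof a b).

Lemma one_cocycle_subproof : (fun=> 1) \in @is_cocycle 0.
Proof.
apply/eqP/funext => s.
by rewrite /coboundary !big_ord_recl big_ord0 /= expr0 expr1 !mulr1 addr0 subrr.
Qed.

Definition cohomology1 : cohomology 0 :=
  \pi_(cohomology 0) (Cocycle one_cocycle_subproof).
Definition cup k l (x : cohomology k) (y : cohomology l) : cohomology (k + l) :=
  \pi_(cohomology (k + l)) (cup_cocycle (repr x) (repr y)).

Lemma cup_coboundary k l (a : cocycle k) (b : cocycle l) :
  a \in @is_coboundary k \/ b \in @is_coboundary l ->
  cup_cocycle a b \in @is_coboundary (k + l).
Proof.
have aux m m' (F : forall m, cochain m) (z : cocycle m) c : m = m'.+1 ->
    val z = F m -> F m'.+1 = coboundary c -> z \in @is_coboundary m.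
  by move=> mE; subst m => zF Fc; apply/asboolP; exists c; rewrite zF.
case: a b => [a a0] [b b0]; case=> [|].
  case: k a a0 => [|k] a a0 /=.
    move=> /eqP[az]; suff -> : cup_cocycle (Cocycle a0) (Cocycle b0) = 0.
      by rewrite rpred0.
    by apply/val_inj/funext => s /=; rewrite /cup_cochain az mul0r.
  move=> /asboolP[c /= ac]; apply/asboolP; exists (cup_cochain (k + l) c b).
  apply/funext => s; rewrite coboundary_cup// (eqP b0) /= ac.
  by rewrite [X in _ + _ * X](_ : _ = 0) ?mulr0 ?addr0// /cup_cochain mulr0.
case: l b b0 => [|l] b b0 /=.
  move=> /eqP[bz]; suff -> : cup_cocycle (Cocycle a0) (Cocycle b0) = 0.
    by rewrite rpred0.
  by apply/val_inj/funext => s /=; rewrite /cup_cochain bz mulr0.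
move=> /asboolP[c /= bc].
apply: (aux _ (k + l)%N (fun m => cup_cochain m a b) _
  (cup_cochain (k + l) (fun s => (-1) ^+ k * a s) c)) => //.
  by rewrite addnS.
have sa0 : coboundary (fun s => (-1) ^+ k * a s) = 0.
  apply/funext => s; transitivity ((-1) ^+ k * coboundary a s).
    by rewrite mulr_sumr; apply: eq_bigr => i _; rewrite mulrCA.
  by rewrite (eqP a0) mulr0.
apply/funext => s; rewrite coboundary_cup// sa0 bc.
by rewrite /cup_cochain mul0r add0r !mulrA -expr2 sqrr_sign mul1r.
Qed.

Lemma pi_cup k l (a : cocycle k) (b : cocycle l) :
  cup (\pi_(cohomology k) a) (\pi_(cohomology l) b) =
  \pi_(cohomology (k + l)) (cup_cocycle a b).
Proof.
rewrite /cup; apply/eqP; rewrite -Quotient.idealrBE.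
set a' := repr _; set b' := repr _.
have a'a : a' - a \in @is_coboundary k by rewrite Quotient.idealrBE reprK.
have b'b : b' - b \in @is_coboundary l by rewrite Quotient.idealrBE reprK.
rewrite (_ : _ - _ = cup_cocycle (a' - a) b' + cup_cocycle a (b' - b)).
  by rewrite rpredD// cup_coboundary//; [left | right].
apply/val_inj/funext => s.
pose u := val a' (restr (fun i => inord i) s).
pose x := val a (restr (fun i => inord i) s).
pose v := val b' (restr (fun i => inord (k + l - l + i)) s).
pose y := val b (restr (fun i => inord (k + l - l + i)) s).
transitivity (u * v - x * y) => //.
transitivity ((u - x) * v + x * (v - y)) => //.
by ring.
Qed.

End SingularCohomology.
Arguments cohomology : clear implicits.
Arguments cohomology1 : clear implicits.

Definition graded_ring_iso (R : realType) (X Y : topologicalType)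
    (phi : forall k, {additive cohomology R X k -> cohomology R Y k}) : Prop :=
  [/\ forall k, bijective (phi k),
      phi 0%N (cohomology1 R X) = cohomology1 R Y &
      forall k l (x : cohomology R X k) (y : cohomology R X l),
        phi (k + l)%N (cup x y) = cup (phi k x) (phi l y)].

(* A topological space with an action of the abstract group [G]. *)
Record gspace (G : groupType) := GSpace {
  gspace_top :> topologicalType;
  gact : G -> gspace_top -> gspace_top;
  gact1 : forall x, gact 1%g x = x;
  gactM : forall g g' x, gact (g * g')%g x = gact g (gact g' x)
}.
Arguments gact {G X} g x : rename.

Section GSpaces.
Variable G : groupType.
Implicit Types X Y : gspace G.

Definition invariant X (A : set X) : Prop :=
  forall (g : G) x, A x -> A (gact g x).

Section SubGSpace.
Variables (X : gspace G) (A : set X) (invA : invariant A).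

Definition sub_gact (g : G) (x : A) : A :=
  @exist _ (fun y => y \in A) (gact g (val x))
    (mem_set (invA g (set_mem (valP x)))).
Lemma sub_gact1 x : sub_gact 1%g x = x.
Proof. by apply/val_inj; rewrite /= gact1. Qed.
Lemma sub_gactM g g' x : sub_gact (g * g')%g x = sub_gact g (sub_gact g' x).
Proof. by apply/val_inj; rewrite /= gactM. Qed.
Definition sub_gspace : gspace G := GSpace sub_gact1 sub_gactM.
End SubGSpace.

Section ProdGSpace.
Variables X Y : gspace G.
Definition prod_gact (g : G) (p : X * Y) : X * Y := (gact g p.1, gact g p.2).
Lemma prod_gact1 p : prod_gact 1%g p = p.
Proof. by case: p => x y; rewrite /prod_gact !gact1. Qed.
Lemma prod_gactM g g' p : prod_gact (g * g')%g p = prod_gact g (prod_gact g' p).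
Proof. by rewrite /prod_gact !gactM. Qed.
Definition prod_gspace : gspace G := GSpace prod_gact1 prod_gactM.
End ProdGSpace.

Section OrbitSpace.
Variable X : gspace G.

Definition same_orbit : rel X := fun x y => `[< exists g : G, gact g x = y >].
Lemma same_orbit_refl : reflexive same_orbit.
Proof. by move=> x; apply/asboolP; exists 1%g; rewrite gact1. Qed.
Lemma same_orbit_sym : symmetric same_orbit.
Proof.
move=> x y; apply/asboolP/asboolP => -[g <-]; exists g^-1%g;
  by rewrite -gactM mulVg gact1.
Qed.
Lemma same_orbit_trans : transitive same_orbit.
Proof.
move=> y x z /asboolP[g <-] /asboolP[g' <-]; apply/asboolP.
by exists (g' * g)%g; rewrite gactM.
Qed.
Canonical orbit_equiv :=
  EquivRel same_orbit same_orbit_refl same_orbit_sym same_orbit_trans.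
Definition orbit_space : topologicalType :=
  quotient_topology {eq_quot same_orbit}.
Definition orbit_of (x : X) : orbit_space := \pi_{eq_quot same_orbit} x.

Definition fixed_points : set X := [set x | forall g : G, gact g x = x].
End OrbitSpace.

End GSpaces.
Arguments fixed_points [G] X.

Section Torus.
Variables (R : realType) (n : nat).
Local Notation C := R[i].

Record torus := Torus {
  torus_mx :> 'M[C]_n;
  torusP : is_diag_mx torus_mx && (torus_mx \is unitarymx)
}.
HB.instance Definition _ := [isSub for torus_mx].
HB.instance Definition _ := [Choice of torus by <:].

Lemma torus_offdiag (D : torus) i j : i != j -> torus_mx D i j = 0.
Proof. by case/andP: (torusP D) => /is_diag_mxP dD _ /dD. Qed.

Lemma torus_unit (D : torus) : torus_mx D \in unitmx.
Proof. by case/andP: (torusP D) => _ /unitarymx_unit. Qed.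

Lemma torus1_subproof :
  is_diag_mx (1%:M : 'M[C]_n) && ((1%:M : 'M[C]_n) \is unitarymx).
Proof.
by rewrite scalar_mx_is_diag; apply/unitarymxP; rewrite trmx1 map_mx1 mulmx1.
Qed.

Lemma torusM_subproof (D D' : torus) :
  is_diag_mx (torus_mx D *m D') && (torus_mx D *m D' \is unitarymx).
Proof.
case/andP: (torusP D) (torusP D') => _ uD /andP[_ uD'].
rewrite mul_unitarymx// andbT; apply/is_diag_mxP => i j ij.
rewrite mxE big1// => k _; have [<-|ik] := eqVneq i k.
  by rewrite [X in _ * X]torus_offdiag ?mulr0.
by rewrite torus_offdiag ?mul0r//.
Qed.

Lemma torusV_subproof (D : torus) :
  is_diag_mx (invmx (torus_mx D)) && (invmx (torus_mx D) \is unitarymx).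
Proof.
case/andP: (torusP D) => _ uD.
rewrite invmx_unitary// trmxC_unitary uD andbT; apply/is_diag_mxP => i j ij.
by rewrite !mxE torus_offdiag ?rmorph0// eq_sym.
Qed.

Definition torus1 := Torus torus1_subproof.
Definition torusM D D' := Torus (torusM_subproof D D').
Definition torusV D := Torus (torusV_subproof D).

Lemma torusMA : associative torusM.
Proof. by move=> D D' D''; apply/val_inj; rewrite /= mulmxA. Qed.
Lemma torus1M : left_id torus1 torusM.
Proof. by move=> D; apply/val_inj; rewrite /= mul1mx. Qed.
Lemma torusM1 : right_id torus1 torusM.
Proof. by move=> D; apply/val_inj; rewrite /= mulmx1. Qed.
Lemma torusVM : left_inverse torus1 torusV torusM.
Proof. by move=> D; apply/val_inj; rewrite /= mulVmx// torus_unit. Qed.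
Lemma torusMV : right_inverse torus1 torusV torusM.
Proof. by move=> D; apply/val_inj; rewrite /= mulmxV// torus_unit. Qed.
HB.instance Definition _ :=
  isGroup.Build torus torusMA torus1M torusM1 torusVM torusMV.

Lemma torus_exp_subproof (theta : 'rV[R]_n) :
  let D : 'M[C]_n :=
    diag_mx (\row_j (cos (theta ord0 j) +i* sin (theta ord0 j))) in
  is_diag_mx D && (D \is unitarymx).
Proof.
rewrite /= diag_mx_is_diag; apply/unitarymxP/matrixP => i j.
rewrite mul_diag_mx !mxE eq_sym; case: eqP => [->|_]; last first.
  by rewrite mulr0n rmorph0 mulr0.
rewrite !mulr1n; apply/eqP; rewrite eq_complex /=; apply/andP; split; apply/eqP.
  by rewrite mulrN opprK -!expr2 cos2Dsin2.
by rewrite mulrN mulrC addrC subrr.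
Qed.
Definition torus_exp (theta : 'rV[R]_n) : torus :=
  Torus (torus_exp_subproof theta).

Section OrbitDimension.
Variable X : gspace torus.

(* The Lie algebra of the stabilizer of [x], inside Lie(T^n) = R^n. *)
Definition stab_lie (x : X) : set 'rV[R]_n :=
  [set theta | forall s : R, gact (torus_exp (s *: theta)) x = x].

(* The largest number of linearly independent elements of [stab_lie x]. *)
Definition stab_dim (x : X) : nat :=
  \max_(d < n.+1 | `[< exists B : 'M[R]_(d, n),
                        row_free B /\ forall i, stab_lie x (row i B) >]) d.

(* The orbit of [x] is T^n modulo the stabilizer of [x]. *)
Definition orbit_dim (x : X) : nat := n - stab_dim x.

Definition orbit_filtration (k : nat) : set (orbit_space X) :=
  [set orbit_of x | x in [set x : X | (orbit_dim x <= k)%N]].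

Definition sphere2 : set 'rV[R]_3 := [set u | \sum_i u ord0 i ^+ 2 = 1].

Definition gkm_vertex : Type := fixed_points X.

Definition gkm_edge (p q : gkm_vertex) : Prop :=
  p <> q /\ exists S : set X,
    [/\ invariant S,
        exists f : sphere2 -> S, homeomorphism f,
        forall x, S x -> (orbit_dim x <= 1)%N &
        S `&` fixed_points X = [set val p; val q]].
End OrbitDimension.

(* The total space of a universal principal T^n-bundle: the n-fold product of  *)
(* the unit sphere of finitely supported complex sequences, an element being   *)
(* written as the sequence of its terms in C^n. On this sphere the topology of *)
(* pointwise convergence is that of Milnor's infinite join of circles.         *)
Definition seq_gact (D : torus) (e : {ptws nat -> 'cV[C]_n}) :
  {ptws nat -> 'cV[C]_n} := fun k => torus_mx D *m e k.
Lemma seq_gact1 e : seq_gact 1%g e = e.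
Proof. by apply/funext => k; rewrite /seq_gact mul1mx. Qed.
Lemma seq_gactM D D' e : seq_gact (D * D')%g e = seq_gact D (seq_gact D' e).
Proof. by apply/funext => k; rewrite /seq_gact mulmxA. Qed.
Definition seq_gspace : gspace torus := GSpace seq_gact1 seq_gactM.

Definition ET_set : set seq_gspace :=
  [set e : nat -> 'cV[C]_n | exists N,
    (forall k, (N <= k)%N -> e k = 0) /\
    (forall j, \sum_(k < N) `|e k j ord0| ^+ 2 = 1)].

Lemma torus_mulE (D : torus) (v : 'cV[C]_n) j :
  (torus_mx D *m v) j ord0 = D j j * v j ord0.
Proof.
rewrite mxE (bigD1 j)//= big1 ?addr0// => k kj.
by rewrite torus_offdiag ?mul0r// eq_sym.
Qed.

Lemma torus_norm (D : torus) j : `|D j j| = 1.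
Proof.
case/andP: (torusP D) => _ /unitarymxP/matrixP/(_ j j).
rewrite !mxE (bigD1 j)//= big1 ?addr0 => [|k kj]; last first.
  by rewrite torus_offdiag ?mul0r// eq_sym.
rewrite !mxE eqxx -normCK => /eqP; rewrite sqrp_eq1 ?normr_ge0// => /eqP.
exact.
Qed.

Lemma ET_invariant : invariant ET_set.
Proof.
move=> D e [N [e0 e1]]; exists N; split=> [k Nk|j].
  by rewrite /= /seq_gact e0// mulmx0.
rewrite -[RHS](e1 j); apply: eq_bigr => k _.
by rewrite /= /seq_gact torus_mulE normrM torus_norm mul1r.
Qed.
Definition ET : gspace torus := sub_gspace ET_invariant.

(* X x_T ET *)
Definition borel_construction (X : gspace torus) : topologicalType :=
  orbit_space (prod_gspace X ET).

Definition mx_gact (D : torus) (A : 'M[C]_n) : 'M[C]_n :=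
  torus_mx D *m A *m invmx (torus_mx D).
Lemma mx_gact1 A : mx_gact 1%g A = A.
Proof. by rewrite /mx_gact mul1mx /= invmx1 mulmx1. Qed.
Lemma mx_gactM D D' A : mx_gact (D * D')%g A = mx_gact D (mx_gact D' A).
Proof.
have VM : invmx (torus_mx D *m D') = invmx (torus_mx D') *m invmx (torus_mx D).
  have E : torusV (torusM D D') = torusM (torusV D') (torusV D) := invgM D D'.
  exact: (congr1 torus_mx E).
by rewrite /mx_gact /= VM !mulmxA.
Qed.
Definition mx_gspace : gspace torus := GSpace mx_gact1 mx_gactM.

(* [n] = {1, ..., n} is indexed from 0: [h : 'I_n -> 'I_n] encodes             *)
(* i + 1 |-> h i + 1.                                                          *)
Definition hessenberg (h : 'I_n -> 'I_n) : Prop :=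
  (forall i : 'I_n, (i <= h i)%N) /\
  (forall i j : 'I_n, j = i.+1 :> nat -> (h i <= h j)%N).

Definition staircase_mx (h : 'I_n -> 'I_n) : set 'M[C]_n :=
  [set A | A \is hermsymmx /\
    forall i j : 'I_n, (h i < j)%N || (h j < i)%N -> A i j = 0].

Definition isospectral_mx (lam : 'I_n -> R) : set 'M[C]_n :=
  [set A | A \is hermsymmx /\
    forall a : C, eigenvalue A a <-> exists i, a = (lam i)%:C].

Definition staircase_set h lam : set mx_gspace :=
  staircase_mx h `&` isospectral_mx lam.

Lemma mx_gact_hermitian D A : A \is hermsymmx -> mx_gact D A \is hermsymmx.
Proof.
case/andP: (torusP D) => _ uD; rewrite /mx_gact invmx_unitary//.
rewrite !is_hermitianmxE !expr0 !scale1r => /eqP hA.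
by rewrite !trmx_mul !map_mxM /= trmxCK -hA mulmxA.
Qed.

Lemma mx_gactE D A i j : mx_gact D A i j = D i i * A i j * (D j j)^*.
Proof.
case/andP: (torusP D) => _ uD; rewrite /mx_gact invmx_unitary//.
rewrite mxE (bigD1 j)//= big1 ?addr0 => [|k kj]; last first.
  by rewrite !mxE torus_offdiag ?rmorph0 ?mulr0// eq_sym.
rewrite !mxE (bigD1 i)//= big1 ?addr0// => k ki.
by rewrite torus_offdiag ?mul0r// eq_sym.
Qed.

Lemma mx_gact_eigenvalue D A a : eigenvalue A a -> eigenvalue (mx_gact D A) a.
Proof.
have uD := torus_unit D.
move=> /eigenvalueP[v vA v0]; apply/eigenvalueP.
exists (v *m invmx (torus_mx D)).
  by rewrite /mx_gact !mulmxA mulmxKV// vA scalemxAl.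
apply: contra v0 => /eqP v0; apply/eqP.
by rewrite -(mulmxKV uD v) v0 mul0mx.
Qed.

Lemma staircase_invariant h lam : invariant (staircase_set h lam).
Proof.
move=> D A [[hA zA] [_ sA]]; split; split; try exact: mx_gact_hermitian.
  by move=> i j ij; rewrite /= mx_gactE zA// mulr0 mul0r.
move=> a; rewrite -sA; split; last exact: mx_gact_eigenvalue.
move=> /(@mx_gact_eigenvalue D^-1%g (mx_gact D A)).
by rewrite -mx_gactM mulVg mx_gact1.
Qed.
Definition isospectral_staircase h lam : gspace torus :=
  sub_gspace (@staircase_invariant h lam).

Definition is_flag (V : {ffun 'I_n.+1 -> {vspace 'cV[C]_n}}) : bool :=
  [forall i : 'I_n.+1, \dim (V i) == i] &&
  [forall i : 'I_n, (V (widen_ord (leqnSn n) i) <= V (lift ord0 i))%VS].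

Record flag := Flag {
  flag_val :> {ffun 'I_n.+1 -> {vspace 'cV[C]_n}};
  flagP : is_flag flag_val
}.
HB.instance Definition _ := [isSub for flag_val].
HB.instance Definition _ := [Choice of flag by <:].

Definition GL : set 'M[C]_n := [set g | g \in unitmx].

Lemma flag_of_subproof (g : GL) :
  is_flag [ffun i : 'I_n.+1 =>
    <<[seq col j (val g) | j : 'I_n <- enum 'I_n & (j < i)%N]>>%VS].
Proof.
have gu : val g \in unitmx by exact: set_mem (valP g).
pose c := [seq col j (val g) | j <- enum 'I_n].
have cfull : <<c>>%VS = fullv.
  apply/eqP; rewrite eqEsubv subvf /=; apply/subvP => v _.
  rewrite -(mulKVmx gu v); set w := invmx _ *m v.
  have -> : val g *m w = \sum_j w j ord0 *: col j (val g).
    apply/colP => i; rewrite mxE summxE; apply: eq_bigr => j _.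
    by rewrite !mxE mulrC.
  by apply: memv_suml => j _; apply/memvZ/memv_span/map_f; rewrite mem_enum.
have cfree : free c.
  by rewrite /free cfull dimvf size_map size_enum_ord /dim /= muln1.
apply/andP; split; apply/forallP => i; rewrite !ffunE.
  pose ci := [seq col j (val g) | j : 'I_n <- enum 'I_n & (j < i)%N].
  have /eqP -> : free ci.
    pose P (j : 'I_n) := (j < i)%N.
    apply: (@catl_free _ _ [seq col j (val g) | j <- enum 'I_n & predC P j]).
    by rewrite -map_cat (perm_free (perm_map _ (permEl (perm_filterC P _)))).
  rewrite size_map size_filter -sum1_count big_enum_cond /=.
  rewrite -(big_ord_widen n (fun=> 1%N)) ?sum_nat_const ?card_ord ?muln1//.
  by rewrite -ltnS.
apply: sub_span => _ /mapP[j + ->]; rewrite mem_filter => /andP[/= ji _].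
by apply: map_f; rewrite mem_filter mem_enum /= /bump /= add1n ltnS ltnW.
Qed.
Definition flag_of (g : GL) : flag := Flag (flag_of_subproof g).

(* The flag variety has the quotient topology from GL_n. *)
Definition flag_open (A : set flag) : Prop := open (flag_of @^-1` A).
Lemma flag_openT : flag_open setT.
Proof. by rewrite /flag_open preimage_setT; exact: openT. Qed.
Lemma flag_openI : setI_closed flag_open.
Proof. by move=> A B; exact: openI. Qed.
Lemma flag_open_bigU (I : Type) (f : I -> set flag) :
  (forall i, flag_open (f i)) -> flag_open (\bigcup_i f i).
Proof. by move=> of_; apply: bigcup_open => i _; exact: of_. Qed.
HB.instance Definition _ :=
  isOpenTopological.Build flag flag_openT flag_openI flag_open_bigU.

Lemma flag_gact_subproof (D : torus) (V : flag) :
  is_flag [ffun i => (linfun (mulmx (torus_mx D)) @: V i)%VS].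
Proof.
case/andP: (flagP V) => /forallP dV /forallP sV.
apply/andP; split; apply/forallP => i; rewrite !ffunE; last exact: limgS.
rewrite limg_dim_eq ?dV//.
suff -> : lker (linfun (mulmx (torus_mx D)) : 'End('cV[C]_n)) = 0%VS.
  by rewrite capv0.
apply/eqP/lker0P => u v; rewrite !lfunE /= => Duv.
by rewrite -(mulKmx (torus_unit D) u) Duv mulKmx// torus_unit.
Qed.
Definition flag_gact (D : torus) (V : flag) : flag :=
  Flag (flag_gact_subproof D V).
Lemma flag_gact1 V : flag_gact 1%g V = V.
Proof.
apply/val_inj/ffunP => i; rewrite /= ffunE.
rewrite (_ : linfun _ = \1%VF) ?lim1g//; apply/lfunP => v.
by rewrite !lfunE /= mul1mx.
Qed.
Lemma flag_gactM D D' V :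
  flag_gact (D * D')%g V = flag_gact D (flag_gact D' V).
Proof.
apply/val_inj/ffunP => i; rewrite /= !ffunE -limg_comp.
by congr (_ @: _)%VS; apply/lfunP => v; rewrite !lfunE /= !lfunE /= mulmxA.
Qed.
Definition flag_variety : gspace torus := GSpace flag_gact1 flag_gactM.

(* [lift ord0 i : 'I_n.+1] has value [i.+1]: it is the index of the subspace   *)
(* of dimension [i + 1], attached to [i] by the 0-based indexing of [n].       *)
Definition hessenberg_set (h : 'I_n -> 'I_n) (lam : 'I_n -> R) :
    set flag_variety :=
  [set V : flag | forall i : 'I_n,
    (linfun (mulmx (diag_mx (\row_j (lam j)%:C))) @: V (lift ord0 i) <=
     V (lift ord0 (h i)))%VS].

Lemma hessenberg_invariant h lam : invariant (hessenberg_set h lam).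
Proof.
move=> D V hV i; rewrite /= !ffunE -limg_comp; set L := linfun _.
suff -> : (L \o linfun (mulmx (torus_mx D)) =
           linfun (mulmx (torus_mx D)) \o L)%VF.
  by rewrite limg_comp; apply: limgS; exact: hV.
apply/lfunP => v; rewrite !lfunE /= !lfunE /= !mulmxA; congr (_ *m v).
apply/matrixP => k l; rewrite mul_diag_mx mul_mx_diag !mxE.
have [->|kl] := eqVneq k l; first by rewrite mulrC.
by rewrite torus_offdiag// mulr0 mul0r.
Qed.
Definition hessenberg_variety h lam : gspace torus :=
  sub_gspace (@hessenberg_invariant h lam).

End Torus.
Arguments orbit_filtration [R n] X k.

(* Main.v *)
(* Let Z be the compact set of unitary U such that (U^* Lambda U)_ij = 0 for   *)
(* i > h(j). The torus acts on Z on both sides; X_h is T\Z, through            *)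
(* U |-> U^* Lambda U, and Y_h is Z/T, through the flag spanned by the columns *)
(* of U. Writing D for a fixed diagonal matrix with distinct real entries,     *)
(* U |-> U D U^* embeds Y_h in the matrices, so taking adjoints exchanges the  *)
(* roles of X_h and Y_h: both are instances of [model].                        *)
(*                                                                             *)
(* (1) Both orbit spaces are T\Z/T, and the stabilisers on the two sides       *)
(* correspond through the doubly stochastic matrix (|U_ij|^2).                 *)
(*                                                                             *)
(* (2) The fixed points are the permutation matrices. Two of them are joined   *)
(* by an invariant sphere exactly when they differ by a transposition and Z    *)
(* contains all the unitary matrices supported on the union of their graphs;   *)
(* this condition is stable under adjunction. That an edge has this form       *)
(* follows from the connectedness of the 2-sphere.                             *)
(*                                                                             *)
(* (3) [x, e] |-> [U^*, U e] maps one Borel construction to the other, where   *)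
(* (U e)_j is the tensor-like sequence (U_jk e_mk)_(m,k), again of norm 1. Its *)
(* composite with the symmetric map moves only the ET-coordinate, equivariantly*)
(* and equivariant maps to ET are homotopic by the usual shifting trick.       *)
(*                                                                             *)
(* (4) The LU decompositions of w^-1 U, w a permutation, give open cells       *)
(* covering Z. On such a cell M = L^-1 Lambda_w L, and for X_h its conjugate   *)
(* by the unitary diagonal factor, are coordinates: M ranges over the lower    *)
(* triangular matrices with diagonal Lambda_w and M_ij = 0 for i > h(j).       *)
(* Ordering the cells by a height function, a cell meets the previous ones     *)
(* where M_ij <> 0 for some i > j with w(i) > w(j). Hence both spaces are built*)
(* from the same even-dimensional relative classes, by excision.               *)

Require Import Defs.
From HB Require Import structures.
From mathcomp Require Import all_boot all_order all_algebra.
From mathcomp Require Import fingroup perm spectral generic_quotient ring_quotient complex zify ring lra.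
From mathcomp Require Import all_classical all_reals topology normedtype trigo sequences realfun.

Set Implicit Arguments.
Unset Strict Implicit.
Unset Printing Implicit Defensive.

Import Order.TTheory GRing.Theory Num.Theory.
Import numFieldNormedType.Exports.

Local Open Scope classical_set_scope.
Local Open Scope complex_scope.
Local Open Scope sesquilinear_scope.
Local Open Scope quotient_scope.
Local Open Scope ring_scope.

(** * Continuity *)

(** Everything is read off one compact set, the unitary U for which U^* Lambda U has the Hessenberg
    zeros ([hess_unitary]). Such a U determines the staircase matrix U^* Lambda U, which forgets
    exactly left multiplication by the torus ([model_fiber]), and the flag of its columns, which
    forgets exactly right multiplication ([unitary_flag]). On each quotient the torus acts through
    the multiplication that the other one forgets, and adjunction exchanges the two sides.
    [staircase_model] and [hessenberg_model] bring both manifolds to the form [model], flags being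
    embedded in hermitian matrices by an auxiliary simple spectrum. Parts (1) and (3) hold for any
    model and any model of the adjoint set, part (2) when the set is moreover [saturated].

    (1) Both orbit spaces are the space of double cosets T U T. An infinitesimal stabiliser is a
    relation between two real vectors carried by the nonzero entries of U ([stab_lie_mpiP]), and
    adjunction only swaps the two vectors.

    (2) A point on an orbit of dimension at most one has at most one symmetric pair of nonzero
    off-diagonal entries ([off_diag_unique]). Hence edges amount to the combinatorial relation
    [link] ([edge_of_link], [link_of_edge]), which inversion of permutations carries to the other
    side ([link_adjoint]).

    (3) Both Borel constructions are quotients by T x T of a product with ET. [borel_map] compares
    them, and a self-map that moves only the ET-coordinate acts trivially on cohomology
    ([cpull_covers_id]).

    (4) No map of spaces is used: both cohomologies are free with the same ranks
    ([quotient_even_free], [free_iso]). Permutations index open cells. By [lead_cover] and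
    [lead_disjoint] a cell meets the cells before it exactly where one of its bad coordinates is
    nonzero, so that it contributes one class of even degree ([convex_pair_free], [excision_free]),
    and classes of even degree cannot cancel ([even_free_cell]). *)

Section Continuity.
Implicit Types (T U V W : topologicalType).

Lemma cts_comp T U V (f : T -> U) (g : U -> V) :
  continuous f -> continuous g -> continuous (fun x => g (f x)).
Proof. by move=> cf cg x; apply: continuous_comp; [exact: cf | exact: cg]. Qed.

Lemma cts_id T : continuous (fun x : T => x).
Proof. by move=> x. Qed.

Lemma cts_cst T U (c : U) : continuous (fun _ : T => c).
Proof. by move=> x; exact: cst_continuous. Qed.

Lemma cts_pair T U V (f : T -> U) (g : T -> V) :
  continuous f -> continuous g -> continuous (fun x => (f x, g x)).
Proof. by move=> cf cg x; apply: cvg_pair; [exact: cf | exact: cg]. Qed.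

Lemma cts_fst T U : continuous (fun x : T * U => x.1).
Proof. by move=> x; exact: cvg_fst. Qed.

Lemma cts_snd T U : continuous (fun x : T * U => x.2).
Proof. by move=> x; exact: cvg_snd. Qed.

Lemma cts_ext T U (f g : T -> U) : f =1 g -> continuous f -> continuous g.
Proof. by move=> /funext ->. Qed.

Section Field.
Variables (K : numFieldType) (T : topologicalType).

Lemma cts_sum I (r : seq I) (P : pred I) (F : I -> T -> K) :
  (forall i, P i -> continuous (F i)) ->
  continuous (fun x => \sum_(i <- r | P i) F i x).
Proof. by move=> h; apply: continuous_big h; exact: add_continuous. Qed.

Lemma cts_mul (f g : T -> K) :
  continuous f -> continuous g -> continuous (fun x => f x * g x).
Proof. by move=> cf cg x; apply: continuousM; [exact: cf | exact: cg]. Qed.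

Lemma cts_add (f g : T -> K) :
  continuous f -> continuous g -> continuous (fun x => f x + g x).
Proof. by move=> cf cg x; apply: continuousD; [exact: cf | exact: cg]. Qed.

Lemma cts_opp (f : T -> K) : continuous f -> continuous (fun x => - f x).
Proof. by move=> cf x; apply: continuousN; exact: cf. Qed.

Lemma cts_inv (f : T -> K) :
  (forall x, f x != 0) -> continuous f -> continuous (fun x => (f x)^-1).
Proof. by move=> f0 cf x; apply: continuousV; [exact: f0 | exact: cf]. Qed.

Lemma cts_prod I (r : seq I) (P : pred I) (F : I -> T -> K) :
  (forall i, P i -> continuous (F i)) ->
  continuous (fun x => \prod_(i <- r | P i) F i x).
Proof. by move=> h; apply: continuous_big h; exact: mul_continuous. Qed.

Lemma cts_entry m n (f : T -> 'M[K]_(m, n)) i j :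
  continuous f -> continuous (fun x => f x i j).
Proof. move=> cf x. apply: (@continuous_comp _ _ _ f (fun M : 'M[K]_(m, n) => M i j)). exact: cf. exact: coord_continuous. Qed.

End Field.

Lemma mx_cts_for (K : numFieldType) T m n (f : T -> 'M[K]_(m, n)) t :
  (forall i j, {for t, continuous (fun x => f x i j)}) -> {for t, continuous f}.
Proof.
move=> cf A [P tP PA].
have : nbhs t (fun x => forall i j, P i j (f x i j)).
  pose Q i j : set T := [set x | P i j (f x i j)].
  apply: (@filter_forall _ _ (fun i => [set x | forall j, Q i j x]) (nbhs t)) => i.
  apply: (@filter_forall _ _ (Q i) (nbhs t)) => j.
  by apply: (cf i j); exact: tP.
by apply: filterS => u Pu; apply: PA.
Qed.

Lemma mx_cts (K : numFieldType) T m n (f : T -> 'M[K]_(m, n)) :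
  (forall i j, continuous (fun x => f x i j)) -> continuous f.
Proof. by move=> cf t; apply: mx_cts_for => i j; exact: cf. Qed.

Section Subtype.
Variables (X : topologicalType) (A : set X).

Lemma cts_val : continuous (fun x : A => val x).
Proof. exact: initial_continuous. Qed.

Lemma sub_cts_for T (f : T -> A) t :
  {for t, continuous (fun x => val (f x))} -> {for t, continuous f}.
Proof.
move=> cf U [_ [[V oV <-] /= Vt VU]].
have : nbhs t (fun x => V (val (f x))) by apply: cf; exact: open_nbhs_nbhs.
by apply: filterS => x /VU.
Qed.

Lemma sub_cts T (f : T -> A) : continuous (fun x => val (f x)) -> continuous f.
Proof. by move=> cf t; apply: sub_cts_for; exact: cf. Qed.

End Subtype.

Lemma cts_closed T U (f : T -> U) (A : set U) :
  continuous f -> closed A -> closed (f @^-1` A).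
Proof. by move=> cf; apply: closed_comp => x _; exact: cf. Qed.

Lemma cts_open T U (f : T -> U) (A : set U) :
  continuous f -> open A -> open (f @^-1` A).
Proof. by move=> cf; apply: open_comp => x _; exact: cf. Qed.

End Continuity.
Arguments cts_closed {T U f A} cf cA.
Arguments cts_open {T U f A} cf oA.
Arguments cts_comp {T U V f g} cf cg.
Arguments cts_id {T}.
Arguments cts_cst {T U} c.
Arguments cts_pair {T U V f g} cf cg.
Arguments cts_fst {T U}.
Arguments cts_snd {T U}.
Arguments cts_ext {T U f g} fg cf.
Arguments cts_sum {K T I r P F} cF.
Arguments cts_mul {K T f g} cf cg.
Arguments cts_add {K T f g} cf cg.
Arguments cts_opp {K T f} cf.
Arguments cts_inv {K T f} f0 cf.
Arguments cts_prod {K T I r P F} cF.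
Arguments cts_entry {K T m n f} i j cf.
Arguments mx_cts {K T m n f} cf.
Arguments cts_val {X A}.
Arguments sub_cts {X A T f} cf.

(** * Relative singular cochains *)

Section Pairs.
Variables (R : realType) (X : topologicalType).
Implicit Types (k : nat).

(** A family of simplices plays the role of a subspace; it may also be the simplices small for a
    cover, which are not those of any subspace. Cochains remain cochains of the whole of X, taken up
    to [vanish] on the family, so that restriction maps are identities. *)
Definition spred := forall k, set (simplex R X k).
Implicit Types (P Q S : spred).

Definition spred_incl P Q := forall k, P k `<=` Q k.
Definition facial P :=
  forall k (s : simplex R X k.+1) (i : 'I_k.+2), P k.+1 s -> P k (restr (lift i) s).
Definition vanish P k (a : cochain R X k) := forall s, P k s -> a s = 0.

(* The exact cochains of the pair, with no exact cochain but [0] in degree 0. *)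
Definition exact_cochain Q k : cochain R X k -> Prop :=
  match k return cochain R X k -> Prop with
  | 0 => fun e => e = 0
  | k'.+1 => fun e => exists2 b : cochain R X k', vanish Q b & e = coboundary b
  end.

Definition rel_cocycle P Q k (a : cochain R X k) :=
  vanish Q a /\ vanish P (coboundary a).
Definition rel_exact P Q k (a : cochain R X k) :=
  exists2 e, exact_cochain Q e & vanish P (a - e).

Definition acyclic P Q k :=
  forall a : cochain R X k, rel_cocycle P Q a -> rel_exact P Q a.

Definition lin_comb k r (z : 'I_r -> cochain R X k) (c : 'I_r -> int) :
  cochain R X k := fun s => \sum_i c i * z i s.

(* H^k of the pair is free abelian on the classes of [r] cocycles. *)
Definition rel_free P Q k r :=
  exists z : 'I_r -> cochain R X k,
    [/\ forall i, rel_cocycle P Q (z i),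
        forall a, rel_cocycle P Q a ->
          exists c, rel_exact P Q (a - lin_comb z c) &
        forall c, rel_exact P Q (lin_comb z c) -> forall i, c i = 0].

Lemma coboundaryB k (a b : cochain R X k) :
  coboundary (a - b) = coboundary a - coboundary b.
Proof. exact: raddfB. Qed.

Lemma coboundary0 k : coboundary (0 : cochain R X k) = 0.
Proof. exact: raddf0. Qed.

Lemma vanishB P k (a b : cochain R X k) :
  vanish P a -> vanish P b -> vanish P (a - b).
Proof.
move=> va vb s Ps; transitivity (a s - b s) => //.
by rewrite va// vb// subrr.
Qed.
Lemma vanishS P Q k (a : cochain R X k) :
  spred_incl Q P -> vanish P a -> vanish Q a.
Proof. by move=> QP va s Qs; apply/va/QP. Qed.
Lemma vanish_coboundary P k (a : cochain R X k) :
  facial P -> vanish P a -> vanish P (coboundary a).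
Proof.
move=> fP va s Ps; rewrite /coboundary big1// => i _.
by rewrite va ?mulr0//; exact: fP.
Qed.

(** The double face (i, j) with i <= j is also the double face (j + 1, i), and the two occur with
    opposite signs; [f] and [g] are this involution. *)
Lemma coboundaryK k (a : cochain R X k) : coboundary (coboundary a) = 0.
Proof.
apply/funext => s; rewrite /coboundary.
pose F i j := a (restr (fun x : 'I_k.+1 => inord (bump i (bump j x))) s).
transitivity (\sum_(i < k.+3) \sum_(j < k.+2) (-1) ^+ (i + j) * F i j).
  apply: eq_bigr => i _; rewrite mulr_sumr; apply: eq_bigr => j _.
  rewrite mulrA -exprD restr_comp; congr (_ * a (restr _ s)).
  apply/funext => x; apply/val_inj; have xk := ltn_ord x.
  by rewrite /= inordK // /bump; lia.
transitivity (\sum_(p : 'I_k.+3 * 'I_k.+2) (-1) ^+ (p.1 + p.2) * F p.1 p.2).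
  by rewrite -(pair_bigA _ (fun (i : 'I_k.+3) (j : 'I_k.+2) => (-1) ^+ (i + j) * F i j)).
rewrite (bigID (fun p : 'I_k.+3 * 'I_k.+2 => (p.1 <= p.2)%N)) /=.
apply/eqP; rewrite addr_eq0 -sumrN; apply/eqP.
pose f (p : 'I_k.+3 * 'I_k.+2) : 'I_k.+3 * 'I_k.+2 := (inord p.2.+1, inord p.1).
pose g (p : 'I_k.+3 * 'I_k.+2) : 'I_k.+3 * 'I_k.+2 := (inord p.2, inord p.1.-1).
rewrite (reindex_onto g f) /=; last first.
  move=> [i j] /= ij; have ik := ltn_ord i; have jk := ltn_ord j.
  by rewrite /f /g /=; congr pair; apply/val_inj; rewrite /= ?inordK; lia.
apply: eq_big => [[i j]|[i j] /=].
  have := ltn_ord i; have := ltn_ord j; rewrite /f /g /= => jk ik.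
  apply/idP/idP.
    move=> /andP[+ /eqP [/(congr1 val) /= + /(congr1 val) /=]].
    by rewrite !inordK; lia.
  move=> ij; rewrite !inordK; try lia.
  apply/andP; split; first lia.
  by apply/eqP; congr pair; apply/val_inj; rewrite /= ?inordK; lia.
have := ltn_ord i; have := ltn_ord j; rewrite /f /g /= => jk ik.
move=> /andP[+ /eqP [/(congr1 val) /= + /(congr1 val) /=]].
rewrite !inordK; try lia; move=> h1 h2 h3.
have -> : (-1 : int) ^+ (j + i.-1) = - (-1) ^+ (i + j).
  by have -> : (i + j = (j + i.-1).+1)%N by [lia]; rewrite exprS mulN1r opprK.
rewrite mulNr; congr (- (_ * a (restr _ s))); apply/funext => x.
by congr inord; rewrite /bump; lia.
Qed.

Lemma exact_cochainB Q k (a b : cochain R X k) :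
  exact_cochain Q a -> exact_cochain Q b -> exact_cochain Q (a - b).
Proof.
case: k a b => [|k] a b /= => [->->|]; first by rewrite subrr.
move=> [a' va ->] [b' vb ->]; exists (a' - b'); first exact: vanishB.
by rewrite coboundaryB.
Qed.
Lemma exact_cochain0 Q k : exact_cochain Q (0 : cochain R X k).
Proof. by case: k => //= k; exists 0 => //; rewrite coboundary0. Qed.
Lemma exact_cochainN Q k (a : cochain R X k) :
  exact_cochain Q a -> exact_cochain Q (- a).
Proof. by rewrite -sub0r; apply: exact_cochainB; exact: exact_cochain0. Qed.
Lemma exact_cochainD Q k (a b : cochain R X k) :
  exact_cochain Q a -> exact_cochain Q b -> exact_cochain Q (a + b).
Proof.
by move=> ea eb; rewrite -[b]opprK; apply: exact_cochainB => //; exact: exact_cochainN.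
Qed.
Lemma exact_cochain_closed Q k (a : cochain R X k) :
  exact_cochain Q a -> coboundary a = 0.
Proof.
case: k a => [|k] a /= => [->|[b _ ->]]; first by rewrite coboundary0.
exact: coboundaryK.
Qed.
Lemma exact_cochainS P Q k (a : cochain R X k) :
  spred_incl Q P -> exact_cochain P a -> exact_cochain Q a.
Proof.
move=> QP; case: k a => [|k] a //= [b vb ->]; exists b => //.
exact: vanishS vb.
Qed.
Lemma lin_combB k r (z : 'I_r -> cochain R X k) c c' :
  lin_comb z (fun i => c i - c' i) = lin_comb z c - lin_comb z c'.
Proof.
apply/funext => s; transitivity (lin_comb z c s - lin_comb z c' s) => //.
by rewrite -sumrB; apply: eq_bigr => i _; rewrite mulrBl.
Qed.

Lemma coboundary_lin_comb k r (z : 'I_r -> cochain R X k) c :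
  coboundary (lin_comb z c) = lin_comb (fun i => coboundary (z i)) c.
Proof.
apply/funext => s; rewrite /coboundary /lin_comb.
under eq_bigr do rewrite mulr_sumr.
rewrite exchange_big; apply: eq_bigr => i _; rewrite mulr_sumr.
by apply: eq_bigr => j _; rewrite mulrCA.
Qed.

Lemma vanish_lin_comb P k r (z : 'I_r -> cochain R X k) c :
  (forall i, vanish P (z i)) -> vanish P (lin_comb z c).
Proof.
by move=> vz s Ps; rewrite /lin_comb big1// => i _; rewrite vz// mulr0.
Qed.

Lemma rel_cocycle_lin_comb P Q k r (z : 'I_r -> cochain R X k) c :
  (forall i, rel_cocycle P Q (z i)) -> rel_cocycle P Q (lin_comb z c).
Proof.
move=> zz; split; first by apply: vanish_lin_comb => i; case: (zz i).
by rewrite coboundary_lin_comb; apply: vanish_lin_comb => i; case: (zz i).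
Qed.

Lemma acyclic_rel_free P Q k : acyclic P Q k -> rel_free P Q k 0.
Proof.
move=> ac; exists (fun _ => 0); split=> [[]//| a za|c _ [] //].
exists (fun=> 0); suff -> : lin_comb (fun _ : 'I_0 => 0) (fun=> 0) = (0 : cochain R X k).
  by rewrite subr0; exact: ac.
by apply/funext => s; rewrite /lin_comb big_ord0.
Qed.

Lemma rel_free_acyclic P Q k : rel_free P Q k 0 -> acyclic P Q k.
Proof.
move=> [z [_ sp _]] a /sp[c].
suff -> : lin_comb z c = (0 : cochain R X k) by rewrite subr0.
by apply/funext => s; rewrite /lin_comb big_ord0.
Qed.

(* Excision algebra: replacing [P] by [P'] when the pair (P, P') is acyclic. *)
Lemma rel_lift P P' Q k (a : cochain R X k) :
  spred_incl Q P' -> acyclic P P' k.+1 -> rel_cocycle P' Q a ->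
  exists2 b, rel_cocycle P Q b & vanish P' (a - b).
Proof.
move=> QP' ac [va za].
have [|e [b vb ->] h] := ac (coboundary a).
  by split => //; rewrite coboundaryK.
exists (a - b); last by rewrite opprB addrCA subrr addr0.
split; last by rewrite coboundaryB.
by apply: vanishB => //; exact: vanishS vb.
Qed.

Lemma rel_exact_restrict P P' Q k (a : cochain R X k) :
  spred_incl P' P -> rel_exact P Q a -> rel_exact P' Q a.
Proof. by move=> PP' [e ee ae]; exists e => //; exact: vanishS ae. Qed.

(** A primitive on P' leaves an error [a - e] that vanishes on P' and is closed on P, so acyclicity
    of (P, P') makes the error exact. *)
Lemma rel_exact_extend P P' Q k (a : cochain R X k) :
  spred_incl Q P' -> acyclic P P' k ->
  vanish P (coboundary a) -> rel_exact P' Q a -> rel_exact P Q a.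
Proof.
move=> QP' ac za [e ee ae].
have [|f ef h] := ac (a - e).
  by split => //; rewrite coboundaryB (exact_cochain_closed ee) subr0.
exists (e + f); last by rewrite opprD addrA.
by apply: exact_cochainD => //; exact: exact_cochainS ef.
Qed.

(** The basis cocycles are closed only on P'. [rel_lift] changes them off P' into cocycles on P, and
    coefficients are unaffected because the corrections vanish on P'. *)
Lemma rel_free_extend P P' Q k r :
  facial P' -> spred_incl P' P -> spred_incl Q P' ->
  (forall k, acyclic P P' k) -> rel_free P' Q k r -> rel_free P Q k r.
Proof.
move=> fP' PP' QP' ac [z [zz sp un]].
have /choice[w hw] : forall i, exists b, rel_cocycle P Q b /\ vanish P' (z i - b).
  by move=> i; have [b] := rel_lift QP' (ac k.+1) (zz i); exists b.
have zw c : vanish P' (lin_comb z c - lin_comb w c).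
  move=> s Ps; transitivity (lin_comb z c s - lin_comb w c s) => //.
  rewrite -sumrB big1// => i _; rewrite -mulrBr.
  by have [_ /(_ s Ps)] := hw i; rewrite -[(z i - w i) s]/(z i s - w i s) => ->; rewrite mulr0.
exists w; split=> [i|a [va za]|c wc]; first by case: (hw i).
  have [|c hc] := sp a; first by split=> //; exact: vanishS za.
  exists c; apply: rel_exact_extend QP' (ac k) _ _.
    rewrite coboundaryB; apply: vanishB => //.
    by have [] := rel_cocycle_lin_comb c (fun i => (hw i).1).
  case: hc => e ee h; exists e => //.
  move=> s Ps; have := h s Ps; have := zw c s Ps.
  change (lin_comb z c s - lin_comb w c s = 0 -> a s - lin_comb z c s - e s = 0 ->
    a s - lin_comb w c s - e s = 0).
  by move=> /subr0_eq ->.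
apply: un; case: (rel_exact_restrict PP' wc) => e ee h; exists e => //.
move=> s Ps; have := h s Ps; have := zw c s Ps.
change (lin_comb z c s - lin_comb w c s = 0 -> lin_comb w c s - e s = 0 ->
  lin_comb z c s - e s = 0).
by move=> /subr0_eq ->.
Qed.

Lemma rel_free_restrict P P' Q k r :
  facial P' -> spred_incl P' P -> spred_incl Q P' ->
  (forall k, acyclic P P' k) -> rel_free P Q k r -> rel_free P' Q k r.
Proof.
move=> fP' PP' QP' ac [z [zz sp un]].
exists z; split=> [i|a za|c zc].
- by have [vz cz] := zz i; split=> //; exact: vanishS cz.
- have [b zb ab] := rel_lift QP' (ac k.+1) za.
  have [c [e ee h]] := sp b zb; exists c, e => //.
  move=> s Ps; have := h s (PP' _ _ Ps); have := ab s Ps.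
  change (a s - b s = 0 -> b s - lin_comb z c s - e s = 0 ->
    a s - lin_comb z c s - e s = 0).
  by move=> /subr0_eq ->.
- apply: un; apply: rel_exact_extend QP' (ac k) _ zc.
  by have [] := rel_cocycle_lin_comb c zz.
Qed.

Lemma lin_comb_split k r r' (x : 'I_r -> cochain R X k) (y : 'I_r' -> cochain R X k)
    (c : 'I_(r + r') -> int) :
  lin_comb (fun i : 'I_(r + r') => match fintype.split i with inl i => x i | inr j => y j end) c =
  lin_comb x (c \o lshift r') + lin_comb y (c \o @rshift r r').
Proof.
apply/funext => s; rewrite /lin_comb big_split_ord /=; congr (_ + _).
  apply: eq_bigr => i _; case: split_ordP => j; first by move=> /lshift_inj ->.
  by move=> /eqP; rewrite eq_lrshift.
apply: eq_bigr => i _; case: split_ordP => j; last by move=> /rshift_inj ->.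
by move=> /eqP; rewrite eq_sym eq_lrshift.
Qed.

(** * The long exact sequence of a triple *)

Section Triple.
Variables P Q S : spred.
Hypotheses (fP : facial P) (fQ : facial Q) (fS : facial S).
Hypotheses (QP : spred_incl Q P) (SQ : spred_incl S Q).
Let SP : spred_incl S P. Proof. by move=> k s /SQ /QP. Qed.

(** Acyclicity of (P, S) makes the connecting map H^k(Q, S) -> H^(k+1)(P, Q) an isomorphism.
    Cochains being defined on all of X, this map is simply [coboundary]. *)
Lemma rel_free_connecting k r :
  acyclic P S k -> acyclic P S k.+1 -> rel_free Q S k r -> rel_free P Q k.+1 r.
Proof.
move=> ac ac1 [z [zz sp un]]; exists (fun i => coboundary (z i)); split.
- by move=> i; have [_ cz] := zz i; split=> //; rewrite coboundaryK.
- move=> a [va ca].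
  have [|e [b vb eb] ae] := ac1 a; first by split=> //; exact: vanishS va.
  have [|c [e' ee' h]] := sp b.
    split=> // s Qs; have := ae s (QP Qs); rewrite eb.
    change (a s - coboundary b s = 0 -> coboundary b s = 0).
    by rewrite va// sub0r => /eqP; rewrite oppr_eq0 => /eqP.
  exists c, (coboundary (b - lin_comb z c - e')).
    by exists (b - lin_comb z c - e').
  rewrite !coboundaryB (exact_cochain_closed ee') subr0 coboundary_lin_comb.
  move=> s Ps; have := ae s Ps; rewrite eb; set w := lin_comb _ _.
  change (a s - coboundary b s = 0 -> a s - w s - (coboundary b s - w s) = 0).
  by move=> /subr0_eq ->; rewrite subrr.
move=> c [_ [b vb ->]]; rewrite -coboundary_lin_comb -coboundaryB => h.
apply: un; have [|e ee he] := ac (lin_comb z c - b).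
  split=> //; apply: vanishB; last exact: vanishS vb.
  by apply: vanish_lin_comb => i; case: (zz i).
exists e => //; move=> s Qs; have := he s (QP Qs).
change (lin_comb z c s - b s - e s = 0 -> lin_comb z c s - e s = 0).
by rewrite (vb s Qs) subr0.
Qed.

(** Degree 0 has no nonzero coboundaries, so H^0(P, Q) is a subgroup of H^0(P, S). *)
Lemma acyclic_connecting0 : acyclic P S 0 -> acyclic P Q 0.
Proof.
move=> ac a [va ca]; have [|e ee ae] := ac a; first by split=> //; exact: vanishS va.
by exists e.
Qed.

(** Injectivity of H^k(P, Q) -> H^k(P, S): the primitive of [a] is a cocycle on Q, hence exact
    there, and subtracting that exact part makes it vanish on Q. *)
Lemma rel_exact_middle k (a e : cochain R X k) :
  (forall j, k = j.+1 -> acyclic Q S j) -> vanish Q a -> exact_cochain S e ->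
  vanish P (a - e) -> rel_exact P Q a.
Proof.
case: k a e => [|k] a e ac0 va; first by exists e.
move=> [b vb eb] h; have [|e' ee' he'] := ac0 k erefl b.
  split=> // s Qs; have := h s (QP Qs); rewrite eb.
  change (a s - coboundary b s = 0 -> coboundary b s = 0).
  by move=> /subr0_eq <-; exact: va.
exists e => //; exists (b - e') => //.
by rewrite coboundaryB (exact_cochain_closed ee') subr0.
Qed.

(** The two vanishing hypotheses reduce the long exact sequence to 0 -> H^k(P, Q) -> H^k(P, S) ->
    H^k(Q, S) -> 0, and a basis is formed by the first one together with lifts of the last. *)
Lemma rel_free_middle k r r' :
  rel_free P Q k r -> rel_free Q S k r' -> acyclic P Q k.+1 ->
  (forall j, k = j.+1 -> acyclic Q S j) -> rel_free P S k (r + r').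
Proof.
move=> [x [zx spx unx]] [y [zy spy uny]] ac1 ac0.
have /choice[w hw] : forall i, exists b, rel_cocycle P S b /\ vanish Q (y i - b).
  by move=> i; have [b] := rel_lift SQ ac1 (zy i); exists b.
have yw c : vanish Q (lin_comb y c - lin_comb w c).
  move=> s Ps; transitivity (lin_comb y c s - lin_comb w c s) => //.
  rewrite -sumrB big1// => i _; rewrite -mulrBr.
  by have [_ /(_ s Ps)] := hw i; rewrite -[(y i - w i) s]/(y i s - w i s) => ->; rewrite mulr0.
exists (fun i : 'I_(r + r') => match fintype.split i with inl i => x i | inr j => w j end); split.
- move=> i; case: split_ordP => j _; last by case: (hw j).
  by have [vx cx] := zx j; split=> //; exact: vanishS vx.
- move=> a [va ca].
  have [|d [e ee h]] := spy a; first by split=> //; exact: vanishS ca.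
  have [|c [f ef h']] := spx (a - lin_comb w d - e).
    split.
      move=> s Qs; have := h s Qs; have := yw d s Qs.
      change (lin_comb y d s - lin_comb w d s = 0 -> a s - lin_comb y d s - e s = 0 ->
        a s - lin_comb w d s - e s = 0).
      by move=> /subr0_eq ->.
    rewrite !coboundaryB (exact_cochain_closed ee) subr0; apply: vanishB => //.
    by have [] := rel_cocycle_lin_comb d (fun i => (hw i).1).
  pose cd (i : 'I_(r + r')) := match fintype.split i with inl i => c i | inr j => d j end.
  exists cd, (e + f); first by apply: exact_cochainD => //; exact: exact_cochainS ef.
  have -> : lin_comb (fun i : 'I_(r + r') => match fintype.split i with inl i => x i | inr j => w j end) cd =
      lin_comb x c + lin_comb w d.
    rewrite lin_comb_split; have -> : cd \o lshift r' = c.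
      apply/funext => i; rewrite /= /cd; case: split_ordP => j.
        by move=> /lshift_inj ->.
      by move=> /eqP; rewrite eq_lrshift.
    suff -> : cd \o @rshift r r' = d by [].
    apply/funext => i; rewrite /= /cd; case: split_ordP => j.
      by move=> /eqP; rewrite eq_sym eq_lrshift.
    by move=> /rshift_inj ->.
  move=> s Ps; have := h' s Ps.
  change (a s - lin_comb w d s - e s - lin_comb x c s - f s = 0 ->
     a s - (lin_comb x c s + lin_comb w d s) - (e s + f s) = 0).
  by move=> <-; ring.
move=> c [e ee]; rewrite lin_comb_split => h.
have d0 : forall j, c (rshift r j) = 0.
  apply: uny; exists e => // s Qs; have := h s (QP Qs); have := yw (c \o @rshift r r') s Qs.
  set u := lin_comb y _; set v := lin_comb w _; set u' := lin_comb x _.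
  change (u s - v s = 0 -> u' s + v s - e s = 0 -> u s - e s = 0).
  move=> /subr0_eq ->; suff -> : u' s = 0 by rewrite add0r.
  by apply: vanish_lin_comb Qs => i; case: (zx i).
have {}h : vanish P (lin_comb x (c \o lshift r') - e).
  move=> s Ps; rewrite -(h s Ps).
  set v := lin_comb w _; set u := lin_comb x _.
  change (u s - e s = u s + v s - e s); suff -> : v s = 0 by rewrite addr0.
  by rewrite /v /lin_comb big1// => i _; rewrite /= d0 mul0r.
have c0 : forall j, c (lshift r' j) = 0.
  apply: unx; apply: rel_exact_middle ac0 _ ee h.
  by apply: vanish_lin_comb => i; case: (zx i).
by move=> i; rewrite -(splitK i); case: (fintype.split i).
Qed.

End Triple.

End Pairs.

(** * Homotopy invariance *)

Section Pullback.
Variables (R : realType).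

Definition mksimplex (X : topologicalType) k (f : std_simplex R k -> X)
  (cf : continuous f) : simplex R X k :=
  HB.pack f (isContinuous.Build _ _ f cf).

Section Post.
Variables (X Y : topologicalType) (f : X -> Y) (cf : continuous f).

Lemma post_subproof k (s : simplex R X k) : continuous (f \o s).
Proof. by move=> t; apply: continuous_comp; [exact: cts_fun | exact: cf]. Qed.
Definition post k (s : simplex R X k) : simplex R Y k :=
  mksimplex (@post_subproof k s).

Lemma restr_post p q (g : 'I_p.+1 -> 'I_q.+1) (s : simplex R X q) :
  restr g (post s) = post (restr g s).
Proof. by apply/continuousEP => t. Qed.

Definition pull k (a : cochain R Y k) : cochain R X k := fun s => a (post s).

Lemma coboundary_pull k (a : cochain R Y k) :
  coboundary (pull a) = pull (coboundary a).
Proof.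
by apply/funext => s; apply: eq_bigr => i _; rewrite /pull restr_post.
Qed.

End Post.

Lemma pull_comp (X Y Z : topologicalType) (f : X -> Y) (g : Y -> Z)
  (cf : continuous f) (cg : continuous g) (cgf : continuous (g \o f)) k
  (a : cochain R Z k) : pull cgf a = pull cf (pull cg a).
Proof. by apply/funext => s; congr (a _); apply/continuousEP => t. Qed.

Lemma pull_ext (X Y : topologicalType) (f g : X -> Y)
  (cf : continuous f) (cg : continuous g) k (a : cochain R Y k) :
  f =1 g -> pull cf a = pull cg a.
Proof.
by move=> fg; apply/funext => s; congr (a _); apply/continuousEP => t /=.
Qed.

End Pullback.

Section Prism.
Variables (R : realType) (X Y : topologicalType) (H : X * R -> Y).
Hypothesis cH : continuous H.

Lemma tilt_subproof p q (s : simplex R X q) (f : 'I_p.+1 -> 'I_q.+1)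
    (c : 'I_p.+1 -> R) :
  continuous (fun t : std_simplex R p =>
    H (s (push f t), \sum_i val t ord0 i * c i)).
Proof.
refine (cts_comp (cts_pair _ _) cH).
  exact: (cts_comp (@push_continuous R p q f) (@cts_fun _ _ s)).
refine (cts_sum _) => i _; refine (cts_mul _ (cts_cst _)).
exact: (cts_entry _ _ cts_val).
Qed.
(** The image under H of the affine simplex with vertices (f i, c i) in the cylinder over the
    standard simplex. The homotopy parameter ranges over all of R, so no product with an interval
    has to be formed. *)
Definition tilt p q (s : simplex R X q) (f : 'I_p.+1 -> 'I_q.+1)
    (c : 'I_p.+1 -> R) : simplex R Y p :=
  mksimplex (@tilt_subproof p q s f c).

Lemma restr_tilt p p' q (s : simplex R X q) (f : 'I_p.+1 -> 'I_q.+1) c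
    (g : 'I_p'.+1 -> 'I_p.+1) :
  restr g (tilt s f c) = tilt s (f \o g) (c \o g).
Proof.
apply/continuousEP => t /=; rewrite push_comp; congr (H (_, _)).
rewrite [RHS](partition_big g xpredT) //=; apply: eq_bigr => j _.
by rewrite mxE mulr_suml; apply: eq_bigr => i /eqP <-.
Qed.

Lemma tilt_restr p q q' (s : simplex R X q) (f : 'I_p.+1 -> 'I_q'.+1) c
    (g : 'I_q'.+1 -> 'I_q.+1) :
  tilt (restr g s) f c = tilt s (g \o f) c.
Proof. by apply/continuousEP => t /=; rewrite push_comp. Qed.

(** Vertex maps are functions on natural numbers, so that faces of faces are compared by plain
    arithmetic. *)
Definition prism_face p q (s : simplex R X q) (f : nat -> nat) (b : nat -> bool) :
    simplex R Y p :=
  tilt s (fun x : 'I_p.+1 => inord (f x)) (fun x : 'I_p.+1 => (b x)%:R).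

(** Dual of the usual prism operator: summand i has the vertices 0, ..., i at height 0 followed by
    i, ..., k at height 1. *)
Definition prism k (a : cochain R Y k.+1) : cochain R X k :=
  fun s => \sum_(i < k.+1) (-1) ^+ i *
    a (prism_face k.+1 s (fun x => x - (i < x)) (fun x => i < x))%N.

Lemma eq_prism_face p q (s : simplex R X q) f g b c :
  (forall x, (x <= p)%N -> f x = g x) -> (forall x, (x <= p)%N -> b x = c x) ->
  prism_face p s f b = prism_face p s g c.
Proof.
move=> fg bc; rewrite /prism_face; congr (tilt s _ _); apply/funext => x.
  by rewrite fg// -ltnS.
by rewrite bc// -ltnS.
Qed.

Lemma restr_prism_face p q (s : simplex R X q) f b (j : 'I_p.+2) :
  restr (lift j) (prism_face p.+1 s f b) =
  prism_face p s (f \o bump j) (b \o bump j).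
Proof. by rewrite restr_tilt. Qed.

Lemma prism_face_restr p q (s : simplex R X q.+1) f b (j : 'I_q.+2) :
  (forall x, (x <= p)%N -> (f x <= q)%N) ->
  prism_face p (restr (lift j) s) f b = prism_face p s (bump j \o f) b.
Proof.
move=> fq; rewrite /prism_face tilt_restr; congr (tilt s _ _); apply/funext => x.
have xq : (f x <= q)%N by rewrite fq// -ltnS.
by apply/val_inj; rewrite /= !inordK // /bump; lia.
Qed.

(** [D i j] stands for face j of the prism simplex i. Away from the diagonal it is a prism simplex
    over a face of the base ([T]); the faces [D i i] and [D i i.+1] are shared by consecutive
    simplices and telescope to the two ends of the prism. *)
Lemma prism_sum k (D T : nat -> nat -> int) (N : nat -> int) :
  (forall i j, (j < i)%N -> (i <= k)%N -> D i j = T j i.-1) ->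
  (forall i j, (i.+1 < j)%N -> (j <= k.+1)%N -> D i j = T j.-1 i) ->
  (forall i, (i <= k)%N -> D i i = N i) ->
  (forall i, (i <= k)%N -> D i i.+1 = N i.+1) ->
  \sum_(i < k.+1) (-1) ^+ i * (\sum_(j < k.+2) (-1) ^+ j * D i j) =
  N 0%N - N k.+1 - \sum_(j < k.+1) (-1) ^+ j * (\sum_(i < k) (-1) ^+ i * T j i).
Proof.
move=> D1 D2 D3 D4.
pose S j i : int := (-1) ^+ j * ((-1) ^+ i * T j i).
have E (i : 'I_k.+1) : (-1) ^+ i * (\sum_(j < k.+2) (-1) ^+ j * D i j) =
    (N i - N i.+1) + (- (\sum_(0 <= j < i) S j i.-1)
     - \sum_(i.+1 <= j < k.+1) S j i).
  have ik : (i <= k)%N by rewrite -ltnS.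
  have sq : (-1 : int) ^+ i * (-1) ^+ i = 1 by rewrite -expr2 sqrr_sign.
  rewrite mulr_sumr -(big_mkord xpredT (fun j => (-1) ^+ i * ((-1) ^+ j * D i j))).
  rewrite (@big_cat_nat _ _ _ i) //=; last by lia.
  rewrite (@big_ltn _ _ _ i); last by lia.
  rewrite (@big_ltn _ _ _ i.+1); last by lia.
  set A := \sum_(0 <= j < i) _; set B := \sum_(i.+2 <= j < k.+2) _.
  have -> : A = - \sum_(0 <= j < i) S j i.-1.
    rewrite -sumrN /A !big_nat; apply: eq_bigr => j /andP[_ ji].
    by rewrite D1// /S; case: (nat_of_ord i) ji => // i' _; rewrite exprS /=; ring.
  have -> : B = - \sum_(i.+1 <= j < k.+1) S j i.
    rewrite /B -[i.+2]addn1 big_addn subn1 /= -sumrN !big_nat.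
    by apply: eq_bigr => j /andP[ji jk]; rewrite D2 /S ?addn1 ?exprS /=; [ring|lia|lia].
  rewrite D3// D4// exprS mulN1r mulNr mulrN !mulrA sq; ring.
rewrite (eq_bigr _ (fun i _ => E i)) big_split /=; congr (_ + _).
  rewrite -(big_mkord xpredT (fun i => N i - N i.+1)) -[RHS]opprB.
  rewrite -(telescope_sumr N (leq0n k.+1)) -sumrN.
  by apply: eq_bigr => i _; rewrite opprB.
rewrite big_split /= !sumrN -opprD; congr (- _).
rewrite big_ord_recl /= big_nil add0r big_ord_recr /= big_geq// addr0.
rewrite -big_split /=; under [RHS]eq_bigr do rewrite mulr_sumr.
rewrite exchange_big; apply: eq_bigr => i _.
by rewrite /bump /= add1n -(@big_cat_nat _ _ _ i.+1) ?big_mkord// ltnS ltnW.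
Qed.

Hypothesis c1 : continuous (fun x => H (x, 1)).
Hypothesis c0 : continuous (fun x => H (x, 0)).

Lemma simplex_sum1 k (t : std_simplex R k) : \sum_i val t ord0 i = 1.
Proof. by case: t => t /= /set_mem[]. Qed.

Lemma push_inord_id k (t : std_simplex R k) :
  push (fun x : 'I_k.+1 => inord x : 'I_k.+1) t = t.
Proof.
apply/val_inj/rowP => j /=; rewrite mxE (bigD1 j) ?inord_val//= big1 ?addr0// => i.
by rewrite inord_val => /andP[/eqP -> /eqP].
Qed.

Lemma prism_face_top k (s : simplex R X k) (b : nat -> bool) :
  (forall x, (x <= k)%N -> b x) -> prism_face k s id b = post c1 s.
Proof.
move=> bt; apply/continuousEP => t /=; rewrite push_inord_id; congr (H (_, _)).
rewrite -[RHS](simplex_sum1 t); apply: eq_bigr => i _.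
by rewrite bt ?mulr1// -ltnS.
Qed.

Lemma prism_face_bottom k (s : simplex R X k) (b : nat -> bool) :
  (forall x, (x <= k)%N -> ~~ b x) -> prism_face k s id b = post c0 s.
Proof.
move=> bt; apply/continuousEP => t /=; rewrite push_inord_id; congr (H (_, _)).
by apply: big1 => i _; rewrite (negbTE (bt _ _)) ?mulr0// -ltnS.
Qed.

(** The last sum is the coboundary of [prism a] for positive k. It is left expanded because [prism]
    takes cochains of positive degree only; for k = 0 its inner sums are empty. *)
Lemma prism_coboundary k (a : cochain R Y k) (s : simplex R X k) :
  prism (coboundary a) s = a (post c1 s) - a (post c0 s) -
    \sum_(j < k.+1) (-1) ^+ j * (\sum_(i < k) (-1) ^+ i *
      a (prism_face k s (fun x => bump j (x - (i < x))) (fun x => i < x))%N).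
Proof.
pose D i j := a (prism_face k s (fun x => bump j x - (i < bump j x))
                                (fun x => i < bump j x))%N.
pose N i := a (prism_face k s id (fun x => i <= x)%N).
pose T j i := a (prism_face k s (fun x => bump j (x - (i < x))) (fun x => i < x))%N.
have -> : a (post c1 s) = N 0%N.
  by rewrite /N prism_face_top.
have -> : a (post c0 s) = N k.+1.
  by rewrite /N prism_face_bottom// => x xk; rewrite -ltnNge.
rewrite -(@prism_sum k D T N).
- apply: eq_bigr => i _; congr (_ * _); apply: eq_bigr => j _.
  by rewrite restr_prism_face.
- move=> i j ji ik; congr (a _); apply: eq_prism_face => x xk; rewrite /bump; lia.
- move=> i j ji ik; congr (a _); apply: eq_prism_face => x xk; rewrite /bump; lia.
- move=> i ik; congr (a _); apply: eq_prism_face => x xk; rewrite /bump /=; lia.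
- move=> i ik; congr (a _); apply: eq_prism_face => x xk; rewrite /bump /=; lia.
Qed.

Lemma coboundary_prism k (a : cochain R Y k.+1) (s : simplex R X k.+1) :
  coboundary (prism a) s =
    \sum_(j < k.+2) (-1) ^+ j * (\sum_(i < k.+1) (-1) ^+ i *
      a (prism_face k.+1 s (fun x => bump j (x - (i < x))) (fun x => i < x))%N).
Proof.
rewrite /coboundary /prism; apply: eq_bigr => j _; congr (_ * _).
apply: eq_bigr => i _; congr (_ * a _).
rewrite prism_face_restr// => x xk; have := ltn_ord i; lia.
Qed.

Definition lands (X : topologicalType) (A : set X) : spred R X :=
  fun k s => forall t, A (s t).

Lemma prism_lands (A : set X) (A' : set Y) k (s : simplex R X k) p f b :
  (forall x t, A x -> 0 <= t <= 1 -> A' (H (x, t))) ->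
  lands A s -> lands A' (prism_face p s f b).
Proof.
move=> AA' sA t /=; apply: AA'; first exact: sA.
case: t => t /= /set_mem[t0 t1]; apply/andP; split.
  by apply: sumr_ge0 => i _; rewrite mulr_ge0.
rewrite -[leRHS]t1; apply: ler_sum => i _; rewrite -[leRHS]mulr1 ler_wpM2l//.
by case: (b i).
Qed.

(** The primitive is [prism a]. Only parameters in [0, 1] matter, since the height of a prism point
    is a convex combination of zeros and ones. *)
Lemma homotopy_exact (A B : set X) (A' B' : set Y) k (a : cochain R Y k) :
  (forall x t, A x -> 0 <= t <= 1 -> A' (H (x, t))) ->
  (forall x t, B x -> 0 <= t <= 1 -> B' (H (x, t))) ->
  rel_cocycle (lands B') (lands A') a ->
  rel_exact (lands B) (lands A) (pull c1 a - pull c0 a).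
Proof.
move=> AA' BB' [va za].
have E s : lands B s -> prism (coboundary a) s = 0.
  move=> sB; apply: big1 => i _; rewrite za ?mulr0//.
  by apply: prism_lands sB => x t; exact: BB'.
case: k a va za E => [|k] a va za E.
  exists 0 => // s sB; change (a (post c1 s) - a (post c0 s) - 0 = 0).
  rewrite subr0; have := E s sB.
  rewrite prism_coboundary [X in _ - X = _]big1 ?subr0// => j _.
  by rewrite big_ord0 mulr0.
exists (coboundary (prism a)).
  exists (prism a) => // s sA; apply: big1 => i _; rewrite va ?mulr0//.
  by apply: prism_lands sA => x t; exact: AA'.
by move=> s sB; have := E s sB; rewrite prism_coboundary -coboundary_prism.
Qed.

End Prism.

Section Vertices.
Variable R : realType.

Lemma vertex_subproof k (i : 'I_k.+1) :
  (delta_mx ord0 i : 'rV[R]_k.+1) \in std_simplex R k.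
Proof.
apply/mem_set; split=> [j|]; first by rewrite mxE ler0n.
rewrite (bigD1 i)//= big1 ?addr0 ?mxE ?eqxx// => j /negbTE ji.
by rewrite mxE ji andbF.
Qed.
Definition vertex k (i : 'I_k.+1) : std_simplex R k :=
  @exist _ (fun u => u \in std_simplex R k) _ (vertex_subproof i).

End Vertices.

(** * Contractible pairs *)

Section Contraction.
Variables (R : realType) (X : topologicalType) (H : X * R -> X) (p : X).
Hypotheses (cH : continuous H) (H0 : forall x, H (x, 0) = x)
  (H1 : forall x, H (x, 1) = p).
Let c1 : continuous (fun x => H (x, 1)).
Proof. by move=> x; under eq_fun do rewrite H1; exact: cst_continuous. Qed.
Let c0 : continuous (fun x => H (x, 0)).
Proof. by move=> x; under eq_fun do rewrite H0. Qed.
Let cst k : simplex R X k := mksimplex (@cst_continuous (std_simplex R k) X p).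

Let pull0 k (a : cochain R X k) : pull c0 a = a.
Proof. by apply/funext => s; congr (a _); apply/continuousEP => t /=. Qed.
Let pull1 k (a : cochain R X k) s : pull c1 a s = a (cst k).
Proof. by congr (a _); apply/continuousEP => t /=. Qed.
Let restr_cst k l (f : 'I_k.+1 -> 'I_l.+1) : restr f (cst l) = cst k.
Proof. exact/continuousEP. Qed.

(** The end of the contraction is constant at p, a point of A, and a relative cocycle vanishes on
    simplices of A; so its pullback at time 1 is zero. *)
Lemma contraction_acyclic (A B : set X) k : A p ->
  (forall x t, A x -> 0 <= t <= 1 -> A (H (x, t))) ->
  (forall x t, B x -> 0 <= t <= 1 -> B (H (x, t))) ->
  acyclic (@lands R X B) (lands A) k.
Proof.
move=> Ap HA HB a za; have [va _] := za.
have [e ee he] := homotopy_exact cH c1 c0 HA HB za.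
exists (- e); first exact: exact_cochainN.
move=> s sB; have := he s sB; change (pull c1 a s - pull c0 a s - e s = 0 -> a s - - e s = 0).
rewrite pull0 pull1 va ?sub0r; last by [].
by move=> /eqP; rewrite -opprD oppr_eq0 opprK => /eqP.
Qed.

Lemma sum_sign_odd n : \sum_(i < n.+1) (-1 : int) ^+ i = (~~ odd n)%:R.
Proof.
elim: n => [|n IH]; first by rewrite big_ord_recl big_ord0.
by rewrite big_ord_recr /= IH -signr_odd /=; case: (odd n).
Qed.

Let coboundary_cst k (a : cochain R X k) :
  coboundary a (cst k.+1) = (odd k)%:R * a (cst k).
Proof.
rewrite /coboundary; under eq_bigr do rewrite restr_cst.
by rewrite -mulr_suml sum_sign_odd /= negbK.
Qed.

Lemma lands_set0 k (s : simplex R X k) : ~ lands set0 s.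
Proof. by move/(_ (vertex R ord0)). Qed.

(** A cocycle is cohomologous to its value on the constant simplex. In degree 0 this value is the
    class; in odd degree it is 0 because the cocycle is closed; in positive even degree a constant
    cochain is the coboundary of a constant cochain. *)
Lemma contraction_free (B : set X) k : B p ->
  (forall x t, B x -> 0 <= t <= 1 -> B (H (x, t))) ->
  rel_free (@lands R X B) (lands set0) k (k == 0)%N.
Proof.
move=> Bp HB.
have hom (a : cochain R X k) : rel_cocycle (lands B) (lands set0) a ->
    rel_exact (lands B) (lands set0) (pull c1 a - a).
  by move=> za; rewrite -[in X in _ - X](pull0 a); exact: homotopy_exact za.
case: k hom => [|k] hom.
  have E (a : cochain R X 0) c : a - lin_comb (fun _ : 'I_1 => fun=> 1) c =
      fun s => a s - c ord0.
    apply/funext => s; congr (_ - _); rewrite /lin_comb big_ord_recl big_ord0.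
    by rewrite mulr1 addr0.
  exists (fun _ => fun=> 1); split.
  - move=> _; split=> [s /lands_set0//|s _]; rewrite /coboundary.
    by rewrite -mulr_suml mulr1 sum_sign_odd.
  - move=> a za; exists (fun=> a (cst 0)); case: (hom a za) => e e0 he.
    exists 0 => // s sB; have := he s sB; rewrite e0 E.
    change (pull c1 a s - a s - 0 = 0 -> a s - a (cst 0) - 0 = 0).
    by rewrite pull1 !subr0 => /subr0_eq ->; rewrite subrr.
  move=> c [e /= -> /(_ (cst 0))]; rewrite /lin_comb => /(_ (fun _ => Bp)).
  change (\sum_(i < 1) c i * 1 - 0 = 0 -> forall i, c i = 0).
  by rewrite big_ord_recl big_ord0 mulr1 addr0 subr0 => c00 i; rewrite (ord1 i).
apply: acyclic_rel_free => a za; have [e ee he] := hom a za; have [_ ca] := za.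
have := coboundary_cst a; rewrite ca; last by [].
case: (boolP (odd k.+1)) => [_ /esym|ek _].
  rewrite mul1r => a0; exists (- e); first exact: exact_cochainN.
  move=> s sB; have := he s sB.
  change (pull c1 a s - a s - e s = 0 -> a s - - e s = 0); rewrite pull1 a0 sub0r.
  by move=> /eqP; rewrite -opprD oppr_eq0 opprK => /eqP.
exists (coboundary (fun=> a (cst k.+1)) - e).
  by apply: exact_cochainB => //; exists (fun=> a (cst k.+1)) => // s /lands_set0.
move=> s sB; have := he s sB; set f := coboundary _.
change (pull c1 a s - a s - e s = 0 -> a s - (f s - e s) = 0).
have -> : f s = a (cst k.+1).
  by rewrite /f /coboundary -mulr_suml sum_sign_odd (negbTE ek : odd k.+1 = false) mul1r.
by rewrite pull1 => h; rewrite -[RHS]oppr0 -h; ring.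
Qed.

End Contraction.

(** * Subdivision and excision *)

Section Delete.
Variable T : Type.
Implicit Types l : seq T.

Definition del i l := take i l ++ drop i.+1 l.

Lemma size_del i l k : size l = k.+1 -> (i <= k)%N -> size (del i l) = k.
Proof. by move=> lk ik; rewrite size_cat size_take size_drop lk ltnS ik; lia. Qed.

Lemma nth_del x0 i l j : nth x0 (del i l) j = nth x0 l (bump i j).
Proof.
rewrite /del nth_cat size_take; have [il|/negbTE il] := boolP (i < size l)%N.
  rewrite ?il; case: ifP => ji; first by rewrite nth_take// /bump leqNgt ji.
  by rewrite nth_drop /bump leqNgt ji; congr nth; lia.
rewrite ?il take_oversize ?drop_oversize; try lia.
case: ifP => jl; first by rewrite /bump; congr nth; lia.
by rewrite nth_nil nth_default// /bump; lia.
Qed.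

Lemma del0 x l : del 0 (x :: l) = l.
Proof. by rewrite /del /= drop0. Qed.

Lemma delS i x l : del i.+1 (x :: l) = x :: del i l.
Proof. by []. Qed.

End Delete.

Lemma map_del (T U : Type) (f : T -> U) i l : map f (del i l) = del i (map f l).
Proof. by rewrite /del map_cat map_take map_drop. Qed.

Lemma mem_del (T : eqType) i (l : seq T) : {subset del i l <= l}.
Proof. by move=> x; rewrite mem_cat => /orP[/mem_take|/mem_drop]. Qed.

Section SeqCochains.
Variables (T : Type) (bary : nat -> seq T -> T).
Implicit Types (phi psi : seq T -> int) (l : seq T).

(** Affine simplices are treated as lists of vertices, a k-simplex being a list of length k + 1, so
    that subdivision becomes recursion on lists. *)
Definition sdiff k phi l : int := \sum_(i < k.+2) (-1) ^+ i * phi (del i l).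

Lemma eq_sdiff k phi psi l : size l = k.+2 ->
  (forall m, size m = k.+1 -> phi m = psi m) -> sdiff k phi l = sdiff k psi l.
Proof.
move=> lk E; apply: eq_bigr => i _; rewrite E//.
by rewrite (size_del lk) // -ltnS.
Qed.

Lemma sdiffB k phi psi l :
  sdiff k (fun m => phi m - psi m) l = sdiff k phi l - sdiff k psi l.
Proof. by rewrite -sumrB; apply: eq_bigr => i _; rewrite mulrBr. Qed.

Lemma del_del i j l : (i <= j)%N -> del j (del i l) = del i (del j.+1 l).
Proof.
elim: l i j => [|x l IH] [|i] [|j] //= ij.
- by rewrite del0 /del /= drop0.
- by rewrite del0 delS del0.
- by rewrite !delS IH.
Qed.

Lemma sdiffK k phi l : sdiff k.+1 (sdiff k phi) l = 0.
Proof.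
rewrite /sdiff; pose F i j := phi (del j (del i l)).
have FE i j : (i <= j)%N -> F i j = F j.+1 i by move=> ij; rewrite /F del_del.
transitivity (\sum_(i < k.+3) \sum_(j < k.+2) (-1) ^+ (i + j) * F i j).
  apply: eq_bigr => i _; rewrite mulr_sumr; apply: eq_bigr => j _.
  by rewrite mulrA -exprD.
transitivity (\sum_(p : 'I_k.+3 * 'I_k.+2) (-1) ^+ (p.1 + p.2) * F p.1 p.2).
  by rewrite -(pair_bigA _ (fun (i : 'I_k.+3) (j : 'I_k.+2) => (-1) ^+ (i + j) * F i j)).
rewrite (bigID (fun p : 'I_k.+3 * 'I_k.+2 => (p.1 <= p.2)%N)) /=.
apply/eqP; rewrite addr_eq0 -sumrN; apply/eqP.
pose f (p : 'I_k.+3 * 'I_k.+2) : 'I_k.+3 * 'I_k.+2 := (inord p.2.+1, inord p.1).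
pose g (p : 'I_k.+3 * 'I_k.+2) : 'I_k.+3 * 'I_k.+2 := (inord p.2, inord p.1.-1).
rewrite (reindex_onto g f) /=; last first.
  move=> [i j] /= ij; have ik := ltn_ord i; have jk := ltn_ord j.
  by rewrite /f /g /=; congr pair; apply/val_inj; rewrite /= ?inordK; lia.
apply: eq_big => [[i j]|[i j] /=].
  have := ltn_ord i; have := ltn_ord j; rewrite /f /g /= => jk ik.
  apply/idP/idP.
    move=> /andP[+ /eqP [/(congr1 val) /= + /(congr1 val) /=]].
    by rewrite !inordK; lia.
  move=> ij; rewrite !inordK; try lia.
  apply/andP; split; first lia.
  by apply/eqP; congr pair; apply/val_inj; rewrite /= ?inordK; lia.
have := ltn_ord i; have := ltn_ord j; rewrite /f /g /= => jk ik.
move=> /andP[+ /eqP [/(congr1 val) /= + /(congr1 val) /=]].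
rewrite !inordK; try lia; move=> h1 h2 h3.
rewrite FE//; have -> : i.-1.+1 = i by lia.
have -> : (-1 : int) ^+ (j + i.-1) = - (-1) ^+ (i + j).
  by have -> : (i + j = (j + i.-1).+1)%N by [lia]; rewrite exprS mulN1r opprK.
by rewrite mulNr.
Qed.

(** Transpose of barycentric subdivision Sd l = b . Sd (boundary l), where b is the barycentre of l
    and the dot denotes the cone. *)
Fixpoint sd k phi l : int :=
  match k with
  | 0 => phi l
  | k'.+1 => sdiff k' (sd k' (phi \o cons (bary k l))) l
  end.

(** Transpose of the homotopy T l = b . (l - T (boundary l)) between subdivision and the
    identity. *)
Fixpoint td k phi l : int :=
  phi (bary k l :: l) -
  match k with
  | 0 => 0
  | k'.+1 => sdiff k' (td k' (phi \o cons (bary k l))) l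
  end.

Lemma eq_sd k phi psi l : size l = k.+1 ->
  (forall m, size m = k.+1 -> phi m = psi m) -> sd k phi l = sd k psi l.
Proof.
elim: k phi psi l => [|k IH] phi psi l lk E /=; first exact: E.
by apply: eq_sdiff => // m mk; apply: IH => // m' m'k; rewrite /= E//= m'k.
Qed.

Lemma eq_td k phi psi l : size l = k.+1 ->
  (forall m, size m = k.+2 -> phi m = psi m) -> td k phi l = td k psi l.
Proof.
elim: k phi psi l => [|k IH] phi psi l lk E /=; first by rewrite E//= lk.
rewrite E/= ?lk//; congr (_ - _).
by apply: eq_sdiff => // m mk; apply: IH => // m' m'k; rewrite /= E//= m'k.
Qed.

Lemma sdB k phi psi l :
  sd k (fun m => phi m - psi m) l = sd k phi l - sd k psi l.
Proof.
elim: k phi psi l => [|k IH] phi psi l //=.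
by rewrite -sdiffB; congr (sdiff k _ l); apply/funext => m; rewrite -IH.
Qed.

Lemma tdB k phi psi l :
  td k (fun m => phi m - psi m) l = td k phi l - td k psi l.
Proof.
elim: k phi psi l => [|k IH] phi psi l /=; first by rewrite !subr0.
rewrite [in LHS](_ : td k _ = fun m =>
    td k (phi \o cons (bary k.+1 l)) m - td k (psi \o cons (bary k.+1 l)) m).
  by rewrite sdiffB !opprB addrACA [in RHS]addrACA [- _ + _]addrC.
by apply/funext => m; rewrite -IH.
Qed.

Lemma sdiff_cons k phi b l :
  sdiff k.+1 phi (b :: l) = phi l - sdiff k (phi \o cons b) l.
Proof.
rewrite /sdiff big_ord_recl /= del0 mul1r -sumrN; congr (_ + _).
by apply: eq_bigr => i _; rewrite delS exprS mulN1r mulNr.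
Qed.

Lemma sdiff_cons0 phi b l : size l = 1%N ->
  sdiff 0 phi (b :: l) = phi l - phi [:: b].
Proof.
case: l => [|x []]// _; rewrite /sdiff !big_ord_recl big_ord0 /=.
by rewrite del0 /del /= mul1r expr1 mulN1r addr0.
Qed.

Lemma sd_sdiff k phi l : size l = k.+2 ->
  sd k.+1 (sdiff k phi) l = sdiff k (sd k phi) l.
Proof.
elim: k phi l => [|k IH] phi l lk.
  set b := bary 1 l; rewrite /= -/b.
  rewrite (@eq_sdiff _ _ (fun m => phi m - phi [:: b]))//; last first.
    by move=> m mk; rewrite /= sdiff_cons0.
  rewrite sdiffB -[RHS]subr0; congr (_ - _).
  by rewrite /sdiff !big_ord_recl big_ord0 /= expr0 expr1 mul1r mulN1r addr0 subrr.
set b := bary k.+2 l.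
change (sdiff k.+1 (sd k.+1 (sdiff k.+1 phi \o cons b)) l = sdiff k.+1 (sd k.+1 phi) l).
rewrite (@eq_sdiff _ _ (fun m => sd k.+1 phi m - sd k.+1 (sdiff k (phi \o cons b)) m))//.
  rewrite sdiffB -[RHS]subr0; congr (_ - _).
  rewrite (@eq_sdiff _ _ (sdiff k (sd k (phi \o cons b))))// ?sdiffK//.
  by move=> m mk; rewrite IH.
move=> m mk; rewrite -sdB; apply: eq_sd => // m' m'k.
by rewrite /= sdiff_cons.
Qed.

Lemma td_sdiff0 phi l : size l = 1%N ->
  td 0 (sdiff 0 phi) l = phi l - phi [:: bary 0 l].
Proof. by move=> l1; rewrite /= subr0 sdiff_cons0. Qed.

(** Induction through the boundary of a cone ([sdiff_cons]). The hypothesis on [bary 0] starts it: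
    the cone over a vertex x is the degenerate edge (x, x), whose boundary is zero. *)
Lemma td_sdiff k phi l : (forall x, bary 0 [:: x] = x) -> size l = k.+2 ->
  td k.+1 (sdiff k.+1 phi) l = phi l - sd k.+1 phi l - sdiff k (td k phi) l.
Proof.
move=> b0; have base psi m : size m = 1%N -> td 0 (sdiff 0 psi) m = 0.
  by move=> m1; rewrite td_sdiff0//; case: m m1 => [|x []]//= _; rewrite b0 subrr.
elim: k phi l => [|k IH] phi l lk.
  set b := bary 1 l.
  change (sdiff 1 phi (b :: l) - sdiff 0 (td 0 (sdiff 1 phi \o cons b)) l =
    phi l - sdiff 0 (sd 0 (phi \o cons b)) l - sdiff 0 (td 0 phi) l).
  rewrite sdiff_cons.
  rewrite (@eq_sdiff _ (td 0 (sdiff 1 phi \o cons b)) (fun m => td 0 phi m - td 0 (sdiff 0 (phi \o cons b)) m))//; last first.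
    by move=> m mk; rewrite -tdB; apply: eq_td => // m' m'k; rewrite /= sdiff_cons.
  suff z : sdiff 0 (td 0 (sdiff 0 (phi \o cons b))) l = 0 by rewrite sdiffB z subr0.
  by rewrite /sdiff big1// => i _; rewrite base ?mulr0// (size_del lk)// -ltnS.
set b := bary k.+2 l.
change (sdiff k.+2 phi (b :: l) - sdiff k.+1 (td k.+1 (sdiff k.+2 phi \o cons b)) l =
  phi l - sdiff k.+1 (sd k.+1 (phi \o cons b)) l - sdiff k.+1 (td k.+1 phi) l).
rewrite sdiff_cons.
rewrite (@eq_sdiff _ (td k.+1 (sdiff k.+2 phi \o cons b)) (fun m => td k.+1 phi m - td k.+1 (sdiff k.+1 (phi \o cons b)) m))//; last first.
  by move=> m mk; rewrite -tdB; apply: eq_td => // m' m'k; rewrite /= sdiff_cons.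
rewrite sdiffB.
rewrite [X in _ - (_ - X)](@eq_sdiff _ (td k.+1 (sdiff k.+1 (phi \o cons b))) (fun m => (phi \o cons b) m - sd k.+1 (phi \o cons b) m
   - sdiff k (td k (phi \o cons b)) m))//.
  by rewrite !sdiffB sdiffK subr0; ring.
by move=> m mk; rewrite IH.
Qed.

End SeqCochains.

Lemma sd_map (T U : Type) (baryT : nat -> seq T -> T) (baryU : nat -> seq U -> U)
    (f : T -> U) k phi l : size l = k.+1 ->
  (forall j m, size m = j.+1 -> baryU j (map f m) = f (baryT j m)) ->
  sd baryU k phi (map f l) = sd baryT k (phi \o map f) l.
Proof.
move=> + H; elim: k phi l => [|k IH] phi l lk //=.
rewrite H// /sdiff; apply: eq_bigr => i _; rewrite -map_del IH//.
by rewrite (size_del lk)// -ltnS.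
Qed.

Lemma td_map (T U : Type) (baryT : nat -> seq T -> T) (baryU : nat -> seq U -> U)
    (f : T -> U) k phi l : size l = k.+1 ->
  (forall j m, size m = j.+1 -> baryU j (map f m) = f (baryT j m)) ->
  td baryU k phi (map f l) = td baryT k (phi \o map f) l.
Proof.
move=> + H; elim: k phi l => [|k IH] phi l lk /=; rewrite H//; congr (_ - _).
rewrite /sdiff; apply: eq_bigr => i _; rewrite -map_del IH//.
by rewrite (size_del lk)// -ltnS.
Qed.

(** * Affine simplices and the mesh of a subdivision *)

Section Affine.
Variable R : realType.

Section Aff.
Variable q : nat.
Implicit Types l : seq (std_simplex R q).

Lemma aff_subproof k l (t : std_simplex R k) :
  (\sum_(i < k.+1) val t ord0 i *: val (nth (vertex R ord0) l i))
    \in std_simplex R q.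
Proof.
have [t0 t1] := set_mem (valP t).
have P i := set_mem (valP (nth (vertex R ord0 : std_simplex R q) l i)).
apply/mem_set; split=> [j|].
  rewrite summxE; apply: sumr_ge0 => i _; rewrite mxE mulr_ge0//.
  by have [] := P i.
under eq_bigr do rewrite summxE.
rewrite exchange_big -[RHS]t1; apply: eq_bigr => i _ /=.
under eq_bigr do rewrite mxE.
by rewrite -mulr_sumr; have [_ ->] := P i; rewrite mulr1.
Qed.
Definition aff k l (t : std_simplex R k) : std_simplex R q :=
  @exist _ (fun u => u \in std_simplex R q) _ (aff_subproof l t).

Lemma aff_continuous k l : continuous (@aff k l).
Proof.
apply: sub_cts; apply: mx_cts => i j /=.
refine (@cts_ext _ _ (fun t : std_simplex R k => \sum_(x < k.+1)
  val t ord0 x * val (nth (vertex R ord0 : std_simplex R q) l x) i j) _ _ _).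
  by move=> t; rewrite summxE; apply: eq_bigr => x _; rewrite mxE.
refine (cts_sum _) => x _; refine (cts_mul _ (cts_cst _)).
exact: (cts_entry _ _ cts_val).
Qed.

Lemma aff_push k p l m (f : 'I_p.+1 -> 'I_k.+1) t :
  (forall x : 'I_p.+1, nth (vertex R ord0) m x = nth (vertex R ord0) l (f x)) ->
  aff l (push f t) = aff m t.
Proof.
move=> ml; apply/val_inj => /=; rewrite [RHS](partition_big f xpredT) //=.
apply: eq_bigr => j _; rewrite mxE scaler_suml; apply: eq_bigr => i /eqP <-.
by rewrite ml.
Qed.

Lemma aff_val_combine k l (t : std_simplex R k) i :
  val (aff l t) ord0 i =
  \sum_(j < k.+1) val t ord0 j * val (nth (vertex R ord0) l j) ord0 i.
Proof. by rewrite /= summxE; apply: eq_bigr => j _; rewrite mxE. Qed.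

Lemma norm_aff_le k l (t : std_simplex R k) (z : 'rV[R]_q.+1) r : size l = k.+1 ->
  (forall v, v \in l -> `|z - val v| <= r) -> `|z - val (aff l t)| <= r.
Proof.
move=> lk zl; have [t0 t1] := set_mem (valP t).
have -> : z - val (aff l t) =
    \sum_(i < k.+1) val t ord0 i *: (z - val (nth (vertex R ord0) l i)).
  under eq_bigr do rewrite scalerBr.
  by rewrite sumrB -scaler_suml t1 scale1r.
apply: (le_trans (ler_norm_sum _ _ _)).
rewrite -[r]mul1r -[X in X * r]t1 mulr_suml; apply: ler_sum => i _.
by rewrite normrZ ger0_norm// ler_wpM2l// zl// mem_nth// lk.
Qed.

End Aff.

Definition verts k : seq (std_simplex R k) := [seq vertex R i | i <- enum 'I_k.+1].

Lemma size_verts k : size (verts k) = k.+1.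
Proof. by rewrite size_map size_enum_ord. Qed.

Lemma nth_verts k (i : 'I_k.+1) x : nth x (verts k) i = vertex R i.
Proof. by rewrite (nth_map ord0) ?size_enum_ord// nth_ord_enum. Qed.

Lemma aff_verts k (t : std_simplex R k) : aff (verts k) t = t.
Proof.
apply/val_inj/rowP => j; rewrite aff_val_combine (bigD1 j)//= big1 ?addr0.
  by rewrite nth_verts mxE !eqxx mulr1.
by move=> i ij; rewrite nth_verts mxE eq_sym (negbTE ij) andbF mulr0.
Qed.

Lemma aff_map p q k (l : seq (std_simplex R q)) (m : seq (std_simplex R p)) (t : std_simplex R k) :
  size m = k.+1 -> aff (map (@aff q p l) m) t = aff l (aff m t).
Proof.
move=> mk; apply/val_inj/rowP => i; rewrite !aff_val_combine.
under [RHS]eq_bigr do rewrite aff_val_combine mulr_suml.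
rewrite exchange_big; apply: eq_bigr => j _ /=.
rewrite (nth_map (vertex R ord0)) ?mk// summxE mulr_sumr; apply: eq_bigr => x _.
by rewrite mxE mulrA.
Qed.

Lemma map_aff_verts q k (l : seq (std_simplex R q)) : size l = k.+1 ->
  map (@aff q k l) (verts k) = l.
Proof.
move=> lk; apply: (@eq_from_nth _ (vertex R ord0)); rewrite size_map size_verts// => i ik.
rewrite (nth_map (vertex R ord0)) ?size_verts// -[ i ]/(val (Ordinal ik)) nth_verts.
apply/val_inj/rowP => j; rewrite aff_val_combine (bigD1 (Ordinal ik))//= big1 ?addr0.
  by rewrite mxE !eqxx mul1r.
by move=> x xi; rewrite mxE (negbTE xi) andbF mul0r.
Qed.

Lemma push_aff p q k (f : 'I_p.+1 -> 'I_q.+1) (m : seq (std_simplex R p)) (t : std_simplex R k) :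
  size m = k.+1 -> aff (map (push f) m) t = push f (aff m t).
Proof.
move=> mk; pose l := [seq vertex R (f i) | i <- enum 'I_p.+1].
have pE u : push f u = aff l u.
  rewrite -[LHS]aff_verts; apply: aff_push => x.
  by rewrite (nth_map ord0) ?size_enum_ord// nth_ord_enum nth_verts.
by rewrite (eq_map pE) pE aff_map.
Qed.

Lemma unif_subproof k : (const_mx k.+1%:R^-1 : 'rV[R]_k.+1) \in std_simplex R k.
Proof.
apply/mem_set; split=> [i|]; first by rewrite mxE invr_ge0.
under eq_bigr do rewrite mxE.
by rewrite sumr_const card_ord -[_ *+ _]mulr_natl mulfV// pnatr_eq0.
Qed.
Definition unif k : std_simplex R k :=
  @exist _ (fun u => u \in std_simplex R k) _ (unif_subproof k).

Definition bary q k (l : seq (std_simplex R q)) : std_simplex R q := aff l (unif k).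

Lemma bary_singleton q (x : std_simplex R q) : bary 0 [:: x] = x.
Proof.
apply/val_inj/rowP => i; rewrite aff_val_combine big_ord_recl big_ord0 addr0 /=.
by rewrite mxE invr1 mul1r.
Qed.

Definition mesh q (D : R) (l : seq (std_simplex R q)) :=
  forall x y, x \in l -> y \in l -> `|val x - val y| <= D.

(** A metric substitute for lying in the convex hull of l: every closed ball containing l, with any
    centre, contains m. *)
Definition hull_of q (l m : seq (std_simplex R q)) :=
  forall (z : 'rV[R]_q.+1) r, (forall v, v \in l -> `|z - val v| <= r) ->
  forall y, y \in m -> `|z - val y| <= r.

(** Among the k + 1 averaged differences from v one is zero, which gains the factor k / (k + 1). *)
Lemma norm_bary_le q k D (l : seq (std_simplex R q)) v : size l = k.+1 ->
  mesh D l -> v \in l -> `|val v - val (bary k l)| <= k%:R / k.+1%:R * D.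
Proof.
move=> lk lD vl.
have -> : val v - val (bary k l) =
    \sum_(i < k.+1) k.+1%:R^-1 *: (val v - val (nth (vertex R ord0) l i)).
  under eq_bigr do rewrite scalerBr.
  rewrite sumrB -scaler_suml sumr_const card_ord -[(k.+1%:R)^-1 *+ _]mulr_natl.
  rewrite mulfV ?pnatr_eq0// scale1r; congr (_ - _).
  by rewrite /=; apply: eq_bigr => i _; rewrite mxE.
apply: (le_trans (ler_norm_sum _ _ _)).
have vi : (index v l < k.+1)%N by rewrite -lk index_mem.
rewrite (bigD1 (Ordinal vi))//= nth_index// subrr scaler0 normr0 add0r.
have -> : k%:R / k.+1%:R * D = \sum_(i < k.+1 | i != Ordinal vi) k.+1%:R^-1 * D.
  rewrite sumr_const cardC1 card_ord /= -[_ *+ _]mulr_natl; ring.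
apply: ler_sum => i _; rewrite normrZ ger0_norm ?invr_ge0// ler_wpM2l ?invr_ge0//.
by apply: lD => //; rewrite mem_nth// lk.
Qed.

(** A piece is the barycentre joined to a piece of a face. The face pieces are small by induction,
    with a better factor, and lie in the hull of l, all of whose points are as near to the
    barycentre as the vertices of l. *)
Lemma sd_small q k D (phi : seq (std_simplex R q) -> int) l : size l = k.+1 -> mesh D l ->
  (forall m, size m = k.+1 -> mesh (k%:R / k.+1%:R * D) m -> hull_of l m -> phi m = 0) ->
  sd (@bary q) k phi l = 0.
Proof.
elim: k phi l => [|k IH] phi l lk lD P /=.
  apply: P => //; last by move=> z r zl y; exact: zl.
  rewrite !mul0r => x y; by case: l lk lD => [|z []]//= _ _; rewrite !inE => /eqP -> /eqP ->; rewrite subrr normr0.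
rewrite /sdiff big1// => i _; rewrite [X in _ * X](_ : _ = 0) ?mulr0//.
have D0 : 0 <= D.
  case: l lk lD {P} => [|x l]// _ /(_ x x (mem_head _ _) (mem_head _ _)).
  by rewrite subrr normr0.
have le_rho : k%:R / k.+1%:R * D <= k.+1%:R / k.+2%:R * D.
  by rewrite ler_wpM2r// ler_pdivrMr// mulrAC ler_pdivlMr// -!natrM ler_nat; lia.
apply: IH => [||m mk mD lm]; first by rewrite (size_del lk)// -ltnS.
  by move=> x y /mem_del xl /mem_del yl; exact: lD.
apply: P => /=; first by rewrite mk.
  have bm y : y \in m -> `|val (bary k.+1 l) - val y| <= k.+1%:R / k.+2%:R * D.
    move=> ym; apply: lm ym => v /mem_del vl; rewrite distrC.
    exact: norm_bary_le.
  move=> x y; rewrite !inE => /orP[/eqP ->|xm] /orP[/eqP ->|ym].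
  - by rewrite subrr normr0 mulr_ge0// divr_ge0.
  - exact: bm.
  - by rewrite distrC; exact: bm.
  - by apply: le_trans le_rho; exact: mD.
move=> z r zl y; rewrite inE => /orP[/eqP ->|ym]; first exact: norm_aff_le.
by apply: lm ym => v /mem_del; exact: zl.
Qed.

Lemma iter_sd_small q k m D (phi : seq (std_simplex R q) -> int) l :
  size l = k.+1 -> mesh D l ->
  (forall l', size l' = k.+1 -> mesh ((k%:R / k.+1%:R) ^+ m * D) l' -> phi l' = 0) ->
  iter m (sd (@bary q) k) phi l = 0.
Proof.
elim: m D l => [|m IH] D l lk lD P; first by apply: P => //; rewrite expr0 mul1r.
rewrite iterS; apply: (sd_small lk lD) => l' l'k l'D _.
by apply: (IH _ _ l'k l'D) => l'' l''k; rewrite mulrA -exprSr; exact: P.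
Qed.

End Affine.

Lemma compact_sub (X : topologicalType) (A : set X) :
  compact A -> compact [set: A].
Proof.
move=> cA F PF _; pose G := [set B : set X | F (val @^-1` B)].
have PG : ProperFilter G.
  split; first exact: (@filter_not_empty _ F).
  split; first exact: (@filterT _ F).
    by move=> B C; exact: filterI.
  by move=> B C BC; apply: filterS => x; exact: BC.
have GA : G A.
  apply: (@filterS _ F _ setT); last exact: filterT.
  by move=> [x xA] _ /=; exact: set_mem.
have [p [Ap cp]] := cA G PG GA.
exists (exist _ p (mem_set Ap)); split=> // B C FB [_ [[V oV <-] /= Vp VC]].
have GB : G (val @` B) by apply: (@filterS _ F _ B) => // x Bx; exists x.
have Vn : nbhs p V by exact: open_nbhs_nbhs.
have [x [[y By <-] Vy]] := cp _ _ GB Vn.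
by exists y; split=> //; exact: VC.
Qed.

Section Lebesgue.
Variables (R : realType) (X : topologicalType) (U V : set X).
Hypotheses (oU : open U) (oV : open V).

Lemma std_simplex_compact k : compact (std_simplex R k).
Proof.
apply: bounded_closed_compact.
  exists 1; split=> // M M1 t [t0 t1]; apply: le_trans (ltW M1).
  rewrite [leLHS]/Num.norm /= mx_normrE; apply: bigmax_le => // -[i j] _ /=.
  rewrite (ord1 i) ger0_norm// -t1 (bigD1 j)//= lerDl.
  exact: sumr_ge0.
have -> : std_simplex R k = \bigcap_(i : 'I_k.+1) [set t : 'rV[R]_k.+1 | 0 <= t ord0 i] `&`
    [set t | \sum_i t ord0 i = 1].
  apply/seteqP; split=> t [t0 t1]; split=> //; first by move=> i _; exact: t0.
  by move=> i; exact: t0.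
apply: closedI.
  apply: closed_bigI => i _.
  refine (@cts_closed _ _ (fun t : 'rV[R]_k.+1 => t ord0 i) [set x | 0 <= x] _ _).
    exact: coord_continuous.
  exact: closed_ge.
refine (@cts_closed _ _ (fun t : 'rV[R]_k.+1 => \sum_i t ord0 i) [set 1] _ _).
  by refine (cts_sum _) => i _; exact: coord_continuous.
exact: closed_eq.
Qed.

Lemma lebesgue_number k (s : simplex R X k) : lands (U `|` V) s ->
  exists2 e : R, 0 < e & forall x : std_simplex R k,
    (forall y : std_simplex R k, `|val x - val y| < e -> U (s y)) \/
    (forall y : std_simplex R k, `|val x - val y| < e -> V (s y)).
Proof.
move=> sUV; pose P (e : R) (x : std_simplex R k) :=
  (forall y : std_simplex R k, `|val x - val y| < e -> U (s y)) \/
  (forall y : std_simplex R k, `|val x - val y| < e -> V (s y)).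
have key (W : set X) x : open W -> W (s x) -> exists2 d : R, 0 < d &
    forall y : std_simplex R k, `|val x - val y| < d -> W (s y).
  move=> oW Wx; have : nbhs x (s @^-1` W).
    by apply: (@cts_fun _ _ s x W); apply: open_nbhs_nbhs.
  move=> [_ [[O oO <-] /= Ox OW]].
  have /nbhs_ballP[d d0 dO] : nbhs (val x) O by apply: open_nbhs_nbhs.
  exists d => // y xy; apply: OW; apply: dO; rewrite -ball_normE /=; exact: xy.
have /compact_near_coveringP/(_ R (0^'+) P _) : compact [set: std_simplex R k].
  exact/compact_sub/std_simplex_compact.
have nbd (x : std_simplex R k) (d : R) : 0 < d ->
    nbhs x [set y : std_simplex R k | `|val x - val y| < d].
  move=> d0; have c : {for x, continuous (fun y : std_simplex R k => val y)}.
    exact: initial_continuous.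
  apply: (c [set z | `|val x - z| < d]).
  by apply/nbhs_ballP; exists d => // y; rewrite -ball_normE.
move=> h; have ne : \forall e \near 0^'+, [set: std_simplex R k] `<=` P e.
  apply: h => x _.
  have [W WUV Wx] : exists2 W, (W = U \/ W = V) & W (s x).
    by case: (sUV x) => h; [exists U|exists V] => //; [left|right].
  have oW : open W by case: WUV => ->.
  have [d d0 dW] := key W x oW Wx; have d2 : 0 < d / 2 by rewrite divr_gt0.
  (* One half of [d] pays for moving the centre, the other for the radius around the new centre. *)
  exists ([set y : std_simplex R k | `|val x - val y| < d / 2], [set e | e <= d / 2]).
    by split; [exact: nbd | exact: nbhs_right_le].
  move=> [x' e] /= [xx' ed]; suff h (y : std_simplex R k) :
      `|val x' - val y| < e -> W (s y).
    by case: WUV => WE; [left|right] => y; rewrite -WE; exact: h.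
  move=> xy; apply: dW; rewrite -(subrK (val x') (val x)) -addrA.
  apply: (le_lt_trans (ler_normD _ _)); rewrite (splitr d) ltrD//.
  exact: lt_le_trans ed.
have : 0^'+ [set e : R | [set: std_simplex R k] `<=` P e /\ 0 < e].
  by apply: filterI; [exact: ne | exact: nbhs_right_gt].
move=> /filter_ex[e [eP e0]]; exists e => // x; exact: eP.
Qed.

End Lebesgue.

Section Subdivision.
Variables (R : realType) (X : topologicalType).

Lemma afs_subproof q k (s : simplex R X q) (l : seq (std_simplex R q)) :
  continuous (s \o @aff R q k l).
Proof. exact: (cts_comp (@aff_continuous R q k l) (@cts_fun _ _ s)). Qed.
Definition afs q k (s : simplex R X q) l : simplex R X k :=
  mksimplex (@afs_subproof q k s l).

Lemma restr_afs q k (s : simplex R X q) l (i : 'I_k.+2) :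
  restr (lift i) (afs k.+1 s l) = afs k s (del i l).
Proof.
by apply/continuousEP => t /=; congr (s _); apply: aff_push => x; rewrite nth_del.
Qed.

Lemma afs_restr p q k (s : simplex R X q) (f : 'I_p.+1 -> 'I_q.+1) l :
  size l = k.+1 -> afs k (restr f s) l = afs k s (map (push f) l).
Proof. by move=> lk; apply/continuousEP => t /=; rewrite push_aff. Qed.

Lemma afs_afs p q k (s : simplex R X q) l (m : seq (std_simplex R p)) :
  size m = k.+1 -> afs k (afs p s l) m = afs k s (map (@aff R q p l) m).
Proof. by move=> mk; apply/continuousEP => t /=; rewrite aff_map. Qed.

Lemma afs_verts k (s : simplex R X k) : afs k s (verts R k) = s.
Proof. by apply/continuousEP => t /=; rewrite aff_verts. Qed.

Lemma afs_lands (A : set X) q k (s : simplex R X q) l :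
  lands A s -> lands A (afs k s l).
Proof. by move=> sA t; exact: sA. Qed.

Lemma bary_map_aff q p (l : seq (std_simplex R q)) k (m : seq (std_simplex R p)) :
  size m = k.+1 -> bary k (map (@aff R q p l) m) = aff l (bary k m).
Proof. exact: aff_map. Qed.

Lemma bary_map_push q p (f : 'I_p.+1 -> 'I_q.+1) k (m : seq (std_simplex R p)) :
  size m = k.+1 -> bary k (map (push f) m) = push f (bary k m).
Proof. exact: push_aff. Qed.

Definition sdc k (a : cochain R X k) : cochain R X k := fun s =>
  sd (@bary R k) k (fun l => a (afs k s l)) (verts R k).

Definition tdc k (a : cochain R X k.+1) : cochain R X k := fun s =>
  td (@bary R k) k (fun l => a (afs k.+1 s l)) (verts R k).

Lemma map_push_verts k (i : 'I_k.+2) : map (@push R _ _ (lift i)) (verts R k) = del i (verts R k.+1).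
Proof.
have sz : size (del i (verts R k.+1)) = k.+1.
  by rewrite (size_del (size_verts R k.+1))// -ltnS.
apply: (@eq_from_nth _ (vertex R ord0)); rewrite size_map size_verts ?sz// => j jk.
rewrite (nth_map (vertex R ord0)) ?size_verts// nth_del -[j]/(val (Ordinal jk)).
rewrite nth_verts -[bump _ _]/(val (lift i (Ordinal jk))) nth_verts.
apply/val_inj/rowP => x; rewrite /= !mxE (bigID (pred1 (Ordinal jk))) /= addrC big1.
  rewrite add0r; case: (eqVneq x (lift i (Ordinal jk))) => [->|xi].
    rewrite (eq_bigl (pred1 (Ordinal jk))) ?big_pred1_eq ?mxE ?eqxx// => y /=.
    by case: (eqVneq y (Ordinal jk)) => [->|_]; rewrite ?eqxx ?andbF.
  rewrite big1// => y /andP[/eqP yx /eqP yj]; by rewrite -yx yj eqxx in xi.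
by move=> y /andP[_ /negbTE yj]; rewrite mxE yj andbF.
Qed.

Lemma sdc_afs q k (a : cochain R X k) (s : simplex R X q) l : size l = k.+1 ->
  sdc a (afs k s l) = sd (@bary R q) k (fun l => a (afs k s l)) l.
Proof.
move=> lk; rewrite -[in RHS](map_aff_verts lk).
rewrite (@sd_map _ _ (@bary R k)) ?size_verts//; last first.
  by move=> j m mj; rewrite bary_map_aff.
by apply: eq_sd; rewrite ?size_verts// => m mk /=; rewrite afs_afs.
Qed.

Lemma iter_sdc_afs q k m (a : cochain R X k) (s : simplex R X q) l :
  size l = k.+1 ->
  iter m (@sdc k) a (afs k s l) = iter m (sd (@bary R q) k) (fun l => a (afs k s l)) l.
Proof.
elim: m l => [|m IH] l lk //; rewrite !iterS sdc_afs//.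
by apply: eq_sd => // l' l'k; rewrite IH.
Qed.

Lemma sdc_restr k (a : cochain R X k) (s : simplex R X k.+1) (i : 'I_k.+2) :
  sdc a (restr (lift i) s) =
  sd (@bary R k.+1) k (fun l => a (afs k s l)) (del i (verts R k.+1)).
Proof.
rewrite -map_push_verts (@sd_map _ _ (@bary R k)) ?size_verts//; last first.
  by move=> j m mj; rewrite bary_map_push.
by apply: eq_sd; rewrite ?size_verts// => m mk /=; rewrite afs_restr.
Qed.

Lemma tdc_restr k (a : cochain R X k.+1) (s : simplex R X k.+1) (i : 'I_k.+2) :
  tdc a (restr (lift i) s) =
  td (@bary R k.+1) k (fun l => a (afs k.+1 s l)) (del i (verts R k.+1)).
Proof.
rewrite -map_push_verts (@td_map _ _ (@bary R k)) ?size_verts//; last first.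
  by move=> j m mj; rewrite bary_map_push.
by apply: eq_td; rewrite ?size_verts// => m mk /=; rewrite afs_restr.
Qed.

Lemma coboundary_afs q k (a : cochain R X k) (s : simplex R X q) l :
  coboundary a (afs k.+1 s l) = sdiff k (fun l => a (afs k s l)) l.
Proof. by apply: eq_bigr => i _; rewrite restr_afs. Qed.

Lemma coboundary_sdc k (a : cochain R X k) : coboundary (sdc a) = sdc (coboundary a).
Proof.
apply/funext => s.
have -> : coboundary (sdc a) s =
    sdiff k (sd (@bary R k.+1) k (fun l => a (afs k s l))) (verts R k.+1).
  by apply: eq_bigr => i _; rewrite sdc_restr.
rewrite -sd_sdiff ?size_verts// /sdc.
by congr (sd _ _ _ _); apply/funext => l; rewrite coboundary_afs.
Qed.

Lemma tdc_coboundary k (a : cochain R X k.+1) s :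
  tdc (coboundary a) s = a s - sdc a s - coboundary (tdc a) s.
Proof.
rewrite [LHS]/tdc; under eq_fun do rewrite coboundary_afs.
rewrite td_sdiff ?size_verts//; last exact: bary_singleton.
rewrite afs_verts; congr (_ - _).
by rewrite /coboundary; apply: eq_bigr => i _; rewrite tdc_restr.
Qed.

Lemma sd_vanish q k (s : simplex R X q) (P : spred R X) (a : cochain R X k) l :
  size l = k.+1 -> (forall l, P k (afs k s l)) -> vanish P a ->
  sd (@bary R q) k (fun l => a (afs k s l)) l = 0.
Proof.
move=> lk Ps va; rewrite (@eq_sd _ _ _ _ (fun _ => 0 - 0)) ?sdB ?subrr//.
by move=> m _; rewrite va// subrr.
Qed.

Lemma td_vanish q k (s : simplex R X q) (P : spred R X) (a : cochain R X k.+1) l :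
  size l = k.+1 -> (forall l, P k.+1 (afs k.+1 s l)) -> vanish P a ->
  td (@bary R q) k (fun l => a (afs k.+1 s l)) l = 0.
Proof.
move=> lk Ps va; rewrite (@eq_td _ _ _ _ (fun _ => 0 - 0)) ?tdB ?subrr//.
by move=> m _; rewrite va// subrr.
Qed.

End Subdivision.

(** * Small simplices and excision *)

Section Excision.
Variables (R : realType) (X : topologicalType) (K U' V' : set X).
Hypotheses (oU : open U') (oV : open V').
Let U := K `&` U'.
Let V := K `&` V'.
Let W := U `|` V.

Definition small : spred R X := fun k s => lands U s \/ lands V s.

Lemma afs_small q k (s : simplex R X q) l : small s -> small (afs k s l).
Proof. by move=> [sU|sV]; [left|right]; exact: afs_lands. Qed.

Lemma sdc_vanish k (P : spred R X) (a : cochain R X k) :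
  (forall s l, P k s -> P k (afs k s l)) -> vanish P a -> vanish P (sdc a).
Proof.
by move=> PP va s Ps; apply: (@sd_vanish _ _ _ _ _ P); rewrite ?size_verts// => l; exact: PP.
Qed.

Lemma iter_sdc_vanish k (P : spred R X) m (a : cochain R X k) :
  (forall s l, P k s -> P k (afs k s l)) -> vanish P a -> vanish P (iter m (@sdc R X k) a).
Proof. by move=> PP va; elim: m => //= m IH; exact: sdc_vanish. Qed.

Lemma tdc_vanish k (P : spred R X) (a : cochain R X k.+1) :
  (forall s l, P k s -> P k.+1 (afs k.+1 s l)) -> vanish P a -> vanish P (tdc a).
Proof.
by move=> PP va s Ps; apply: (@td_vanish _ _ _ _ _ P); rewrite ?size_verts// => l; exact: PP.
Qed.

(** The mesh after m subdivisions is at most (k / (k + 1))^m D, eventually below a Lebesgue number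
    of the cover pulled back along s. The bound depends on s but not on the cochain. *)
Lemma iter_sdc_small k (s : simplex R X k) : lands W s ->
  exists M, forall m (a : cochain R X k), (M <= m)%N -> vanish small a ->
    iter m (@sdc R X k) a s = 0.
Proof.
move=> sW; have KW t : K (s t) by case: (sW t) => -[].
have [|e e0 he] := lebesgue_number oU oV (s := s).
  by move=> t; case: (sW t) => -[]; [left|right].
have [D D0 hD] : exists2 D, 0 < D & mesh D (verts R k).
  pose D : R := 1 + \sum_(x <- verts R k) \sum_(y <- verts R k) `|val x - val y|.
  exists D; first by rewrite ltr_pwDl// sumr_ge0// => x _; rewrite sumr_ge0.
  move=> x y xl yl; apply: (@le_trans _ _ (\sum_(y <- verts R k) `|val x - val y|)).
    by rewrite (big_rem y yl)/= lerDl sumr_ge0.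
  rewrite /D [X in _ <= _ + X](big_rem x xl)/= addrCA lerDl addr_ge0// sumr_ge0// => z _.
  exact: sumr_ge0.
have [M hM] : exists M, forall m, (M <= m)%N -> (k%:R / k.+1%:R) ^+ m * D < e.
  have rk : `|k%:R / k.+1%:R : R| < 1.
    by rewrite ger0_norm ?divr_ge0// ltr_pdivrMr// mul1r ltr_nat.
  have /cvgrPdist_lt/(_ (e / D)) := cvg_expr rk.
  rewrite divr_gt0// => /(_ isT) [M _ hM]; exists M => m /hM /=.
  by rewrite sub0r normrN ger0_norm ?exprn_ge0 ?divr_ge0// ltr_pdivlMr.
exists M => m a Mm va; rewrite -[s]afs_verts iter_sdc_afs ?size_verts//.
apply: (iter_sd_small (D := D)); rewrite ?size_verts// => l lk lD.
apply: va; case: l lk lD => [//|x l] lk lD; have [h|h] := he x; [left|right];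
  move=> t; (split; first exact: KW); rewrite /=; apply: h; apply: le_lt_trans (hM _ Mm); apply: norm_aff_le => // v vl;
  by apply: lD; rewrite ?mem_head.
Qed.

(** On W the cocycle satisfies a - Sd a = d (T a), so the primitive is T a + Sd (T a) + Sd^2 (T a) +
    ... . The series is finite on each simplex s, because T a vanishes on small simplices and
    iterated subdivision makes s small; it is cut at [M s]. *)
Lemma small_acyclic k : acyclic (@lands R X W) small k.
Proof.
move=> a [va za].
have cl k' l' (A : set X) (s : simplex R X k') l : lands A s -> lands A (afs l' s l).
  by move=> sA; exact: afs_lands.
case: k a va za => [|k] a va za.
  exists 0 => // s sW; have [M /(_ M a (leqnn _) va)] := iter_sdc_small sW.
  suff -> : iter M (@sdc R X 0) a = a.
    by move=> as0; change (a s - 0 = 0); rewrite as0 subr0.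
  elim: M => //= M ->; apply/funext => s'; rewrite /sdc /= afs_verts//.
have /choice[M hM] : forall s : simplex R X k, exists M,
    lands W s -> forall m (c : cochain R X k), (M <= m)%N -> vanish small c ->
    iter m (@sdc R X k) c s = 0.
  move=> s; have [sW|nW] := pselect (lands W s); last by exists 0%N.
  by have [M hM] := iter_sdc_small sW; exists M.
have vt : vanish small (tdc a).
  by apply: tdc_vanish va => s l; exact: afs_small.
pose c i := iter i (@sdc R X k) (tdc a).
have cM s N : lands W s -> (M s <= N)%N -> \sum_(i < M s) c i s = \sum_(i < N) c i s.
  move=> sW MN; rewrite -(big_mkord xpredT (fun i => c i s)) -[RHS](big_mkord xpredT (fun i => c i s)).
  rewrite (@big_cat_nat _ _ _ (M s) 0 N)//= [X in _ = _ + X]big_nat.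
  by rewrite [X in _ = _ + X]big1 ?addr0// => i /andP[Mi _]; exact: hM.
pose b : cochain R X k := fun s => \sum_(i < M s) c i s.
exists (coboundary b).
  exists b => // s sm; apply: big1 => i _.
  by apply: iter_sdc_vanish vt _ sm => s' l; exact: afs_small.
move=> s sW; change (a s - coboundary b s = 0); apply/eqP; rewrite subr_eq0; apply/eqP.
have [M' hM'] := iter_sdc_small sW.
(* The cut-off varies with the simplex; this N is large enough for s and all its faces at once, so
   that the sum telescopes. *)
pose N := (M' + \sum_(j < k.+2) M (restr (lift j) s))%N.
have -> : coboundary b s = \sum_(i < N) coboundary (c i) s.
  rewrite /coboundary exchange_big; apply: eq_bigr => j _; rewrite -mulr_sumr.
  congr (_ * _); apply: cM; first by move=> t; exact: sW.
  by rewrite /N (bigD1 j)//= addnCA leq_addr.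
have E i : coboundary (c i) s = iter i (@sdc R X k.+1) a s - iter i.+1 (@sdc R X k.+1) a s.
  have -> : coboundary (c i) = iter i (@sdc R X k.+1) (coboundary (tdc a)).
    by rewrite /c; elim: i => //= i IH; rewrite coboundary_sdc IH.
  have vd : vanish (lands W) (coboundary (tdc a) - (a - sdc a)).
    move=> s' s'W; have := tdc_coboundary a s'.
    rewrite (@tdc_vanish _ (lands W) (coboundary a) _ za s' s'W); last by move=> *; exact: cl.
    change (0 = a s' - sdc a s' - coboundary (tdc a) s' ->
      coboundary (tdc a) s' - (a s' - sdc a s') = 0).
    by move=> /esym/subr0_eq ->; rewrite subrr.
  have sdcB x y : @sdc R X k.+1 (x - y) = sdc x - sdc y.
    by apply/funext => u; exact: sdB.
  have itB m x y : iter m (@sdc R X k.+1) (x - y) = iter m (@sdc R X k.+1) x - iter m (@sdc R X k.+1) y.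
    by elim: m => //= m ->.
  have := iter_sdc_vanish i (fun s l => @cl k.+1 k.+1 W s l) vd sW.
  rewrite !itB -iterSr; set x := iter _ _ _; set y := iter _ _ _; set z := iter _ _ _.
  change (x s - (y s - z s) = 0 -> x s = y s - z s).
  by move=> /subr0_eq.
under eq_bigr do rewrite E.
have -> : \sum_(i < N) (iter i (@sdc R X k.+1) a s - iter i.+1 (@sdc R X k.+1) a s) =
   a s - iter N (@sdc R X k.+1) a s.
  by elim: N => [|N IH]; rewrite ?big_ord0 ?subrr// big_ord_recr IH /=; ring.
by rewrite hM' ?subr0// leq_addr.
Qed.

End Excision.

(** * Cells *)

Section ExcisionFree.
Variables (R : realType) (X : topologicalType).
Local Notation lands := (@lands R X).

Lemma lands_facial (A : set X) : facial (lands A).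
Proof. by move=> k s i sA t; exact: sA. Qed.

Lemma landsS (A B : set X) : A `<=` B -> spred_incl (lands A) (lands B).
Proof. by move=> AB k s sA t; apply: AB; exact: sA. Qed.

Variables (K U' V' : set X).
Hypotheses (oU : open U') (oV : open V').
Let U := K `&` U'.
Let V := K `&` V'.

Let ext k (a : cochain R X k) : cochain R X k :=
  fun s => if `[< lands V s >] then a s else 0.

Let extV k (a : cochain R X k) s : lands V s -> ext a s = a s.
Proof. by move=> sV; rewrite /ext asboolT. Qed.

Let extU k (a : cochain R X k) : vanish (lands (U `&` V)) a -> vanish (lands U) (ext a).
Proof.
move=> va s sU; rewrite /ext; case: asboolP => // sV; apply: va => t.
by split; [exact: sU | exact: sV].
Qed.

Let coboundary_extV k (a : cochain R X k) s :
  lands V s -> coboundary (ext a) s = coboundary a s.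
Proof. by move=> sV; apply: eq_bigr => i _; rewrite extV//; exact: lands_facial. Qed.

Let coboundary_extU k (a : cochain R X k) :
  vanish (lands (U `&` V)) a -> vanish (lands U) (coboundary (ext a)).
Proof. by move=> va; apply: vanish_coboundary (extU va); exact: lands_facial. Qed.

Let lin_comb_extV k r (z : 'I_r -> cochain R X k) c s :
  lands V s -> lin_comb (fun i => ext (z i)) c s = lin_comb z c s.
Proof. by move=> sV; apply: eq_bigr => i _; rewrite extV. Qed.

Let exact_ext k (e : cochain R X k) : exact_cochain (lands (U `&` V)) e ->
  exists e', [/\ exact_cochain (lands U) e', forall s, lands V s -> e' s = e s &
    vanish (lands U) e'].
Proof.
case: k e => [|k] e /= => [->|[b vb ->]]; first by exists 0.
exists (coboundary (ext b)); split; last exact: coboundary_extU.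
  by exists (ext b) => //; exact: extU.
exact: coboundary_extV.
Qed.

(** By [small_acyclic] only simplices lying in U or in V count, and on these a cochain of V that
    vanishes on the intersection extends by zero to U. *)
Lemma excision_free k r :
  rel_free (lands V) (lands (U `&` V)) k r -> rel_free (lands (U `|` V)) (lands U) k r.
Proof.
move=> [z [zz sp un]].
apply: (@rel_free_extend _ _ _ (@small R X K U' V')).
- move=> l s i [sU|sV]; [left|right]; exact: lands_facial.
- by move=> l s [sU|sV] t; [left; exact: sU|right; exact: sV].
- by move=> l s; left.
- by move=> l; exact: small_acyclic.
have vz i : vanish (lands (U `&` V)) (z i) by case: (zz i).
exists (fun i => ext (z i)); split.
- move=> i; split; first exact: extU.
  move=> s [sU|sV]; first exact: coboundary_extU.
  by rewrite coboundary_extV//; case: (zz i) => _; exact.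
- move=> a [va ca]; have [|c [e ee he]] := sp a.
    split; first by apply: vanishS va; apply: landsS => x [].
    by move=> s sV; apply: ca; right.
  exists c; have vl : vanish (lands U) (lin_comb (fun i => ext (z i)) c).
    by apply: vanish_lin_comb => i; exact: extU.
  have [e' [ee' e'V e'U]] := exact_ext ee.
  exists e' => // s sUV.
  change (a s - lin_comb (fun i => ext (z i)) c s - e' s = 0).
  case: sUV => [sU|sV]; first by rewrite va// vl// e'U// !subr0.
  by rewrite lin_comb_extV// e'V//; exact: he.
move=> c [e ee he]; apply: un; exists e.
  by apply: exact_cochainS ee; apply: landsS => x [].
move=> s sV; have := he s (or_intror sV).
change (lin_comb (fun i => ext (z i)) c s - e s = 0 -> lin_comb z c s - e s = 0).
by rewrite lin_comb_extV.
Qed.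

End ExcisionFree.

(** * A convex set relative to the complement of a linear subspace *)

Section ConvexPair.
Variables (R : realType) (E : topologicalType) (K : set E).
Variables (line : E -> E -> R -> E) (c : nat -> E -> R) (m : nat).
Variables (p0 : E) (e : bool -> nat -> E).
Hypothesis line_cts : forall p, continuous (fun x : E * R => line p x.1 x.2).
Hypothesis line0 : forall p x, line p x 0 = x.
Hypothesis line1 : forall p x, line p x 1 = p.
Hypothesis lineK : forall p x t, K p -> K x -> 0 <= t <= 1 -> K (line p x t).
Hypothesis c_cts : forall i, continuous (c i).
Hypothesis c_line : forall i p x t, c i (line p x t) = (1 - t) * c i x + t * c i p.
Hypothesis Kp0 : K p0.
Hypothesis Ke : forall b j, (j < m)%N -> K (e b j).
Hypothesis c_e : forall b i j, (i < m)%N -> (j < m)%N ->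
  c i (e b j) = (-1) ^+ b * (i == j)%:R.

Definition nonzero_coord j : set E := [set x | exists2 i, (i < j)%N & c i x != 0].
Let Q j := K `&` nonzero_coord j.
Let A (b : bool) j : set E := nonzero_coord j `|` [set x | 0 < (-1) ^+ b * c j x].

Let open_nonzero j : open (nonzero_coord j).
Proof.
have -> : nonzero_coord j = \bigcup_(i in [set i | (i < j)%N]) (c i @^-1` [set x | x != 0]).
  by apply/seteqP; split=> x [i ij ci]; exists i.
apply: bigcup_open => i _; apply: (@cts_open _ _ (c i) [set x | x != 0]).
  exact: c_cts.
exact: open_neq.
Qed.

Let openA b j : open (A b j).
Proof.
apply: openU => //.
apply: (@cts_open _ _ (fun x => (-1) ^+ b * c j x) [set x | 0 < x]).
  exact: (cts_mul (cts_cst _) (@c_cts j)).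
exact: open_gt.
Qed.

(** Moving towards [e b j] rescales the coordinates before j and pushes coordinate j to the sign
    given by b, so the contraction preserves [A b j]. *)
Let acycA b j k : (j < m)%N -> acyclic (@lands R E K) (lands (K `&` A b j)) k.
Proof.
move=> jm; pose H (xt : E * R) := line (e b j) xt.1 xt.2.
refine (@contraction_acyclic R E H (e b j) _ _ _ (K `&` A b j) K k _ _ _).
- exact: (@line_cts (e b j)).
- by move=> x; exact: line0.
- by move=> x; exact: line1.
- split; first exact: Ke.
  by right; rewrite /= c_e// eqxx mulr1 -expr2 sqrr_sign.
- move=> x t [Kx Ax] t01; rewrite /H /=; split; first by apply: lineK => //; exact: Ke.
  move: (t01) => /andP[t0]; rewrite le_eqVlt => /orP[/eqP ->|t1].
    by rewrite line1; right; rewrite /= c_e// eqxx mulr1 -expr2 sqrr_sign.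
  have t1' : 0 < 1 - t by rewrite subr_gt0.
  case: Ax => [[i ij ci]|cj].
    left; exists i => //; rewrite c_line c_e ?(ltn_trans ij jm)// ltn_eqF// !mulr0 addr0.
    by rewrite mulf_neq0// gt_eqF.
  right; rewrite /=  c_line c_e// eqxx mulr1 mulrDr mulrCA [X in _ + X]mulrCA -expr2 sqrr_sign mulr1.
  by rewrite ltr_pwDl// mulr_gt0.
- by move=> x t Kx t01; apply: lineK => //; exact: Ke.
Qed.

Let AUA j : K `&` A false j `|` K `&` A true j = Q j.+1.
Proof.
rewrite -setIUr /Q; congr (K `&` _); apply/seteqP; split=> x.
  move=> [ [ [i ij ci]|h]|[ [i ij ci]|h]].
  - by exists i => //; exact: ltnW.
  - by exists j => //; apply: contraTneq h => /= ->; rewrite mulr0 ltxx.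
  - by exists i => //; exact: ltnW.
  - by exists j => //; apply: contraTneq h => /= ->; rewrite mulr0 ltxx.
move=> [ i ]; rewrite ltnS leq_eqVlt => /orP[/eqP ->|ij] ci.
  move: ci; rewrite neq_lt => /orP[ci|ci].
    by right; right; rewrite /= mulN1r oppr_gt0.
  by left; right; rewrite /= mul1r.
by left; left; exists i.
Qed.

Let AIA j : (K `&` A false j) `&` (K `&` A true j) = Q j.
Proof.
apply/seteqP; split=> x; last by move=> [Kx nx]; split; split=> //; left.
move=> [[Kx [nx|h]] [_ [nx'|h']]]; split=> //.
by move: h h' => /=; rewrite mul1r mulN1r oppr_gt0 => h /(lt_trans h); rewrite ltxx.
Qed.

(** Suspension: Q (j + 1) is the union of two relatively open pieces A+ and A- with intersection Q
    j, and (K, A+) and (K, A-) are acyclic. Hence H^(k+1)(K, Q (j + 1)) = H^k(Q (j + 1), A+) =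
    H^k(A-, Q j) = H^k(K, Q j), the middle step being excision. *)
Lemma convex_pair_free j k : (j <= m)%N ->
  rel_free (@lands R E K) (lands (K `&` nonzero_coord j)) k (k == j)%N.
Proof.
elim: j k => [|j IH] k jm.
  have -> : K `&` nonzero_coord 0 = set0 by apply/seteqP; split=> // x [_ []].
  pose H (xt : E * R) := line p0 xt.1 xt.2.
  refine (@contraction_free R E H p0 _ _ _ K k _ _) => //.
  - exact: (@line_cts p0).
  - by move=> x; exact: line0.
  - by move=> x; exact: line1.
  - by move=> x t Kx t01; exact: lineK.
have sA b : K `&` A b j `<=` K by move=> x [].
have QA b : Q j `<=` K `&` A b j by move=> x [Kx nx]; split=> //; left.
have AQ : K `&` A false j `<=` Q j.+1 by rewrite -AUA => x; left.
have QK : Q j.+1 `<=` K by move=> x [].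
case: k => [|k].
  apply: acyclic_rel_free.
  apply: (@acyclic_connecting0 _ _ _ _ (lands (K `&` A false j)));
    try exact: landsS; exact: acycA.
rewrite eqSS; apply: (@rel_free_connecting _ _ _ _ (lands (K `&` A false j)));
  try exact: lands_facial; try exact: landsS; try exact: acycA.
rewrite -[K `&` nonzero_coord j.+1]AUA; apply: excision_free => //; rewrite AIA.
apply: rel_free_restrict (IH k (ltnW jm)); try exact: lands_facial; try exact: landsS.
by move=> l; exact: acycA.
Qed.

End ConvexPair.

(** * Transport of relative cohomology along a chart *)

Section Transport.
Variables (R : realType) (X E : topologicalType) (V A : set X) (K B : set E).
Variables (phi : X -> E) (psi : E -> X) (p0 : E).
Hypothesis psi_cts : continuous psi.
Hypothesis phi_cts : forall x, V x -> {for x, continuous phi}.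
Hypothesis phiK : forall x, V x -> psi (phi x) = x.
Hypothesis psiK : forall y, K y -> phi (psi y) = y.
Hypothesis phiV : forall x, V x -> K (phi x).
Hypothesis psiV : forall y, K y -> V (psi y).
Hypothesis AV : A `<=` V.
Hypothesis BK : B `<=` K.
Hypothesis AB : forall y, K y -> (A (psi y) <-> B y).

Lemma chart_lift_subproof k (s : simplex R X k) : lands V s -> continuous (phi \o s).
Proof.
move=> sV t; apply: continuous_comp; first exact: cts_fun.
by apply: phi_cts; exact: sV.
Qed.

(** Since [phi] is continuous only at points of V, simplices not contained in V receive a dummy
    constant lift. *)
Definition chart_lift k (s : simplex R X k) : simplex R E k :=
  match pselect (lands V s) with
  | left sV => mksimplex (@chart_lift_subproof k s sV)
  | right _ => mksimplex (@cst_continuous (std_simplex R k) E p0)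
  end.

Let chart_liftE k (s : simplex R X k) t : lands V s -> chart_lift s t = phi (s t).
Proof. by move=> sV; rewrite /chart_lift; case: pselect. Qed.

Let chart_liftK k (s : simplex R X k) : lands V s -> post psi_cts (chart_lift s) = s.
Proof. by move=> sV; apply/continuousEP => t /=; rewrite chart_liftE// phiK. Qed.

Let post_lift k (s : simplex R E k) : lands K s -> chart_lift (post psi_cts s) = s.
Proof.
move=> sK; apply/continuousEP => t; rewrite chart_liftE /= ?psiK//.
by move=> u; apply: psiV; exact: sK.
Qed.

Let restr_lift k (s : simplex R X k.+1) (i : 'I_k.+2) :
  lands V s -> restr (lift i) (chart_lift s) = chart_lift (restr (lift i) s).
Proof.
move=> sV; apply/continuousEP => t; rewrite /= !chart_liftE//.
by move=> u; exact: sV.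
Qed.

Let lift_K k (s : simplex R X k) : lands V s -> lands K (chart_lift s).
Proof. by move=> sV t; rewrite chart_liftE//; apply: phiV; exact: sV. Qed.

Let lift_B k (s : simplex R X k) : lands A s -> lands B (chart_lift s).
Proof.
move=> sA t; have sV : lands V s by move=> u; apply: AV; exact: sA.
by rewrite chart_liftE//; apply/AB; [apply: phiV|rewrite phiK].
Qed.

Let post_V k (s : simplex R E k) : lands K s -> lands V (post psi_cts s).
Proof. by move=> sK t; apply: psiV; exact: sK. Qed.

Let post_A k (s : simplex R E k) : lands B s -> lands A (post psi_cts s).
Proof. by move=> sB t /=; apply/AB; [apply: BK|]; exact: sB. Qed.

Let plift k (a : cochain R E k) : cochain R X k := fun s => a (chart_lift s).

Let coboundary_plift k (a : cochain R E k) s :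
  lands V s -> coboundary (plift a) s = coboundary a (chart_lift s).
Proof. by move=> sV; apply: eq_bigr => i _; rewrite /plift restr_lift. Qed.

Let exact_plift k (e : cochain R E k) : exact_cochain (lands B) e ->
  exists2 e', exact_cochain (lands A) e' & forall s, lands V s -> e' s = plift e s.
Proof.
case: k e => [|k] e /= => [->|[b vb ->]]; first by exists 0.
exists (coboundary (plift b)); last by move=> s sV; rewrite coboundary_plift.
by exists (plift b) => // s sA; apply: vb; exact: lift_B.
Qed.

Let exact_pull k (e : cochain R X k) : exact_cochain (lands A) e ->
  exact_cochain (lands B) (pull psi_cts e).
Proof.
case: k e => [|k] e /= => [->|[b vb ->]] //.
exists (pull psi_cts b); last by rewrite coboundary_pull.
by move=> s sB; apply: vb; exact: post_A.
Qed.

(** [phi] and [psi] identify (V, A) with (K, B). Cochains of X are pulled back along [psi], which is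
    continuous everywhere; those of E are evaluated on lifts, which agree with [phi] on V. *)
Lemma chart_free k r :
  rel_free (@lands R E K) (lands B) k r -> rel_free (lands V) (@lands R X A) k r.
Proof.
move=> [z [zz sp un]]; exists (fun i => plift (z i)); split.
- move=> i; have [vz cz] := zz i; split=> s sA; first by apply: vz; exact: lift_B.
  by rewrite coboundary_plift// cz//; exact: lift_K.
- move=> a [va ca]; have [|c [e ee he]] := sp (pull psi_cts a).
    split=> s sB; first by apply: va; exact: post_A.
    by rewrite coboundary_pull; apply: ca; exact: post_V.
  have [e' ee' he'] := exact_plift ee.
  exists c, e' => // s sV; have := he (chart_lift s) (lift_K sV).
  change (a (post psi_cts (chart_lift s)) - lin_comb z c (chart_lift s) - e (chart_lift s) = 0 ->
     a s - lin_comb (fun i => plift (z i)) c s - e' s = 0).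
  by rewrite chart_liftK// he'.
move=> c [e ee he]; apply: un; exists (pull psi_cts e); first exact: exact_pull.
move=> s sK; have := he (post psi_cts s) (post_V sK).
change (\sum_i c i * plift (z i) (post psi_cts s) - e (post psi_cts s) = 0 ->
  \sum_i c i * z i s - e (post psi_cts s) = 0).
by rewrite /plift post_lift.
Qed.

End Transport.

(** * Spaces built from relative classes of even degree *)

Section EvenCells.
Variables (R : realType) (X : topologicalType).

Definition even_free (O : set X) (f : nat -> nat) :=
  (forall k, odd k -> f k = 0%N) /\
  forall k, rel_free (@lands R X O) (lands set0) k (f k).

Lemma acyclic_middle (P Q S : spred R X) k : spred_incl Q P ->
  acyclic P Q k -> acyclic Q S k -> spred_incl S Q -> facial Q -> acyclic P S k.
Proof.
move=> QP acP acQ SQ fQ a [va ca].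
have [|e ee he] := acQ a; first by split=> //; exact: vanishS ca.
have [|f ef hf] := acP (a - e).
  by split=> //; rewrite coboundaryB (exact_cochain_closed ee) subr0.
exists (e + f); first by apply: exact_cochainD => //; exact: exact_cochainS ef.
by rewrite opprD addrA.
Qed.

(** Excision turns (O u V, O) into (V, O n V). All classes have even degree, so the connecting maps
    vanish and ranks add. *)
Lemma even_free_cell (O V : set X) (f : nat -> nat) m :
  open O -> open V -> ~~ odd m -> even_free O f ->
  (forall k, rel_free (@lands R X V) (lands (O `&` V)) k (k == m)%N) ->
  even_free (O `|` V) (fun k => (k == m) + f k)%N.
Proof.
move=> oO oV em [fo ff] H.
have fodd k : odd k -> ((k == m) + f k = 0)%N.
  by move=> ko; rewrite fo// addn0; case: eqP => // km; rewrite -km ko in em.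
have HO k : rel_free (lands (O `|` V)) (@lands R X O) k (k == m)%N.
  have := @excision_free R X setT O V oO oV k (k == m)%N; rewrite !setTI.
  by apply; exact: H.
have OV : spred_incl (@lands R X O) (lands (O `|` V)) by move=> k s sO t; left; exact: sO.
have S0 : spred_incl (@lands R X set0) (lands O) by move=> k s /lands_set0.
split=> // k; have [ko|ke] := boolP (odd k).
  rewrite fodd//; apply: acyclic_rel_free.
  apply: (@acyclic_middle _ (@lands R X O)) => //; try exact: lands_facial.
  + by apply: rel_free_acyclic; have := HO k; rewrite (_ : (k == m)%N = false)//;
      apply/eqP => km; rewrite -km ko in em.
  + by apply: rel_free_acyclic; have := ff k; rewrite fo.
apply: (@rel_free_middle _ _ _ (@lands R X O)) => //; try exact: lands_facial.
- apply: rel_free_acyclic; have := HO k.+1; rewrite (_ : (k.+1 == m)%N = false)//.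
  by apply/eqP => km; rewrite -km /= ke in em.
- move=> j kj; apply: rel_free_acyclic; have := ff j; rewrite fo//.
  by move: ke; rewrite kj /= negbK.
Qed.

Lemma even_free_set0 : even_free set0 (fun=> 0%N).
Proof.
split=> // k; apply: acyclic_rel_free => a [va _].
by exists 0 => //; [exact: exact_cochain0|rewrite subr0].
Qed.

Lemma even_free_cells (I : Type) (V : I -> set X) (m : I -> nat) (w : seq I) :
  (forall i, open (V i)) -> (forall i, ~~ odd (m i)) ->
  (forall w1 i w2, w = w1 ++ i :: w2 -> forall k,
     rel_free (@lands R X (V i)) (lands (\big[setU/set0]_(j <- w1) V j `&` V i)) k (k == m i)%N) ->
  even_free (\big[setU/set0]_(j <- w) V j) (fun k => count (fun i => k == m i)%N w).
Proof.
move=> oV em; elim/last_ind: w => [|w i IH] H.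
  by rewrite big_nil; exact: even_free_set0.
rewrite -cats1 big_cat big_seq1 /=.
have -> : (fun k => count (fun i => k == m i)%N (w ++ [:: i])) =
    (fun k => (k == m i) + count (fun i => k == m i) w)%N.
  by apply/funext => k; rewrite count_cat /= addn0 addnC.
apply: even_free_cell => //.
- by elim/big_ind: _ => // [|U U']; [exact: open0 | exact: openU].
- apply: IH => w1 j w2 E; apply: (H w1 j (rcons w2 i)).
  by rewrite E rcons_cat.
- by move=> k; apply: (H w i [::]); rewrite cats1.
Qed.

End EvenCells.

(** * Functoriality of cohomology *)

Section Classes.
Variables (R : realType) (X : topologicalType).

Lemma mkcocycle_subproof k (a : cochain R X k) :
  coboundary a = 0 -> a \in @is_cocycle R X k.
Proof. by move=> za; apply/eqP. Qed.
Definition mkcocycle k (a : cochain R X k) (za : coboundary a = 0) : cocycle R X k :=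
  Cocycle (mkcocycle_subproof za).

Lemma cocycleP k (a : cocycle R X k) : coboundary (val a) = 0.
Proof. by case: a => a h; apply/eqP. Qed.

Definition cls k (a : cocycle R X k) : cohomology R X k := \pi_(cohomology R X k) a.

Lemma clsP k (x : cohomology R X k) : exists a, x = cls a.
Proof. by exists (repr x); rewrite /cls reprK. Qed.

Lemma clsB k (a b : cocycle R X k) : cls (a - b) = cls a - cls b.
Proof. by rewrite /cls !piE. Qed.

Lemma is_coboundaryE k (a : cocycle R X k) :
  a \in @is_coboundary R X k <-> exact_cochain (@lands R X set0) (val a).
Proof.
case: k a => [|k] a /=.
  by split=> [/eqP -> //|a0]; apply/eqP/val_inj.
split=> [/asboolP[b ab]|[b _ ab]]; last by apply/asboolP; exists b.
by exists b => // s /lands_set0.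
Qed.

Lemma eq_cls k (a b : cocycle R X k) :
  cls a = cls b <-> exact_cochain (@lands R X set0) (val a - val b).
Proof.
have -> : val a - val b = val (a - b) by [].
rewrite -is_coboundaryE; split=> [/eqP|]; first by rewrite -Quotient.idealrBE.
by rewrite Quotient.idealrBE => /eqP.
Qed.

Lemma rel_cocycle_abs k (a : cochain R X k) :
  rel_cocycle (lands setT) (lands set0) a <-> coboundary a = 0.
Proof.
split=> [[_ ca]|ca]; first by apply/funext => s; exact: ca.
by split=> [s /lands_set0//|s _]; rewrite ca.
Qed.

Lemma rel_exact_abs k (a : cochain R X k) :
  rel_exact (lands setT) (lands set0) a <-> exact_cochain (lands set0) a.
Proof.
split=> [[e ee ae]|ea]; last by exists a => //; rewrite subrr.
suff -> : a = e by [].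
by apply/funext => s; apply: subr0_eq; exact: ae.
Qed.

Lemma free_coordinates k r : rel_free (@lands R X setT) (lands set0) k r ->
  exists (theta : ('I_r -> int) -> cohomology R X k)
         (coord : cohomology R X k -> 'I_r -> int),
  [/\ cancel theta coord, cancel coord theta &
      forall c d, theta (fun i => c i - d i) = theta c - theta d].
Proof.
move=> [z [zz sp un]].
have cz c : coboundary (lin_comb z c) = 0.
  by apply/rel_cocycle_abs; exact: rel_cocycle_lin_comb.
pose theta c := cls (mkcocycle (cz c)).
have thetaB c d : theta (fun i => c i - d i) = theta c - theta d.
  by rewrite -clsB; congr cls; apply/val_inj; rewrite /= lin_combB.
have theta_onto x : exists c, theta c = x.
  have [a ->] := clsP x; have [|c] := sp (val a); first exact/rel_cocycle_abs/cocycleP.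
  by move=> /rel_exact_abs h; exists c; apply/esym/eq_cls.
have [coord coordK] := choice theta_onto.
exists theta, coord; split=> // c; apply/funext => i; apply/eqP; rewrite -subr_eq0; apply/eqP.
apply: (un (fun i => coord (theta c) i - c i)); apply/rel_exact_abs; rewrite lin_combB.
by apply/(eq_cls (mkcocycle (cz _)) (mkcocycle (cz _))); exact: coordK.
Qed.

End Classes.

(** The isomorphism matches coordinates in two chosen bases; no map of spaces induces it. *)
Lemma free_iso (R : realType) (X Y : topologicalType) k r :
  rel_free (@lands R X setT) (lands set0) k r ->
  rel_free (@lands R Y setT) (lands set0) k r ->
  exists phi : {additive cohomology R X k -> cohomology R Y k}, bijective phi.
Proof.
move=> /free_coordinates[tX [cX [tXK cXK tXB]]] /free_coordinates[tY [cY [tYK cYK tYB]]].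
pose f x := tY (cX x).
have fB : zmod_morphism f.
  move=> x y; rewrite /f -tYB -[in LHS](cXK x) -[in LHS](cXK y) -tXB tXK.
  by [].
pose fA : {additive cohomology R X k -> cohomology R Y k} :=
  HB.pack f (GRing.isZmodMorphism.Build _ _ f fB).
exists fA.
by exists (fun y => tX (cY y)) => x /=; rewrite /f ?tYK ?cXK// tXK cYK.
Qed.

Section Functoriality.
Variable R : realType.

Section Pull.
Variables (X Y : topologicalType) (f : X -> Y) (cf : continuous f).

Lemma cpull_subproof k (a : cocycle R Y k) : coboundary (pull cf (val a)) = 0.
Proof. by rewrite coboundary_pull cocycleP. Qed.

Definition cpull k (x : cohomology R Y k) : cohomology R X k :=
  cls (mkcocycle (cpull_subproof (repr x))).

Lemma exact_cochain_pull k (e : cochain R Y k) :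
  exact_cochain (lands set0) e -> exact_cochain (lands set0) (pull cf e).
Proof.
case: k e => [|k] e /= => [->|[b vb ->]] //.
by exists (pull cf b); [move=> s /lands_set0|rewrite coboundary_pull].
Qed.

Lemma cpull_cls k (a : cocycle R Y k) :
  cpull (cls a) = cls (mkcocycle (cpull_subproof a)).
Proof.
apply/eq_cls => /=; rewrite -[_ - _]/(pull cf (val (repr (cls a)) - val a)).
by apply: exact_cochain_pull; apply/eq_cls; rewrite /cls reprK.
Qed.

Lemma cpull_is_zmod k : zmod_morphism (@cpull k).
Proof.
move=> x y; have [a ->] := clsP x; have [b ->] := clsP y.
by rewrite -clsB !cpull_cls -clsB; congr cls; exact/val_inj.
Qed.
HB.instance Definition _ k :=
  GRing.isZmodMorphism.Build _ _ (@cpull k) (@cpull_is_zmod k).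

Lemma cpull1 : cpull (cohomology1 R Y) = cohomology1 R X.
Proof. by rewrite cpull_cls; congr cls; exact/val_inj. Qed.

Lemma cpull_cup k l (x : cohomology R Y k) (y : cohomology R Y l) :
  cpull (cup x y) = cup (cpull x) (cpull y).
Proof.
have [a ->] := clsP x; have [b ->] := clsP y.
rewrite [cup _ _]pi_cup !cpull_cls [cup _ _]pi_cup.
by congr cls; apply/val_inj/funext => s; rewrite /= /pull /cup_cochain !restr_post.
Qed.

End Pull.

Lemma cpull_comp (X Y Z : topologicalType) (f : X -> Y) (g : Y -> Z)
    (cf : continuous f) (cg : continuous g) (cgf : continuous (g \o f)) k
    (x : cohomology R Z k) : cpull cgf x = cpull cf (cpull cg x).
Proof.
have [a ->] := clsP x; rewrite !cpull_cls; congr cls; apply/val_inj => /=.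
exact: pull_comp.
Qed.

Lemma cpull_id (X : topologicalType) (f : X -> X) (cf : continuous f) k
    (x : cohomology R X k) : f =1 id -> cpull cf x = x.
Proof.
move=> fi; have [a ->] := clsP x; rewrite cpull_cls; congr cls; apply/val_inj/funext => s /=.
by rewrite /pull; congr (val a _); apply/continuousEP => t /=; rewrite fi.
Qed.

Lemma cpull_homotopy (X Y : topologicalType) (H : X * R -> Y) (f g : X -> Y)
    (cf : continuous f) (cg : continuous g) k (x : cohomology R Y k) :
  continuous H -> (forall x, H (x, 0) = f x) -> (forall x, H (x, 1) = g x) ->
  cpull cf x = cpull cg x.
Proof.
move=> cH H0 H1; have [a ->] := clsP x; rewrite !cpull_cls; apply/esym/eq_cls => /=.
have c1 : continuous (fun x => H (x, 1)) by rewrite (_ : (fun x => _) = g)//; exact/funext.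
have c0 : continuous (fun x => H (x, 0)) by rewrite (_ : (fun x => _) = f)//; exact/funext.
rewrite (@pull_ext _ _ _ g _ cg c1)// (@pull_ext _ _ _ f _ cf c0)//.
apply/rel_exact_abs.
apply: (homotopy_exact cH c1 c0 (A' := set0) (B' := setT)) => //.
exact/rel_cocycle_abs/cocycleP.
Qed.

Lemma homotopy_equiv_iso (X Y : topologicalType) (f : X -> Y) (g : Y -> X)
    (cf : continuous f) (cg : continuous g)
    (cgf : continuous (g \o f)) (cfg : continuous (f \o g)) :
  (forall k (x : cohomology R X k), cpull cgf x = x) ->
  (forall k (x : cohomology R Y k), cpull cfg x = x) ->
  exists phi : forall k, {additive cohomology R X k -> cohomology R Y k},
    graded_ring_iso phi.
Proof.
move=> gf fg; exists (fun k => @cpull Y X g cg k : {additive _ -> _}); split.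
- move=> k; exists (fun y => cpull cf y) => x /=.
    by rewrite -(cpull_comp cf cg cgf).
  by rewrite -(cpull_comp cg cf cfg).
- exact: cpull1.
- by move=> k l x y; exact: cpull_cup.
Qed.

End Functoriality.

(** * Complex matrices *)

Section ComplexTopology.
Variable R : realType.
Local Notation C := R[i].

Lemma norm_Re_le (z : C) : (`|complex.Re z|)%:C <= `|z|.
Proof.
rewrite normc_def lecR -sqrtr_sqr ler_wsqrtr// lerDl sqr_ge0//.
Qed.

Lemma norm_Im_le (z : C) : (`|complex.Im z|)%:C <= `|z|.
Proof.
rewrite normc_def lecR -sqrtr_sqr ler_wsqrtr// lerDr sqr_ge0//.
Qed.

Lemma norm_le_ReIm (z : C) : `|z| <= (`|complex.Re z| + `|complex.Im z|)%:C.
Proof.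
rewrite normc_def lecR -[leRHS]ger0_norm ?addr_ge0// -sqrtr_sqr ler_wsqrtr//.
by rewrite sqrrD !real_normK ?num_real// addrAC lerDl mulrn_wge0// mulr_ge0.
Qed.

Lemma nbhs_complexP (z : C) (A : set C) :
  nbhs z A <-> exists2 e : R, 0 < e & forall w, `|z - w| < e%:C -> A w.
Proof.
split=> [/nbhs_ballP[e /= e0 eA]|[e e0 eA]].
  have eR : e = (complex.Re e)%:C.
    by move: e0; rewrite ltcE /= => /andP[/eqP ei _]; case: e ei {eA} => a b /= ->.
  exists (complex.Re e); first by rewrite -ltcR -eR.
  by move=> w zw; apply: eA; rewrite -ball_normE /= eR.
apply/nbhs_ballP; exists e%:C; first by rewrite /= ltcR.
by move=> w; rewrite -ball_normE /=; exact: eA.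
Qed.

Lemma cts_Re : continuous (@complex.Re R : C -> R).
Proof.
move=> z A /nbhs_ballP[e /= e0 eA]; apply/nbhs_complexP; exists e => // w zw.
apply: eA; rewrite -ball_normE /= -ltcR; apply: le_lt_trans zw.
by apply: le_trans (norm_Re_le _); rewrite raddfB.
Qed.

Lemma cts_Im : continuous (@complex.Im R : C -> R).
Proof.
move=> z A /nbhs_ballP[e /= e0 eA]; apply/nbhs_complexP; exists e => // w zw.
apply: eA; rewrite -ball_normE /= -ltcR; apply: le_lt_trans zw.
by apply: le_trans (norm_Im_le _); rewrite raddfB.
Qed.

Lemma cts_complex (T : topologicalType) (f g : T -> R) :
  continuous f -> continuous g -> continuous (fun x => f x +i* g x : C).
Proof.
move=> cf cg x A /nbhs_complexP[e e0 eA].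
have e2 : 0 < e / 2 by rewrite divr_gt0.
have near_cts (h : T -> R) : continuous h -> nbhs x [set y | `|h x - h y| < e / 2].
  move=> ch; apply: (ch x [set u | `|h x - u| < e / 2]); apply/nbhs_ballP.
  by exists (e / 2) => // y; rewrite -ball_normE.
apply: filterS2 (near_cts f cf) (near_cts g cg) => y fy gy; apply: eA.
apply: (le_lt_trans (norm_le_ReIm _)); rewrite ltcR /= (splitr e).
exact: ltrD.
Qed.

Lemma cts_real_complex : continuous (fun x : R => x%:C).
Proof. exact: (cts_complex cts_id (cts_cst _)). Qed.

Lemma cts_conj : continuous (Num.conj : C -> C).
Proof.
refine (@cts_ext _ _ (fun z : C => complex.Re z +i* (- complex.Im z)) _ _ _).
  by case.
exact: (cts_complex cts_Re (cts_opp cts_Im)).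
Qed.

Lemma cts_normc : continuous (fun z : C => complex.Re `|z|).
Proof.
refine (@cts_ext _ _ (fun z : C => Num.sqrt (complex.Re z ^+ 2 + complex.Im z ^+ 2)) _ _ _).
  by move=> z; rewrite normc_def.
refine (cts_comp _ (@sqrt_continuous R)).
exact: (cts_add (cts_mul cts_Re cts_Re) (cts_mul cts_Im cts_Im)).
Qed.

Section Matrices.
Variable T : topologicalType.

Lemma cts_mulmx m n p (f : T -> 'M[C]_(m, n)) (g : T -> 'M[C]_(n, p)) :
  continuous f -> continuous g -> continuous (fun x => f x *m g x).
Proof.
move=> cf cg; apply: mx_cts => i j.
refine (@cts_ext _ _ (fun x => \sum_k f x i k * g x k j) _ _ _).
  by move=> x; rewrite mxE.
by refine (cts_sum _) => k _; exact: (cts_mul (cts_entry _ _ cf) (cts_entry _ _ cg)).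
Qed.

Lemma cts_addmx m n (f g : T -> 'M[C]_(m, n)) :
  continuous f -> continuous g -> continuous (fun x => f x + g x).
Proof.
move=> cf cg; apply: mx_cts => i j.
refine (@cts_ext _ _ (fun x => f x i j + g x i j) _ _ _).
  by move=> x; rewrite mxE.
exact: (cts_add (cts_entry _ _ cf) (cts_entry _ _ cg)).
Qed.

Lemma cts_scalemx m n (a : T -> C) (f : T -> 'M[C]_(m, n)) :
  continuous a -> continuous f -> continuous (fun x => a x *: f x).
Proof.
move=> ca cf; apply: mx_cts => i j.
refine (@cts_ext _ _ (fun x => a x * f x i j) _ _ _).
  by move=> x; rewrite mxE.
exact: (cts_mul ca (cts_entry _ _ cf)).
Qed.

Lemma cts_adjoint m n (f : T -> 'M[C]_(m, n)) :
  continuous f -> continuous (fun x => (f x)^t*).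
Proof.
move=> cf; apply: mx_cts => i j.
refine (@cts_ext _ _ (fun x => Num.conj (f x j i)) _ _ _).
  by move=> x; rewrite !mxE.
exact: (cts_comp (cts_entry _ _ cf) cts_conj).
Qed.

Lemma cts_det n (f : T -> 'M[C]_n) : continuous f -> continuous (fun x => \det (f x)).
Proof.
move=> cf; refine (cts_sum _) => s _; refine (cts_mul (cts_cst _) _).
by refine (cts_prod _) => i _; exact: (cts_entry _ _ cf).
Qed.

Lemma cts_adjugate n (f : T -> 'M[C]_n) : continuous f -> continuous (fun x => \adj (f x)).
Proof.
move=> cf; apply: mx_cts => i j.
refine (@cts_ext _ _ (fun x => (-1) ^+ (j + i) * \det (row' j (col' i (f x)))) _ _ _).
  by move=> x; rewrite mxE.
refine (cts_mul (cts_cst _) (cts_det _)); apply: mx_cts => k l.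
refine (@cts_ext _ _ (fun x => f x (lift j k) (lift i l)) _ _ _).
  by move=> x; rewrite !mxE.
exact: (cts_entry _ _ cf).
Qed.

End Matrices.

Lemma separated_hausdorff (T : topologicalType) :
  (forall x y : T, x <> y -> exists2 f : T -> R, continuous f & f x <> f y) ->
  hausdorff_space T.
Proof.
move=> sep p q pq; apply: contrapT => /sep[f cf]; apply.
apply: (@Rhausdorff R) => A B nA nB.
have [x [fA fB]] := pq (f @^-1` A) (f @^-1` B) (cf p A nA) (cf q B nB).
by exists (f x).
Qed.

Lemma mx_separated m n (A B : 'M[C]_(m, n)) : A <> B ->
  exists2 f : 'M[C]_(m, n) -> R, continuous f & f A <> f B.
Proof.
move=> AB; apply: contrapT => h; apply: AB; apply/matrixP => i j.
have ce : continuous (fun M : 'M[C]_(m, n) => M i j) by exact: coord_continuous.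
apply/eqP; rewrite eq_complex; apply/andP; split; apply/eqP; apply: contrapT => AB; apply: h.
  by exists (fun M : 'M[C]_(m, n) => complex.Re (M i j)) => //; exact: (cts_comp ce cts_Re).
by exists (fun M : 'M[C]_(m, n) => complex.Im (M i j)) => //; exact: (cts_comp ce cts_Im).
Qed.

Lemma mx_hausdorff m n : hausdorff_space 'M[C]_(m, n).
Proof. by apply: separated_hausdorff => A B; exact: mx_separated. Qed.

Lemma unitary_norm_le n (U : 'M[C]_n) i j : U \is unitarymx -> `|U i j| <= 1.
Proof.
move=> /unitarymxP/matrixP/(_ i i); rewrite !mxE eqxx /= => h.
have : `|U i j| ^+ 2 <= 1 ^+ 2.
  rewrite expr1n -[leRHS]h (bigD1 j)//= !mxE -normCK lerDl sumr_ge0// => k _.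
  by rewrite !mxE -normCK exprn_ge0.
by rewrite ler_sqr ?nnegrE.
Qed.

Lemma closed_unitary n : closed [set U : 'M[C]_n | U \is unitarymx].
Proof.
have -> : [set U : 'M[C]_n | U \is unitarymx] =
    (fun U : 'M[C]_n => U *m U^t*) @^-1` [set 1%:M].
  by apply/seteqP; split=> U /unitarymxP.
apply: (@cts_closed _ _ (fun U : 'M[C]_n => U *m U^t*)).
  exact: (cts_mulmx cts_id (cts_adjoint cts_id)).
apply: accessible_closed_set1; apply: hausdorff_accessible; exact: mx_hausdorff.
Qed.

(** Entries of a unitary matrix have modulus at most 1, so this closed set lies in the continuous
    image of a real cube. *)
Lemma compact_unitary n : compact [set U : 'M[C]_n | U \is unitarymx].
Proof.
pose I : finType := ('I_n * 'I_n * bool)%type.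
pose F (v : 'rV[R]_#|I|) : 'M[C]_n :=
  \matrix_(i, j) (v ord0 (enum_rank ((i, j, true) : I)) +i* v ord0 (enum_rank ((i, j, false) : I))).
have cF : continuous F.
  apply: mx_cts => i j.
  refine (@cts_ext _ _ (fun v : 'rV[R]_#|I| => v ord0 (enum_rank ((i, j, true) : I)) +i*
     v ord0 (enum_rank ((i, j, false) : I))) _ _ _); first by move=> v; rewrite mxE.
  by apply: (@cts_complex _ (fun v : 'rV[R]_#|I| => v ord0 _) (fun v => v ord0 _)) => v; exact: coord_continuous.
pose box : set 'rV[R]_#|I| := [set v | forall k, `[-1, 1]%classic (v ord0 k)].
have cbox : compact box.
  have := @rV_compact R #|I| (fun=> `[-1, 1]%classic); apply => k.
  exact: segment_compact.
apply: (@subclosed_compact _ _ (F @` box)).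
- exact: closed_unitary.
- by apply: continuous_compact => //; exact: continuous_subspaceT.
move=> U uU.
pose v : 'rV[R]_#|I| := \row_k let: (i, j, b) := (enum_val k : I) in
   if b then complex.Re (U i j) else complex.Im (U i j).
exists v.
  move=> k; rewrite /= in_itv /= mxE -ler_norml; case: (enum_val k) => -[i j] b.
  have := unitary_norm_le i j uU.
  case: b => h; rewrite -lecR; apply: le_trans h; [exact: norm_Re_le|exact: norm_Im_le].
by apply/matrixP => i j; rewrite !mxE !enum_rankK; case: (U i j).
Qed.

End ComplexTopology.

(** * Quotients of a biinvariant set of unitary matrices *)

Section OpenQuotient.
Variables (A B : topologicalType) (q : A -> B).
Hypothesis q_open : forall O : set A, open O -> open (q @` O).
Hypothesis q_onto : forall b, exists a, q a = b.

Lemma open_quotient_cts (D : topologicalType) (f : B -> D) :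
  continuous (fun a => f (q a)) -> continuous f.
Proof.
move=> cfq; apply/continuousP => O oO.
have -> : f @^-1` O = q @` ((fun a => f (q a)) @^-1` O).
  apply/seteqP; split=> [b Ob|_ [a Oa <-]] //.
  by have [a qa] := q_onto b; exists a => //=; rewrite qa.
by apply: q_open; exact: (cts_open cfq oO).
Qed.

Lemma open_map_prod (T : topologicalType) (O : set (A * T)) :
  open O -> open ((fun x : A * T => (q x.1, x.2)) @` O).
Proof.
rewrite !openE => oO _ [[a t] Oat <-] /=.
have [[U V] /= [nU nV] UV] := oO (a, t) Oat.
move: nU; rewrite nbhsE => -[U' [oU' U'a] U'U].
exists (q @` U', V) => /=.
  by split=> //; apply: open_nbhs_nbhs; split; [exact: q_open|exists a].
move=> [b u] /= [[a' U'a' <-] Vu]; exists (a', u) => //.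
by apply: UV; split=> //; exact: U'U.
Qed.

End OpenQuotient.

Lemma quotient_homeo (A B B' : topologicalType) (q : A -> B) (q' : A -> B') :
  continuous q -> continuous q' ->
  (forall O : set A, open O -> open (q @` O)) ->
  (forall O : set A, open O -> open (q' @` O)) ->
  (forall b, exists a, q a = b) -> (forall b, exists a, q' a = b) ->
  (forall a a', q a = q a' <-> q' a = q' a') ->
  exists f : B -> B', homeomorphism f /\ forall a, f (q a) = q' a.
Proof.
move=> cq cq' oq oq' sq sq' E.
have [r rK] := choice sq; have [r' r'K] := choice sq'.
pose f b := q' (r b); pose g b := q (r' b).
have fq a : f (q a) = q' a by apply/E; rewrite rK.
have gq a : g (q' a) = q a by apply/E; rewrite r'K.
exists f; split=> //; split.
  by apply: (open_quotient_cts oq sq); under eq_fun do rewrite fq.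
exists g; split.
- by move=> b; have [a <-] := sq b; rewrite fq gq.
- by move=> b; have [a <-] := sq' b; rewrite gq fq.
- by apply: (open_quotient_cts oq' sq'); under eq_fun do rewrite gq.
Qed.

Lemma compact_closed_map (A B : topologicalType) (f : A -> B) :
  compact [set: A] -> hausdorff_space B -> continuous f ->
  forall D : set A, closed D -> closed (f @` D).
Proof.
move=> cA hB cf D cD; apply: compact_closed => //.
apply: continuous_compact; first exact: continuous_subspaceT.
exact: subclosed_compact cD cA _.
Qed.

(** A continuous injection of a compact space into a Hausdorff space is a closed embedding. This
    lets maps into X be tested on matrix entries. *)
Lemma closed_embedding_cts (A B D : topologicalType) (m : A -> B) (f : D -> A) :
  compact [set: A] -> hausdorff_space B -> continuous m -> injective m ->
  continuous (fun x => m (f x)) -> continuous f.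
Proof.
move=> cA hB cm im cmf; apply/continuous_closedP => E cE.
have -> : f @^-1` E = (fun x => m (f x)) @^-1` (m @` E).
  apply/seteqP; split=> x /=; first by exists (f x).
  by move=> [y Ey /im <-].
exact: (cts_closed cmf (compact_closed_map cA hB cm cE)).
Qed.

Section OrbitSpaces.
Variables (G : groupType) (X : gspace G).

Lemma eq_orbit_of (x y : X) : orbit_of x = orbit_of y <-> exists g : G, gact g x = y.
Proof.
split=> [/eqmodP/asboolP //|gxy]; by apply/eqmodP/asboolP.
Qed.

Lemma orbit_of_cts : continuous (@orbit_of G X).
Proof. exact: pi_continuous. Qed.

Lemma orbit_of_onto (o : orbit_space X) : exists x, orbit_of x = o.
Proof. by exists (repr o); rewrite /orbit_of reprK. Qed.

Lemma orbit_of_open : (forall g : G, continuous (@gact G X g)) ->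
  forall O : set X, open O -> open (@orbit_of G X @` O).
Proof.
move=> cg O oO.
have -> : open (@orbit_of G X @` O) = open (@orbit_of G X @^-1` (@orbit_of G X @` O)) by [].
have -> : @orbit_of G X @^-1` (@orbit_of G X @` O) =
    \bigcup_(g in [set: G]) (@gact G X g @^-1` O).
  apply/seteqP; split=> [x [y Oy /eq_orbit_of[g gyx]]|x [g _ Ogx]].
    by exists g^-1%g => //=; rewrite -gyx -gactM mulVg gact1.
  by exists (gact g x) => //; apply/eq_orbit_of; exists g^-1%g; rewrite -gactM mulVg gact1.
by apply: bigcup_open => g _; exact: (cts_open (@cg g) oO).
Qed.

End OrbitSpaces.

(** * Models of one-sided torus quotients *)

Section Models.
Variables (R : realType) (n : nat).
Local Notation C := R[i].
Local Notation M := 'M[C]_n.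
Local Notation torus := (torus R n).

Definition real_diag (d : 'I_n -> R) : M := diag_mx (\row_j (d j)%:C).
Definition conj_diag d (U : M) : M := U^t* *m real_diag d *m U.

Lemma cts_conj_diag d : continuous (conj_diag d).
Proof.
exact: (cts_mulmx (cts_mulmx (cts_adjoint cts_id) (cts_cst _)) cts_id).
Qed.

Lemma conj_diagE d U i j :
  conj_diag d U i j = \sum_k Num.conj (U k i) * (d k)%:C * U k j.
Proof.
rewrite /conj_diag /real_diag mxE; apply: eq_bigr => k _.
by rewrite mul_mx_diag !mxE.
Qed.

Record biinvariant (Z : set M) : Prop := Biinvariant {
  bi_unitary : forall U, Z U -> U \is unitarymx;
  bi_closed : closed Z;
  bi_left : forall (t : torus) U, Z U -> Z (torus_mx t *m U);
  bi_right : forall (t : torus) U, Z U -> Z (U *m torus_mx t)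
}.

Definition adjoint_set (Z : set M) : set M := [set U | Z (U^t*)].

Lemma torus_adjoint (t : torus) : (torus_mx t)^t* = torus_mx t^-1%g.
Proof. by case/andP: (torusP t) => _ uD; rewrite /= invmx_unitary. Qed.

Lemma adjointM m p q (A : 'M[C]_(m, p)) (B : 'M[C]_(p, q)) : (A *m B)^t* = B^t* *m A^t*.
Proof. by rewrite trmx_mul map_mxM. Qed.

Lemma adjointVM (U : M) : U \is unitarymx -> U^t* *m U = 1%:M.
Proof.
by move=> uU; rewrite -(invmx_unitary uU) mulVmx//; exact: (unitarymx_unit uU).
Qed.

Lemma adjointMV (U : M) : U \is unitarymx -> U *m U^t* = 1%:M.
Proof. by move/unitarymxP. Qed.

Lemma biinvariant_adjoint Z : biinvariant Z -> biinvariant (adjoint_set Z).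
Proof.
move=> [Zu Zc Zl Zr]; split.
- by move=> U /Zu; rewrite trmxC_unitary.
- exact: (cts_closed (cts_adjoint cts_id) Zc).
- move=> t U ZU; rewrite /adjoint_set /= adjointM torus_adjoint.
  exact: Zr.
- move=> t U ZU; rewrite /adjoint_set /= adjointM torus_adjoint.
  exact: Zl.
Qed.

Lemma adjoint_setK Z : adjoint_set (adjoint_set Z) = Z.
Proof. by apply/seteqP; split=> U; rewrite /adjoint_set /= trmxCK. Qed.

(* X is the quotient of Z by left multiplication, embedded by U |-> U^* d U. *)
Record model (Z : set M) (d : 'I_n -> R) (X : gspace torus) := Model {
  mpi : Z -> X;
  mmx : X -> M;
  mpi_cts : continuous mpi;
  mpi_onto : forall x, exists U, mpi U = x;
  mmx_cts : continuous mmx;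
  mmx_inj : injective mmx;
  mmx_mpi : forall U, mmx (mpi U) = conj_diag d (val U);
  mmx_act : forall t x, mmx (gact t x) = mx_gact t (mmx x)
}.

Arguments mpi_cts {Z d X} _.
Arguments mmx_cts {Z d X} _.

Section ModelTheory.
Variables (Z : set M) (d : 'I_n -> R) (X : gspace torus).
Hypotheses (bZ : biinvariant Z) (d_inj : injective d) (mX : model Z d X).
Local Notation pi := (mpi mX).
Local Notation m := (mmx mX).

Lemma zsub_unitary (U : Z) : val U \is unitarymx.
Proof. by apply: (bi_unitary bZ); exact: set_mem (valP U). Qed.

Lemma compact_Z : compact [set: Z].
Proof.
apply: compact_sub; apply: (@subclosed_compact _ Z [set U : M | U \is unitarymx]).
- exact: bi_closed bZ.
- exact: compact_unitary.
- by move=> U /(bi_unitary bZ).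
Qed.

Lemma model_compact : compact [set: X].
Proof.
have -> : [set: X] = pi @` [set: Z].
  by apply/seteqP; split=> // x _; have [U <-] := mpi_onto mX x; exists U.
apply: continuous_compact compact_Z; apply: continuous_subspaceT; exact: mpi_cts.
Qed.

Lemma model_hausdorff : hausdorff_space X.
Proof.
apply: separated_hausdorff => x y xy.
have [|f cf fxy] := @mx_separated R _ _ (m x) (m y); first by move/mmx_inj.
by exists (fun x => f (m x)) => //; exact: (cts_comp (mmx_cts mX) cf).
Qed.

Lemma model_cts (T : topologicalType) (f : T -> X) :
  continuous (fun x => m (f x)) -> continuous f.
Proof.
apply: (closed_embedding_cts model_compact); first exact: mx_hausdorff.
  exact: mmx_cts.
exact: mmx_inj.
Qed.

Lemma cts_mx_gact (t : torus) : continuous (@mx_gact R n t).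
Proof. exact: (cts_mulmx (cts_mulmx (cts_cst _) cts_id) (cts_cst _)). Qed.

Lemma gact_cts t : continuous (@gact _ X t).
Proof.
apply: model_cts; under eq_fun do rewrite mmx_act.
exact: (cts_comp (mmx_cts mX) (@cts_mx_gact t)).
Qed.

Definition zleft (t : torus) (U : Z) : Z :=
  exist (fun U => U \in Z) (torus_mx t *m val U)
    (mem_set (bi_left bZ t (set_mem (valP U)))).
Definition zright (t : torus) (U : Z) : Z :=
  exist (fun U => U \in Z) (val U *m torus_mx t)
    (mem_set (bi_right bZ t (set_mem (valP U)))).

Lemma zleft_cts t : continuous (zleft t).
Proof. apply: sub_cts; exact: (cts_mulmx (cts_cst _) cts_val). Qed.

Lemma real_diag_comm (A : M) : A *m real_diag d = real_diag d *m A -> is_diag_mx A.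
Proof.
move=> /matrixP h; apply/is_diag_mxP => i j ij; have := h i j.
rewrite /real_diag mul_mx_diag mul_diag_mx !mxE mulrC => /eqP.
rewrite -subr_eq0 -mulrBl mulf_eq0 => /orP[|/eqP//].
rewrite subr_eq0 => /eqP/complexI/d_inj ji; by rewrite ji eqxx in ij.
Qed.

Lemma conj_diag_left (t : torus) U : conj_diag d (torus_mx t *m U) = conj_diag d U.
Proof.
have [tD tU] := andP (torusP t).
have tc : real_diag d *m torus_mx t = torus_mx t *m real_diag d.
  apply/matrixP => i j; rewrite /real_diag mul_diag_mx mul_mx_diag !mxE.
  have [->|ij] := eqVneq i j; first by rewrite mulrC.
  by rewrite torus_offdiag// mulr0 mul0r.
rewrite /conj_diag adjointM -!mulmxA [real_diag d *m (_ *m U)]mulmxA tc !mulmxA.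
by rewrite -(mulmxA _ _ (torus_mx t)) (adjointVM tU) mulmx1.
Qed.

(** If U and U' conjugate [real_diag d] to the same matrix, then U' U^* commutes with [real_diag d];
    the entries being distinct, it is diagonal. *)
Lemma model_fiber (U U' : Z) : pi U = pi U' <-> exists t, zleft t U = U'.
Proof.
split=> [|[t <-]]; last by apply: (@mmx_inj _ _ _ mX); rewrite !mmx_mpi conj_diag_left.
move=> /(congr1 m); rewrite !mmx_mpi /conj_diag => E.
have uU := zsub_unitary U; have uU' := zsub_unitary U'.
have VU := adjointVM uU; have UV := adjointMV uU; have UV' := adjointMV uU'.
pose t := val U' *m (val U)^t*.
have tD : is_diag_mx t.
  apply: real_diag_comm; rewrite /t.
  have := congr1 (fun A => val U' *m A *m (val U)^t*) E.
  rewrite !mulmxA UV' mul1mx -!mulmxA UV mulmx1 !mulmxA => ->.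
  by [].
have tU : t \is unitarymx := mul_unitarymx uU' (etrans (trmxC_unitary _) uU).
have tP : is_diag_mx t && (t \is unitarymx) by rewrite tD.
by exists (Torus tP); apply/val_inj; rewrite /= /t -mulmxA VU mulmx1.
Qed.

Lemma mpi_act t (U : Z) : gact t (pi U) = pi (zright t^-1%g U).
Proof.
apply: (@mmx_inj _ _ _ mX); rewrite mmx_act !mmx_mpi /conj_diag /mx_gact.
by rewrite adjointM torus_adjoint invgK /= !mulmxA.
Qed.

(** The complement of the saturation of O is closed, and its image is closed because Z is compact
    and X is Hausdorff. *)
Lemma mpi_open (O : set Z) : open O -> open (pi @` O).
Proof.
move=> oO; pose S := \bigcup_(t in [set: torus]) (zleft t @^-1` O).
have oS : open S by apply: bigcup_open => t _; exact: (cts_open (@zleft_cts t) oO).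
have -> : pi @` O = ~` (pi @` (~` S)).
  apply/seteqP; split=> x.
    move=> [U OU <-] [U' nS /model_fiber[t tU]]; apply: nS.
    by exists t => //=; rewrite tU.
  move=> nx; have [U Ux] := mpi_onto mX x.
  have [t _ OtU] : S U by apply: contrapT => nS; apply: nx; exists U.
  by exists (zleft t U) => //; rewrite -Ux; apply/esym/model_fiber; exists t.
rewrite openC; apply: (compact_closed_map compact_Z model_hausdorff (mpi_cts mX)).
by rewrite closedC.
Qed.

End ModelTheory.
End Models.
Arguments mpi_cts {R n Z d X} _.
Arguments mmx_cts {R n Z d X} _.
Arguments gact_cts {R n Z d X} bZ mX t.
Arguments orbit_of_cts {G} X.

(** * Orbit spaces *)

Section StabDim.
Variables (R : realType) (n : nat).
Local Notation C := R[i].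
Local Notation torus := (torus R n).

(** [Q] undoes [P] on the stabiliser of x, so independent rows there remain independent after
    multiplication by [P]. *)
Lemma stab_dim_leq (X Y : gspace torus) (x : X) (y : Y) (P Q : 'M[R]_n) :
  (forall v, stab_lie x v -> stab_lie y (v *m P)) ->
  (forall v, stab_lie x v -> v *m P *m Q = v) ->
  (stab_dim x <= stab_dim y)%N.
Proof.
move=> sP sPQ; apply/bigmax_leqP => d /asboolP[B [fB sB]].
apply: (@leq_bigmax_cond _ _ (fun d : 'I_n.+1 => (d : nat))); apply/asboolP.
exists (B *m P); split=> [|i]; last by rewrite row_mul; exact: sP.
have BPQ : B *m P *m Q = B by apply/row_matrixP => i; rewrite !row_mul sPQ.
rewrite /row_free eqn_leq rank_leq_row /=.
by apply: leq_trans (mxrankM_maxl _ Q); rewrite BPQ (eqP fB).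
Qed.

Lemma stab_dim_ge (X : gspace torus) (x : X) d (B : 'M[R]_(d, n)) :
  row_free B -> (forall i, stab_lie x (row i B)) -> (d <= stab_dim x)%N.
Proof.
move=> fB sB; have dn : (d < n.+1)%N by rewrite ltnS -(eqP fB) rank_leq_col.
apply: (@leq_bigmax_cond _ _ (fun d : 'I_n.+1 => (d : nat)) (Ordinal dn)).
by apply/asboolP; exists B.
Qed.

Lemma stab_dim_witness (X : gspace torus) (x : X) :
  exists B : 'M[R]_(stab_dim x, n), row_free B /\ forall i, stab_lie x (row i B).
Proof.
pose P (d : 'I_n.+1) := `[< exists B : 'M[R]_(d, n),
  row_free B /\ forall i, stab_lie x (row i B) >].
have P0 : P ord0.
  by apply/asboolP; exists 0; split=> [|[]//]; rewrite /row_free mxrank0.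
have [d Pd E] := @eq_bigmax_cond _ P (fun d : 'I_n.+1 => (d : nat))
  (introT card_gt0P (ex_intro _ ord0 P0)).
have -> : stab_dim x = d := E.
exact/asboolP.
Qed.

Lemma torus_expE (v : 'rV[R]_n) j :
  torus_mx (torus_exp v) j j = cos (v ord0 j) +i* sin (v ord0 j).
Proof. by rewrite /= !mxE eqxx. Qed.

Section Stab.
Variables (Z : set 'M[C]_n) (d : 'I_n -> R) (X : gspace torus).
Hypotheses (bZ : biinvariant Z) (d_inj : injective d) (mX : model Z d X).

(** Conjugation by exp(i s v) multiplies the entry (i, j) by the phase of angle s (v_i - v_j). *)
Lemma stab_lie_mmxP (x : X) (v : 'rV[R]_n) :
  stab_lie x v <-> forall i j, mmx mX x i j != 0 -> v ord0 i = v ord0 j.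
Proof.
have e1 (a b : R) : complex.Re ((cos a +i* sin a) * Num.conj (cos b +i* sin b : C)) = cos (a - b).
  by rewrite cosB /= mulrN opprK.
split=> [sv i j Aij|h s].
  apply: contrapT => /eqP vij; move/negP: Aij; apply.
  have vij' : v ord0 i - v ord0 j != 0 by rewrite subr_eq0.
  (* At this time the phase is -1, which cannot fix a nonzero entry. *)
  have /(congr1 (mmx mX)) := sv (pi / (v ord0 i - v ord0 j)).
  rewrite mmx_act => /matrixP/(_ i j); rewrite mx_gactE !torus_expE !mxE.
  set a := _ / _ * _; set b := _ / _ * _; set A := mmx mX x i j.
  rewrite mulrAC -[X in _ = X]mul1r => /eqP; rewrite -subr_eq0 -mulrBl mulf_eq0.
  case/orP => //; rewrite subr_eq0 => /eqP/(congr1 (@complex.Re R)).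
  rewrite e1 (_ : a - b = pi); first by rewrite cospi /= => /eqP; rewrite -subr_eq0 -opprD oppr_eq0 -(natrD _ 1 1) pnatr_eq0.
  by rewrite /a /b -mulrBr divfK.
apply: (@mmx_inj _ _ _ _ _ mX); rewrite mmx_act; apply/matrixP => i j.
rewrite mx_gactE; have [->|Aij] := eqVneq (mmx mX x i j) 0; first by rewrite mulr0 mul0r.
rewrite mulrAC -[RHS]mul1r; congr (_ * _).
suff -> : torus_mx (torus_exp (s *: v)) i i = torus_mx (torus_exp (s *: v)) j j.
  by rewrite -normCK torus_norm expr1n.
by rewrite !torus_expE !mxE (h _ _ Aij).
Qed.

(** If diag(v) commutes with U^* d U, then N = U diag(v) U^* commutes with d, hence is diagonal; w
    is its diagonal, and N U = U diag(v) is the stated relation. In this form the condition is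
    symmetric in v and w up to adjunction. *)
Lemma stab_lie_mpiP (U : Z) (v : 'rV[R]_n) :
  stab_lie (mpi mX U) v <->
  exists w : 'rV[R]_n, forall i k, val U i k != 0 -> w ord0 i = v ord0 k.
Proof.
have uU := zsub_unitary bZ U; set A := mmx mX (mpi mX U).
have AE i j : A i j = \sum_k Num.conj (val U k i) * (d k)%:C * val U k j.
  by rewrite /A mmx_mpi conj_diagE.
rewrite stab_lie_mmxP -/A; split=> [h|[w h] i j Aij]; last first.
  have [k Uki Ukj] : exists2 k, val U k i != 0 & val U k j != 0.
    apply: contrapT => nk; move/eqP: Aij; apply; rewrite AE big1// => k _.
    have [->|Uki] := eqVneq (val U k i) 0; first by rewrite rmorph0 !mul0r.
    have [->|Ukj] := eqVneq (val U k j) 0; first by rewrite mulr0.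
    by case: nk; exists k.
  by rewrite -(h _ _ Uki) (h _ _ Ukj).
pose T : 'M[C]_n := real_diag (fun j => v ord0 j).
have AT : A *m T = T *m A.
  apply/matrixP => i j; rewrite /T /real_diag mul_mx_diag mul_diag_mx !mxE.
  have [->|Aij] := eqVneq (A i j) 0; first by rewrite mulr0 mul0r.
  by rewrite (h _ _ Aij) mulrC.
have AUE : A = (val U)^t* *m real_diag d *m val U by rewrite /A mmx_mpi.
have dU : real_diag d *m val U = val U *m A.
  by rewrite AUE !mulmxA (adjointMV uU) mul1mx.
have Ud : A *m (val U)^t* = (val U)^t* *m real_diag d.
  by rewrite AUE -!mulmxA (adjointMV uU) mulmx1.
pose N := val U *m T *m (val U)^t*.
have /is_diag_mxP dN : is_diag_mx N.
  apply: (real_diag_comm d_inj); rewrite /N !mulmxA dU -[val U *m A *m T]mulmxA AT.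
  by rewrite -!mulmxA Ud.
have NU : N *m val U = val U *m T by rewrite /N -!mulmxA (adjointVM uU) mulmx1.
exists (\row_i complex.Re (N i i)) => i k Uik; rewrite mxE.
move/matrixP/(_ i k): NU; rewrite mxE (bigD1 i)//= big1 ?addr0 => [|j ji]; last first.
  by rewrite dN ?mul0r// eq_sym.
rewrite /T /real_diag mul_mx_diag !mxE mulrC => /(mulfI Uik) ->.
by [].
Qed.

Definition unistochastic (U : 'M[C]_n) : 'M[R]_n :=
  \matrix_(i, k) complex.Re (`|U i k| ^+ 2).

Lemma unitary_row_norm (U : 'M[C]_n) i : U \is unitarymx ->
  \sum_k complex.Re (`|U i k| ^+ 2) = 1.
Proof.
move=> /adjointMV E; transitivity (complex.Re ((U *m U^t*) i i)); last by rewrite E mxE eqxx.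
rewrite mxE raddf_sum; apply: eq_bigr => k _.
by rewrite !mxE normCK.
Qed.

(** The weights |U_ik|^2 of row i have sum 1 and live where v_k = w_i. Thus w is the image of v
    under a linear map that depends on U only. *)
Lemma unistochastic_mul (U : 'M[C]_n) (w v : 'rV[R]_n) : U \is unitarymx ->
  (forall i k, U i k != 0 -> w ord0 i = v ord0 k) -> v *m (unistochastic U)^T = w.
Proof.
move=> uU h; apply/rowP => i; rewrite mxE -[RHS]mulr1 -(unitary_row_norm i uU) mulr_sumr.
apply: eq_bigr => k _; rewrite !mxE; have [->|Uik] := eqVneq (U i k) 0.
  by rewrite normr0 expr0n /= !mulr0.
by rewrite (h _ _ Uik).
Qed.

End Stab.

Section TwoModels.
Variables (Z : set 'M[C]_n) (d d' : 'I_n -> R) (X Y : gspace torus).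
Hypotheses (bZ : biinvariant Z) (d_inj : injective d) (d'_inj : injective d').
Hypotheses (mX : model Z d X) (mY : model (adjoint_set Z) d' Y).

Lemma zadj_subproof (U : Z) : (val U)^t* \in adjoint_set Z.
Proof. by apply/mem_set; rewrite /adjoint_set /= trmxCK; exact: set_mem (valP U). Qed.
Definition zadj (U : Z) : adjoint_set Z :=
  exist (fun U => U \in adjoint_set Z) _ (zadj_subproof U).

Lemma zadj_inv_subproof (U : adjoint_set Z) : (val U)^t* \in Z.
Proof. by apply/mem_set; exact: set_mem (valP U). Qed.
Definition zadj_inv (U : adjoint_set Z) : Z :=
  exist (fun U => U \in Z) _ (zadj_inv_subproof U).

Lemma zadjK : cancel zadj zadj_inv.
Proof. by move=> U; apply/val_inj; rewrite /= trmxCK. Qed.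
Lemma zadj_invK : cancel zadj_inv zadj.
Proof. by move=> U; apply/val_inj; rewrite /= trmxCK. Qed.
Lemma zadj_cts : continuous zadj.
Proof. apply: sub_cts; exact: (cts_adjoint cts_val). Qed.
Lemma zadj_inv_cts : continuous zadj_inv.
Proof. apply: sub_cts; exact: (cts_adjoint cts_val). Qed.
Lemma zadj_open (O : set Z) : open O -> open (zadj @` O).
Proof.
have -> : zadj @` O = zadj_inv @^-1` O.
  apply/seteqP; split=> [_ [U OU <-] /=|U OU]; first by rewrite zadjK.
  by exists (zadj_inv U) => //; rewrite zadj_invK.
by move=> oO; exact: (cts_open zadj_inv_cts oO).
Qed.

Lemma unistochastic_adjoint (U : 'M[C]_n) : unistochastic (U^t*) = (unistochastic U)^T.
Proof. by apply/matrixP => i j; rewrite !mxE norm_conjC. Qed.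

(** The matrix (|U_ij|^2) and its transpose are mutually inverse between the two infinitesimal
    stabilisers. *)
Lemma orbit_dim_adjoint (U : Z) : orbit_dim (mpi mX U) = orbit_dim (mpi mY (zadj U)).
Proof.
have bZ' := biinvariant_adjoint bZ.
have uU := zsub_unitary bZ U; have uU' := zsub_unitary bZ' (zadj U).
have XY (v w : 'rV[R]_n) : (forall i k, val U i k != 0 -> w ord0 i = v ord0 k) <->
    (forall k i, val (zadj U) k i != 0 -> v ord0 k = w ord0 i).
  have E k i : (val (zadj U) k i != 0) = (val U i k != 0).
    by rewrite /= !mxE conjC_eq0.
  by split=> h a b; [rewrite E => /h|rewrite -E => /h].
have PX v : stab_lie (mpi mX U) v ->
    stab_lie (mpi mY (zadj U)) (v *m (unistochastic (val U))^T) /\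
    v *m (unistochastic (val U))^T *m (unistochastic (val U)) = v.
  move=> /(stab_lie_mpiP bZ d_inj)[w h]; have vw := unistochastic_mul uU h.
  rewrite vw; split; first by apply/(stab_lie_mpiP bZ' d'_inj); exists v; apply/XY.
  have := unistochastic_mul uU' ((XY v w).1 h).
  by rewrite unistochastic_adjoint trmxK.
have PY w : stab_lie (mpi mY (zadj U)) w ->
    stab_lie (mpi mX U) (w *m (unistochastic (val U))) /\
    w *m (unistochastic (val U)) *m (unistochastic (val U))^T = w.
  move=> /(stab_lie_mpiP bZ' d'_inj)[v h]; have wv := unistochastic_mul uU' h.
  move: wv; rewrite unistochastic_adjoint trmxK => wv.
  rewrite wv; split; first by apply/(stab_lie_mpiP bZ d_inj); exists w; apply/XY.
  exact: unistochastic_mul uU ((XY v w).2 h).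
rewrite /orbit_dim; congr (n - _)%N; apply/eqP; rewrite eqn_leq; apply/andP; split.
  by apply: (@stab_dim_leq _ _ _ _ (unistochastic (val U))^T (unistochastic (val U))) => v /PX[].
by apply: (@stab_dim_leq _ _ _ _ (unistochastic (val U)) (unistochastic (val U))^T) => v /PY[].
Qed.

(** Both orbit spaces are open quotients of Z with the same fibres, the double cosets T U T. *)
Lemma orbit_spaces_homeo : exists f : orbit_space X -> orbit_space Y,
  homeomorphism f /\ forall k, f @` orbit_filtration X k = orbit_filtration Y k.
Proof.
have bZ' := biinvariant_adjoint bZ.
pose qX U := orbit_of (mpi mX U); pose qY U := orbit_of (mpi mY (zadj U)).
have cX : continuous qX := cts_comp (mpi_cts mX) (orbit_of_cts X).
have cY : continuous qY := cts_comp (cts_comp zadj_cts (mpi_cts mY)) (orbit_of_cts Y).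
have sX b : exists U, qX U = b.
  by have [x <-] := orbit_of_onto b; have [U <-] := mpi_onto mX x; exists U.
have sY b : exists U, qY U = b.
  have [x <-] := orbit_of_onto b; have [U <-] := mpi_onto mY x; exists (zadj_inv U).
  by rewrite /qY zadj_invK.
have oX (O : set Z) : open O -> open (qX @` O).
  move=> oO; rewrite (_ : qX @` O = @orbit_of _ X @` (mpi mX @` O)); last by rewrite image_comp.
  exact (@orbit_of_open _ X (gact_cts bZ mX) _ (@mpi_open _ _ _ _ _ bZ d_inj mX _ oO)).
have oY (O : set Z) : open O -> open (qY @` O).
  move=> oO; rewrite (_ : qY @` O = @orbit_of _ Y @` (mpi mY @` (zadj @` O))); last by rewrite !image_comp.
  exact (@orbit_of_open _ Y (gact_cts bZ' mY) _ (@mpi_open _ _ _ _ _ bZ' d'_inj mY _ (zadj_open oO))).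
have fib U U' : qX U = qX U' <-> qY U = qY U'.
  rewrite !eq_orbit_of; split=> -[g]; rewrite mpi_act.
    move=> /(model_fiber bZ d_inj mX)[t tU]; exists t; rewrite mpi_act.
    apply/(model_fiber bZ' d'_inj mY); exists g; apply/val_inj.
    change (torus_mx g *m ((val U)^t* *m torus_mx t^-1%g) = (val U')^t*).
    have -> : val U' = torus_mx t *m (val U *m torus_mx g^-1%g) by rewrite -tU.
    by rewrite !adjointM !torus_adjoint invgK mulmxA.
  move=> /(model_fiber bZ' d'_inj mY)[t tU]; exists t; rewrite mpi_act.
  apply/(model_fiber bZ d_inj mX); exists g; apply/val_inj.
  change (torus_mx g *m (val U *m torus_mx t^-1%g) = val U').
  have E : (val U')^t* = torus_mx t *m ((val U)^t* *m torus_mx g^-1%g).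
    by move/(congr1 val): tU.
  by rewrite -[val U']trmxCK E !adjointM !torus_adjoint !trmxCK invgK mulmxA.
have [f [hf fq]] := quotient_homeo cX cY oX oY sX sY fib.
exists f; split=> // k; apply/seteqP; split=> [_ [_ [x xk <-] <-]|_ [y yk <-]].
  have [U Ux] := mpi_onto mX x; rewrite -Ux -/(qX U) fq; exists (mpi mY (zadj U)) => //.
  by rewrite /= -orbit_dim_adjoint Ux.
have [U Uy] := mpi_onto mY y; exists (qX (zadj_inv U)).
  exists (mpi mX (zadj_inv U)) => //; by rewrite /= orbit_dim_adjoint zadj_invK Uy.
by rewrite fq /qY zadj_invK Uy.
Qed.

End TwoModels.

End StabDim.

(** * The universal bundle *)

Section ETTopology.
Variables (R : realType) (n : nat).
Local Notation C := R[i].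
Local Notation torus := (torus R n).
Local Notation ET := (@ET R n).

Definition etc (e : ET) (k : nat) (j : 'I_n) : C := (val e : nat -> 'cV[C]_n) k j ord0.

Lemma cts_etc k j : continuous (fun e : ET => etc e k j).
Proof.
have c1 : continuous (fun e : {ptws nat -> 'cV[C]_n} => e k).
  exact: (@proj_continuous nat (fun=> 'cV[C]_n) k).
have c2 := cts_comp (@cts_val _ (@ET_set R n)) c1.
exact: (@cts_entry _ _ _ _ (fun e : ET => val e k) j ord0 c2).
Qed.

Lemma cts_into_ET (T : topologicalType) (f : T -> ET) :
  (forall k j, continuous (fun x => etc (f x) k j)) -> continuous f.
Proof.
move=> cf; apply: sub_cts => x.
apply/(@pointwise_cvgP nat 'cV[C]_n) => k.
have ck : continuous (fun x => (val (f x) : nat -> 'cV[C]_n) k).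
  by apply: mx_cts => j i; rewrite (ord1 i); exact: cf.
exact: (ck x).
Qed.
Arguments cts_etc k j : clear implicits.

Lemma ET_supp (e : ET) : exists N,
  (forall k j, (N <= k)%N -> etc e k j = 0) /\
  (forall j N', (N <= N')%N -> \sum_(k < N') `|etc e k j| ^+ 2 = 1).
Proof.
have [N [e0 e1]] := set_mem (valP e); exists N; split=> [k j Nk|j N' NN'].
  by rewrite /etc e0// mxE.
rewrite -(e1 j) -(big_mkord xpredT (fun k => `|etc e k j| ^+ 2)).
rewrite (@big_cat_nat _ _ _ N)//= [X in _ + X]big_nat [X in _ + X]big1 ?addr0 ?big_mkord//.
by move=> k /andP[Nk _]; rewrite /etc e0// mxE normr0 expr0n.
Qed.

Lemma mkET_subproof (u : nat -> 'I_n -> C) :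
  (exists N, (forall k j, (N <= k)%N -> u k j = 0) /\
     forall j, \sum_(k < N) `|u k j| ^+ 2 = 1) ->
  ((fun k => \col_j u k j) : {ptws nat -> 'cV[C]_n}) \in @ET_set R n.
Proof.
move=> [N [u0 u1]]; apply/mem_set; exists N; split=> [k Nk|j].
  by apply/colP => j; rewrite !mxE u0.
by rewrite -[RHS](u1 j); apply: eq_bigr => k _; rewrite mxE.
Qed.
Definition mkET u hu : ET := exist (fun e => e \in @ET_set R n) _ (@mkET_subproof u hu).

Lemma etc_mkET u hu k j : etc (@mkET u hu) k j = u k j.
Proof. by rewrite /etc /= mxE. Qed.

Lemma eq_ET (e e' : ET) : (forall k j, etc e k j = etc e' k j) -> e = e'.
Proof.
move=> ee; apply/val_inj/funext => k; apply/colP => j; exact: ee.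
Qed.

Lemma etc_gact (t : torus) (e : ET) k j : etc (gact t e) k j = t j j * etc e k j.
Proof. exact: torus_mulE. Qed.

Lemma ET_gact_cts (t : torus) : continuous (@gact _ ET t).
Proof.
apply: cts_into_ET => k j; under eq_fun do rewrite etc_gact.
exact: (cts_mul (cts_cst _) (cts_etc k j)).
Qed.

Lemma ET_last (e : ET) j : exists2 k, etc e k j != 0 & forall l, (k < l)%N -> etc e l j = 0.
Proof.
have [N [e0 e1]] := ET_supp e.
have : exists k, (k < N)%N && (etc e k j != 0).
  apply: contrapT => h; have := e1 j N (leqnn N); rewrite big1 => [/esym/eqP|k _].
    by rewrite oner_eq0.
  have [->|ek] := eqVneq (etc e k j) 0; first by rewrite normr0 expr0n.
  by case: h; exists (val k); rewrite ltn_ord.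
move=> ex; have ub k : (k < N)%N && (etc e k j != 0) -> (k <= N)%N by move=> /andP[/ltnW].
case: (ex_maxnP ex ub) => k /andP[kN ek] kmax; exists k => // l kl.
apply/eqP; apply: contraTT isT => el; have lN : (l < N)%N.
  by rewrite ltnNge; apply/negP => Nl; move: el; rewrite e0// eqxx.
by have := kmax l; rewrite lN el => /(_ isT); rewrite leqNgt kl.
Qed.

Definition ndot N (u v : nat -> 'I_n -> C) j : R :=
  complex.Re (\sum_(k < N) u k j * Num.conj (v k j)).

Definition esupp (e : ET) : nat := projT1 (cid (ET_supp e)).

Lemma esuppP (e : ET) :
  (forall k j, (esupp e <= k)%N -> etc e k j = 0) /\
  (forall j N', (esupp e <= N')%N -> \sum_(k < N') `|etc e k j| ^+ 2 = 1).
Proof. by rewrite /esupp; case: cid. Qed.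

Definition edot (e e' : ET) j : R := ndot (maxn (esupp e) (esupp e')) (etc e) (etc e') j.

Lemma edotE (e e' : ET) N j :
  (forall k, (N <= k)%N -> etc e k j = 0 \/ etc e' k j = 0) ->
  edot e e' j = complex.Re (\sum_(k < N) etc e k j * Num.conj (etc e' k j)).
Proof.
have aux (M M' : nat) : (M <= M')%N -> (forall k, (M <= k)%N -> etc e k j = 0 \/ etc e' k j = 0) ->
  \sum_(k < M') etc e k j * Num.conj (etc e' k j) = \sum_(k < M) etc e k j * Num.conj (etc e' k j).
  move=> MM h; rewrite -(big_mkord xpredT (fun k => etc e k j * Num.conj (etc e' k j))).
  rewrite (@big_cat_nat _ _ _ M)//= [X in _ + X]big_nat [X in _ + X]big1 ?addr0 ?big_mkord//.
  by move=> k /andP[Mk _]; case: (h k Mk) => ->; rewrite ?rmorph0 ?mulr0 ?mul0r.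
move=> h; rewrite /edot /ndot; set M := maxn _ _; congr complex.Re.
have hM k : (M <= k)%N -> etc e k j = 0 \/ etc e' k j = 0.
  by move=> Mk; left; apply: (esuppP e).1; apply: leq_trans Mk; exact: leq_maxl.
by rewrite -(aux M (maxn M N) (leq_maxl _ _) hM) (aux N (maxn M N) (leq_maxr _ _) h).
Qed.

Section LinearPath.
Variables (T : topologicalType) (f g : T -> ET).
Hypotheses (cf : continuous f) (cg : continuous g).
Hypothesis cdot : forall j, continuous (fun x => edot (f x) (g x) j).
Hypothesis nz : forall x (t : R) j, exists k,
  (1 - t)%:C * etc (f x) k j + t%:C * etc (g x) k j != 0.

(** The squared norm of (1 - t) f + t g in the sphere number j, expanded with the help of |f| = |g|
    = 1. *)
Definition path_sqnorm (x : T) (t : R) j : R :=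
  (1 - t) ^+ 2 + t ^+ 2 + 2 * (t * (1 - t)) * edot (f x) (g x) j.

Let entry (x : T) (t : R) k j : C := (1 - t)%:C * etc (f x) k j + t%:C * etc (g x) k j.

Lemma path_sqnormE x t N j : (esupp (f x) <= N)%N -> (esupp (g x) <= N)%N ->
  \sum_(k < N) `|entry x t k j| ^+ 2 = (path_sqnorm x t j)%:C.
Proof.
move=> fN gN.
have e (a b : R) (u v : C) : `|a%:C * u + b%:C * v| ^+ 2 = (a ^+ 2)%:C * `|u| ^+ 2 +
   (b ^+ 2)%:C * `|v| ^+ 2 + (b * a)%:C * (u * Num.conj v + Num.conj (u * Num.conj v)).
  have cr (r : R) : Num.conj (r%:C : C) = r%:C by rewrite /Num.conj /= oppr0.
  rewrite !normCK !rmorphD !rmorphM /= !cr conjCK.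
  by rewrite ?rmorphXn ?rmorphM /=; ring.
rewrite /entry; under eq_bigr do rewrite e.
rewrite !big_split /= -!mulr_sumr (esuppP (f x)).2// (esuppP (g x)).2//.
rewrite big_split /= -rmorph_sum /path_sqnorm.
rewrite (@edotE _ _ N); last by move=> k Nk; left; apply: (esuppP (f x)).1; exact: leq_trans Nk.
set s := \sum_(i < N) _; rewrite (_ : s + Num.conj s = (2 * complex.Re s)%:C); last first.
  by rewrite [LHS]addcJ rmorphM /= rmorph_nat.
by rewrite !rmorphD !rmorphM /=; ring.
Qed.

Lemma path_sqnorm_gt0 x t j : 0 < path_sqnorm x t j.
Proof.
pose N := maxn (esupp (f x)) (esupp (g x)).
have := @path_sqnormE x t N j (leq_maxl _ _) (leq_maxr _ _).
have [k ek] := nz x t j.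
have kN : (k < N)%N.
  rewrite ltnNge; apply/negP => Nk; move: ek.
  rewrite (esuppP (f x)).1 ?(esuppP (g x)).1 ?mulr0 ?addr0 ?eqxx//.
    by apply: leq_trans Nk; exact: leq_maxr.
  by apply: leq_trans Nk; exact: leq_maxl.
rewrite (bigD1 (Ordinal kN))//= => h; rewrite -ltcR -h.
by rewrite ltr_pwDl ?exprn_gt0 ?normr_gt0// sumr_ge0// => i _; rewrite exprn_ge0.
Qed.

Lemma path_subproof x t : exists N, (forall k j, (N <= k)%N ->
    ((Num.sqrt (path_sqnorm x t j))^-1)%:C * entry x t k j = 0) /\
  forall j, \sum_(k < N) `|((Num.sqrt (path_sqnorm x t j))^-1)%:C * entry x t k j| ^+ 2 = 1.
Proof.
exists (maxn (esupp (f x)) (esupp (g x))); split=> [k j Nk|j].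
  rewrite /entry (esuppP (f x)).1 ?(esuppP (g x)).1 ?mulr0 ?addr0 ?mulr0//.
    by apply: leq_trans Nk; exact: leq_maxr.
  by apply: leq_trans Nk; exact: leq_maxl.
have p0 := path_sqnorm_gt0 x t j.
under eq_bigr do rewrite normrM exprMn.
rewrite -mulr_sumr path_sqnormE ?leq_maxl ?leq_maxr//.
rewrite ger0_norm; last by rewrite ler0c invr_ge0 sqrtr_ge0.
by rewrite -rmorphXn -rmorphM /= exprVn sqr_sqrtr ?ltW// mulVf ?gt_eqF.
Qed.

(** The straight line, normalised in each of the n spheres separately; [nz] keeps it off the origin
    for every real t. Continuity of the norm involves all coordinates at once, whereas the topology
    is pointwise; hence the hypothesis on [edot]. *)
Definition linear_path (xt : T * R) : ET := mkET (path_subproof xt.1 xt.2).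

Lemma etc_linear_path x t k j : etc (linear_path (x, t)) k j =
  ((Num.sqrt (path_sqnorm x t j))^-1)%:C *
  ((1 - t)%:C * etc (f x) k j + t%:C * etc (g x) k j).
Proof. by rewrite etc_mkET. Qed.

Lemma linear_path0 x : linear_path (x, 0) = f x.
Proof.
apply: eq_ET => k j; rewrite etc_linear_path /path_sqnorm subr0 mul0r mulr0 mul0r addr0.
by rewrite expr1n expr0n /= addr0 sqrtr1 invr1 !mul1r mul0r addr0.
Qed.

Lemma linear_path1 x : linear_path (x, 1) = g x.
Proof.
apply: eq_ET => k j; rewrite etc_linear_path /path_sqnorm subrr !mulr0 mul0r addr0.
by rewrite expr1n expr0n /= add0r sqrtr1 invr1 mul0r add0r !mul1r.
Qed.

Lemma linear_path_cts : continuous linear_path.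
Proof.
apply: cts_into_ET => k j.
refine (@cts_ext _ _ (fun xt : T * R => ((Num.sqrt (path_sqnorm xt.1 xt.2 j))^-1)%:C *
  ((1 - xt.2)%:C * etc (f xt.1) k j + xt.2%:C * etc (g xt.1) k j)) _ _ _).
  by move=> [x t]; rewrite etc_linear_path.
have c1 : continuous (fun xt : T * R => 1 - xt.2).
  exact: (cts_add (cts_cst _) (cts_opp cts_snd)).
have cN : continuous (fun xt : T * R => path_sqnorm xt.1 xt.2 j).
  refine (cts_add (cts_add (cts_mul c1 c1) (cts_mul cts_snd cts_snd)) _).
  exact: (cts_mul (cts_mul (cts_cst _) (cts_mul cts_snd c1)) (cts_comp cts_fst (@cdot j))).
refine (cts_mul _ (cts_add (cts_mul _ _) (cts_mul _ _))).
- refine (cts_comp (cts_inv _ (cts_comp cN (@sqrt_continuous R))) (@cts_real_complex R)).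
  by move=> xt; rewrite gt_eqF// sqrtr_gt0 path_sqnorm_gt0.
- exact: (cts_comp c1 (@cts_real_complex R)).
- exact: (cts_comp (cts_comp cts_fst cf) (cts_etc k j)).
- exact: (cts_comp cts_snd (@cts_real_complex R)).
- exact: (cts_comp (cts_comp cts_fst cg) (cts_etc k j)).
Qed.

End LinearPath.

Lemma edot_gact (t : torus) (e e' : ET) j : edot (gact t e) (gact t e') j = edot e e' j.
Proof.
pose N := maxn (esupp e) (esupp e').
have z k : (N <= k)%N -> etc e k j = 0.
  by move=> Nk; apply: (esuppP e).1; apply: leq_trans Nk; exact: leq_maxl.
rewrite (@edotE _ _ N) => [|k /z ek]; last by left; rewrite etc_gact ek mulr0.
rewrite (@edotE _ _ N) => [|k /z ek]; last by left.
congr complex.Re; apply: eq_bigr => k _; rewrite !etc_gact rmorphM mulrACA.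
by rewrite -normCK torus_norm expr1n mul1r.
Qed.

End ETTopology.

Lemma cts_squeeze (R : realType) (T : topologicalType) (c : T -> R) :
  (forall x0, exists p r : T -> R, [/\ continuous p, continuous r, r x0 = 0 &
     forall x, `|c x - p x| <= r x]) -> continuous c.
Proof.
move=> h x0; have [p [r [cp cr r0 H]]] := h x0.
have p0 : c x0 = p x0.
  by apply/eqP; rewrite -subr_eq0 -normr_le0 -r0.
apply/cvgrPdist_lt => e e0; have e2 : 0 < e / 2 by rewrite divr_gt0.
have np : \forall x \near x0, `|p x0 - p x| < e / 2.
  by have /cvgrPdist_lt := cp x0; exact.
have nr : \forall x \near x0, `|r x0 - r x| < e / 2.
  by have /cvgrPdist_lt := cr x0; exact.
apply: filterS2 np nr => x px rx; rewrite p0.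
have -> : p x0 - c x = (p x0 - p x) + (p x - c x) by rewrite addrA subrK.
apply: le_lt_trans (ler_normD _ _) _; rewrite (splitr e) ltrD//.
rewrite distrC; apply: le_lt_trans (H x) _; move: rx; rewrite r0 sub0r normrN.
by apply: le_lt_trans; exact: ler_norm.
Qed.

Section Shift.
Variables (R : realType) (n : nat).
Local Notation C := R[i].
Local Notation torus := (torus R n).
Local Notation ET := (@ET R n).

(** The two shifts fill the odd and the positive even positions. Position 0 stays empty, so that
    every index moves strictly up, which is what keeps the line from a sequence to its shift away
    from 0. *)
Definition shift_index (b : bool) k : nat := (k.*2 + b).+1.

Definition shift_seq (b : bool) (u : nat -> 'I_n -> C) : nat -> 'I_n -> C :=
  fun k j => if (0 < k)%N && (odd k.-1 == b) then u k.-1./2 j else 0.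

Lemma shift_seq_index b u k j : shift_seq b u (shift_index b k) j = u k j.
Proof.
rewrite /shift_seq /shift_index /= oddD odd_double oddb eqxx.
by have -> : ((k.*2 + b)./2 = k)%N by case: b; lia.
Qed.

Lemma shift_seq_neq b u k j : (forall l, k <> shift_index b l) -> shift_seq b u k j = 0.
Proof.
move=> h; rewrite /shift_seq; case: ifP => // /andP[k0 /eqP kb]; case: (h k.-1./2).
by rewrite /shift_index -kb addnC odd_double_half prednK.
Qed.

Lemma sum_shift b (G : nat -> C -> C) u N j : (forall k, G k 0 = 0) ->
  \sum_(k < N.*2.+1) G k (shift_seq b u k j) = \sum_(k < N) G (shift_index b k) (u k j).
Proof.
move=> G0; elim: N => [|N IH].
  by rewrite big_ord_recl !big_ord0 /shift_seq /= G0 addr0.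
rewrite doubleS big_ord_recr big_ord_recr /= IH [RHS]big_ord_recr /= -addrA; congr (_ + _).
rewrite /shift_seq /shift_index /= odd_double /= doubleK uphalf_double.
by case: (b); rewrite /= G0 ?addr0 ?add0r ?addn1 ?addn0.
Qed.

Lemma shift_subproof b (e : ET) : exists N,
  (forall k j, (N <= k)%N -> shift_seq b (etc e) k j = 0) /\
  forall j, \sum_(k < N) `|shift_seq b (etc e) k j| ^+ 2 = 1.
Proof.
exists (esupp e).*2.+1; split=> [k j Nk|j]; last first.
  rewrite (@sum_shift b (fun _ z => `|z| ^+ 2)) ?(esuppP e).2// => k.
  by rewrite normr0 expr0n.
rewrite /shift_seq; case: ifP => // /andP[k0 _]; apply: (esuppP e).1.
by rewrite -(doubleK (esupp e)); apply: half_leq; lia.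
Qed.
Definition eshift b (e : ET) : ET := mkET (shift_subproof b e).

Lemma etc_eshift b e k j : etc (eshift b e) k j = shift_seq b (etc e) k j.
Proof. exact: etc_mkET. Qed.

Lemma eshift_cts b : continuous (eshift b).
Proof.
apply: cts_into_ET => k j.
refine (@cts_ext _ _ (fun e : ET => shift_seq b (etc e) k j) _ _ _).
  by move=> e; rewrite etc_eshift.
rewrite /shift_seq; case: ((0 < k)%N && (odd k.-1 == b)); last exact: (cts_cst _).
exact: (@cts_etc R n).
Qed.

Lemma eshift_gact b (t : torus) e : eshift b (gact t e) = gact t (eshift b e).
Proof.
apply: eq_ET => k j; rewrite etc_gact !etc_eshift /shift_seq.
by case: ifP; rewrite ?mulr0// etc_gact.
Qed.

Lemma sum_shift_le (F : nat -> R) b K N : (forall k, 0 <= F k) -> (K <= N)%N ->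
  \sum_(K <= k < N) F (shift_index b k) <= \sum_(K <= k < N.*2 + b) F k.
Proof.
move=> F0; elim: N => [|N IH]; first by rewrite leqn0 => /eqP ->; rewrite [leLHS]big_geq// sumr_ge0.
rewrite leq_eqVlt => /orP[/eqP ->|]; first by rewrite [leLHS]big_geq// sumr_ge0.
rewrite ltnS => KN; rewrite big_nat_recr//= doubleS !addSn.
rewrite !big_nat_recr/=; try lia.
by rewrite -addrA lerD ?IH// lerDr.
Qed.

Lemma Re_sqr_norm (z : C) : complex.Re (`|z| ^+ 2) = complex.Re `|z| ^+ 2.
Proof.
have nE : `|z| = (complex.Re `|z|)%:C by rewrite normc_def.
by rewrite {1}nE -rmorphXn.
Qed.

(** With K bounding the support of e0, the terms of index at least K are dominated, through 2 x y <=
    x^2 + y^2, by the tail 1 - sum_(k < K) |e_k|^2. This tail is continuous in e and vanishes at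
    e0. *)
Lemma edot_shift_cts b j : continuous (fun e : ET => edot e (eshift b e) j).
Proof.
apply: cts_squeeze => e0; pose K := esupp e0.
pose F (e : ET) k : R := complex.Re (`|etc e k j| ^+ 2).
pose D (e : ET) k : R := complex.Re (etc e (shift_index b k) j * Num.conj (etc e k j)).
have cF k : continuous (F^~ k).
  refine (@cts_ext _ _ (fun e : ET => complex.Re `|etc e k j| * complex.Re `|etc e k j|) _ _ _).
    by move=> e; rewrite /F Re_sqr_norm expr2.
  have c := @cts_comp _ _ _ (fun e : ET => etc e k j) _ (@cts_etc R n k j) (@cts_normc R).
  exact: (cts_mul c c).
have cD k : continuous (D^~ k).
  refine (cts_comp (cts_mul (@cts_etc R n _ j) _) (@cts_Re R)).
  exact: (cts_comp (@cts_etc R n k j) (@cts_conj R)).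
exists (fun e => \sum_(k < K) D e k), (fun e => 1 - \sum_(k < K) F e k); split.
- by refine (cts_sum _) => k _; exact: cD.
- refine (cts_add (cts_cst _) (cts_opp _)).
  by refine (cts_sum _) => k _; exact: cF.
- rewrite -raddf_sum (esuppP e0).2//=; exact: subrr.
move=> e; have F0 k : 0 <= F e k by rewrite /F -lecR RRe_real ?exprn_ge0 ?ger0_real ?exprn_ge0.
pose N := (maxn K (esupp e)).
have EN : edot e (eshift b e) j = \sum_(k < N) D e k.
  rewrite (@edotE _ _ _ _ N.*2.+1) => [|k Nk].
    under eq_bigr do rewrite etc_eshift.
    rewrite (@sum_shift b (fun k z => etc e k j * Num.conj z)) => [|k].
      by rewrite raddf_sum.
    by rewrite rmorph0 mulr0.
  left; apply: (esuppP e).1; have := leq_maxr K (esupp e); rewrite -/N; lia.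
have S1 M : (esupp e <= M)%N -> \sum_(k < M) F e k = 1.
  by move=> eM; rewrite -raddf_sum (esuppP e).2.
have KN : (K <= N)%N by exact: leq_maxl.
have split_sum (G : nat -> R) M : (K <= M)%N ->
    \sum_(k < M) G k = \sum_(k < K) G k + \sum_(K <= k < M) G k.
  by move=> KM; rewrite -!(big_mkord xpredT G) (@big_cat_nat _ _ _ K).
rewrite EN (split_sum (D e) N)// addrC addKr.
have -> : 1 - \sum_(k < K) F e k = \sum_(K <= k < N.*2 + b) F e k.
  rewrite -(S1 (N.*2 + b)%N); last by rewrite -addnn; have := leq_maxr K (esupp e); lia.
  by rewrite (split_sum (F e)) 1?addrC ?addKr//; lia.
have DF k : `|D e k| <= (F e (shift_index b k) + F e k) / 2.
  rewrite /D /F; set x := etc e _ j; set y := etc e k j.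
  have nE (z : C) : `|z| = (complex.Re `|z|)%:C by rewrite normc_def.
  rewrite !Re_sqr_norm; apply: (@le_trans _ _ (complex.Re `|x| * complex.Re `|y|)).
    rewrite -lecR; apply: le_trans (norm_Re_le _) _.
    by rewrite normrM norm_conjC {1}[`|x|]nE {1}[`|y|]nE -rmorphM.
  have := sqr_ge0 (complex.Re `|x| - complex.Re `|y|).
  set p := complex.Re _; set q := complex.Re _; nra.
apply: le_trans (ler_norm_sum _ _ _) _; apply: le_trans (ler_sum _ (fun k _ => DF k)) _.
rewrite -mulr_suml big_split /= ler_pdivrMr// mulr_natr mulr2n lerD//.
  exact: sum_shift_le.
rewrite (@big_cat_nat _ _ _ N K (N.*2 + b)) /=; [|exact: KN|lia].
by rewrite lerDl sumr_ge0.
Qed.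

End Shift.

(** * Borel constructions *)

Lemma descend (A B D : topologicalType) (q : A -> B) (f : A -> D) :
  (forall O : set A, open O -> open (q @` O)) -> (forall b, exists a, q a = b) ->
  continuous f -> (forall a a', q a = q a' -> f a = f a') ->
  exists2 g : B -> D, continuous g & forall a, g (q a) = f a.
Proof.
move=> oq sq cf E; have [r rK] := choice sq.
have gq a : f (r (q a)) = f a by apply: E; rewrite rK.
exists (fun b => f (r b)) => //.
by apply: (open_quotient_cts oq sq); under eq_fun do rewrite gq.
Qed.

Section Borel.
Variables (R : realType) (n : nat).
Local Notation C := R[i].
Local Notation M := 'M[C]_n.
Local Notation torus := (torus R n).
Local Notation ET := (@ET R n).

Section Tensor.
Variables (Z : set M) (bZ : biinvariant Z).

Lemma sum_block (V : nmodType) (F : nat -> V) N :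
  \sum_(l < N * n) F l = \sum_(m < N) \sum_(k < n) F (m * n + k)%N.
Proof.
elim: N => [|N IH]; first by rewrite mul0n !big_ord0.
rewrite big_ord_recr /= -IH -!(big_mkord xpredT) mulSn addnC.
rewrite (@big_cat_nat _ _ _ (N * n)) //=; last exact: leq_addr.
congr (_ + _); rewrite -{1}[(N * n)%N]add0n big_addn addKn.
by rewrite !big_mkord; apply: eq_bigr => k _; rewrite addnC.
Qed.

(** The double sequence U_jk u_mk flattened along l = m n + k. The sum has exactly one term; it only
    turns the remainder of l into an index in ['I_n]. *)
Definition tensor_seq (U : M) (u : nat -> 'I_n -> C) : nat -> 'I_n -> C :=
  fun l j => \sum_(k < n | val k == (l %% n)%N) U j k * u (l %/ n)%N k.

Lemma tensor_seq_block U u m (k : 'I_n) j :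
  tensor_seq U u (m * n + k)%N j = U j k * u m k.
Proof.
have n0 : (0 < n)%N by exact: leq_ltn_trans (ltn_ord k).
rewrite /tensor_seq modnMDl modn_small// divnMDl// divn_small// addn0.
by rewrite (big_pred1 k).
Qed.

(** The squared norm of sequence j is the sum over k of |U_jk|^2 times the squared norm of e_k, that
    is, the squared norm of row j of U. *)
Lemma tensor_subproof (x : Z * ET) : exists N,
  (forall k j, (N <= k)%N -> tensor_seq (val x.1) (etc x.2) k j = 0) /\
  forall j, \sum_(k < N) `|tensor_seq (val x.1) (etc x.2) k j| ^+ 2 = 1.
Proof.
case: x => U e /=; exists (esupp e * n)%N; split=> [l j Nl|j].
  rewrite /tensor_seq big1// => k _; rewrite (esuppP e).1 ?mulr0//.
  by rewrite leq_divRL//; exact: leq_ltn_trans (ltn_ord j).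
rewrite (sum_block (fun l => `|tensor_seq (val U) (etc e) l j| ^+ 2)).
under eq_bigr => m _ do under eq_bigr => k _ do rewrite tensor_seq_block normrM exprMn.
rewrite exchange_big /=; under eq_bigr do rewrite -mulr_sumr (esuppP e).2// mulr1.
have /matrixP/(_ j j) := adjointMV (zsub_unitary bZ U).
rewrite !mxE eqxx -[RHS]/(1 : C) => /= {1}<-.
by apply: eq_bigr => k _; rewrite !mxE -normCK.
Qed.

Definition tensor (x : Z * ET) : ET := mkET (tensor_subproof x).

Lemma tensor_cts : continuous tensor.
Proof.
apply: cts_into_ET => l j.
refine (@cts_ext _ _ (fun x : Z * ET => tensor_seq (val x.1) (etc x.2) l j) _ _ _).
  by move=> x; rewrite etc_mkET.
refine (cts_sum _) => k _; refine (cts_mul _ _).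
  exact: (cts_entry _ _ (cts_comp cts_fst cts_val)).
exact: (cts_comp cts_snd (@cts_etc R n _ k)).
Qed.

Definition zact (t g : torus) (U : Z) : Z := zleft bZ t (zright bZ g^-1%g U).

Lemma zactE t g U j k :
  val (zact t g U) j k = t j j * val U j k * Num.conj (g k k).
Proof.
have -> : val (zact t g U) = torus_mx t *m val U *m (torus_mx g)^t*.
  by rewrite torus_adjoint -mulmxA.
rewrite mxE (bigD1 k)//= big1 ?addr0 => [|l lk]; last first.
  by rewrite !mxE torus_offdiag ?rmorph0 ?mulr0// eq_sym.
rewrite !mxE (bigD1 j)//= big1 ?addr0// => l lj.
by rewrite torus_offdiag ?mul0r// eq_sym.
Qed.

(** The factor g^-1 on the columns of U cancels the action of g on e, and the row factor t comes
    out: the two tori exchange roles. *)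
Lemma tensor_act t g U e : tensor (zact t g U, gact g e) = gact t (tensor (U, e)).
Proof.
apply: eq_ET => l j; rewrite etc_gact !etc_mkET /tensor_seq mulr_sumr.
apply: eq_bigr => k _; rewrite zactE etc_gact /=.
have gg : Num.conj (g k k) * g k k = 1 by rewrite mulrC -normCK torus_norm expr1n.
by rewrite -!mulrA [Num.conj _ * _]mulrA gg mul1r.
Qed.

End Tensor.

Section Model.
Variables (Z : set M) (d : 'I_n -> R) (X : gspace torus).
Hypotheses (bZ : biinvariant Z) (d_inj : injective d) (mX : model Z d X).
Local Notation BX := (borel_construction X).
Local Notation zact := (zact bZ).

Definition bpi (x : Z * ET) : BX := @orbit_of _ (prod_gspace X ET) (mpi mX x.1, x.2).

Lemma bpi_cts : continuous bpi.
Proof.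
refine (cts_comp _ (orbit_of_cts (prod_gspace X ET))).
exact: (cts_pair (cts_comp cts_fst (mpi_cts mX)) cts_snd).
Qed.

Lemma bpi_onto b : exists x, bpi x = b.
Proof.
have [[x e] <-] := orbit_of_onto b; have [U Ux] := mpi_onto mX x.
by exists (U, e); rewrite /bpi /= Ux.
Qed.

Lemma bpi_open (O : set (Z * ET)) : open O -> open (bpi @` O).
Proof.
move=> oO; have o1 := open_map_prod (@mpi_open _ _ _ _ _ bZ d_inj mX) oO.
have cg (g : torus) : continuous (@gact _ (prod_gspace X ET) g).
  exact: (cts_pair (cts_comp cts_fst (gact_cts bZ mX g)) (cts_comp cts_snd (@ET_gact_cts R n g))).
have := @orbit_of_open _ (prod_gspace X ET) cg _ o1.
by rewrite image_comp.
Qed.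

Lemma bpi_zact t g U e : bpi (zact t g U, gact g e) = bpi (U, e).
Proof.
apply/esym/(@eq_orbit_of _ (prod_gspace X ET)); exists g; congr pair => /=.
rewrite mpi_act; apply/(model_fiber bZ d_inj mX); exists t; exact/val_inj.
Qed.

Lemma bpi_fiber x x' : bpi x = bpi x' ->
  exists t g, x' = (zact t g x.1, gact g x.2).
Proof.
case: x x' => U e [U' e'] /(@eq_orbit_of _ (prod_gspace X ET))[g [gU ge]].
move: gU; rewrite /= mpi_act => /(model_fiber bZ d_inj mX)[t tU].
by exists t, g; rewrite -ge -tU.
Qed.

Definition equivariant_on (phi : Z * ET -> ET) :=
  forall t g U e, phi (zact t g U, gact g e) = gact g (phi (U, e)).

Definition covers (phi : Z * ET -> ET) (b : BX -> BX) :=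
  forall x, b (bpi x) = bpi (x.1, phi x).

Lemma covered phi : continuous phi -> equivariant_on phi ->
  exists2 b : BX -> BX, continuous b & covers phi b.
Proof.
move=> cphi ephi; apply: (@descend _ _ _ bpi (fun x => bpi (x.1, phi x))).
- exact: bpi_open.
- exact: bpi_onto.
- exact: (cts_comp (cts_pair cts_fst cphi) bpi_cts).
by move=> [U e] x' /bpi_fiber[t [g ->]] /=; rewrite ephi bpi_zact.
Qed.

(** A homotopy of the ET-coordinate through equivariant maps descends to the Borel construction,
    since the product of an open quotient with R is again an open quotient. *)
Lemma cpull_covers (Phi : (Z * ET) * R -> ET) phi0 phi1 b0 b1
    (c0 : continuous b0) (c1 : continuous b1) k (y : cohomology R BX k) :
  continuous Phi -> (forall s, equivariant_on (fun x => Phi (x, s))) ->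
  (forall x, Phi (x, 0) = phi0 x) -> (forall x, Phi (x, 1) = phi1 x) ->
  covers phi0 b0 -> covers phi1 b1 -> cpull c0 y = cpull c1 y.
Proof.
move=> cP eP P0 P1 v0 v1.
have [H cH HE] : exists2 H : BX * R -> BX, continuous H &
    forall x, H (bpi x.1, x.2) = bpi (x.1.1, Phi x).
  apply: (@descend _ _ _ (fun x : (Z * ET) * R => (bpi x.1, x.2)) (fun x => bpi (x.1.1, Phi x))).
  - by move=> O oO; exact: (open_map_prod bpi_open oO).
  - by move=> [b s]; have [x <-] := bpi_onto b; exists (x, s).
  - refine (cts_comp (cts_pair (cts_comp cts_fst cts_fst) cP) bpi_cts).
  move=> [[U e] s] [x' s'] /= [] /bpi_fiber[t [g ->]] <- /=.
  by rewrite (eP s t g U e) bpi_zact.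
apply: (@cpull_homotopy _ _ _ H) => // b; have [x <-] := bpi_onto b.
  by rewrite (HE (x, 0)) P0 v0.
by rewrite (HE (x, 1)) P1 v1.
Qed.

Lemma linear_path_equivariant phi0 phi1
    (nz : forall x t j, exists k,
       (1 - t)%:C * etc (phi0 x) k j + t%:C * etc (phi1 x) k j != 0) s :
  equivariant_on phi0 -> equivariant_on phi1 ->
  equivariant_on (fun x => linear_path nz (x, s)).
Proof.
move=> e0 e1 t g U e; apply: eq_ET => k j; rewrite etc_gact !etc_linear_path /path_sqnorm.
by rewrite e0 e1 edot_gact !etc_gact; ring.
Qed.

Lemma cpull_linear phi0 phi1 b0 b1 (c0 : continuous b0) (c1 : continuous b1) k
    (y : cohomology R BX k) :
  continuous phi0 -> continuous phi1 -> equivariant_on phi0 -> equivariant_on phi1 ->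
  (forall j, continuous (fun x => edot (phi0 x) (phi1 x) j)) ->
  (forall x (t : R) j, exists k,
       (1 - t)%:C * etc (phi0 x) k j + t%:C * etc (phi1 x) k j != 0) ->
  covers phi0 b0 -> covers phi1 b1 -> cpull c0 y = cpull c1 y.
Proof.
move=> cp0 cp1 e0 e1 cd nz v0 v1.
apply: (@cpull_covers (linear_path nz) phi0 phi1) => //.
- exact: linear_path_cts.
- by move=> s; exact: linear_path_equivariant.
- by move=> x; rewrite linear_path0.
- by move=> x; rewrite linear_path1.
Qed.

Lemma shift_index_neq b k l : shift_index b k != shift_index (~~ b) l.
Proof. by rewrite /shift_index; apply/eqP; case: b => /=; lia. Qed.

Lemma eshift_equivariant b phi : equivariant_on phi ->
  equivariant_on (fun x => eshift b (phi x)).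
Proof. by move=> e t g U x; rewrite e eshift_gact. Qed.

(** The line from a sequence to its shift avoids 0: if l is the last index with a nonzero entry,
    then position [shift_index b l], beyond l, holds t times that entry; at t = 0 position l
    serves. *)
Lemma cpull_eshift b phi b0 b1 (c0 : continuous b0) (c1 : continuous b1) k
    (y : cohomology R BX k) :
  continuous phi -> equivariant_on phi ->
  covers phi b0 -> covers (fun x => eshift b (phi x)) b1 -> cpull c0 y = cpull c1 y.
Proof.
move=> cp ep; apply: cpull_linear => //.
- exact: (cts_comp cp (@eshift_cts R n b)).
- exact: eshift_equivariant.
- by move=> j; exact: (cts_comp cp (@edot_shift_cts R n b j)).
move=> x t j; have [l nl zl] := ET_last (phi x) j.
have [->|t0] := eqVneq t 0.
  by exists l; rewrite subr0 mul0r addr0 mul1r.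
exists (shift_index b l); rewrite zl ?mulr0 ?add0r; last by rewrite /shift_index; lia.
by rewrite etc_eshift shift_seq_index mulf_neq0// fmorph_eq0.
Qed.

(** Opposite shifts have disjoint supports, so the inner product is identically 0 and the line
    between them cannot reach 0. *)
Lemma cpull_opposite_shifts phi0 phi1 b0 b1 (c0 : continuous b0) (c1 : continuous b1) k
    (y : cohomology R BX k) :
  continuous phi0 -> continuous phi1 -> equivariant_on phi0 -> equivariant_on phi1 ->
  covers (fun x => eshift false (phi0 x)) b0 -> covers (fun x => eshift true (phi1 x)) b1 ->
  cpull c0 y = cpull c1 y.
Proof.
move=> cp0 cp1 e0 e1.
have dis b (u : nat -> 'I_n -> C) k' j : shift_seq (~~ b) u (shift_index b k') j = 0.
  by apply: shift_seq_neq => l; apply/eqP; exact: shift_index_neq.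
apply: cpull_linear => //.
- exact: (cts_comp cp0 (@eshift_cts R n false)).
- exact: (cts_comp cp1 (@eshift_cts R n true)).
- exact: eshift_equivariant.
- exact: eshift_equivariant.
- move=> j; refine (@cts_ext _ _ (fun=> 0) _ _ (cts_cst _)) => x.
  rewrite (@edotE _ _ _ _ 0) ?big_ord0// => l _; rewrite !etc_eshift.
  case: l => [|l]; first by left.
  rewrite (_ : l.+1 = shift_index (odd l) l./2); last first.
    by rewrite /shift_index addnC odd_double_half.
  by case: (odd l); [left; exact: (dis true)|right; exact: (dis false)].
move=> x t j; have [t1|t1] := eqVneq t 1.
  have [l nl _] := ET_last (phi1 x) j; exists (shift_index true l).
  by rewrite t1 subrr mul0r add0r mul1r etc_eshift shift_seq_index.
have [l nl _] := ET_last (phi0 x) j; exists (shift_index false l).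
rewrite !etc_eshift shift_seq_index (dis false) mulr0 addr0.
by rewrite mulf_neq0// fmorph_eq0 subr_eq0 eq_sym.
Qed.

(* Any two equivariant maps to ET are homotopic: move them to disjoint        *)
(* coordinates first.                                                          *)
Lemma cpull_covers_id phi b (c : continuous b) k (y : cohomology R BX k) :
  continuous phi -> equivariant_on phi -> covers phi b -> cpull c y = y.
Proof.
move=> cp ep vb.
have cs : continuous (fun x : Z * ET => x.2) := cts_snd.
have es : equivariant_on (fun x => x.2) by [].
have [b1 cb1 v1] := covered (cts_comp cs (@eshift_cts R n false)) (eshift_equivariant false es).
have [b2 cb2 v2] := covered (cts_comp cp (@eshift_cts R n true)) (eshift_equivariant true ep).
rewrite (cpull_eshift c cb2 y cp ep vb v2) -(cpull_opposite_shifts cb1 cb2 y cs cp es ep v1 v2).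
have ci : continuous (fun x : BX => x) := cts_id.
rewrite -(cpull_eshift ci cb1 y cs es _ v1); last by case.
exact: cpull_id.
Qed.

End Model.

Section Map.
Variables (Z Z' : set M) (d d' : 'I_n -> R) (X Y : gspace torus).
Hypotheses (bZ : biinvariant Z) (bZ' : biinvariant Z').
Hypotheses (d_inj : injective d) (d'_inj : injective d').
Hypotheses (mX : model Z d X) (mY : model Z' d' Y).

(** The torus acting on Y is the one divided out in X. So e has to be traded for a point of ET on
    which the left factor acts, which [tensor] provides. *)
Lemma borel_map (j : Z -> Z') : continuous j ->
  (forall t g U, j (zact bZ t g U) = zact bZ' g t (j U)) ->
  exists2 f : borel_construction X -> borel_construction Y,
  continuous f & forall x, f (bpi mX x) = bpi mY (j x.1, tensor bZ x).
Proof.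
move=> cj jz; apply: (@descend _ _ _ (bpi mX) (fun x : Z * ET => bpi mY (j x.1, tensor bZ x))).
- exact: bpi_open.
- exact: bpi_onto.
- exact: (cts_comp (cts_pair (cts_comp cts_fst cj) (@tensor_cts _ bZ)) (@bpi_cts _ _ _ mY)).
by move=> [U e] x' /(bpi_fiber bZ d_inj)[t [g ->]] /=; rewrite tensor_act jz bpi_zact.
Qed.

Lemma tensor_tensor_cts (j : Z -> Z') : continuous j ->
  continuous (fun x => tensor bZ' (j x.1, tensor bZ x)).
Proof.
move=> cj; exact: (cts_comp (cts_pair (cts_comp cts_fst cj) (@tensor_cts _ bZ)) (@tensor_cts _ bZ')).
Qed.

Lemma tensor_tensor_equivariant (j : Z -> Z') :
  (forall t g U, j (zact bZ t g U) = zact bZ' g t (j U)) ->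
  equivariant_on bZ (fun x => tensor bZ' (j x.1, tensor bZ x)).
Proof. by move=> jz t g U e /=; rewrite jz tensor_act tensor_act. Qed.

End Map.

Section TwoModels.
Variables (Z : set M) (d d' : 'I_n -> R) (X Y : gspace torus).
Hypotheses (bZ : biinvariant Z) (d_inj : injective d) (d'_inj : injective d').
Hypotheses (mX : model Z d X) (mY : model (adjoint_set Z) d' Y).
Let bZ' := biinvariant_adjoint bZ.

Lemma zadj_zact t g (U : Z) : zadj (zact bZ t g U) = zact bZ' g t (zadj U).
Proof.
have E (W : Z) a b : val (zadj W) a b = Num.conj (val W b a) by rewrite !mxE.
apply/val_inj/matrixP => i j; rewrite [RHS]zactE !E zactE !rmorphM.
rewrite [X in _ * X = _](conjCK (g i i)).
by rewrite mulrC mulrA [RHS]mulrAC.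
Qed.

Lemma zadj_inv_zact t g (U : adjoint_set Z) :
  zadj_inv (zact bZ' t g U) = zact bZ g t (zadj_inv U).
Proof. by apply: (can_inj (@zadjK _ _ Z)); rewrite zadj_zact !zadj_invK. Qed.

Lemma borel_cohomology_iso :
  exists phi : forall k, {additive cohomology R (borel_construction X) k ->
                                   cohomology R (borel_construction Y) k},
    graded_ring_iso phi.
Proof.
have [f cf fE] := borel_map d_inj d'_inj mX mY (@zadj_cts _ _ Z) zadj_zact.
have [g cg gE] := borel_map d'_inj d_inj mY mX (@zadj_inv_cts _ _ Z) zadj_inv_zact.
have cgf : continuous (g \o f) := cts_comp cf cg.
have cfg : continuous (f \o g) := cts_comp cg cf.
apply: (homotopy_equiv_iso cf cg (cgf := cgf) (cfg := cfg)) => k y.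
  refine (@cpull_covers_id Z d X bZ d_inj mX (fun x => tensor bZ' (zadj x.1, tensor bZ x)) _ cgf k y _ _ _).
  - exact: (@tensor_tensor_cts _ _ bZ bZ' _ (@zadj_cts _ _ Z)).
  - exact: (@tensor_tensor_equivariant _ _ bZ bZ' _ zadj_zact).
  - by move=> x; rewrite /= fE gE /= zadjK.
refine (@cpull_covers_id _ d' Y bZ' d'_inj mY (fun x => tensor bZ (zadj_inv x.1, tensor bZ' x)) _ cfg k y _ _ _).
- exact: (@tensor_tensor_cts _ _ bZ' bZ _ (@zadj_inv_cts _ _ Z)).
- exact: (@tensor_tensor_equivariant _ _ bZ' bZ _ zadj_inv_zact).
- by move=> x; rewrite /= gE fE /= zadj_invK.
Qed.

End TwoModels.
End Borel.

(** * The GKM graph *)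

Section SphereConnected.
Variable R : realType.
Local Notation sphere2 := (@sphere2 R).

Definition dot3 (u v : 'rV[R]_3) : R := \sum_i u ord0 i * v ord0 i.

Lemma sqnorm_comb (u v : 'rV[R]_3) a b : sphere2 u -> sphere2 v ->
  \sum_i (a * u ord0 i + b * v ord0 i) ^+ 2 = a ^+ 2 + b ^+ 2 + 2 * (a * b) * dot3 u v.
Proof.
move=> su sv.
transitivity (\sum_i (a ^+ 2 * u ord0 i ^+ 2 + b ^+ 2 * v ord0 i ^+ 2 +
    2 * (a * b) * (u ord0 i * v ord0 i))).
  by apply: eq_bigr => i _; ring.
by rewrite !big_split /= -!mulr_sumr su sv !mulr1.
Qed.

Lemma dot3_bounds (u v : 'rV[R]_3) : sphere2 u -> sphere2 v -> -1 <= dot3 u v <= 1.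
Proof.
move=> su sv.
have := sqnorm_comb 1 1 su sv; have := sqnorm_comb 1 (-1) su sv.
have h b : 0 <= \sum_i (1 * u ord0 i + b * v ord0 i) ^+ 2 by apply: sumr_ge0 => i _; exact: sqr_ge0.
by have := h 1; have := h (-1); move=> + + e1 e2; rewrite e1 e2; lra.
Qed.

Lemma segment_norm (u v : 'rV[R]_3) t : sphere2 u -> sphere2 v -> dot3 u v != -1 ->
  0 < \sum_i ((1 - t) * u ord0 i + t * v ord0 i) ^+ 2.
Proof.
move=> su sv uv; rewrite (sqnorm_comb _ _ su sv).
have /andP[uv1 uv2] := dot3_bounds su sv.
have {uv uv1} : -1 < dot3 u v by rewrite lt_neqAle eq_sym uv.
move: (dot3 u v) uv2 => c c2 c1.
have -> : (1 - t) ^+ 2 + t ^+ 2 + 2 * ((1 - t) * t) * c = 1 - 2 * (t * (1 - t)) * (1 - c) by ring.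
have t4 : t * (1 - t) <= 1 / 4 by have := sqr_ge0 (t - 1 / 2); nra.
have [t0|t0] := leP (t * (1 - t)) 0; nra.
Qed.

Lemma sphere2_path (u v : sphere2) : dot3 (val u) (val v) != -1 ->
  exists g : R -> sphere2, [/\ continuous g, g 0 = u & g 1 = v].
Proof.
move=> uv; have su : sphere2 (val u) := set_mem (valP u).
have sv : sphere2 (val v) := set_mem (valP v).
pose N t := \sum_i ((1 - t) * val u ord0 i + t * val v ord0 i) ^+ 2.
have N0 t : 0 < N t := segment_norm t su sv uv.
pose w t : 'rV[R]_3 := \row_i ((Num.sqrt (N t))^-1 * ((1 - t) * val u ord0 i + t * val v ord0 i)).
have sw t : w t \in sphere2.
  apply/mem_set; rewrite /sphere2 /=; under eq_bigr do rewrite mxE exprMn.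
  by rewrite -mulr_sumr -/(N t) exprVn sqr_sqrtr ?ltW// mulVf ?gt_eqF.
have cl i : continuous (fun t : R => (1 - t) * val u ord0 i + t * val v ord0 i).
  refine (cts_add (cts_mul (cts_add (cts_cst _) (cts_opp cts_id)) (cts_cst _)) (cts_mul cts_id (cts_cst _))).
have cN : continuous N.
  by refine (cts_sum _) => i _; exact: (cts_mul (@cl i) (@cl i)).
exists (fun t => exist (fun u => u \in sphere2) (w t) (sw t)); split.
- apply: sub_cts; apply: mx_cts => i j.
  refine (@cts_ext _ _ (fun t => (Num.sqrt (N t))^-1 * ((1 - t) * val u ord0 j + t * val v ord0 j)) _ _ _).
    by move=> t; rewrite /= mxE.
  refine (cts_mul (cts_inv _ (cts_comp cN (@sqrt_continuous R))) (@cl j)).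
  by move=> t; rewrite gt_eqF// sqrtr_gt0.
- apply/val_inj/rowP => i; rewrite /= mxE.
  rewrite /N; under eq_bigr do rewrite subr0 mul1r mul0r addr0.
  by rewrite su sqrtr1 invr1 mul1r subr0 mul1r mul0r addr0.
apply/val_inj/rowP => i; rewrite /= mxE.
rewrite /N; under eq_bigr do rewrite subrr mul1r mul0r add0r.
by rewrite sv sqrtr1 invr1 mul1r subrr mul1r mul0r add0r.
Qed.

(** Points that are not antipodal are joined by a normalised segment; antipodal ones are joined
    through a third point. *)
Lemma sphere2_clopen (B : set sphere2) : open B -> closed B -> B !=set0 -> B = setT.
Proof.
move=> oB cB [u Bu].
have step (v w : sphere2) : dot3 (val v) (val w) != -1 -> B v -> B w.
  move=> /sphere2_path[g [cg g0 g1]] Bv.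
  have gR : g @^-1` B = setT.
    have cR : connected [set: R].
      by rewrite -set_itvNyy; apply/connected_intervalP; exact: interval_is_interval.
    apply: cR.
    - by exists 0; rewrite /= g0.
    - by exists (g @^-1` B); [exact: (cts_open cg oB)|rewrite setTI].
    - by exists (g @^-1` B); [exact: (cts_closed cg cB)|rewrite setTI].
  have h : (g @^-1` B) 1 by rewrite gR.
  by move: h; rewrite /preimage /= g1.
apply/seteqP; split=> // v _; have [uv|uv] := eqVneq (dot3 (val u) (val v)) (-1); last exact: step uv Bu.
have su : sphere2 (val u) := set_mem (valP u).
have sv : sphere2 (val v) := set_mem (valP v).
have vu : val v = - val u.
  have : \sum_i (val u ord0 i + val v ord0 i) ^+ 2 = 0.
    have := sqnorm_comb 1 1 su sv; under eq_bigr do rewrite !mul1r.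
    by move=> ->; rewrite uv; ring.
  move/psumr_eq0P => h; apply/rowP => i; have := h (fun i _ => sqr_ge0 _) i isT.
  by move/eqP; rewrite sqrf_eq0 addrC addr_eq0 !mxE => /eqP.
pose e (k : 'I_3) : 'rV[R]_3 := \row_i (i == k)%:R.
have se k : e k \in sphere2.
  apply/mem_set; rewrite /sphere2 /= (bigD1 k)//= big1 ?addr0 => [|i ik].
    by rewrite mxE eqxx expr1n.
  by rewrite mxE (negPf ik) expr0n.
pose E k : sphere2 := exist (fun u => u \in sphere2) _ (se k).
have de k (w : 'rV[R]_3) : dot3 w (e k) = w ord0 k.
  rewrite /dot3 (bigD1 k)//= big1 ?addr0 => [|i ik]; first by rewrite mxE eqxx mulr1.
  by rewrite mxE (negPf ik) mulr0.
(* If every coordinate of u were 1 or -1, its squared norm would be 3. For this k the basis vector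
   [e k] is antipodal neither to u nor to -u. *)
have [k [uk vk]] : exists k, val u ord0 k != -1 /\ val u ord0 k != 1.
  apply: contrapT => h; have sq1 k : val u ord0 k ^+ 2 = 1.
    apply/eqP; rewrite sqrf_eq1; apply: contrapT => /negP.
    by rewrite negb_or => /andP[a b]; apply: h; exists k.
  move: su; rewrite /sphere2 /=; under eq_bigr do rewrite sq1.
  by rewrite sumr_const card_ord => /eqP; rewrite (eqr_nat R 3 1).
apply: (step (E k)); last by apply: (step u) => //; rewrite /= de.
rewrite (_ : dot3 _ _ = dot3 (val v) (e k)); last by apply: eq_bigr => i _; rewrite mulrC.
by rewrite de vu mxE eqr_opp.
Qed.

End SphereConnected.

Lemma sphere2_cover (R : realType) (X : topologicalType) (g : @sphere2 R -> X) (K L : set X) u :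
  continuous g -> closed K -> closed L -> (forall v, K (g v) \/ L (g v)) ->
  (forall v, ~ (K (g v) /\ L (g v))) -> K (g u) -> forall v, K (g v).
Proof.
move=> cg cK cL KL nKL Ku v.
have kT : g @^-1` K = setT; last by have h : (g @^-1` K) v by rewrite kT.
apply: sphere2_clopen; [|exact: (cts_closed cg cK)|by exists u].
have -> : g @^-1` K = ~` (g @^-1` L).
  apply/seteqP; split=> w /= h; first by move=> Lw; exact: (nKL w).
  by case: (KL w).
by rewrite openC; exact: (cts_closed cg cL).
Qed.

(** * Permutation matrices and 2 x 2 blocks *)

Section Graph.
Variables (R : realType) (n : nat).
Local Notation C := R[i].
Local Notation M := 'M[C]_n.
Local Notation torus := (torus R n).

Definition pmx (s : 'S_n) : M := \matrix_(k, l) (k == s l)%:R.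

Lemma pmx_adjoint s : (pmx s)^t* = pmx s^-1.
Proof.
apply/matrixP => k l; rewrite !mxE rmorph_nat; congr (_ %:R); congr nat_of_bool.
by rewrite eq_sym (can2_eq (permK s) (permKV s)).
Qed.

(** Away from the columns i and j the support is that of the permutation matrix of s; these two
    columns form a block in the rows s i and s j. *)
Definition blk (s : 'S_n) i j (U : M) :=
  forall k l, U k l != 0 -> k = s l \/ k = s (tperm i j l).

Definition full_blk (s : 'S_n) i j (U : M) :=
  [/\ U (s i) i != 0, U (s i) j != 0, U (s j) i != 0 & U (s j) j != 0].

(** By [sat_blk] one member of Z with a nowhere zero block decides that the whole block family lies
    in Z; so an edge can be detected at a single point. *)
Record saturated (Z : set M) : Prop := Saturated {
  sat_perm : forall s, Z (pmx s);
  sat_blk : forall s i j U, i != j -> Z U -> blk s i j U -> full_blk s i j U ->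
    forall U', U' \is unitarymx -> blk s i j U' -> Z U'
}.

Lemma blk_adjoint s i j U : blk s i j U -> blk s^-1 (s i) (s j) (U^t*).
Proof.
move=> h k l; rewrite !mxE conjC_eq0 => /h[->|->]; first by left; rewrite permK.
by right; rewrite -tpermJ /conjg !permM !permK tpermK.
Qed.

Lemma full_blk_adjoint s i j U : full_blk s i j U -> full_blk s^-1 (s i) (s j) (U^t*).
Proof. by case=> a b c e; split; rewrite permK !mxE conjC_eq0. Qed.

Lemma saturated_adjoint Z : saturated Z -> saturated (adjoint_set Z).
Proof.
move=> [sp sb]; split=> [s|s i j U ij ZU bU fU U' uU' bU'].
  by rewrite /adjoint_set /= pmx_adjoint.
have sij : s i != s j by rewrite (inj_eq perm_inj).
have uV : U'^t* \is unitarymx by rewrite trmxC_unitary.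
exact: (sb _ _ _ _ sij ZU (blk_adjoint bU) (full_blk_adjoint fU) _ uV (blk_adjoint bU')).
Qed.

Definition link (Z : set M) (s s' : 'S_n) : Prop :=
  exists i j, [/\ i != j, s' = (tperm i j * s)%g &
    forall U, U \is unitarymx -> blk s i j U -> Z U].

Lemma link_adjoint Z s s' : link Z s s' -> link (adjoint_set Z) s^-1 s'^-1.
Proof.
move=> [i [j [ij -> h]]]; exists (s i), (s j); split.
- by rewrite (inj_eq perm_inj).
- by rewrite invMg tpermV -tpermJ /conjg mulgA mulgK.
move=> U uU bU; apply: h; first by rewrite trmxC_unitary.
by have := blk_adjoint bU; rewrite invgK !permK.
Qed.

Section Block.
Variables (d : 'I_n -> R) (d_inj : injective d) (U : M) (uU : U \is unitarymx).
Local Notation A := (conj_diag d U).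

Definition near_diag (i j : 'I_n) (B : M) :=
  forall k l, k != l -> ((k == i) && (l == j)) || ((k == j) && (l == i)) \/ B k l = 0.

Lemma conj_diag_eigen k l : (d k)%:C * U k l = \sum_m U k m * A m l.
Proof.
have /matrixP/(_ k l) : real_diag d *m U = U *m A.
  by rewrite /conj_diag !mulmxA (adjointMV uU) mul1mx.
by rewrite /real_diag mul_diag_mx !mxE.
Qed.

Lemma column_orthogonal k l : \sum_m Num.conj (U m k) * U m l = (k == l)%:R.
Proof.
have /matrixP/(_ k l) := adjointVM uU; rewrite !mxE => <-.
by apply: eq_bigr => m _; rewrite !mxE.
Qed.

(** Such a column of U is an eigenvector of the diagonal matrix. *)
Lemma column_support l k : (forall m, m != l -> A m l = 0) -> U k l != 0 ->
  (d k)%:C = A l l.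
Proof.
move=> nA Ukl; apply: (mulIf Ukl); rewrite conj_diag_eigen (bigD1 l)//= big1 ?addr0 1?mulrC//.
by move=> m /nA ->; rewrite mulr0.
Qed.

Lemma near_diag_column i j l : near_diag i j A -> l != i -> l != j ->
  forall m, m != l -> A m l = 0.
Proof.
by move=> nA li lj m /nA[|//]; rewrite (negPf li) (negPf lj) !andbF.
Qed.

(** A nonzero determinant has a nonzero transversal; [column_support] reads the eigenvalues along
    it. *)
Lemma exists_perm : exists s : 'S_n, forall l, (forall m, m != l -> A m l = 0) ->
  A l l = (d (s l))%:C.
Proof.
have [s Us] : exists s : 'S_n, forall l, U (s l) l != 0.
  apply: contrapT => h; have := unitarymx_unit uU; rewrite unitmxE unitfE -det_tr => /eqP; apply.
  rewrite /determinant big1// => s _.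
  have [l Ul] : exists l, U (s l) l = 0.
    apply: contrapT => h'; apply: h; exists s => l; apply/eqP => Ul; apply: h'; by exists l.
  by rewrite (bigD1 l)//= mxE Ul mul0r mulr0.
by exists s => l nA; rewrite -(column_support nA (Us l)).
Qed.

(** A column l other than i and j is an eigenvector, so it sits in row s l alone because the d are
    distinct; orthogonality then confines columns i and j to the two remaining rows. *)
Lemma blk_of (s : 'S_n) i j : near_diag i j A -> (forall l, l != i -> l != j -> A l l = (d (s l))%:C) ->
  blk s i j U.
Proof.
move=> nA As.
have col l k : l != i -> l != j -> U k l != 0 -> k = s l.
  move=> li lj /(column_support (near_diag_column nA li lj)); rewrite As//.
  by move/complexI/d_inj.
move=> k l Ukl; have [lE|/negP] := boolP ((l == i) || (l == j)); last first.
  by move=> /negP; rewrite negb_or => /andP[li lj]; left; exact: col.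
pose m := (s^-1)%g k; have km : k = s m by rewrite permKV.
have [mE|] := boolP ((m == i) || (m == j)).
  rewrite km; case/orP: lE => /eqP ->; case/orP: mE => /eqP ->;
    rewrite ?tpermL ?tpermR; by [left|right].
rewrite negb_or => /andP[mi mj]; exfalso.
have ml : m != l by apply/eqP => E; case/orP: lE => /eqP lE; [move: mi|move: mj]; rewrite E lE eqxx.
have := column_orthogonal m l; rewrite (negPf ml) (bigD1 k)//= big1 ?addr0 => [|k' k'k].
  move/eqP; rewrite mulf_eq0 conjC_eq0 (negPf Ukl) orbF => /eqP Ukm.
  have := column_orthogonal m m; rewrite eqxx big1 => [/esym/eqP|k' _]; first by rewrite oner_eq0.
  have [->|/(col _ _ mi mj)] := eqVneq (U k' m) 0; first by rewrite mulr0.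
  by rewrite -km => ->; rewrite Ukm mulr0.
have [->|/(col _ _ mi mj)] := eqVneq (U k' m) 0; first by rewrite rmorph0 mul0r.
by rewrite -km => /eqP; rewrite (negPf k'k).
Qed.

Lemma blk_sum (F : 'I_n -> C) (s : 'S_n) i j : i != j -> blk s i j U ->
  \sum_k Num.conj (U k i) * F k * U k j =
  Num.conj (U (s i) i) * F (s i) * U (s i) j + Num.conj (U (s j) i) * F (s j) * U (s j) j.
Proof.
move=> ij bU; have sij : s i != s j by rewrite (inj_eq perm_inj).
rewrite (bigD1 (s i))//= (bigD1 (s j)) 1?eq_sym//= big1 ?addr0// => k /andP[ki kj].
have [->|/bU] := eqVneq (U k j) 0; first by rewrite mulr0.
by rewrite tpermR => -[] kE; [move: kj|move: ki]; rewrite kE eqxx.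
Qed.

(** Orthogonality of columns i and j makes two products of block entries opposite. If one were 0
    both would be, and with them A_ij, which is a combination of the two. *)
Lemma full_blk_of (s : 'S_n) i j : i != j -> blk s i j U -> A i j != 0 -> full_blk s i j U.
Proof.
move=> ij bU Aij.
have o : Num.conj (U (s i) i) * U (s i) j = - (Num.conj (U (s j) i) * U (s j) j).
  apply/eqP; rewrite -addr_eq0; have := blk_sum (fun=> 1) ij bU; rewrite !mulr1 => <-.
  under eq_bigr do rewrite mulr1.
  by rewrite column_orthogonal (negPf ij).
have w0 : Num.conj (U (s i) i) * U (s i) j != 0.
  apply: contra Aij => /eqP w0; rewrite conj_diagE (blk_sum (fun k => (d k)%:C) ij bU).
  have w1 : Num.conj (U (s j) i) * U (s j) j = 0 by apply/eqP; rewrite -oppr_eq0 -o w0.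
  by rewrite mulrAC w0 mul0r add0r mulrAC w1 mul0r.
have w1 : Num.conj (U (s j) i) * U (s j) j != 0 by rewrite -oppr_eq0 -o.
by move: w0 w1; rewrite !mulf_eq0 !negb_or !conjC_eq0 => /andP[a b] /andP[c e]; split.
Qed.

End Block.
End Graph.

Section Vertices.
Variables (R : realType) (n : nat).
Local Notation C := R[i].
Local Notation M := 'M[C]_n.
Local Notation torus := (torus R n).

Section Model.
Variables (Z : set M) (d : 'I_n -> R) (X : gspace torus).
Hypotheses (bZ : biinvariant Z) (sZ : saturated Z) (d_inj : injective d) (mX : model Z d X).
Local Notation pi := (mpi mX).
Local Notation m := (mmx mX).

Lemma fixed_diagP (x : X) : fixed_points X x <-> forall i j, i != j -> m x i j = 0.
Proof.
split=> [fx i j ij|dx t]; last first.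
  apply: (@mmx_inj _ _ _ _ _ mX); rewrite mmx_act; apply/matrixP => i j; rewrite mx_gactE.
  have [->|ij] := eqVneq i j; last by rewrite dx// mulr0 mul0r.
  by rewrite mulrAC -normCK torus_norm expr1n mul1r.
apply/eqP; apply: contraT => mij.
have := (stab_lie_mmxP mX x (\row_k (k == i)%:R)).1 (fun s => fx _) i j mij.
by rewrite !mxE eqxx eq_sym (negPf ij) => /eqP; rewrite oner_eq0.
Qed.

Definition zperm (s : 'S_n) : Z := exist (fun U => U \in Z) (pmx R s) (mem_set (sat_perm sZ s)).

Lemma mmx_zperm s k l : m (pi (zperm s)) k l = (k == l)%:R * (d (s k))%:C.
Proof.
rewrite mmx_mpi conj_diagE (bigD1 (s k))//= big1 ?addr0 => [|i ik].
  by rewrite !mxE eqxx rmorph1 mul1r (inj_eq perm_inj) mulrC.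
by rewrite !mxE (negPf ik) rmorph0 !mul0r.
Qed.

Lemma vtx_subproof s : pi (zperm s) \in fixed_points X.
Proof.
by apply/mem_set/fixed_diagP => i j ij; rewrite mmx_zperm (negPf ij) mul0r.
Qed.
Definition vtx s : gkm_vertex X := exist (fun x => x \in fixed_points X) _ (vtx_subproof s).

Lemma mmx_vtx s k l : m (val (vtx s)) k l = (k == l)%:R * (d (s k))%:C.
Proof. exact: mmx_zperm. Qed.

Lemma vtx_inj : injective vtx.
Proof.
move=> s s' ss; apply/permP => k; apply: d_inj; apply: complexI.
have := congr1 (fun p => m (val p) k k) ss.
by rewrite !mmx_vtx eqxx !mul1r.
Qed.

Lemma vtx_onto p : exists s, vtx s = p.
Proof.
case: p => x fx; have [U Ux] := mpi_onto mX x.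
have dx := (fixed_diagP x).1 (set_mem fx).
have [s sE] := exists_perm d (zsub_unitary bZ U).
exists s; apply/val_inj/(@mmx_inj _ _ _ _ _ mX)/matrixP => k l; rewrite mmx_vtx.
have [<-|kl] := eqVneq k l; last by rewrite mul0r dx.
rewrite mul1r -sE => [|i ik]; first by rewrite -(mmx_mpi mX) Ux.
by rewrite -(mmx_mpi mX) Ux; exact: dx.
Qed.

End Model.
End Vertices.

(** * The round spheres of block unitary conjugates *)

Section RowVector3.
Variable R : realType.
Local Notation o0 := (ord0 : 'I_3).
Local Notation o1 := (lift ord0 (ord0 : 'I_2) : 'I_3).
Local Notation o2 := (lift ord0 (lift ord0 (ord0 : 'I_1)) : 'I_3).
Definition vx (u : 'rV[R]_3) := u ord0 o0.
Definition vy (u : 'rV[R]_3) := u ord0 o1.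
Definition vz (u : 'rV[R]_3) := u ord0 o2.
Definition vec3 (x y z : R) : 'rV[R]_3 := \row_k [:: x; y; z]`_k.

Lemma vec3K u : vec3 (vx u) (vy u) (vz u) = u.
Proof.
apply/rowP => k; rewrite mxE; case: k => -[|[|[|//]]] lk /=;
  by rewrite /vx /vy /vz; congr (u _ _); exact/val_inj.
Qed.
Lemma vxE x y z : vx (vec3 x y z) = x. Proof. by rewrite /vx mxE. Qed.
Lemma vyE x y z : vy (vec3 x y z) = y. Proof. by rewrite /vy mxE. Qed.
Lemma vzE x y z : vz (vec3 x y z) = z. Proof. by rewrite /vz mxE. Qed.
Lemma sphere2E u : sphere2 u <-> vx u ^+ 2 + vy u ^+ 2 + vz u ^+ 2 = 1.
Proof. by rewrite /sphere2 /= !big_ord_recl big_ord0 addr0 addrA. Qed.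
Lemma cts_vec3 (T : topologicalType) (x y z : T -> R) :
  continuous x -> continuous y -> continuous z -> continuous (fun t => vec3 (x t) (y t) (z t)).
Proof.
move=> cx cy cz; apply: mx_cts => i k.
case: k => -[|[|[|//]]] lk.
- by refine (cts_ext _ cx) => t; rewrite mxE.
- by refine (cts_ext _ cy) => t; rewrite mxE.
- by refine (cts_ext _ cz) => t; rewrite mxE.
Qed.

(** A lift of the point through the Hopf map, normalised to have a real first component. At the pole
    x = -1 that component is 0, and b = 1 is one choice of phase. *)
Lemma spinor u : sphere2 u -> exists (a : R) (b : R[i]),
  [/\ a ^+ 2 = (1 + vx u) / 2, b * Num.conj b = ((1 - vx u) / 2)%:C &
      a%:C * b = ((vy u / 2) +i* (vz u / 2))].
Proof.
move=> /sphere2E su; have [x1|x1] := eqVneq (vx u) (-1).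
  exists 0, 1; rewrite x1 rmorph1 mulr1.
  have yz : vy u ^+ 2 + vz u ^+ 2 = 0 by move: su; rewrite x1; lra.
  have /andP[/eqP y0 /eqP z0] : (vy u == 0) && (vz u == 0).
    rewrite -(sqrf_eq0 (vy u)) -(sqrf_eq0 (vz u)); have := sqr_ge0 (vy u); have := sqr_ge0 (vz u).
    by move=> z y; apply/andP; split; apply/eqP; lra.
  split; first by rewrite subrr mul0r expr0n.
    by rewrite (_ : (1 - -1) / 2 = 1 :> R) ?rmorph1 ?mulr1 //; lra.
  by rewrite y0 z0 !mul0r.
have xb : -1 < vx u.
  rewrite lt_neqAle eq_sym x1 /=; have := sqr_ge0 (vy u); have := sqr_ge0 (vz u).
  nra.
pose a := Num.sqrt ((1 + vx u) / 2).
have a2 : a ^+ 2 = (1 + vx u) / 2 by rewrite sqr_sqrtr//; lra.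
have a0 : a != 0 by rewrite -sqrf_eq0 a2; apply/eqP; lra.
exists a, ((vy u / (2 * a)) +i* (vz u / (2 * a))); split=> //.
  apply/eqP; rewrite eq_complex /=; apply/andP; split; last by apply/eqP; ring.
  rewrite mulrN opprK -!expr2 !expr_div_n -mulrDl exprMn a2; apply/eqP; apply: (@mulIf _ (2 * (1 + vx u))); first by apply/eqP; lra.
  have -> : vy u ^+ 2 + vz u ^+ 2 = (1 - vx u) * (1 + vx u) by move: su; nra.
  by field; apply/eqP; lra.
apply/eqP; rewrite eq_complex /= !mul0r subr0 addr0.
by apply/andP; split; apply/eqP; field.
Qed.

End RowVector3.

Section SphereBlock.
Variables (R : realType) (n : nat) (s : 'S_n) (i j : 'I_n) (ij : i != j).
Local Notation C := R[i].
Local Notation M := 'M[C]_n.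

(** The 2 x 2 matrix with rows (a, b) and (-conj b, a), placed in rows s i, s j and columns i, j;
    elsewhere the permutation matrix of s. *)
Definition block_unitary (a : R) (b : C) : M := \matrix_(k, l)
  (if l == i then (k == s i)%:R * a%:C - (k == s j)%:R * Num.conj b
   else if l == j then (k == s i)%:R * b + (k == s j)%:R * a%:C
   else (k == s l)%:R).

Lemma block_sum (a : R) (b : C) (F : 'I_n -> C) k l :
  let W := block_unitary a b in
  \sum_m Num.conj (W m k) * F m * W m l =
  Num.conj (W (s i) k) * F (s i) * W (s i) l + Num.conj (W (s j) k) * F (s j) * W (s j) l +
  ((k == l) && (k != i) && (k != j))%:R * F (s k).
Proof.
move=> W; have sij : s i != s j by rewrite (inj_eq perm_inj).
rewrite (bigD1 (s i))//= (bigD1 (s j)) 1?eq_sym//= addrA; congr (_ + _).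
have We m p : m != s i -> m != s j -> W m p = ((p != i) && (p != j) && (m == s p))%:R.
  move=> mi mj; rewrite /W mxE (negPf mi) (negPf mj) !mul0r subr0 addr0.
  by case: eqP => //= _; case: eqP.
have [kl|kl] := eqVneq k l; last first.
  rewrite mul0r big1// => m /andP[mi mj]; rewrite !We//.
  have [mk|] := eqVneq m (s k); last by rewrite andbF rmorph0 !mul0r.
  by rewrite mk (inj_eq perm_inj) (negPf kl) andbF mulr0.
rewrite -kl; have [ki|ki] := eqVneq k i.
  rewrite ki /= mul0r big1// => m /andP[mi mj].
  by rewrite !We// eqxx /= mulr0.
have [kj|kj] := eqVneq k j.
  rewrite kj /= mul0r big1// => m /andP[mi mj].
  by rewrite !We// eqxx /= andbF mulr0.
rewrite (bigD1 (s k)) /= ?(inj_eq perm_inj) ?ki ?kj//= big1 ?addr0 => [|m /andP[/andP[mi mj] mk]].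
  by rewrite !We ?(inj_eq perm_inj)// ki kj eqxx /= rmorph1 !mul1r mulr1.
by rewrite !We// (negPf mk) andbF mulr0.
Qed.

Lemma block_entry a b :
  let W := block_unitary a b in
  [/\ W (s i) i = a%:C, W (s j) i = - Num.conj b, W (s i) j = b & W (s j) j = a%:C] /\
  forall l, l != i -> l != j -> ((W (s i) l = 0) * (W (s j) l = 0))%type.
Proof.
have sij : (s i == s j) = false by rewrite (inj_eq perm_inj) (negPf ij).
have ji : (j == i) = false by rewrite eq_sym (negPf ij).
split.
  rewrite !mxE !eqxx ji ![s j == s i]eq_sym !sij !mul0r !mul1r subr0 sub0r addr0 add0r.
  by split.
move=> l li lj; rewrite !mxE (negPf li) (negPf lj) !(inj_eq perm_inj).
by rewrite ![_ == l]eq_sym (negPf li) (negPf lj).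
Qed.

Lemma conjNconj (z : C) : Num.conj (- Num.conj z) = - z.
Proof. by rewrite rmorphN; congr (- _); exact: conjCK. Qed.

Lemma block_unitaryP a b : a%:C ^+ 2 + b * Num.conj b = 1 -> block_unitary a b \is unitarymx.
Proof.
move=> ab; have [[e1 e2 e3 e4] e0] := block_entry a b.
suff E : (block_unitary a b)^t* *m block_unitary a b = 1%:M.
  by apply/unitarymxP; rewrite (mulmx1C E).
have cr (r : R) : Num.conj (r%:C : C) = r%:C by rewrite /Num.conj /= oppr0.
apply/matrixP => k l; rewrite mxE [RHS]mxE.
transitivity (\sum_m Num.conj (block_unitary a b m k) * 1 * block_unitary a b m l).
  by apply: eq_bigr => m _; rewrite !mxE mulr1.
rewrite (block_sum a b (fun=> 1)) /= !mulr1.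
have [->|ki] := eqVneq k i.
  rewrite andbF /= addr0 e1 e2 conjNconj cr.
  have [->|li] := eqVneq l i; first by rewrite ?eqxx e1 e2 mulrNN mulr1n -ab; ring.
  have [->|lj] := eqVneq l j; first by rewrite ?(negPf ij) e3 e4 mulrC mulNr subrr.
  by rewrite !(e0 l li lj) !mulr0 addr0.
have [->|kj] := eqVneq k j.
  rewrite andbF /= addr0 e3 e4 cr.
  have [->|li] := eqVneq l i; first by rewrite e1 e2 ?[j == i]eq_sym ?(negPf ij) mulrN mulrC subrr.
  have [->|lj] := eqVneq l j; first by rewrite ?eqxx e3 e4 mulr1n -ab; ring.
  by rewrite !(e0 l li lj) !mulr0 addr0.
by rewrite !(e0 k ki kj) rmorph0 !mul0r !add0r !andbT.
Qed.

Lemma blk_block_unitary a b : blk s i j (block_unitary a b).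
Proof.
move=> k l; rewrite mxE; have [->|li] := eqVneq l i.
  rewrite tpermL; have [|ki] := eqVneq k (s i); first by left.
  have [|kj] := eqVneq k (s j); first by right.
  by rewrite !mul0r subrr eqxx.
have [->|lj] := eqVneq l j.
  rewrite tpermR; have [|ki] := eqVneq k (s i); first by right.
  have [|kj] := eqVneq k (s j); first by left.
  by rewrite !mul0r addr0 eqxx.
by have [|] := eqVneq k (s l); [left|rewrite eqxx].
Qed.

Variable d : 'I_n -> R.
Let mid := (d (s i) + d (s j)) / 2.
Let rad := (d (s i) - d (s j)) / 2.

(* The conjugates of diag d by the block unitaries form a round sphere. *)
Definition sphere_mx (u : 'rV[R]_3) : M := \matrix_(k, l)
  if k == l then
    (if k == i then mid + rad * vx u else if k == j then mid - rad * vx u else d (s k))%:C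
  else if (k == i) && (l == j) then rad%:C * (vy u +i* vz u)
  else if (k == j) && (l == i) then rad%:C * (vy u +i* (- vz u)) else 0.

Lemma sphere_mxP u : sphere2 u -> exists U, [/\ U \is unitarymx, blk s i j U &
  conj_diag d U = sphere_mx u].
Proof.
move=> /spinor[a [b [a2 b2 ab]]].
have cr (r : R) : Num.conj (r%:C : C) = r%:C by rewrite /Num.conj /= oppr0.
have aC : a%:C * a%:C = ((1 + vx u) / 2)%:C :> C by rewrite -rmorphM -expr2 a2.
have nij : (i == j) = false := negPf ij.
have ji : (j == i) = false by rewrite eq_sym.
exists (block_unitary a b); split.
- apply: block_unitaryP; rewrite expr2 aC b2 -rmorphD.
  by rewrite (_ : _ + _ = 1 :> R) ?rmorph1//; field.
- exact: blk_block_unitary.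
have [[e1 e2 e3 e4] e0] := block_entry a b.
have two : 2 * (a%:C * b) = (vy u +i* vz u).
  by rewrite ab mulr_natl mulr2n; apply/eqP; rewrite eq_complex /= -!splitr !eqxx.
have twoc : 2 * (a%:C * Num.conj b) = (vy u +i* (- vz u)).
  rewrite -[RHS]/(Num.conj (vy u +i* vz u)) -two.
  transitivity (Num.conj 2 * (Num.conj a%:C * Num.conj b)); last by rewrite !rmorphM.
  by rewrite cr (@conjC_nat C 2).
have radE : rad%:C * 2 = (d (s i))%:C - (d (s j))%:C :> C.
  by rewrite -rmorphB -(rmorph_nat (real_complex R)) -rmorphM; congr (_ %:C); rewrite /rad; field.
have mr : (mid + rad * vx u)%:C = (d (s i))%:C * (a%:C * a%:C) + (d (s j))%:C * (b * Num.conj b) :> C.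
  by rewrite aC b2 -!rmorphM -rmorphD; congr (_ %:C); rewrite /mid /rad; field.
have mr' : (mid - rad * vx u)%:C = (d (s i))%:C * (b * Num.conj b) + (d (s j))%:C * (a%:C * a%:C) :> C.
  by rewrite aC b2 -!rmorphM -rmorphD; congr (_ %:C); rewrite /mid /rad; field.
apply/matrixP => k l; rewrite conj_diagE (block_sum a b (fun m => (d m)%:C)) [RHS]mxE /=.
have [->|ki] := eqVneq k i.
  rewrite andbF /= mul0r addr0 e1 e2 conjNconj cr.
  have [->|li] := eqVneq l i.
    rewrite ?eqxx e1 e2 mr; ring.
  have [->|lj] := eqVneq l j.
    rewrite ?nij ?eqxx /= e3 e4 -two mulrA radE; ring.
  by rewrite !(e0 l li lj) !mulr0 addr0 ?nij.
have [->|kj] := eqVneq k j.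
  rewrite andbF /= mul0r addr0 e3 e4 cr.
  have [->|li] := eqVneq l i.
    rewrite ?ji e1 e2 ?eqxx /= -twoc mulrA radE; ring.
  have [->|lj] := eqVneq l j.
    rewrite ?eqxx e3 e4 mr'; ring.
  by rewrite !(e0 l li lj) !mulr0 addr0.
rewrite !(e0 k ki kj) rmorph0 !mul0r !add0r !andbT /=.
by case: eqP => [->|_]; rewrite ?mul1r ?mul0r.
Qed.

Lemma cts_sphere_mx (T : topologicalType) (f : T -> 'rV[R]_3) :
  continuous f -> continuous (fun t => sphere_mx (f t)).
Proof.
move=> cf; have cx := cts_entry ord0 ord0 cf; have cy := cts_entry ord0 (lift ord0 ord0) cf.
have cz := cts_entry ord0 (lift ord0 (lift ord0 ord0)) cf.
have cre (g : T -> R) : continuous g -> continuous (fun t : T => (g t)%:C : C).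
  by move=> cg; exact: (cts_comp cg (@cts_real_complex R)).
apply: mx_cts => k l; rewrite /sphere_mx; under eq_fun do rewrite mxE.
case: (k == l); last first.
  case: (_ && _); first by exact: (cts_mul (cts_cst _) (cts_complex cy cz)).
  case: (_ && _); first by exact: (cts_mul (cts_cst _) (cts_complex cy (cts_opp cz))).
  exact: cts_cst.
case: (k == i); first exact: (cre _ (cts_add (cts_cst _) (cts_mul (cts_cst _) cx))).
case: (k == j); last exact: cts_cst.
exact: (cre _ (cts_add (cts_cst _) (cts_opp (cts_mul (cts_cst _) cx)))).
Qed.

Definition sphere_coord (A : M) : 'rV[R]_3 :=
  vec3 (complex.Re (A i i - A j j) / (2 * rad)) (complex.Re (A i j) / rad) (complex.Im (A i j) / rad).

Lemma cts_sphere_coord : continuous sphere_coord.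
Proof.
have ce k l : continuous (fun A : M => A k l) by exact: coord_continuous.
apply: cts_vec3.
- refine (cts_mul (cts_comp _ (@cts_Re R)) (cts_cst _)); exact: (cts_add (@ce _ _) (cts_opp (@ce _ _))).
- exact: (cts_mul (cts_comp (@ce _ _) (@cts_Re R)) (cts_cst _)).
- exact: (cts_mul (cts_comp (@ce _ _) (@cts_Im R)) (cts_cst _)).
Qed.

Lemma sphere_mxK u : rad != 0 -> sphere_coord (sphere_mx u) = u.
Proof.
move=> r0; rewrite -[RHS]vec3K /sphere_coord !mxE !eqxx [j == i]eq_sym (negPf ij) /=.
by congr vec3; rewrite ?mul0r ?subr0 ?addr0; field.
Qed.

End SphereBlock.

(** * Edges are links *)

Section Edges.
Variables (R : realType) (n : nat).
Local Notation C := R[i].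
Local Notation M := 'M[C]_n.
Local Notation torus := (torus R n).

Section Model.
Variables (Z : set M) (d : 'I_n -> R) (X : gspace torus).
Hypotheses (bZ : biinvariant Z) (sZ : saturated Z) (d_inj : injective d) (mX : model Z d X).
Local Notation pi := (mpi mX).
Local Notation m := (mmx mX).
Local Notation vtx := (vtx sZ mX).
Local Notation sphere2 := (@sphere2 R).

Lemma stab_dim_one (x : X) i j : (forall v : 'rV[R]_n, v ord0 i = v ord0 j -> stab_lie x v) ->
  (orbit_dim x <= 1)%N.
Proof.
move=> h; pose c : 'cV[R]_n := \col_k ((k == i)%:R - (k == j)%:R).
have cE (v : 'rV[R]_n) : (v *m c) ord0 ord0 = v ord0 i - v ord0 j.
  have e k : \sum_l v ord0 l * (l == k)%:R = v ord0 k.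
    by rewrite (bigD1 k)//= eqxx mulr1 big1 ?addr0// => l /negPf ->; rewrite mulr0.
  rewrite mxE -!e -sumrB; apply: eq_bigr => k _; by rewrite mxE mulrBr.
have := @stab_dim_ge _ _ X x _ (row_base (kermx c)) (row_base_free _) => H.
have : (n - \rank c <= stab_dim x)%N.
  rewrite -mxrank_ker; apply: H => k; apply: h; apply/eqP; rewrite -subr_eq0 -cE.
  suff -> : row k (row_base (kermx c)) *m c = 0 by rewrite mxE.
  apply/sub_kermxP; apply: submx_trans (row_sub _ _) _; by rewrite eq_row_base.
have := rank_leq_col c; rewrite /orbit_dim; lia.
Qed.

Lemma edge_of_link s s' : link Z s s' -> gkm_edge (vtx s) (vtx s').
Proof.
move=> [i [j [ij -> Zblk]]]; split.
  move=> /(vtx_inj d_inj)/permP/(_ i); rewrite permM tpermL => /perm_inj/eqP.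
  by rewrite (negPf ij).
have ji : (j == i) = false by rewrite eq_sym (negPf ij).
have r0 : (d (s i) - d (s j)) / 2 != 0.
  rewrite mulf_neq0 ?invr_eq0 ?pnatr_eq0// subr_eq0; apply: contra ij => /eqP/d_inj/perm_inj ->.
  exact: eqxx.
pose S : set X := [set x | exists u : sphere2, m x = sphere_mx s i j d (val u)].
have exf (u : sphere2) : exists x, m x = sphere_mx s i j d (val u).
  have [U [uU bU E]] := sphere_mxP s ij d (set_mem (valP u)).
  by exists (pi (exist (fun U => U \in Z) U (mem_set (Zblk U uU bU)))); rewrite mmx_mpi.
have [f fE] := choice exf.
have cf : continuous f.
  refine (@model_cts R n Z d X bZ mX _ f _); under eq_fun do rewrite fE.
  exact: (@cts_sphere_mx R n s i j d _ _ cts_val).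
exists S; split.
- move=> t x [u xu].
  (* Conjugation by t rotates the sphere about the x-axis; w is the rotated point y + i z. *)
  pose w : C := t i i * Num.conj (t j j) * (vy (val u) +i* vz (val u)).
  have w2 : complex.Re w ^+ 2 + complex.Im w ^+ 2 = vy (val u) ^+ 2 + vz (val u) ^+ 2.
    have sqn (z : C) : `|z| ^+ 2 = (complex.Re z ^+ 2 + complex.Im z ^+ 2)%:C.
      by rewrite normc_def -rmorphXn sqr_sqrtr ?addr_ge0 ?sqr_ge0.
    apply: complexI; rewrite -sqn -[RHS](sqn (vy (val u) +i* vz (val u))).
    by rewrite /w !normrM norm_conjC !torus_norm !mul1r.
  have su' : vec3 (vx (val u)) (complex.Re w) (complex.Im w) \in sphere2.
    apply/mem_set/sphere2E; rewrite vxE vyE vzE -addrA w2 addrA.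
    by apply/sphere2E; exact: set_mem (valP u).
  exists (exist (fun u => u \in sphere2) _ su'); rewrite mmx_act xu.
  apply/matrixP => k l; rewrite mx_gactE !mxE vxE vyE vzE.
  have [->|kl] := eqVneq k l.
    by rewrite mulrAC -normCK torus_norm expr1n mul1r.
  case: (boolP (_ && _)) => [/andP[/eqP -> /eqP ->]|_].
    rewrite -[complex.Re w +i* _]/(complex.Re w +i* complex.Im w).
    rewrite (_ : complex.Re w +i* complex.Im w = w); last by case: (w).
    by rewrite /w; ring.
  case: (boolP (_ && _)) => [/andP[/eqP -> /eqP ->]|_]; last by rewrite mulr0 mul0r.
  have -> : complex.Re w +i* (- complex.Im w) = Num.conj w by case: (w).
  have -> : Num.conj w = Num.conj (t i i) * t j j * (vy (val u) +i* (- vz (val u))).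
    rewrite /w [LHS]rmorphM [X in X * _ = _]rmorphM.
    congr (_ * _ * _); exact: conjCK.
  by ring.
- have Sf (u : sphere2) : f u \in S by apply/mem_set; exists u.
  pose F (u : sphere2) : S := exist (fun x => x \in S) (f u) (Sf u).
  have sg (x : S) : sphere_coord s i j d (m (val x)) \in sphere2.
    by have [u ->] := set_mem (valP x); rewrite sphere_mxK//; exact: valP.
  pose G (x : S) : sphere2 := exist (fun u => u \in sphere2) _ (sg x).
  exists F; split; first by refine (@sub_cts _ _ _ F _); exact: cf.
  have FK : cancel F G by move=> u; apply/val_inj; rewrite /= fE sphere_mxK.
  exists G; split=> //.
    move=> x; apply/val_inj/(@mmx_inj _ _ _ _ _ mX); rewrite /= fE /=.
    by have [u ->] := set_mem (valP x); rewrite sphere_mxK.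
  refine (@sub_cts _ _ _ G _).
  have c1 : continuous (fun x : S => m (val x)) := cts_comp cts_val (mmx_cts mX).
  exact: (cts_comp c1 (@cts_sphere_coord R n s i j d)).
- move=> x [u xu]; apply: (@stab_dim_one x i j) => v vij.
  apply/(stab_lie_mmxP mX) => k l; rewrite xu mxE; have [->//|kl] := eqVneq k l.
  case: (boolP (_ && _)) => [/andP[/eqP -> /eqP ->]//|_].
  by case: (boolP (_ && _)) => [/andP[/eqP -> /eqP ->]//|_]; rewrite eqxx.
have mid1 : (d (s i) + d (s j)) / 2 + (d (s i) - d (s j)) / 2 * 1 = d (s i) by field.
have mid2 : (d (s i) + d (s j)) / 2 - (d (s i) - d (s j)) / 2 * 1 = d (s j) by field.
have mid3 : (d (s i) + d (s j)) / 2 + (d (s i) - d (s j)) / 2 * -1 = d (s j) by field.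
have mid4 : (d (s i) + d (s j)) / 2 - (d (s i) - d (s j)) / 2 * -1 = d (s i) by field.
have mp : sphere_mx s i j d (vec3 1 0 0) = m (val (vtx s)).
  apply/matrixP => k l; rewrite mmx_vtx mxE vxE vyE vzE oppr0 -[0 +i* 0]/(0 : C) mulr0.
  have [_|kl] := eqVneq k l; last by rewrite mul0r; case: (_ && _) => //; case: (_ && _).
  rewrite mul1r mid1 mid2; have [->//|_] := eqVneq k i; by have [->|_] := eqVneq k j.
have mq : sphere_mx s i j d (vec3 (-1) 0 0) = m (val (vtx (tperm i j * s)%g)).
  apply/matrixP => k l; rewrite mmx_vtx mxE vxE vyE vzE oppr0 -[0 +i* 0]/(0 : C) mulr0 permM.
  have [_|kl] := eqVneq k l; last by rewrite mul0r; case: (_ && _) => //; case: (_ && _).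
  rewrite mul1r mid3 mid4; have [->|ki] := eqVneq k i; first by rewrite tpermL.
  have [->|kj] := eqVneq k j; first by rewrite tpermR.
  by rewrite tpermD 1?eq_sym.
have s1 e : e ^+ 2 = 1 -> vec3 e 0 0 \in sphere2.
  by move=> e1; apply/mem_set/sphere2E; rewrite vxE vyE vzE e1 expr0n /= !addr0.
have sp : vec3 1 0 0 \in sphere2 by apply: s1; rewrite expr1n.
have sq : vec3 (-1) 0 0 \in sphere2 by apply: s1; rewrite sqrrN expr1n.
apply/seteqP; split=> [x [[u xu] fx]|x [->|->]]; last 2 first.
- split; last exact: set_mem (valP (vtx s)).
  by exists (exist (fun u => u \in sphere2) _ sp); rewrite /= mp.
- split; last exact: set_mem (valP (vtx (tperm i j * s)%g)).
  by exists (exist (fun u => u \in sphere2) _ sq); rewrite /= mq.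
have := (fixed_diagP mX x).1 fx i j ij; rewrite xu mxE (negPf ij) !eqxx /= => /eqP.
rewrite mulf_eq0 fmorph_eq0 (negPf r0) /= => /eqP[y0 z0].
have ux : vec3 (vx (val u)) 0 0 = val u by rewrite -[RHS]vec3K y0 z0.
have /eqP : vx (val u) ^+ 2 = 1.
  by have /sphere2E := set_mem (valP u); rewrite y0 z0 expr0n /= !addr0.
rewrite sqrf_eq1 => /orP[] /eqP E; rewrite E in ux.
  by left; apply: (@mmx_inj _ _ _ _ _ mX); rewrite -mp ux.
by right; apply: (@mmx_inj _ _ _ _ _ mX); rewrite -mq ux.
Qed.

(** Each nonzero entry (k, l) imposes v_k = v_l on the stabiliser. Two different unordered pairs
    give independent conditions, the columns of [W], and the orbit would have dimension at least
    2. *)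
Lemma off_diag_unique (x : X) i j : (orbit_dim x <= 1)%N -> i != j -> m x i j != 0 ->
  near_diag i j (m x).
Proof.
move=> x1 ij xij k l kl; have [->|xkl] := eqVneq (m x k l) 0; [by right|left].
apply/negPn/negP; rewrite negb_or !negb_and => /andP[n1 n2].
have [B [fB sB]] := stab_dim_witness x.
pose W : 'M[R]_(n, 2) := \matrix_(r, e)
  (if e == ord0 then (r == i)%:R - (r == j)%:R else (r == k)%:R - (r == l)%:R).
have BW : B *m W = 0.
  apply/matrixP => r e; rewrite !mxE.
  have h := (stab_lie_mmxP mX x (row r B)).1 (sB r).
  have e1 p : \sum_q B r q * (q == p)%:R = B r p.
    by rewrite (bigD1 p)//= eqxx mulr1 big1 ?addr0// => q /negPf ->; rewrite mulr0.
  under eq_bigr do rewrite mxE.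
  case: (e == ord0); under eq_bigr do rewrite mulrBr; rewrite sumrB !e1.
    by have := h _ _ xij; rewrite !mxE => ->; rewrite subrr.
  by have := h _ _ xkl; rewrite !mxE => ->; rewrite subrr.
have fW : row_free W^T.
  apply: inj_row_free => v vW.
  have eqn r : v ord0 ord0 * W r ord0 + v ord0 (lift ord0 ord0) * W r (lift ord0 ord0) = 0.
    have /rowP/(_ r) := vW; rewrite [LHS]mxE [RHS]mxE !big_ord_recl big_ord0 addr0 => <-.
    by congr (_ * _ + _ * _); rewrite [RHS]mxE.
  have v0 : v ord0 ord0 = 0.
    have ji : j != i by rewrite eq_sym.
    have [/andP[ik il]|] := boolP ((i != k) && (i != l)).
      by have := eqn i; rewrite !mxE /= eqxx (negPf ij) (negPf ik) (negPf il) subrr mulr0 addr0 subr0 mulr1.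
    rewrite negb_and !negbK => ikl.
    have jk : j != k by apply/eqP => jk; move: ikl n1 n2; rewrite -jk (negPf ij) eqxx /= => /eqP <-; rewrite eqxx.
    have jl : j != l by apply/eqP => jl; move: ikl n1 n2; rewrite -jl (negPf ij) orbF eqxx => /eqP <-; rewrite eqxx.
    have := eqn j; rewrite !mxE /= eqxx (negPf ji) (negPf jk) (negPf jl) subrr mulr0 addr0 sub0r.
    by move/eqP; rewrite mulf_eq0 oppr_eq0 oner_eq0 orbF => /eqP.
  apply/rowP => e; rewrite mxE; case: e => -[|[|//]] le.
    by rewrite -[RHS]v0; congr (v _ _); exact/val_inj.
  have := eqn k; rewrite v0 mul0r add0r !mxE /= eqxx (negPf kl) subr0 mulr1 => <-.
  by congr (v _ _); exact/val_inj.
have := mulmx0_rank_max BW; rewrite (eqP fB) -(mxrank_tr W) (eqP fW).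
by move: x1; rewrite /orbit_dim; have := rank_leq_col B; rewrite (eqP fB); lia.
Qed.

(** A closed set, so that connectedness can be applied to it. The only vertices in it are s and s
    composed with the transposition of i and j ([near_vtx_vtx], [perm_agree]). *)
Definition near_vtx (s : 'S_n) i j : set X :=
  [set x | near_diag i j (m x) /\ forall l, l != i -> l != j -> m x l l = (d (s l))%:C].

Lemma closed_entry k l (c : C) : closed [set x | m x k l = c].
Proof.
have -> : [set x | m x k l = c] = (fun x => m x k l) @^-1` [set c] by [].
apply: (@cts_closed _ _ (fun x => m x k l)); first exact: (cts_entry k l (mmx_cts mX)).
by apply: accessible_closed_set1; apply: hausdorff_accessible; exact: norm_hausdorff.
Qed.

Lemma closed_forall (T : topologicalType) (I : Type) (F : I -> set T) :
  (forall i, closed (F i)) -> closed [set x | forall i, F i x].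
Proof.
move=> cF; rewrite (_ : [set x | _] = \bigcap_i F i); first by apply: closed_bigI => i _; exact: cF.
by apply/seteqP; split=> [x h i _|x h i]; exact: h.
Qed.

Lemma closed_exists (T : topologicalType) (I : finType) (F : I -> set T) :
  (forall i, closed (F i)) -> closed [set x | exists i, F i x].
Proof.
move=> cF; rewrite (_ : [set x | _] = \bigcup_(i in setT) F i); last first.
  by apply/seteqP; split=> x; case=> i; [by exists i|by move=> _; exists i].
by apply: closed_bigcup => [|i _]; [exact: finite_finset|exact: cF].
Qed.

Lemma closed_imply (T : topologicalType) (P : Prop) (F : set T) :
  closed F -> closed [set x | P -> F x].
Proof.
move=> cF; have [p|np] := pselect P.
  by rewrite (_ : [set x | _] = F)//; apply/seteqP; split=> x /= h; [exact: (h p)|move=> _].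
rewrite (_ : [set x | _] = setT); first exact: closedT.
by apply/seteqP; split=> x // _ /np.
Qed.

Lemma closed_or (T : topologicalType) (P : Prop) (F : set T) :
  closed F -> closed [set x | P \/ F x].
Proof.
move=> cF; have [p|np] := pselect P.
  rewrite (_ : [set x | _] = setT); first exact: closedT.
  by apply/seteqP; split=> x // _; left.
by rewrite (_ : [set x | _] = F)//; apply/seteqP; split=> x /=; [case|right].
Qed.

Lemma closed_guard (T : topologicalType) (P : Prop) (F : set T) :
  closed F -> closed [set x | P /\ F x].
Proof.
move=> cF; have [p|np] := pselect P.
  by rewrite (_ : [set x | _] = F)//; apply/seteqP; split=> x /=; [case|].
rewrite (_ : [set x | _] = set0); first exact: closed0.
by apply/seteqP; split=> x //= -[].
Qed.

Lemma closed_near_vtx s i j : closed (near_vtx s i j).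
Proof.
apply: closedI.
  apply: closed_forall => k; apply: closed_forall => l; apply: closed_imply.
  refine (@closed_or X (((k == i) && (l == j)) || ((k == j) && (l == i))) _ (@closed_entry k l 0)).
apply: closed_forall => l; do 2 apply: closed_imply.
exact: (@closed_entry l l (d (s l))%:C).
Qed.

Lemma perm_agree (s s' : 'S_n) i j : (forall l, l != i -> l != j -> s' l = s l) ->
  s' = s \/ s' = (tperm i j * s)%g.
Proof.
move=> h; have E k : s' k = s i \/ s' k = s j -> k = i \/ k = j.
  move=> sk; apply: contrapT => nk.
  have ki : k != i by apply/eqP => ki; apply: nk; left.
  have kj : k != j by apply/eqP => kj; apply: nk; right.
  by case: sk; rewrite (h k ki kj) => /perm_inj ke; apply: nk; [left|right].
have surj p : exists k, s' k = p by exists ((s'^-1)%g p); rewrite permKV.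
have [a sa] := surj (s i); have [b sb] := surj (s j).
have [] := E a (or_introl sa) => ai; have [] := E b (or_intror sb) => bj; subst a b.
- left; apply/permP => l; have [->//|li] := eqVneq l i; have [->|lj] := eqVneq l j; last exact: h.
  by have := sb; rewrite sa => /perm_inj <-; rewrite -sa.
- left; apply/permP => l; have [->//|li] := eqVneq l i; have [->|lj] := eqVneq l j; [exact: sb|exact: h].
- right; apply/permP => l; rewrite permM; have [->|li] := eqVneq l i; first by rewrite tpermL.
  have [->|lj] := eqVneq l j; first by rewrite tpermR.
  by rewrite tpermD 1?eq_sym//; exact: h.
- left; apply/permP => l; have [->|li] := eqVneq l i; last first.
    by have [->//|lj] := eqVneq l j; exact: h.
  by have := sb; rewrite sa => /perm_inj ->; rewrite -sb.
Qed.

Lemma near_vtx_vtx (s s' : 'S_n) i j : near_vtx s i j (val (vtx s')) ->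
  forall l, l != i -> l != j -> s' l = s l.
Proof.
move=> [_ h] l li lj; apply: d_inj; apply: complexI.
by have := h l li lj; rewrite mmx_vtx eqxx mul1r.
Qed.

Lemma vtx_near_vtx (s s' : 'S_n) i j : (forall l, l != i -> l != j -> s' l = s l) ->
  near_vtx s i j (val (vtx s')).
Proof.
move=> h; split=> [k l kl|l li lj]; rewrite mmx_vtx.
  by right; rewrite (negPf kl) mul0r.
by rewrite eqxx mul1r h.
Qed.

Lemma link_of_near (s : 'S_n) i j x : i != j -> near_vtx s i j x -> m x i j != 0 ->
  link Z s (tperm i j * s)%g.
Proof.
move=> ij [nx dx] xij; exists i, j; split=> //; have [U Ux] := mpi_onto mX x.
have mU : m x = conj_diag d (val U) by rewrite -Ux mmx_mpi.
rewrite mU in nx dx xij; have uU := zsub_unitary bZ U.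
have bU := blk_of d_inj uU nx dx.
exact: (sat_blk sZ ij (set_mem (valP U)) bU (full_blk_of uU ij bU xij)).
Qed.

(* The sphere [S] is covered by two closed sets: the part made of the         *)
(* one-dimensional orbits that end at [s], and the rest.                       *)
Lemma link_of_edge s s' : gkm_edge (vtx s) (vtx s') -> link Z s s'.
Proof.
move=> [ss [S [invS [f [cf [g [fK gK cg]]]] dS Sfix]]].
pose p := val (vtx s); pose q := val (vtx s').
have pq : p <> q by move=> /val_inj.
have [Sp fp] : (S `&` fixed_points X) p by rewrite Sfix; left.
have [Sq fq] : (S `&` fixed_points X) q by rewrite Sfix; right.
have fixS x : S x -> fixed_points X x -> x = p \/ x = q.
  move=> Sx fx; have : (S `&` fixed_points X) x by [].
  by rewrite Sfix.
pose K : set X := [set x | x = p] `|` [set x | exists ij : 'I_n * 'I_n,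
  (ij.1 != ij.2 /\ exists y, [/\ S y, near_vtx s ij.1 ij.2 y & m y ij.1 ij.2 != 0]) /\
  near_vtx s ij.1 ij.2 x].
pose L : set X := [set x | x = q] `|` [set x | exists rij : 'S_n * ('I_n * 'I_n),
  ~ near_vtx rij.1 rij.2.1 rij.2.2 p /\ near_vtx rij.1 rij.2.1 rij.2.2 x].
have c1 x : closed [set y : X | y = x].
  by apply: accessible_closed_set1; apply: hausdorff_accessible; exact: (model_hausdorff mX).
have cK : closed K.
  by apply: closedU => //; apply: closed_exists => ij; apply: closed_guard; exact: closed_near_vtx.
have cL : closed L.
  by apply: closedU => //; apply: closed_exists => ij; apply: closed_guard; exact: closed_near_vtx.
(* If q is in K, some point of S has a nonzero entry (i, j) in a region containing both p and q, and
   saturation yields the link. Otherwise K and L would separate p from q on the sphere. *)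
have [Kq|nKq] := pselect (K q).
  case: Kq => [/esym//|[[i j] /= [[ij [y [Sy ny yij]]] nq]]].
  have [s'E|->] := perm_agree (near_vtx_vtx nq); last exact: link_of_near ij ny yij.
  by case: pq; rewrite /p /q s'E.
have KL x : S x -> K x \/ L x.
  move=> Sx; have [fx|nfx] := pselect (fixed_points X x).
    by have [->|->] := fixS x Sx fx; [left; left|right; left].
  have [i [j [ij xij]]] : exists i j, i != j /\ m x i j != 0.
    apply: contrapT => h; apply: nfx; apply/(fixed_diagP mX) => i j ij.
    by apply/eqP; apply: contraT => xij; case: h; exists i, j.
  have nx := off_diag_unique (dS x Sx) ij xij.
  have [U Ux] := mpi_onto mX x; have mU : m x = conj_diag d (val U) by rewrite -Ux mmx_mpi.
  have [s0 s0P] := exists_perm d (zsub_unitary bZ U).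
  have n0 : near_vtx s0 i j x.
    split=> // l li lj; rewrite mU in nx *; apply: s0P; exact: near_diag_column nx li lj.
  have [np|np] := pselect (near_vtx s0 i j p); last first.
    by right; right; exists (s0, (i, j)).
  have ns : near_vtx s i j x.
    split=> // l li lj; rewrite (near_vtx_vtx np li lj); exact: n0.2.
  by left; right; exists (i, j); split=> //; split=> //; exists x.
(* A common non-fixed point has a single pair of nonzero off-diagonal entries, so both regions
   concern the same i and j and prescribe the same other diagonal entries; then the region used in L
   would contain p. *)
have nKL x : S x -> ~ (K x /\ L x).
  move=> Sx [Kx [xq|[[r [k l0]] /= [np nr]]]]; first by apply: nKq; rewrite -xq.
  have [xq|nq] := pselect (x = q); first by apply: nKq; rewrite -xq.
  case: Kx => [xp|[[i j] /= [[ij _] ns]]]; first by apply: np; rewrite -xp.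
  have [fx|nfx] := pselect (fixed_points X x).
    by case: (fixS x Sx fx) => // xp; apply: np; rewrite -xp.
  have [a [b [ab xab]]] : exists a b, a != b /\ m x a b != 0.
    apply: contrapT => h; apply: nfx; apply/(fixed_diagP mX) => a b ab.
    by apply/eqP; apply: contraT => xab; case: h; exists a, b.
  have pair i' j' : near_diag i' j' (m x) -> (a = i' /\ b = j') \/ (a = j' /\ b = i').
    by move=> /(_ a b ab)[/orP[] /andP[/eqP -> /eqP ->]|/eqP]; [left|right|rewrite (negPf xab)].
  apply: np; apply: vtx_near_vtx => l lk ll0; apply: d_inj; apply: complexI.
  by case: (pair i j ns.1) (pair k l0 nr.1) => -[ai bj] [] [ak bl];
    rewrite -(nr.2 l lk ll0) ns.2 // -?ai -?bj ?ak ?bl.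
have gq : val (f (g (exist (fun x => x \in S) q (mem_set Sq)))) = q by rewrite gK.
apply: contrapT => _; apply: nKq; rewrite -gq.
apply: (@sphere2_cover R X (fun u => val (f u)) K L (g (exist (fun x => x \in S) p (mem_set Sp)))).
- exact: (cts_comp cf cts_val).
- exact: cK.
- exact: cL.
- by move=> u; apply: KL; exact: set_mem (valP (f u)).
- by move=> u; apply: nKL; exact: set_mem (valP (f u)).
- by rewrite gK; left.
Qed.

End Model.

Section TwoModels.
Variables (Z : set M) (d d' : 'I_n -> R) (X Y : gspace torus).
Hypotheses (bZ : biinvariant Z) (sZ : saturated Z).
Hypotheses (d_inj : injective d) (d'_inj : injective d').
Hypotheses (mX : model Z d X) (mY : model (adjoint_set Z) d' Y).
Let bZ' := biinvariant_adjoint bZ.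
Let sZ' := saturated_adjoint sZ.

Lemma gkm_graph_iso : exists f : gkm_vertex X -> gkm_vertex Y,
  bijective f /\ forall p q, gkm_edge p q <-> gkm_edge (f p) (f q).
Proof.
have [r rK] := choice (vtx_onto bZ sZ mX).
have [r' r'K] := choice (vtx_onto bZ' sZ' mY).
have Kr s : r (vtx sZ mX s) = s by apply: (vtx_inj (sZ := sZ) d_inj (mX := mX)); rewrite rK.
have Kr' s : r' (vtx sZ' mY s) = s by apply: (vtx_inj (sZ := sZ') d'_inj (mX := mY)); rewrite r'K.
exists (fun p => vtx sZ' mY (r p)^-1%g); split.
  exists (fun q => vtx sZ mX (r' q)^-1%g) => p; first by rewrite Kr' invgK rK.
  by rewrite Kr invgK r'K.
move=> p q; rewrite -{1}(rK p) -{1}(rK q); split.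
  move=> /(link_of_edge bZ d_inj)/link_adjoint; exact: edge_of_link.
move=> /(link_of_edge bZ' d'_inj)/link_adjoint; rewrite adjoint_setK !invgK.
exact: edge_of_link.
Qed.

End TwoModels.
End Edges.

(** * Triangular factorisations and charts *)

Section Triangular.
Variables (F : fieldType) (n : nat).
Local Notation M := 'M[F]_n.
Implicit Types (A B L C : M) (x : 'cV[F]_n).

Definition upper A := forall i j : 'I_n, (j < i)%N -> A i j = 0.
Definition lower A := forall i j : 'I_n, (i < j)%N -> A i j = 0.
Definition lowuni L := lower L /\ forall i, L i i = 1.

Lemma upper_det A : upper A -> \det A = \prod_i A i i.
Proof.
move=> uA; rewrite -det_tr det_trig; first by apply: eq_bigr => i _; rewrite mxE.
by apply/is_trig_mxP => i j ij; rewrite mxE uA.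
Qed.

Lemma lower_det A : lower A -> \det A = \prod_i A i i.
Proof. by move=> lA; rewrite det_trig//; apply/is_trig_mxP. Qed.

Lemma lowuni_unit L : lowuni L -> L \in unitmx.
Proof.
by move=> [lL L1]; rewrite unitmxE unitfE lower_det// big1 ?oner_eq0.
Qed.

Lemma upper_solve C x a : upper C -> (forall i, C i i != 0) ->
  (forall i : 'I_n, (a <= i)%N -> (C *m x) i ord0 = 0) ->
  forall i : 'I_n, (a <= i)%N -> x i ord0 = 0.
Proof.
move=> uC C0 h; suff H m (i : 'I_n) : (n - i <= m)%N -> (a <= i)%N -> x i ord0 = 0.
  by move=> i; exact: (H n i (leq_subr _ _)).
elim: m i => [|m IH] i nm ai; first by have := ltn_ord i; lia.
have := h i ai; rewrite mxE (bigD1 i)//= big1 ?addr0 => [/eqP|k ki].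
  by rewrite mulf_eq0 (negPf (C0 i)) => /eqP.
have [ik|] := ltnP i k; first by rewrite IH ?mulr0//; have := ltn_ord k; lia.
by rewrite leq_eqVlt (inj_eq val_inj) (negPf ki) /= => /uC ->; rewrite mul0r.
Qed.

Lemma lower_solve L x a : lower L -> (forall i, L i i != 0) ->
  (forall i : 'I_n, (i < a)%N -> (L *m x) i ord0 = 0) ->
  forall i : 'I_n, (i < a)%N -> x i ord0 = 0.
Proof.
move=> lL L0 h; suff H m (i : 'I_n) : (i < m)%N -> (i < a)%N -> x i ord0 = 0.
  by move=> i; exact: (H i.+1 i (leqnn _)).
elim: m i => [//|m IH] i im ia.
have := h i ia; rewrite mxE (bigD1 i)//= big1 ?addr0 => [/eqP|k ki].
  by rewrite mulf_eq0 (negPf (L0 i)) => /eqP.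
have [ki'|] := ltnP k i; first by rewrite IH ?mulr0//; lia.
by rewrite leq_eqVlt (inj_eq val_inj) eq_sym (negPf ki) /= => /lL ->; rewrite mul0r.
Qed.

Lemma mulmx_col A B i j : (A *m B) i j = (A *m col j B) i ord0.
Proof. by rewrite !mxE; apply: eq_bigr => k _; rewrite mxE. Qed.

Lemma upper_quotient C A B : upper C -> (forall i, C i i != 0) -> upper B ->
  C *m A = B -> upper A.
Proof.
move=> uC C0 uB E i j ji.
have := @upper_solve C (col j A) j.+1 uC C0 _ i ji; rewrite mxE; apply=> k jk.
by rewrite -mulmx_col E uB.
Qed.

Lemma lower_quotient L A B : lower L -> (forall i, L i i != 0) -> lower B ->
  L *m A = B -> lower A.
Proof.
move=> lL L0 lB E i j ij.
have := @lower_solve L (col j A) j lL L0 _ i ij; rewrite mxE; apply=> k kj.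
by rewrite -mulmx_col E lB.
Qed.

Lemma upper_mul A B : upper A -> upper B -> upper (A *m B).
Proof.
move=> uA uB i j ji; rewrite mxE big1// => k _.
have [ki|ik] := ltnP k i; first by rewrite uA ?mul0r.
by rewrite uB ?mulr0//; exact: leq_trans ik.
Qed.

Lemma upper_mul_diag A B i : upper A -> upper B -> (A *m B) i i = A i i * B i i.
Proof.
move=> uA uB; rewrite mxE (bigD1 i)//= big1 ?addr0// => k ki.
have [ik|] := ltnP i k; first by rewrite uB ?mulr0.
by rewrite leq_eqVlt (inj_eq val_inj) (negPf ki) /= => /uA ->; rewrite mul0r.
Qed.

Lemma lower_mul_diag A B i : lower A -> lower B -> (A *m B) i i = A i i * B i i.
Proof.
move=> lA lB; rewrite mxE (bigD1 i)//= big1 ?addr0// => k ki.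
have [ik|] := ltnP i k; first by rewrite lA ?mul0r.
by rewrite leq_eqVlt (inj_eq val_inj) (negPf ki) /= => /lB ->; rewrite mulr0.
Qed.

Lemma upper_unit C : upper C -> (C \in unitmx) = [forall i, C i i != 0].
Proof.
move=> uC; rewrite unitmxE unitfE upper_det//.
by apply/prodf_neq0/forallP => h i; [exact: h|move=> _; exact: h].
Qed.

(** The inverse through the adjugate is visibly rational in the entries, whence its continuity. *)
Definition ainv A := (\det A)^-1 *: \adj A.

Lemma mulmx_ainv A : \det A != 0 -> A *m ainv A = 1%:M.
Proof. by move=> dA; rewrite /ainv -scalemxAr mul_mx_adj scale_scalar_mx mulVf. Qed.

Lemma ainv_mulmx A : \det A != 0 -> ainv A *m A = 1%:M.
Proof. by move=> dA; apply: mulmx1C; exact: mulmx_ainv. Qed.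

(** The leading k x k block, padded by the identity so that all leading blocks have the same
    type. *)
Definition lead k A : M :=
  \matrix_(i, j) if (i < k)%N && (j < k)%N then A i j else (i == j)%:R.

Lemma lead_neq0 k A :
  (forall x, (forall a : 'I_n, (k <= a)%N -> x a ord0 = 0) ->
     (forall a : 'I_n, (a < k)%N -> (A *m x) a ord0 = 0) -> x = 0) -> \det (lead k A) != 0.
Proof.
move=> h; rewrite -det_tr; apply/negP => /det0P[v v0 vA]; move/negP: v0; apply.
have Av : lead k A *m v^T = 0 by rewrite -[lead k A]trmxK -trmx_mul vA trmx0.
have vk (a : 'I_n) : (k <= a)%N -> v^T a ord0 = 0.
  move=> ka; have /matrixP/(_ a ord0) := Av; rewrite [RHS]mxE mxE (bigD1 a)//= big1 ?addr0.
    by rewrite mxE ltnNge ka eqxx mul1r.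
  by move=> b ba; rewrite mxE ltnNge ka eq_sym (negPf ba) mul0r.
apply/eqP/trmx_inj; rewrite trmx0; apply: (h _ vk) => a ak.
have /matrixP/(_ a ord0) := Av; rewrite [RHS]mxE => <-; rewrite [LHS]mxE [RHS]mxE; apply: eq_bigr => b _.
rewrite [lead _ _ _ _]mxE ak /=; have [//|kb] := ltnP b k.
by have -> := vk b kb; rewrite !mulr0.
Qed.

(* The LU factorisation g = L C^-1 *)
Record lu (g L C : M) : Prop := LU {
  lu_lowuni : lowuni L;
  lu_upper : upper C;
  lu_diag : forall i, C i i != 0;
  lu_mul : g *m C = L
}.

(* Column [k] solves the [k.+1]-th leading block, so that [g *m cmx g] is lower *)
(* unitriangular.                                                              *)
Definition cmx A : M := \matrix_(i, k) ainv (lead k.+1 A) i k.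

Lemma cmx_lu g : (forall k, \det (lead k g) != 0) -> lu g (g *m cmx g) (cmx g).
Proof.
move=> dg; have lE (k i : 'I_n) : \sum_l lead k.+1 g i l * cmx g l k = (i == k)%:R.
  have /matrixP/(_ i k) := mulmx_ainv (dg k.+1); rewrite !mxE => <-.
  by apply: eq_bigr => l _; rewrite !mxE.
have uC : upper (cmx g).
  move=> i k ki; have := lE k i.
  have -> : (i == k) = false by apply/eqP => ik; rewrite ik ltnn in ki.
  rewrite (bigD1 i)//= big1 ?addr0 => [|l li].
    by rewrite mxE ltnS [(i <= k)%N]leqNgt ki eqxx mul1r.
  by rewrite mxE ltnS [(i <= k)%N]leqNgt ki eq_sym (negPf li) mul0r.
have gC (i k : 'I_n) : (i <= k)%N -> (g *m cmx g) i k = (i == k)%:R.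
  move=> ik; rewrite mxE -lE; apply: eq_bigr => l _.
  have [kl|lk] := ltnP k l; first by rewrite uC// !mulr0.
  by rewrite [lead _ _ _ _]mxE !ltnS ik lk.
have lL : lowuni (g *m cmx g).
  split=> [i k ik|i]; last by rewrite gC// eqxx.
  by rewrite gC 1?ltnW//; case: eqP => // E; rewrite E ltnn in ik.
split=> // i.
have : cmx g \in unitmx.
  by have := lowuni_unit lL; rewrite unitmx_mul => /andP[].
by rewrite upper_unit// => /forallP.
Qed.

Lemma lu_unit g L C : lu g L C -> C \in unitmx.
Proof. by move=> [_ uC C0 _]; rewrite upper_unit//; apply/forallP. Qed.

Lemma lu_lead g L C : lu g L C -> forall k, \det (lead k g) != 0.
Proof.
move=> H k; have [[lL L1] uC C0 gC] := H; apply: lead_neq0 => x xk gx.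
have Cu := lu_unit H; pose u := invmx C *m x; have Cux : C *m u = x by rewrite mulKVmx.
have uk (i : 'I_n) : (k <= i)%N -> u i ord0 = 0.
  by apply: upper_solve uC C0 _ i => j; rewrite Cux; exact: xk.
have uk' (i : 'I_n) : (i < k)%N -> u i ord0 = 0.
  apply: (lower_solve lL) => [j|j jk]; first by rewrite L1 oner_eq0.
  by rewrite -gC -mulmxA Cux gx.
suff u0 : u = 0 by rewrite -Cux u0 mulmx0.
by apply/colP => i; rewrite [RHS]mxE; case: (ltnP i k) => [/uk'|/uk].
Qed.

(** The quotient C^-1 C' is upper triangular, and it equals L^-1 L', which is lower triangular with
    unit diagonal. *)
Lemma lu_unique g L C L' C' : lu g L C -> lu g L' C' -> L = L' /\ C = C'.
Proof.
move=> H H'; have [[lL L1] uC C0 gC] := H; have [[lL' L1'] uC' C0' gC'] := H'.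
have L0 i : L i i != 0 by rewrite L1 oner_eq0.
pose W := invmx C *m C'; have CW : C *m W = C' by rewrite mulKVmx// (lu_unit H).
have LW : L *m W = L' by rewrite -gC -mulmxA CW.
have uW := upper_quotient uC C0 uC' CW; have lW := lower_quotient lL L0 lL' LW.
have W1 : W = 1%:M.
  apply/matrixP => i j; rewrite [RHS]mxE; have [->|ij] := eqVneq i j.
    by have := L1' j; rewrite -LW lower_mul_diag// L1 mul1r => ->.
  have : (i != j :> nat) by [].
  by rewrite neq_ltn => /orP[/lW|/uW].
by rewrite -LW -CW W1 !mulmx1.
Qed.

Lemma lu_upper_mul g L C B : lu g L C -> upper B -> B \in unitmx ->
  lu (g *m invmx B) L (B *m C).
Proof.
move=> H uB Bu; have [lL uC C0 gC] := H; split=> //; first exact: upper_mul.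
  move=> i; rewrite upper_mul_diag// mulf_neq0//.
  by move: Bu; rewrite upper_unit// => /forallP.
by rewrite mulmxA mulmxKV.
Qed.

(** The zero pattern is a condition on the standard flag, which upper triangular matrices preserve.
    Column j of A C uses columns q <= j of A only, and these vanish below row h j because h q <= h
    j. *)
Lemma upper_hessenberg C A B (h : 'I_n -> 'I_n) :
  (forall i j : 'I_n, (i <= j)%N -> (h i <= h j)%N) -> upper C -> (forall i, C i i != 0) ->
  (forall i j : 'I_n, (h j < i)%N -> A i j = 0) -> C *m B = A *m C ->
  forall i j : 'I_n, (h j < i)%N -> B i j = 0.
Proof.
move=> hm uC C0 hA E i j hji.
have := @upper_solve C (col j B) (h j).+1 uC C0 _ i hji; rewrite mxE; apply=> k hk.
rewrite -mulmx_col E mxE big1// => q _; have [qj|jq] := leqP q j.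
  by rewrite hA ?mul0r//; exact: leq_ltn_trans (hm _ _ qj) hk.
by rewrite uC ?mulr0.
Qed.

Section Eigen.
Variables (del : 'I_n -> F) (del_inj : injective del).
Local Notation D := (diag_mx (\row_j del j) : M).

Lemma conj_lower L B : lowuni L -> L *m B = D *m L -> lower B /\ forall i, B i i = del i.
Proof.
move=> [lL L1] E; have L0 i : L i i != 0 by rewrite L1 oner_eq0.
have lDL : lower (D *m L) by move=> i j ij; rewrite mul_diag_mx !mxE lL ?mulr0.
have lB := lower_quotient lL L0 lDL E; split=> // i.
have /matrixP/(_ i i) := E; rewrite lower_mul_diag// mul_diag_mx !mxE L1.
by rewrite mul1r mulr1.
Qed.

(* Row [i] of L is the left eigenvector of [A] for [del i] with [i]-th entry 1:  *)
(* it is the solution of x (A - del_i + E_ii) = e_i.                           *)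
Definition eigen_mx A i : M :=
  \matrix_(a, b) (A a b - (a == b)%:R * del i + ((a == i) && (b == i))%:R).
Definition eigen_rows A : M := \matrix_(i, j) ainv (eigen_mx A i) i j.

Lemma eigen_mx_det A i : lower A -> (forall i, A i i = del i) -> \det (eigen_mx A i) != 0.
Proof.
move=> lA dA; rewrite lower_det => [|a b ab]; last first.
  rewrite mxE lA// (_ : (a == b) = false); last by apply/eqP => E; rewrite E ltnn in ab.
  rewrite mul0r subrr add0r; case: eqP => //= ai; case: eqP => // bi.
  by rewrite ai bi ltnn in ab.
apply/prodf_neq0 => a _; rewrite mxE dA eqxx mul1r andbb.
have [->|ai] := eqVneq a i; first by rewrite subrr add0r oner_eq0.
by rewrite addr0 subr_eq0 (inj_eq del_inj).
Qed.

Lemma mul_eigen_mx A i (x : 'rV[F]_n) b :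
  (x *m eigen_mx A i) ord0 b = (x *m A) ord0 b - x ord0 b * del i + x ord0 i * (b == i)%:R.
Proof.
rewrite !mxE (eq_bigr (fun a => x ord0 a * A a b - (a == b)%:R * (x ord0 a * del i) +
   (a == i)%:R * (x ord0 a * (b == i)%:R))); last first.
  by move=> a _; rewrite mxE; case: (a == i); case: (b == i); rewrite /= ; ring.
rewrite big_split sumrB /=; congr (_ - _ + _).
  by rewrite (bigD1 b)//= eqxx mul1r big1 ?addr0// => a /negPf ->; rewrite mul0r.
by rewrite (bigD1 i)//= eqxx mul1r big1 ?addr0// => a /negPf ->; rewrite mul0r.
Qed.

(** Entry i of the defining equation gives x_i = 1, because triangularity makes the entry i of x A
    equal to x_i del_i; the equation then reduces to x A = del_i x. *)
Lemma eigen_rowsP A : lower A -> (forall i, A i i = del i) ->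
  lowuni (eigen_rows A) /\ eigen_rows A *m A = D *m eigen_rows A.
Proof.
move=> lA dA.
have lT i : lower (eigen_mx A i).
  move=> a b ab; rewrite mxE lA// (_ : (a == b) = false); last by apply/eqP => E; rewrite E ltnn in ab.
  rewrite mul0r subrr add0r; case: eqP => //= ai; case: eqP => // bi.
  by rewrite ai bi ltnn in ab.
have dT i := eigen_mx_det i lA dA.
have lL : lower (eigen_rows A).
  move=> i j ij; rewrite mxE; have T0 a : eigen_mx A i a a != 0.
    by have := dT i; rewrite lower_det// => /prodf_neq0; apply.
  apply: (lower_quotient (lT i) T0 _ (mulmx_ainv (dT i)) ij) => a b ab.
  by rewrite mxE; case: eqP => // E; rewrite E ltnn in ab.
have rowT i : row i (eigen_rows A) *m eigen_mx A i = delta_mx ord0 i.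
  have -> : row i (eigen_rows A) = row i (ainv (eigen_mx A i)) by apply/rowP => j; rewrite !mxE.
  by rewrite -row_mul ainv_mulmx// row1.
have key i b := mul_eigen_mx A i (row i (eigen_rows A)) b.
have L1 i : eigen_rows A i i = 1.
  have := key i i; rewrite rowT eqxx mulr1 [LHS]mxE !eqxx.
  rewrite (_ : (row i (eigen_rows A) *m A) ord0 i = (eigen_rows A *m A) i i); last first.
    by rewrite -row_mul mxE.
  by rewrite lower_mul_diag// dA !mxE subrr add0r => <-.
split=> //; apply/matrixP => i b; have := key i b.
have rE c : row i (eigen_rows A) ord0 c = eigen_rows A i c by rewrite [LHS]mxE.
rewrite rowT !rE L1 mul1r -row_mul [LHS]mxE eqxx [X in _ = X - _ + _]mxE.
rewrite -{1}[(b == i)%:R]add0r => /addIr/esym/eqP; rewrite subr_eq0 => /eqP ->.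
by rewrite mul_diag_mx [RHS]mxE [X in _ = X * _]mxE mulrC.
Qed.

Lemma eigen_rows_unique A L L' : lower A -> (forall i, A i i = del i) ->
  lowuni L -> lowuni L' -> L *m A = D *m L -> L' *m A = D *m L' -> L = L'.
Proof.
move=> lA dA [lL L1] [lL' L1'] E E'; apply/row_matrixP => i; apply/eqP; rewrite -subr_eq0; apply/eqP.
set x := row i L - row i L'; have T := mulmx_ainv (eigen_mx_det i lA dA).
suff xT : x *m eigen_mx A i = 0 by rewrite -[x]mulmx1 -T mulmxA xT mul0mx.
apply/rowP => b; rewrite mul_eigen_mx [RHS]mxE.
have xi : x ord0 i = 0 by rewrite !mxE L1 L1' subrr.
have -> : (x *m A) ord0 b = x ord0 b * del i.
  by rewrite mulmxBl -!row_mul E E' !mul_diag_mx !mxE mulrBl ![del i * _]mulrC.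
by rewrite xi mul0r addr0 subrr.
Qed.

End Eigen.
End Triangular.

(** * Gram-Schmidt and the charts of the big cell *)

Section QR.
Variables (R : realType) (n : nat).
Local Notation C := R[i].
Local Notation M := 'M[C]_n.
Local Notation torus := (torus R n).

Lemma adjoint_mul_self (x : 'cV[C]_n) : x^t* *m x = 0 -> x = 0.
Proof.
move=> /matrixP/(_ ord0 ord0); rewrite [LHS]mxE [RHS]mxE => h; apply/colP => i.
have := h; under eq_bigr do rewrite !mxE mulrC -normCK.
move/psumr_eq0P => /(_ (fun i _ => exprn_ge0 2 (normr_ge0 _)) i isT)/eqP.
by rewrite expf_eq0 normr_eq0 /= mxE => /eqP.
Qed.

Lemma gram_lead (A : M) k : A \in unitmx -> \det (lead k (A^t* *m A)) != 0.
Proof.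
move=> uA; apply: lead_neq0 => x xk gx.
suff Ax : A *m x = 0 by rewrite -(mulKmx uA x) Ax mulmx0.
apply: adjoint_mul_self; rewrite adjointM -mulmxA [A^t* *m _]mulmxA.
apply/matrixP => i j; rewrite (ord1 i) (ord1 j) [RHS]mxE mxE big1// => a _.
have [ak|ka] := ltnP a k; first by rewrite gx ?mulr0.
by rewrite !mxE (xk a ka) rmorph0 mul0r.
Qed.

Lemma adjointE p q (A : 'M[C]_(p, q)) i j : (A^t*) i j = Num.conj (A j i).
Proof. by rewrite !mxE. Qed.

(** QR factorisation with the triangular factor on the side of A: B is the inverse of the usual R
    factor. *)
Record qr (A Q B : M) : Prop := QR {
  qr_unitary : Q \is unitarymx;
  qr_upper : upper B;
  qr_diag : forall i, 0 < B i i;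
  qr_mul : A *m B = Q
}.

(** Gram-Schmidt in closed form: the triangular factor of the Gram matrix orthogonalises the
    columns, and [norm_mx] normalises them. Continuity follows from the formula. *)
Definition gram_mx (A : M) : M := cmx (A^t* *m A).
Definition norm_mx (A : M) : M :=
  diag_mx (\row_j ((Num.sqrt (complex.Re (gram_mx A j j)))^-1)%:C).
Definition qmx (A : M) : M := A *m gram_mx A *m norm_mx A.

(** The Gram matrix of A B equals B^* L, a product of lower triangular matrices; being hermitian, it
    is diagonal. *)
Lemma gram_diag (A B L : M) : A^t* *m A *m B = L -> lowuni L -> upper B ->
  (forall i, B i i != 0) ->
  (forall i, 0 < B i i) /\ forall i j, ((A *m B)^t* *m (A *m B)) i j = B i i *+ (i == j).
Proof.
move=> GL [lL L1] uB B0; set P := _ *m _.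
have PE : P = B^t* *m L by rewrite /P adjointM -GL !mulmxA.
have Pup (i j : 'I_n) : (i < j)%N -> P i j = 0.
  move=> ij; rewrite PE mxE big1// => a _; have [ia|ai] := ltnP i a.
    by rewrite adjointE uB// rmorph0 mul0r.
  by rewrite [L a j]lL ?mulr0//; exact: leq_ltn_trans ij.
have Ph i j : P i j = Num.conj (P j i).
  by rewrite -adjointE; congr (fun_of_matrix _ i j); rewrite /P [RHS]adjointM trmxCK.
have Pd i : P i i = Num.conj (B i i).
  rewrite PE mxE (bigD1 i)//= L1 big1 ?addr0 => [|a ai].
    by rewrite adjointE mulr1.
  have [ia|] := ltnP i a; first by rewrite adjointE uB// rmorph0 mul0r.
  rewrite leq_eqVlt (inj_eq val_inj) (negPf ai) /= => ai'.
  by rewrite [L a i]lL ?mulr0.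
have Pge i : 0 <= P i i.
  by rewrite mxE sumr_ge0// => a _; rewrite adjointE mulrC -normCK exprn_ge0.
have Bge i : 0 <= B i i by rewrite -conjC_ge0 -Pd.
split=> [i|i j]; first by rewrite lt_def B0 Bge.
have [<-|ij] := eqVneq i j; first by rewrite Pd geC0_conj.
have : (i != j :> nat) by [].
by rewrite neq_ltn => /orP[/Pup|/Pup E]; [move=> ->|rewrite Ph E rmorph0].
Qed.

Lemma qmx_qr A : A \in unitmx -> qr A (qmx A) (gram_mx A *m norm_mx A).
Proof.
move=> uA; have [lL uB B0 GB] := cmx_lu (fun k => gram_lead k uA).
have [Bpos OO] := gram_diag erefl lL uB B0; rewrite -/(gram_mx A) in uB Bpos OO.
have nuE i j : norm_mx A i j =
    ((Num.sqrt (complex.Re (gram_mx A j j)))^-1)%:C *+ (i == j).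
  by rewrite /norm_mx mxE; have [->|] := eqVneq i j; rewrite ?mulr0n// !mulr1n mxE.
rewrite /qmx; move: {lL B0 GB} (norm_mx A) (gram_mx A) nuE uB Bpos OO => N B nuE uB Bpos OO.
have Bre i : B i i = (complex.Re (B i i))%:C.
  by have := Bpos i; rewrite ltcE => /andP[/eqP + _]; case: (B i i) => a b /= ->.
have Rpos i : 0 < complex.Re (B i i) by have := Bpos i; rewrite {1}Bre ltcR.
pose nu i : C := ((Num.sqrt (complex.Re (B i i)))^-1)%:C.
have nupos i : 0 < nu i by rewrite ltcR invr_gt0 sqrtr_gt0.
have {}nuE i j : N i j = nu j *+ (i == j) := nuE i j.
have BN (X : M) i j : (X *m N) i j = X i j * nu j.
  rewrite mxE (bigD1 j)//= big1 ?addr0 => [|k kj].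
    by rewrite nuE eqxx mulr1n.
  by rewrite nuE (negPf kj) mulr0n mulr0.
have NB (X : M) i j : (N^t* *m X) i j = nu i * X i j.
  rewrite mxE (bigD1 i)//= big1 ?addr0 => [|k ki].
    by rewrite adjointE nuE eqxx mulr1n geC0_conj ?ltW.
  by rewrite adjointE nuE (negPf ki) mulr0n rmorph0 mul0r.
have uN : upper N.
  by move=> i j ji; rewrite nuE; case: eqP => // E; rewrite E ltnn in ji.
split.
- suff E : (A *m B *m N)^t* *m (A *m B *m N) = 1%:M by apply/unitarymxP; rewrite (mulmx1C E).
  rewrite adjointM -mulmxA; apply/matrixP => i j.
  rewrite NB mulmxA BN OO mxE; have [->|_] := eqVneq i j; last by rewrite mulr0n mul0r mulr0.
  rewrite !mulr1n Bre /nu -!rmorphM mulrCA -invfM -expr2 sqr_sqrtr ?ltW//.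
  by rewrite mulfV ?gt_eqF.
- exact: upper_mul.
- by move=> i; rewrite BN mulr_gt0.
- by rewrite mulmxA.
Qed.

(** The unitary matrix Q^* U is a quotient of upper triangular matrices, and so is its adjoint;
    hence it is diagonal. *)
Lemma triangular_torus A Q U B B' : A \in unitmx -> Q \is unitarymx -> U \is unitarymx ->
  upper B -> (forall i, B i i != 0) -> upper B' -> (forall i, B' i i != 0) ->
  A *m B = Q -> A *m B' = U ->
  exists t : torus, torus_mx t = Q^t* *m U /\ B *m torus_mx t = B'.
Proof.
move=> uA uQ uU uB B0 uB' B0' AB AB'; pose W := Q^t* *m U.
have cancelA X Y : A *m X = A *m Y -> X = Y by move=> E; rewrite -(mulKmx uA X) E mulKmx.
have BW : B *m W = B'.
  by apply: cancelA; rewrite mulmxA AB /W mulmxA (adjointMV uQ) mul1mx AB'.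
have WB : B' *m W^t* = B.
  by apply: cancelA; rewrite mulmxA AB' /W adjointM trmxCK mulmxA (adjointMV uU) mul1mx AB.
have uW := upper_quotient uB B0 uB' BW; have lW := upper_quotient uB' B0' uB WB.
have dW : is_diag_mx W.
  apply/is_diag_mxP => i j; rewrite neq_ltn => /orP[ij|]; last exact: uW.
  by have := lW j i ij; rewrite adjointE => /eqP; rewrite conjC_eq0 => /eqP.
have UW : W \is unitarymx := mul_unitarymx (etrans (trmxC_unitary _) uQ) uU.
have WP : is_diag_mx W && (W \is unitarymx) by rewrite dW.
by exists (Torus WP).
Qed.

Lemma qr_unique A Q B Q' B' : A \in unitmx -> qr A Q B -> qr A Q' B' -> Q = Q'.
Proof.
move=> uA [uQ uB B0 AB] [uQ' uB' B0' AB'].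
have [|i|t [tE tB]] := triangular_torus uA uQ uQ' uB _ uB' _ AB AB'.
- by move=> i; rewrite gt_eqF.
- by rewrite gt_eqF.
suff t1 : torus_mx t = 1%:M.
  by rewrite -[Q']mul1mx -(adjointMV uQ) -mulmxA -tE t1 mulmx1.
apply/matrixP => i j; rewrite mxE; have [<-|ij] := eqVneq i j; last by rewrite torus_offdiag.
have ti : B i i * t i i = B' i i.
  rewrite -tB mxE (bigD1 i)//= big1 ?addr0// => k ki.
  by rewrite torus_offdiag ?mulr0.
have t0 : 0 < t i i by have := B0' i; rewrite -ti pmulr_rgt0.
by have := torus_norm t i; rewrite ger0_norm ?ltW.
Qed.

Lemma mx_gact_mul (t : torus) (A B : M) : mx_gact t (A *m B) = mx_gact t A *m mx_gact t B.
Proof. by rewrite /mx_gact !mulmxA mulmxKV ?torus_unit. Qed.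

Lemma mx_gact_lowuni (t : torus) A : lowuni A -> lowuni (mx_gact t A).
Proof.
move=> [lA A1]; split=> [i j ij|i]; rewrite mx_gactE; first by rewrite lA// mulr0 mul0r.
by rewrite A1 mulr1 -normCK torus_norm expr1n.
Qed.

Lemma mx_gact_upper (t : torus) A : upper A -> upper (mx_gact t A).
Proof. by move=> uA i j ij; rewrite mx_gactE uA// mulr0 mul0r. Qed.

Lemma mx_gact_diagE (t : torus) A i : mx_gact t A i i = A i i.
Proof. by rewrite mx_gactE mulrAC -normCK torus_norm expr1n mul1r. Qed.

Lemma mx_gact_unitary (t : torus) A : A \is unitarymx -> mx_gact t A \is unitarymx.
Proof.
move=> uA; have [_ ut] := andP (torusP t); have [_ ut'] := andP (torusP t^-1%g).
exact: mul_unitarymx (mul_unitarymx ut uA) ut'.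
Qed.

Lemma mx_gact_unit (t : torus) A : A \in unitmx -> mx_gact t A \in unitmx.
Proof.
move=> uA; have ut := torus_unit t; have ut' := torus_unit t^-1%g.
by rewrite /mx_gact unitmx_mul unitmx_mul ut uA ut'.
Qed.

Lemma qmx_gact (t : torus) A : A \in unitmx -> qmx (mx_gact t A) = mx_gact t (qmx A).
Proof.
move=> uA; have [uQ uB B0 AB] := qmx_qr uA; have utA := mx_gact_unit t uA.
apply: (qr_unique utA (qmx_qr utA) (B' := mx_gact t (gram_mx A *m norm_mx A))).
split; [exact: mx_gact_unitary|exact: mx_gact_upper| |by rewrite -mx_gact_mul AB].
by move=> i; rewrite mx_gact_diagE.
Qed.

Section Chart.
Variables (del : 'I_n -> R) (del_inj : injective del).
Variables (h : 'I_n -> 'I_n) (h_mono : forall i j : 'I_n, (i <= j)%N -> (h i <= h j)%N).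
Local Notation D := (real_diag del).
Local Notation L_ N := (eigen_rows (fun i => (del i)%:C) N).

Let delC_inj : injective (fun i => (del i)%:C : C).
Proof. by move=> i j /complexI/del_inj. Qed.

Let DE : diag_mx (\row_j (del j)%:C) = D. Proof. by []. Qed.

Definition hess (A : M) := forall i j : 'I_n, (h j < i)%N -> A i j = 0.

Definition cell_space : set M :=
  [set N | [/\ lower N, forall i, N i i = (del i)%:C & hess N]].

Definition big_cell : set M := [set g | forall k : 'I_n.+1, \det (lead k g) != 0].

Lemma big_cellP g : big_cell g -> forall k, \det (lead k g) != 0.
Proof.
move=> cg k; have [kn|nk] := ltnP k n.+1; first exact: (cg (Ordinal kn)).
have := cg ord_max; rewrite (_ : lead k g = lead (ord_max : 'I_n.+1) g)//.
apply/matrixP => i j; rewrite !mxE !ltn_ord /=.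
by rewrite !(leq_trans _ (ltnW nk)).
Qed.

Lemma lu_big_cell g L B : lu g L B -> big_cell g.
Proof. by move=> H k; exact: (lu_lead H). Qed.

Definition lmx (g : M) := g *m cmx g.
(** This is L^-1 D L, the adjugate being the inverse because det L = 1. It depends on L alone and so
    is invariant under right multiplication by the torus. *)
Definition mchart (g : M) : M := \adj (lmx g) *m D *m lmx g.
(** The diagonal phases by which g differs from the Gram-Schmidt representative of its right torus
    coset. Conjugating [mchart] by them makes [xchart] invariant under left multiplication
    instead. *)
Definition tchart (g : M) : M := (qmx (lmx g))^t* *m g.
Definition xchart (g : M) : M := (tchart g)^t* *m mchart g *m tchart g.
Definition csection (N : M) : M := qmx (L_ N).

Lemma big_cell_lu g : big_cell g -> lu g (lmx g) (cmx g).
Proof. by move=> cg; apply: cmx_lu; exact: big_cellP. Qed.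

Lemma lu_lmx g L B : lu g L B -> lmx g = L.
Proof. by move=> H; have [] := lu_unique (big_cell_lu (lu_big_cell H)) H. Qed.

Lemma lowuni_adj (L : M) : lowuni L -> \adj L *m L = 1%:M.
Proof. by move=> [lL L1]; rewrite mul_adj_mx lower_det// big1. Qed.

Lemma mchartE g L B N : lu g L B -> L *m N = D *m L -> mchart g = N.
Proof.
move=> H E; rewrite /mchart (lu_lmx H) -mulmxA -E mulmxA lowuni_adj ?mul1mx//.
by case: H.
Qed.

Lemma lmx_mchart g : big_cell g -> lmx g *m mchart g = D *m lmx g.
Proof.
move=> cg; have [lL _ _ _] := big_cell_lu cg.
by rewrite /mchart !mulmxA (mulmx1C (lowuni_adj lL)) mul1mx.
Qed.

Lemma unitary_conj_solve (g A N D' : M) : g \is unitarymx ->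
  g *m A *m N = D' *m (g *m A) -> A *m N = g^t* *m D' *m g *m A.
Proof.
move=> ug E; have VU := adjointVM ug; transitivity (g^t* *m (g *m A *m N)).
  by rewrite !mulmxA VU mul1mx.
by rewrite E !mulmxA.
Qed.

(** As L^-1 D L the matrix is lower triangular; as C^-1 (g^* D g) C with C upper triangular it keeps
    the Hessenberg zeros. *)
Lemma mchart_cell g : g \is unitarymx -> big_cell g -> hess (g^t* *m D *m g) ->
  cell_space (mchart g).
Proof.
move=> ug cg hg; have [lL uC C0 gC] := big_cell_lu cg.
have E := lmx_mchart cg; have [lN dN] := conj_lower lL E.
split=> //; apply: (upper_hessenberg h_mono uC C0 hg).
exact: (unitary_conj_solve ug E).
Qed.

Lemma tchart_torus g : g \is unitarymx -> big_cell g ->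
  exists t : torus, torus_mx t = tchart g /\ qmx (lmx g) *m torus_mx t = g.
Proof.
move=> ug cg; have H := big_cell_lu cg; have [lL uC C0 gC] := H.
have uL := lowuni_unit lL; have [uQ uB B0 AB] := qmx_qr uL; have uC' := lu_unit H.
have CV : cmx g *m invmx (cmx g) = 1%:M by rewrite mulmxV.
have uV : upper (invmx (cmx g)).
  by apply: upper_quotient uC C0 _ CV => i j ji; rewrite mxE; case: eqP => // E; rewrite E ltnn in ji.
have V0 i : invmx (cmx g) i i != 0.
  have := upper_mul_diag i uC uV; rewrite CV mxE eqxx => /esym/eqP.
  by apply: contraTneq => ->; rewrite mulr0 eq_sym oner_eq0.
have Lg : lmx g *m invmx (cmx g) = g by rewrite /lmx -mulmxA CV mulmx1.
have B0' i : (gram_mx (lmx g) *m norm_mx (lmx g)) i i != 0 by rewrite gt_eqF.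
have [t [tE _]] := triangular_torus uL uQ ug uB B0' uV V0 AB Lg.
by exists t; split=> //; rewrite tE mulmxA (adjointMV uQ) mul1mx.
Qed.

(** The factor L is recovered from its chart as the matrix of normalised left eigenvectors. *)
Lemma csection_mchart g : g \is unitarymx -> big_cell g -> hess (g^t* *m D *m g) ->
  csection (mchart g) = qmx (lmx g).
Proof.
move=> ug cg hg; have [lN dN _] := mchart_cell ug cg hg; congr qmx.
have [lL LN] := eigen_rowsP delC_inj lN dN; have [lL' _ _ _] := big_cell_lu cg.
exact: (eigen_rows_unique delC_inj lN dN lL lL' LN (lmx_mchart cg)).
Qed.

Lemma mx_gact_D (t : torus) : mx_gact t D = D.
Proof.
apply/matrixP => i j; have [->|ij] := eqVneq i j; first by rewrite mx_gact_diagE.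
by rewrite mx_gactE !mxE (negPf ij) mulr0n mulr0 mul0r.
Qed.

Lemma cell_space_gact (t : torus) N : cell_space N -> cell_space (mx_gact t N).
Proof.
move=> [lN dN hN]; split=> [i j ij|i|i j ij].
- by rewrite mx_gactE lN// mulr0 mul0r.
- by rewrite mx_gact_diagE.
- by rewrite mx_gactE hN// mulr0 mul0r.
Qed.

Lemma csection_gact (t : torus) N : cell_space N -> csection (mx_gact t N) = mx_gact t (csection N).
Proof.
move=> cN; have [lN dN _] := cN; have [lN' dN' _] := cell_space_gact t cN.
have [lL LN] := eigen_rowsP delC_inj lN dN; have [lL' LN'] := eigen_rowsP delC_inj lN' dN'.
have uL := lowuni_unit lL; rewrite /csection -(qmx_gact t uL).
have E : mx_gact t (L_ N) *m mx_gact t N = D *m mx_gact t (L_ N).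
  rewrite -[LHS]mx_gact_mul LN mx_gact_mul.
  exact: (congr1 (fun X => X *m mx_gact t (L_ N)) (mx_gact_D t)).
by rewrite (eigen_rows_unique delC_inj lN' dN' lL' (mx_gact_lowuni t lL) LN' E).
Qed.

Lemma xchartE g (t : torus) : torus_mx t = tchart g -> xchart g = mx_gact t^-1%g (mchart g).
Proof. by move=> E; rewrite /xchart /mx_gact -E torus_adjoint /= -[invmx (invmx _)]/(torus_mx t^-1^-1%g) invgK. Qed.

Lemma xchart_cell g : g \is unitarymx -> big_cell g -> hess (g^t* *m D *m g) ->
  cell_space (xchart g) /\ exists t : torus, csection (xchart g) = torus_mx t *m g.
Proof.
move=> ug cg hg; have [t [tE tg]] := tchart_torus ug cg; have cM := mchart_cell ug cg hg.
rewrite (xchartE tE); split; first exact: cell_space_gact.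
exists t^-1%g; rewrite csection_gact// csection_mchart// -{2}tg /mx_gact mulmxA.
by rewrite -[invmx (torus_mx t^-1%g)]/(torus_mx t^-1^-1%g) invgK.
Qed.

Lemma csectionP N : cell_space N ->
  [/\ csection N \is unitarymx, exists B, lu (csection N) (L_ N) B,
      hess ((csection N)^t* *m D *m csection N), mchart (csection N) = N &
      xchart (csection N) = N].
Proof.
move=> [lN dN hN]; have [lL LN] := eigen_rowsP delC_inj lN dN.
have uL := lowuni_unit lL; have := qmx_qr uL; rewrite /csection.
have [L LE] : exists L, L = L_ N by exists (L_ N).
rewrite -LE in lL LN uL *; have [g gE] : exists g, g = qmx L by exists (qmx L).
rewrite -gE; move: (gram_mx L *m norm_mx L) => B [ug uB B0 AB].
have B0' i : B i i != 0 by rewrite gt_eqF.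
have Bu : B \in unitmx by rewrite upper_unit//; apply/forallP.
have BV : B *m invmx B = 1%:M by rewrite mulmxV.
have uV : upper (invmx B).
  by apply: upper_quotient uB B0' _ BV => i j ji; rewrite mxE; case: eqP => // E; rewrite E ltnn in ji.
have H : lu g L (invmx B).
  split=> //; last by rewrite -AB mulmxK.
  move=> i; have := upper_mul_diag i uB uV; rewrite BV mxE eqxx => /esym/eqP.
  by apply: contraTneq => ->; rewrite mulr0 eq_sym oner_eq0.
have mE : mchart g = N := mchartE H LN.
split; [exact: ug|by exists (invmx B)| |exact: mE|].
  apply: (upper_hessenberg h_mono uB B0' hN).
  have LB : L *m (N *m B) = L *m (B *m (g^t* *m D *m g)).
    rewrite [LHS]mulmxA LN [RHS]mulmxA AB !mulmxA (adjointMV ug) mul1mx.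
    by rewrite -mulmxA AB.
  by have := congr1 (mulmx (invmx L)) LB; rewrite !(mulKmx uL) => ->.
rewrite /xchart /tchart (lu_lmx H) -gE (adjointVM ug) mulmx1 mE.
by rewrite trmx1 map_mx1 mul1mx.
Qed.

Lemma lu_gact (t : torus) g L B : lu g L B ->
  lu (torus_mx t *m g) (mx_gact t L) (B *m torus_mx t^-1%g).
Proof.
move=> [lL uB B0 gB].
have tE i : (B *m torus_mx t^-1%g) i i = B i i * torus_mx t^-1%g i i.
  rewrite mxE (bigD1 i)//= big1 ?addr0// => k ki; by rewrite (@torus_offdiag _ _ t^-1%g) ?mulr0.
split.
- exact: mx_gact_lowuni.
- move=> i j ji; rewrite mxE big1// => k _; have [->|kj] := eqVneq k j.
    by rewrite uB ?mul0r.
  by rewrite (@torus_offdiag _ _ t^-1%g) ?mulr0.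
- move=> i; rewrite tE mulf_neq0// -normr_gt0.
  by rewrite (torus_norm t^-1%g).
- by rewrite /mx_gact -gB !mulmxA.
Qed.

Lemma lu_gactr (t : torus) g L B : lu g L B ->
  lu (g *m torus_mx t) L (torus_mx t^-1%g *m B).
Proof.
move=> [lL uB B0 gB].
split=> //.
- move=> i j ji; rewrite mxE big1// => k _; have [<-|ki] := eqVneq i k.
    by rewrite uB ?mulr0.
  by rewrite (@torus_offdiag _ _ t^-1%g) ?mul0r.
- move=> i; rewrite mxE (bigD1 i)//= big1 ?addr0 => [|k ki]; last first.
    by rewrite (@torus_offdiag _ _ t^-1%g) ?mul0r// eq_sym.
  by rewrite mulf_neq0// -normr_gt0 (torus_norm t^-1%g).
- by rewrite -gB !mulmxA mulmxK ?torus_unit.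
Qed.

Lemma mchart_right (t : torus) g : big_cell g ->
  big_cell (g *m torus_mx t) /\ mchart (g *m torus_mx t) = mchart g.
Proof.
move=> cg; have H := lu_gactr t (big_cell_lu cg); split; first exact: lu_big_cell H.
by apply: (mchartE H); exact: lmx_mchart.
Qed.

Lemma mx_gact_adjoint (t : torus) A : mx_gact t A = torus_mx t *m A *m (torus_mx t)^t*.
Proof. by rewrite torus_adjoint. Qed.

Lemma unitary_conj_mul (s Q g : M) : s \is unitarymx ->
  (s *m Q *m s^t*)^t* *m (s *m g) = s *m (Q^t* *m g).
Proof.
move=> us; have VU := adjointVM us; rewrite !adjointM trmxCK -!mulmxA.
by rewrite [s^t* *m (s *m g)]mulmxA VU mul1mx.
Qed.

Lemma unitary_conj_cancel (s T A : M) : s \is unitarymx ->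
  (s *m T)^t* *m (s *m A *m s^t*) *m (s *m T) = T^t* *m A *m T.
Proof.
move=> us; have VU := adjointVM us; rewrite adjointM -!mulmxA.
by rewrite [s^t* *m (s *m T)]mulmxA VU mul1mx [s^t* *m (s *m _)]mulmxA VU mul1mx.
Qed.

Lemma xchart_left (t : torus) g : g \is unitarymx -> big_cell g ->
  big_cell (torus_mx t *m g) /\ xchart (torus_mx t *m g) = xchart g.
Proof.
move=> ug cg; have Hg := big_cell_lu cg; have H := lu_gact t Hg.
have ctg := lu_big_cell H; split; first exact: ctg.
have mE : mchart (torus_mx t *m g) = mx_gact t (mchart g).
  by apply: (mchartE H); rewrite -mx_gact_mul lmx_mchart// mx_gact_mul mx_gact_D.
have [_ ut] := andP (torusP t).
have tE : tchart (torus_mx t *m g) = torus_mx t *m tchart g.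
  have uL : lmx g \in unitmx by apply: lowuni_unit; case: Hg.
  rewrite /tchart (lu_lmx H) (qmx_gact t uL) mx_gact_adjoint.
  exact: unitary_conj_mul.
rewrite /xchart tE mE mx_gact_adjoint; exact: unitary_conj_cancel.
Qed.

End Chart.
End QR.

(** * The order of the cells *)

Section Bruhat.
Variables (F : fieldType) (n : nat).
Local Notation M := 'M[F]_n.
Implicit Types (w v : 'S_n) (L N g : M).

Definition prefix_sum w k : nat := \sum_(a < n | (a < k)%N) w a.
(** Comparing all prefix sums is a partial order on permutations, for which this total is strictly
    monotone ([height_inj]). *)
Definition height w : nat := \sum_(k < n.+1) prefix_sum w k.

Lemma prefix_sumS w (k : 'I_n) : prefix_sum w k.+1 = (prefix_sum w k + w k)%N.
Proof.
rewrite /prefix_sum (bigD1 k)//= addnC; congr (_ + _)%N; apply: eq_bigl => a.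
by rewrite ltnS [in RHS]ltn_neqAle andbC.
Qed.

Lemma prefix_sum_inj v w : (forall k : 'I_n.+1, prefix_sum v k = prefix_sum w k) -> v = w.
Proof.
move=> h; apply/permP => k; apply/val_inj/eqP => /=.
have h1 := h (lift ord0 k); have h2 := h (widen_ord (leqnSn n) k).
by rewrite /= /bump add1n !prefix_sumS h2 in h1; rewrite -(eqn_add2l (prefix_sum w k)) h1.
Qed.

Lemma height_inj v w : (forall k : 'I_n.+1, (prefix_sum v k <= prefix_sum w k)%N) ->
  (height w <= height v)%N -> v = w.
Proof.
move=> h vw; apply: prefix_sum_inj => k; apply/eqP; rewrite eqn_leq h /=.
rewrite leqNgt; apply/negP => hk; move: vw; rewrite leqNgt => /negP; apply.
by rewrite /height (bigD1 k)//= [X in (_ < X)%N](bigD1 k)//= -addSn leq_add// leq_sum.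
Qed.

Lemma height_tperm w (i j : 'I_n) : (j < i)%N -> (w j < w i)%N ->
  (height w < height (tperm i j * w)%g)%N.
Proof.
move=> ji wji; set v := (tperm i j * w)%g.
have vj : v j = w i by rewrite permM tpermR.
have vo a : a != i -> a != j -> v a = w a by move=> ai aj; rewrite permM tpermD// eq_sym.
have vge a : a != i -> (w a <= v a)%N.
  by move=> ai; have [->|aj] := eqVneq a j; [rewrite vj ltnW|rewrite vo].
have le k : (prefix_sum w k <= prefix_sum v k)%N.
  have [ik|ki] := ltnP i k; last first.
    by apply: leq_sum => a ak; apply: vge; apply/eqP => ai; move: ak; rewrite ai ltnNge ki.
  rewrite /prefix_sum (reindex_inj (@perm_inj _ (tperm i j))) /=.
  rewrite (eq_bigl (fun a : 'I_n => (a < k)%N)) => [|a]; last first.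
    by case: tpermP => [->|->|//]; rewrite ik (ltn_trans ji ik).
  by apply: leq_sum => a _; rewrite permM.
have jn : (j.+1 < n.+1)%N by rewrite ltnS.
rewrite /height (bigD1 (Ordinal jn))//= [X in (_ < X)%N](bigD1 (Ordinal jn))//= -addSn leq_add//.
  rewrite !prefix_sumS vj -addnS leq_add//.
by apply: leq_sum => k _; exact: le.
Qed.

Lemma det_transversal (A : M) : \det A != 0 -> exists s : 'S_n, forall a, A a (s a) != 0.
Proof.
move=> dA; apply: contrapT => h; move/eqP: dA; apply.
rewrite /determinant big1// => s _.
have [a Aa] : exists a, A a (s a) = 0.
  apply: contrapT => h'; apply: h; exists s => a; apply/eqP => Aa; apply: h'; by exists a.
by rewrite (bigD1 a)//= Aa mul0r mulr0.
Qed.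

(** A nonzero leading minor has a transversal s, which permutes the indices below k and satisfies v
    a <= w (s a) there; summation compares the prefix sums. *)
Lemma lead_transversal L w v :
  (forall i j, L i j != 0 -> (w i <= w j)%N) ->
  (forall k : 'I_n.+1, \det (lead k (row_perm (v * w^-1)%g L)) != 0) ->
  forall k : 'I_n.+1, (prefix_sum v k <= prefix_sum w k)%N.
Proof.
move=> Lw dL k; have [s sP] := det_transversal (dL k).
have sk (a : 'I_n) : (a < k)%N -> (s a < k)%N /\ (v a <= w (s a))%N.
  move=> ak; have := sP a; rewrite mxE ak /=.
  case: (boolP (s a < k)%N) => [sak|nsak].
    by rewrite mxE => /Lw; rewrite permM permKV.
  by case: (boolP (a == s a)) => [/eqP E|]; [move: nsak; rewrite -E ak|rewrite eqxx].
have sk' (a : 'I_n) : ~~ (a < k)%N -> s a = a.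
  move=> ak; have := sP a; rewrite mxE (negPf ak) /=.
  by case: (boolP (a == s a)) => [/eqP|]; [|rewrite eqxx].
rewrite /prefix_sum [leqRHS](reindex_inj (@perm_inj _ s)) /=.
rewrite [leqRHS](eq_bigl (fun a : 'I_n => (a < k)%N)) => [|a]; last first.
  by case: (boolP (a < k)%N) => ak; [have [] := sk a ak|rewrite sk'// (negPf ak)].
by apply: leq_sum => a ak; have [] := sk a ak.
Qed.

Section EigenOrder.
Variables (del : 'I_n -> F) (del_inj : injective del).
Local Notation D := (diag_mx (\row_j del j) : M).
Variables (w : 'S_n) (L N : M).
Hypotheses (lL : lowuni L) (lN : lower N) (dN : forall i, N i i = del i) (LN : L *m N = D *m L).

Let LNE i j : \sum_k L i k * N k j = del i * L i j.
Proof. by have /matrixP/(_ i j) := LN; rewrite mul_diag_mx !mxE. Qed.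

(** For j < i the equation L N = D L writes (del_i - del_j) L_ij as a sum of L_ik N_kj with j < k <=
    i. A nonzero term gives w i <= w k < w j, by induction on i - j. The bound b allows use when
    only entries near the diagonal are controlled. *)
Lemma eigen_order b :
  (forall i j : 'I_n, (j < i)%N -> (i - j < b)%N -> N i j != 0 -> (w i < w j)%N) ->
  forall i j : 'I_n, (i - j < b)%N -> L i j != 0 -> (w i <= w j)%N.
Proof.
move=> Nw; suff H m (i j : 'I_n) : (i - j <= m)%N -> (i - j < b)%N -> L i j != 0 -> (w i <= w j)%N.
  by move=> i j; exact: (H (i - j)%N).
elim: m i j => [|m IH] i j im ib Lij.
  have : (i <= j)%N by lia.
  rewrite leq_eqVlt => /orP[/eqP/val_inj -> //|ij].
  by rewrite lL.1 ?eqxx in Lij.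
have [ij|] := leqP i j.
  by move: ij; rewrite leq_eqVlt => /orP[/eqP/val_inj -> //|/lL.1 E]; rewrite E eqxx in Lij.
move=> ji; have [k [kj Lik Nkj]] : exists k, [/\ k != j, L i k != 0 & N k j != 0].
  apply: contrapT => h; have := LNE i j; rewrite (bigD1 j)//= big1 ?addr0 => [|k kj].
    rewrite dN mulrC => /eqP; rewrite -subr_eq0 -mulrBl mulf_eq0 (negPf Lij) orbF subr_eq0.
    by rewrite (inj_eq del_inj) => /eqP E; move: ji; rewrite E ltnn.
  have [->|Lik] := eqVneq (L i k) 0; first by rewrite mul0r.
  have [->|Nkj] := eqVneq (N k j) 0; first by rewrite mulr0.
  by case: h; exists k.
have jk : (j < k)%N.
  rewrite ltn_neqAle eq_sym (inj_eq val_inj) kj leqNgt; apply/negP => kj'.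
  by rewrite lN ?eqxx in Nkj.
have ki : (k <= i)%N by rewrite leqNgt; apply/negP => ik; rewrite lL.1 ?eqxx in Lik.
apply: leq_trans (ltnW (Nw k j jk _ Nkj)); last by lia.
by apply: IH => //; lia.
Qed.

(** Without bad entries [eigen_order] controls all of L, so the prefix sums of v are at most those
    of w; a height at least as large forces equality. *)
Lemma lead_disjoint v :
  (forall i j : 'I_n, (j < i)%N -> N i j != 0 -> (w i < w j)%N) ->
  (forall k : 'I_n.+1, \det (lead k (row_perm (v * w^-1)%g L)) != 0) ->
  (height w <= height v)%N -> v = w.
Proof.
move=> Nw dL; apply: height_inj; apply: lead_transversal dL => i j.
apply: (@eigen_order n) => [a b ba _|]; first exact: Nw.
by have := ltn_ord i; lia.
Qed.

(** Minimality of i - j controls the entries of L and N closer to the diagonal. Swapping rows i and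
    j changes the first k rows only if j < k <= i. For a kernel vector x of such a block, w a <= w j
    wherever x_a is nonzero, so row i has no term but L_ij x_j; hence x_j = 0, row j vanishes too,
    and x = 0. *)
Lemma lead_tperm (i j : 'I_n) : (j < i)%N -> (w j < w i)%N -> N i j != 0 ->
  (forall p q : 'I_n, (q < p)%N -> (w q < w p)%N -> N p q != 0 -> (i - j <= p - q)%N) ->
  forall k : 'I_n.+1, \det (lead k (row_perm (tperm i j) L)) != 0.
Proof.
move=> ji wji Nij mini k.
have Nw (p q : 'I_n) : (q < p)%N -> (p - q < i - j)%N -> N p q != 0 -> (w p < w q)%N.
  move=> qp pq Npq; rewrite ltnNge; apply/negP; rewrite leq_eqVlt => /orP[/eqP|wqp].
    by move/val_inj/perm_inj => E; rewrite E ltnn in qp.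
  by have := mini p q qp wqp Npq; rewrite leqNgt pq.
have Lw := eigen_order Nw.
(* If L_ij were 0, the equation for (i, j) would leave N_ij plus terms L_ia N_aj with j < a < i; a
   nonzero one would give w i <= w a < w j. *)
have Lij : L i j != 0.
  apply/eqP => L0; move/eqP: Nij; apply.
  have := LNE i j; rewrite L0 mulr0 (bigD1 i)//= lL.2 mul1r big1 ?addr0// => a ai.
  have [->|Lia] := eqVneq (L i a) 0; first by rewrite mul0r.
  have [->|Naj] := eqVneq (N a j) 0; first by rewrite mulr0.
  have [aj|aj] := eqVneq a j; first by rewrite aj L0 mul0r.
  have ia : (a < i)%N.
    rewrite ltn_neqAle (inj_eq val_inj) ai leqNgt; apply/negP => ia.
    by rewrite lL.1 ?eqxx in Lia.
  have ja : (j < a)%N.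
    rewrite ltn_neqAle eq_sym (inj_eq val_inj) aj leqNgt; apply/negP => aj'.
    by rewrite lN ?eqxx in Naj.
  have h1 := Lw i a _ Lia; have h2 := Nw a j ja _ Naj.
  by exfalso; have := h1 ltac:(lia); have := h2 ltac:(lia); lia.
have L0 a : L a a != 0 by rewrite lL.2 oner_eq0.
apply: lead_neq0 => x xk Lx.
have rE a : (row_perm (tperm i j) L *m x) a ord0 = (L *m x) (tperm i j a) ord0.
  by rewrite !mxE; apply: eq_bigr => b _; rewrite mxE.
suff Lx0 : forall a : 'I_n, (a < k)%N -> (L *m x) a ord0 = 0.
  have x0 := lower_solve lL.1 L0 Lx0.
  by apply/colP => a; rewrite [RHS]mxE; case: (ltnP a k) => [/x0|/xk].
have Lxt (a : 'I_n) : (tperm i j a < k)%N -> (L *m x) a ord0 = 0.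
  by move=> ak; have := Lx _ ak; rewrite rE tpermK.
have [ik|ki] := ltnP i k.
  by move=> a ak; apply: Lxt; case: tpermP => [_|_|//]; [exact: ltn_trans ik|].
have [kj|jk] := leqP k j.
  move=> a ak; apply: Lxt; rewrite tpermD//; apply/eqP => E; move: ak; rewrite -E.
    by rewrite ltnNge ki.
  by rewrite ltnNge kj.
have Lxa (a : 'I_n) : (a < k)%N -> a != j -> (L *m x) a ord0 = 0.
  move=> ak aj; apply: Lxt; rewrite tpermD//; last by rewrite eq_sym.
  by apply/eqP => E; move: ak; rewrite -E ltnNge ki.
have Lxi : (L *m x) i ord0 = 0 by apply: Lxt; rewrite tpermL.
have xj (a : 'I_n) : (a < j)%N -> x a ord0 = 0.
  apply: (lower_solve lL.1 L0) => b bj; apply: Lxa; first exact: ltn_trans jk.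
  by apply/eqP => E; rewrite E ltnn in bj.
have xw m (a : 'I_n) : (a < m)%N -> (a < k)%N -> x a ord0 != 0 -> (w a <= w j)%N.
  elim: m a => [//|m IH] a am ak xa.
  have [->//|aj] := eqVneq a j.
  have ja : (j < a)%N.
    rewrite ltn_neqAle eq_sym (inj_eq val_inj) aj leqNgt; apply/negP => /xj E.
    by rewrite E eqxx in xa.
  have [b [ba Lab xb]] : exists b, [/\ b != a, L a b != 0 & x b ord0 != 0].
    apply: contrapT => h; have := Lxa a ak aj.
    rewrite mxE (bigD1 a)//= lL.2 mul1r big1 ?addr0 => [E|b ba]; first by rewrite E eqxx in xa.
    have [->|Lab] := eqVneq (L a b) 0; first by rewrite mul0r.
    have [->|xb] := eqVneq (x b ord0) 0; first by rewrite mulr0.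
    by case: h; exists b.
  have ba' : (b < a)%N.
    rewrite ltn_neqAle (inj_eq val_inj) ba leqNgt; apply/negP => ab.
    by rewrite lL.1 ?eqxx in Lab.
  have jb : (j <= b)%N by rewrite leqNgt; apply/negP => /xj E; rewrite E eqxx in xb.
  apply: leq_trans (IH b _ _ xb); [apply: Lw Lab; lia|lia|lia].
have xj0 : x j ord0 = 0.
  have := Lxi; rewrite mxE (bigD1 j)//= big1 ?addr0 => [/eqP|b bj].
    by rewrite mulf_eq0 (negPf Lij) => /eqP.
  have [->|xb] := eqVneq (x b ord0) 0; first by rewrite mulr0.
  have [->|Lib] := eqVneq (L i b) 0; first by rewrite mul0r.
  have bk : (b < k)%N by rewrite ltnNge; apply/negP => /xk E; rewrite E eqxx in xb.
  have jb : (j < b)%N.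
    rewrite ltn_neqAle eq_sym (inj_eq val_inj) bj leqNgt; apply/negP => /xj E.
    by rewrite E eqxx in xb.
  have h1 := xw n b (ltn_ord b) bk xb; have h2 : (w i <= w b)%N by apply: Lw Lib; lia.
  by exfalso; lia.
move=> a ak; have [->|aj] := eqVneq a j; last exact: Lxa.
rewrite mxE big1// => b _; have [->|bj] := eqVneq b j; first by rewrite xj0 mulr0.
have [bj'|jb] := ltnP b j; first by rewrite xj ?mulr0.
by rewrite lL.1 ?mul0r// ltn_neqAle eq_sym (inj_eq val_inj) bj.
Qed.

Lemma lead_cover :
  (exists i j : 'I_n, [/\ (j < i)%N, (w j < w i)%N & N i j != 0]) ->
  exists v, (height w < height v)%N /\
    forall k : 'I_n.+1, \det (lead k (row_perm (v * w^-1)%g L)) != 0.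
Proof.
move=> [i0 [j0 [ji0 wji0 N0]]].
pose P m := [exists i : 'I_n, [exists j : 'I_n,
  [&& (j < i)%N, (w j < w i)%N, N i j != 0 & (i - j == m)%N] ] ].
have exP : exists m, P m.
  exists (i0 - j0)%N; apply/existsP; exists i0; apply/existsP; exists j0.
  by rewrite ji0 wji0 N0 eqxx.
case: (ex_minnP exP) => m /existsP[i /existsP[j /and4P[ji wji Nij /eqP mE]]] mini.
exists (tperm i j * w)%g; split; first exact: height_tperm.
rewrite mulgK; apply: (lead_tperm ji wji Nij) => p q qp wqp Npq.
rewrite mE; apply: mini; apply/existsP; exists p; apply/existsP; exists q.
by rewrite qp wqp Npq eqxx.
Qed.

End EigenOrder.
End Bruhat.

(** * Cell decompositions *)

Section ChartContinuity.
Variables (R : realType) (n : nat) (T : topologicalType).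
Local Notation C := R[i].
Local Notation M := 'M[C]_n.
Implicit Types f : T -> M.

Lemma cts_ainv f : continuous f -> (forall x, \det (f x) != 0) -> continuous (fun x => ainv (f x)).
Proof.
move=> cf d0; exact: (cts_scalemx (cts_inv d0 (cts_det cf)) (cts_adjugate cf)).
Qed.

Lemma cts_lead k f : continuous f -> continuous (fun x => lead k (f x)).
Proof.
move=> cf; apply: mx_cts => i j.
refine (@cts_ext _ _ (fun x => if (i < k)%N && (j < k)%N then f x i j else (i == j)%:R) _ _ _).
  by move=> x; rewrite mxE.
case: (_ && _); [exact: (cts_entry i j cf)|exact: cts_cst].
Qed.

Lemma cts_cmx f : continuous f -> (forall x k, \det (lead k (f x)) != 0) ->
  continuous (fun x => cmx (f x)).
Proof.
move=> cf d0; apply: mx_cts => i k.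
refine (@cts_ext _ _ (fun x => ainv (lead k.+1 (f x)) i k) _ _ _); first by move=> x; rewrite [RHS]mxE.
refine (cts_entry i k _); apply: cts_ainv => [|x]; [exact: cts_lead|exact: d0].
Qed.

Lemma cts_qmx f : continuous f -> (forall x, f x \in unitmx) -> continuous (fun x => qmx (f x)).
Proof.
move=> cf uf.
have cG : continuous (fun x => gram_mx (f x)).
  apply: cts_cmx; first exact: (cts_mulmx (cts_adjoint cf) cf).
  by move=> x k; exact: gram_lead.
have cN : continuous (fun x => norm_mx (f x)).
  apply: mx_cts => i j.
  refine (@cts_ext _ _ (fun x => ((Num.sqrt (complex.Re (gram_mx (f x) i i)))^-1)%:C *+ (i == j)) _ _ _).
    by move=> x; rewrite !mxE.
  case: (i == j); last exact: cts_cst.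
  refine (cts_comp (cts_inv _ _) (@cts_real_complex R)) => [x|].
    have := qr_diag (qmx_qr (uf x)) i; rewrite /norm_mx mul_mx_diag !mxE.
    by move=> h; apply: contraTneq h => ->; rewrite invr0 mulr0 ltxx.
  exact: (cts_comp (cts_comp (cts_entry i i cG) (@cts_Re R)) (@sqrt_continuous R)).
exact: (cts_mulmx (cts_mulmx cf cG) cN).
Qed.

Lemma cts_eigen_rows (del : 'I_n -> C) f : injective del -> continuous f ->
  (forall x, lower (f x) /\ forall i, f x i i = del i) ->
  continuous (fun x => eigen_rows del (f x)).
Proof.
move=> di cf lf; apply: mx_cts => i j.
refine (@cts_ext _ _ (fun x => ainv (eigen_mx del (f x) i) i j) _ _ _); first by move=> x; rewrite [RHS]mxE.
refine (cts_entry i j _); apply: cts_ainv => [|x]; last first.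
  by have [lx dx] := lf x; exact: eigen_mx_det.
apply: mx_cts => a b.
refine (@cts_ext _ _ (fun x => f x a b - (a == b)%:R * del i + ((a == i) && (b == i))%:R) _ _ _).
  by move=> x; rewrite mxE.
exact: (cts_add (cts_add (cts_entry a b cf) (cts_cst _)) (cts_cst _)).
Qed.

Lemma cts_lmx f : continuous f -> (forall x, big_cell (f x)) -> continuous (fun x => lmx (f x)).
Proof.
move=> cf bf; refine (cts_mulmx cf _); apply: cts_cmx => // x; exact: big_cellP.
Qed.

Lemma cts_mchart (del : 'I_n -> R) f : continuous f -> (forall x, big_cell (f x)) ->
  continuous (fun x => mchart del (f x)).
Proof.
move=> cf bf; have cl := cts_lmx cf bf.
exact: (cts_mulmx (cts_mulmx (cts_adjugate cl) (cts_cst _)) cl).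
Qed.

Lemma cts_xchart (del : 'I_n -> R) f : continuous f -> (forall x, big_cell (f x)) ->
  continuous (fun x => xchart del (f x)).
Proof.
move=> cf bf; have cl := cts_lmx cf bf.
have ct : continuous (fun x => tchart (f x)).
  refine (cts_mulmx (cts_adjoint _) cf); apply: cts_qmx => // x.
  by apply: lowuni_unit; case: (big_cell_lu (bf x)).
exact: (cts_mulmx (cts_mulmx (cts_adjoint ct) (@cts_mchart del f cf bf)) ct).
Qed.

Lemma cts_row_perm (s : 'S_n) f : continuous f -> continuous (fun x => row_perm s (f x)).
Proof.
move=> cf; apply: mx_cts => i j.
refine (@cts_ext _ _ (fun x => f x (s i) j) _ _ _); first by move=> x; rewrite mxE.
exact: (cts_entry _ _ cf).
Qed.

End ChartContinuity.

(** * The cell space relative to its bad coordinates *)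

Section CellPair.
Variables (R : realType) (n : nat).
Local Notation C := R[i].
Local Notation M := 'M[C]_n.
Variables (h : 'I_n -> 'I_n) (del : 'I_n -> R) (bad : pred ('I_n * 'I_n)).
Hypothesis h_ge : forall i : 'I_n, (i <= h i)%N.
Hypothesis bad_low : forall p, bad p -> (p.2 < p.1)%N /\ (p.1 <= h p.2)%N.
Local Notation K := (@cell_space R n del h).

Definition bads := [seq p <- enum {: 'I_n * 'I_n} | bad p].
(** Real coordinate q is the real part (q even) or imaginary part (q odd) of the bad entry number
    q/2; out of range the value is [None]. *)
Definition badp q := nth None [seq Some p | p <- bads] q./2.

Lemma badpP q : (q < (size bads).*2)%N ->
  exists p, [/\ badp q = Some p, bad p & index p bads = q./2].
Proof.
move=> qs; have qs' : (q./2 < size bads)%N by rewrite ltn_half_double.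
case E : bads qs' => [//|p0 s0]; rewrite -E => qs'.
exists (nth p0 bads q./2); split; first by rewrite /badp (nth_map p0).
  by have := mem_nth p0 qs'; rewrite mem_filter => /andP[].
by rewrite index_uniq// filter_uniq// enum_uniq.
Qed.

Lemma bad_badp p (b : bool) : bad p ->
  badp ((index p bads).*2 + b) = Some p /\ ((index p bads).*2 + b < (size bads).*2)%N.
Proof.
move=> bp; have pm : p \in bads by rewrite mem_filter bp mem_enum.
have ps : (index p bads < size bads)%N by rewrite index_mem.
rewrite /badp; have -> : (((index p bads).*2 + b)./2 = index p bads)%N by case: b; lia.
by split; [rewrite (nth_map p)// nth_index|case: b; lia].
Qed.

Definition cell_coord q (N : M) : R :=
  if badp q is Some p then
    (if odd q then complex.Im (N p.1 p.2) else complex.Re (N p.1 p.2)) else 0.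

Definition cell_line (p x : M) (t : R) : M := (1 - t)%:C *: x + t%:C *: p.

Definition cell_unit (b : bool) q : M := \matrix_(k, l)
  if k == l then (del k)%:C else if badp q == Some (k, l) then
    (if odd q then 0 +i* (-1) ^+ b else ((-1) ^+ b)%:C) else 0.

Let Re_scale (r : R) (z : C) : complex.Re (r%:C * z) = r * complex.Re z.
Proof. by case: z => a b /=; rewrite mul0r subr0. Qed.

Let Im_scale (r : R) (z : C) : complex.Im (r%:C * z) = r * complex.Im z.
Proof. by case: z => a b /=; rewrite mul0r addr0. Qed.

Lemma cell_space_diag : K (real_diag del).
Proof.
split=> [i j ij|i|i j hij]; rewrite !mxE ?eqxx ?mulr1n//.
  by case: eqP => // E; rewrite E ltnn in ij.
by case: eqP => // E; have := h_ge j; rewrite leqNgt -{2}E hij.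
Qed.

Lemma cell_space_unit b q : (q < (size bads).*2)%N -> K (cell_unit b q).
Proof.
move=> /badpP[p [E bp _]]; have [p21 ph] := bad_low bp.
split=> [i j ij|i|i j hij]; rewrite !mxE ?eqxx//.
  case: eqP => [ijE|_]; first by rewrite ijE ltnn in ij.
  rewrite E; case: eqP => // -[pE]; move: p21; rewrite pE /=.
  by rewrite ltnNge (ltnW ij).
case: eqP => [ijE|_]; first by have := h_ge j; rewrite leqNgt -{2}ijE hij.
rewrite E; case: eqP => // -[pE]; move: ph; rewrite pE /=.
by rewrite leqNgt hij.
Qed.

Lemma cell_coord_unit b i j : (i < (size bads).*2)%N -> (j < (size bads).*2)%N ->
  cell_coord i (cell_unit b j) = (-1) ^+ b * (i == j)%:R.
Proof.
move=> /badpP[p [Ep bp ip]] /badpP[p' [Ep' _ ip']]; have [p21 _] := bad_low bp.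
rewrite /cell_coord Ep !mxE (_ : (p.1 == p.2) = false); last first.
  by apply/eqP => E; rewrite E ltnn in p21.
rewrite Ep' -surjective_pairing (inj_eq (@Some_inj _)) [p' == p]eq_sym.
have [pp|pp] := eqVneq p p'; last first.
  have -> : (i == j) = false.
    apply/eqP => ij; move: Ep; rewrite ij Ep' => -[E]; by rewrite E eqxx in pp.
  by rewrite mulr0; case: (odd i).
have ij2 : i./2 = j./2 by rewrite -ip -ip' pp.
have -> : (i == j) = (odd i == odd j).
  rewrite -[in LHS](odd_double_half i) -[in LHS](odd_double_half j) ij2 eqn_add2r.
  by case: (odd i); case: (odd j).
by case: (odd i); case: (odd j); rewrite /= ?mulr1 ?mulr0.
Qed.

Lemma cell_pair_free k :
  rel_free (@lands R M K)
    (lands (K `&` [set N : M | exists p, bad p /\ N p.1 p.2 != 0])) k (k == (size bads).*2)%N.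
Proof.
have -> : K `&` [set N : M | exists p, bad p /\ N p.1 p.2 != 0] =
    K `&` nonzero_coord cell_coord (size bads).*2.
  congr (_ `&` _); apply/seteqP; split=> N.
    move=> [p [bp Np]]; have [Nr|Nr] := eqVneq (complex.Re (N p.1 p.2)) 0.
      have [E l] := bad_badp true bp; exists ((index p bads).*2 + true)%N => //.
      rewrite /cell_coord E oddD odd_double /=; apply: contra Np => /eqP Ni.
      by rewrite eq_complex /= Nr Ni !eqxx.
    have [E l] := bad_badp false bp; exists ((index p bads).*2 + false)%N => //.
    by rewrite /cell_coord E oddD odd_double.
  move=> [q /badpP[p [E bp _]]]; rewrite /cell_coord E => Nq; exists p; split=> //.
  by apply: contraNneq Nq => ->; case: (odd q).
have ce (i j : 'I_n) : continuous (fun N : M => N i j) by exact: coord_continuous.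
apply: (@convex_pair_free R M K cell_line cell_coord (size bads).*2 (real_diag del) cell_unit) => //.
- move=> p; have c1 : continuous (fun x : M * R => (1 - x.2)%:C : C).
    exact: (cts_comp (cts_add (cts_cst _) (cts_opp cts_snd)) (@cts_real_complex R)).
  refine (cts_addmx (cts_scalemx c1 cts_fst) (cts_scalemx _ (cts_cst _))).
  exact: (cts_comp cts_snd (@cts_real_complex R)).
- by move=> p x; rewrite /cell_line subr0 scale1r scale0r addr0.
- by move=> p x; rewrite /cell_line subrr scale0r scale1r add0r.
- move=> p x t [lp dp hp] [lx dx hx] _; split=> [i j ij|i|i j hij]; rewrite /cell_line !mxE.
  + by rewrite lp// lx// !mulr0 addr0.
  + by rewrite dp dx -mulrDl -rmorphD subrK mul1r.
  + by rewrite hp// hx// !mulr0 addr0.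
- move=> q; rewrite /cell_coord; case: (badp q) => [p|]; last exact: cts_cst.
  by case: (odd q); [exact: (cts_comp (@ce _ _) (@cts_Im R))|exact: (cts_comp (@ce _ _) (@cts_Re R))].
- move=> q p x t; rewrite /cell_coord; case: (badp q) => [ij|]; last by rewrite !mulr0 addr0.
  rewrite /cell_line !mxE; case: (odd q); first by rewrite raddfD /= !Im_scale.
  by rewrite raddfD /= !Re_scale.
- exact: cell_space_diag.
- by move=> b j; exact: cell_space_unit.
- by move=> b i j; exact: cell_coord_unit.
Qed.

End CellPair.

Section BigCells.
Variables (R : realType) (n : nat).
Local Notation C := R[i].
Local Notation M := 'M[C]_n.

Lemma upper_inv (B : M) : upper B -> B \in unitmx -> upper (invmx B).
Proof.
move=> uB Bu; have BV : B *m invmx B = 1%:M by rewrite mulmxV.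
have /forallP B0 : [forall i, B i i != 0] by rewrite -upper_unit.
apply: upper_quotient uB B0 _ BV => i j ji.
by rewrite mxE; case: eqP => // E; rewrite E ltnn in ji.
Qed.

Lemma big_cell_upper (g B : M) : big_cell g -> upper B -> B \in unitmx -> big_cell (g *m B).
Proof.
move=> cg uB Bu; have uV := upper_inv uB Bu; have Vu : invmx B \in unitmx by rewrite unitmx_inv.
by have := lu_big_cell (lu_upper_mul (big_cell_lu cg) uV Vu); rewrite invmxK.
Qed.

(** An upper triangular factor on the right does not affect leading minors being nonzero. Membership
    in the other cells can thus be read on L. *)
Lemma big_cell_lu_rows (s : 'S_n) (g L B : M) : lu g L B ->
  big_cell (row_perm s g) <-> big_cell (row_perm s L).
Proof.
move=> H; have [_ uB B0 gB] := H; have Bu := lu_unit H; split=> c.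
  by rewrite -gB row_permE mulmxA -row_permE; exact: big_cell_upper.
have -> : g = L *m invmx B by rewrite -gB mulmxK.
rewrite row_permE mulmxA -row_permE; apply: big_cell_upper c _ _.
  exact: upper_inv.
by rewrite unitmx_inv.
Qed.

End BigCells.

Lemma exists_big_cell (R : realType) n (U : 'M[R[i] ]_n) : U \in unitmx ->
  exists w : 'S_n, big_cell (row_perm w U).
Proof.
case: n U => [|n] U uU.
  by exists 1%g => k; rewrite det_mx00 oner_eq0.
have := cormen_lup_correct U; have := cormen_lup_perm U; have := @cormen_lup_lower _ n U.
have := @cormen_lup_upper _ n U; case: (cormen_lup U) => -[P L] B /= uB lL /is_perm_mxP[s ->] E.
have lL' : lowuni L.
  split=> [i j ij|i]; rewrite lL ?eqxx// 1?ltnW//.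
  by case: eqP => // ijE; rewrite ijE ltnn in ij.
have {}E : row_perm s U = L *m B by rewrite row_permE.
have Bu : B \in unitmx.
  have : L *m B \in unitmx by rewrite -E row_permE unitmx_mul uU unitmx_perm.
  by rewrite unitmx_mul => /andP[].
exists s; apply: (@lu_big_cell _ _ _ L (invmx B)); have uV := upper_inv uB Bu.
split=> //; last by rewrite E mulmxK.
by have : invmx B \in unitmx by [rewrite unitmx_inv]; rewrite upper_unit// => /forallP h i; exact: h.
Qed.

(** * Cells indexed by permutations *)

Section Cells.
Variables (R : realType) (n : nat).
Local Notation C := R[i].
Local Notation M := 'M[C]_n.
Variables (h : 'I_n -> 'I_n) (lam : 'I_n -> R).
Hypotheses (lam_inj : injective lam) (h_ge : forall i : 'I_n, (i <= h i)%N).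
Hypothesis h_mono : forall i j : 'I_n, (i <= j)%N -> (h i <= h j)%N.

Definition hess_unitary : set M :=
  [set U | U \is unitarymx /\ hess h (conj_diag lam U)].
Local Notation Z := hess_unitary.

Definition wlam (w : 'S_n) i := lam (w i).

Lemma wlam_inj w : injective (wlam w).
Proof. by move=> i j /lam_inj/perm_inj. Qed.

Lemma conj_diag_row_perm w U : conj_diag lam U = conj_diag (wlam w) (row_perm w U).
Proof.
apply/matrixP => i j; rewrite !conj_diagE (reindex_inj (@perm_inj _ w)).
by apply: eq_bigr => k _; rewrite !mxE.
Qed.

Lemma row_perm_unitary (w : 'S_n) (U : M) : (row_perm w U \is unitarymx) = (U \is unitarymx).
Proof.
have aux (s : 'S_n) (V : M) : V \is unitarymx -> row_perm s V \is unitarymx.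
  move=> uV; have VV := adjointMV uV; apply/unitarymxP/matrixP => i j.
  have /matrixP/(_ (s i) (s j)) := VV; rewrite !mxE (inj_eq perm_inj) => <-.
  by apply: eq_bigr => k _; rewrite !mxE.
apply/idP/idP; last exact: aux.
by move=> /(aux w^-1%g); rewrite -row_permM mulVg row_perm1.
Qed.

(** Projects all matrices onto the cell space, so that the section becomes total and continuous, as
    [chart_free] requires. *)
Definition retract w (N : M) : M := \matrix_(i, j)
  if i == j then (wlam w i)%:C else if (j < i)%N && (i <= h j)%N then N i j else 0.

Lemma retract_cell w N : cell_space (wlam w) h (retract w N).
Proof.
split=> [i j ij|i|i j hij]; rewrite mxE ?eqxx//.
  case: eqP => [E|_]; first by rewrite E ltnn in ij.
  by rewrite ltnNge ltnW.
case: eqP => [E|_]; first by have := h_ge j; rewrite leqNgt -{2}E hij.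
by rewrite [(i <= h j)%N]leqNgt hij andbF.
Qed.

Lemma retract_id w N : cell_space (wlam w) h N -> retract w N = N.
Proof.
move=> [lN dN hN]; apply/matrixP => i j; rewrite mxE; have [<-|ij] := eqVneq i j; first by rewrite dN.
have [ji|] := ltnP j i; last first.
  by rewrite leq_eqVlt (inj_eq val_inj) (negPf ij) /= => /lN ->.
by have [//|/hN ->] := leqP i (h j).
Qed.

Lemma retract_cts w : continuous (retract w).
Proof.
apply: mx_cts => i j.
refine (@cts_ext _ _ (fun N : M => if i == j then (wlam w i)%:C
  else if (j < i)%N && (i <= h j)%N then N i j else 0) _ _ _); first by move=> N; rewrite mxE.
case: (i == j); first exact: cts_cst.
by case: (_ && _); [exact: coord_continuous|exact: cts_cst].
Qed.

Definition cell_section w (N : M) : M :=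
  row_perm w^-1%g (csection (wlam w) (retract w N)).

Lemma row_perm_section w N : row_perm w (cell_section w N) = csection (wlam w) (retract w N).
Proof. by rewrite /cell_section -row_permM mulgV row_perm1. Qed.

Lemma cell_section_subproof w N : cell_section w N \in Z.
Proof.
have [ug _ hg _ _] := csectionP (@wlam_inj w) h_mono (retract_cell w N).
apply/mem_set; split; first by rewrite /cell_section row_perm_unitary.
by rewrite (conj_diag_row_perm w) row_perm_section.
Qed.
Definition zsection w N : Z := exist (fun U => U \in Z) _ (cell_section_subproof w N).

Lemma zsection_cts w : continuous (zsection w).
Proof.
refine (@sub_cts _ _ _ (zsection w) _); apply: cts_row_perm.
have dC : injective (fun i => (wlam w i)%:C : C) by move=> i j /complexI/wlam_inj.
have lr N := retract_cell w N.
apply: cts_qmx.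
  apply: (cts_eigen_rows dC (@retract_cts w)) => N; have [lN dN _] := lr N; by split.
move=> N; have [lN dN _] := lr N; apply: lowuni_unit.
by have [] := eigen_rowsP dC lN dN.
Qed.

Definition zcell w : set Z := [set U : Z | big_cell (row_perm w (val U))].

Lemma zcell_open w : open (zcell w).
Proof.
pose G (k : 'I_n.+1) := [set U : Z | \det (lead k (row_perm w (val U))) = 0].
have cG k : closed (G k).
  apply: (@cts_closed _ _ (fun U : Z => \det (lead k (row_perm w (val U)))) [set 0]).
    refine (cts_det (@cts_lead R n Z k _ _)); exact: (@cts_row_perm R n Z w _ cts_val).
  by apply: accessible_closed_set1; apply: hausdorff_accessible; exact: norm_hausdorff.
have -> : zcell w = ~` [set U : Z | exists k, G k U].
  apply/seteqP; split=> U /=; first by move=> cU [k /eqP]; rewrite (negPf (cU k)).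
  by move=> nG k; apply/eqP => Gk; apply: nG; exists k.
rewrite openC; exact: closed_exists.
Qed.

(** The free entries whose nonvanishing puts the point in a higher cell as well; their number is
    half the degree of the class contributed by w. *)
Definition bad_pair (w : 'S_n) : pred ('I_n * 'I_n) :=
  [pred p : 'I_n * 'I_n | [&& (p.2 < p.1)%N, (p.1 <= h p.2)%N & (w p.2 < w p.1)%N]].
Definition cell_dim w := (size (bads (bad_pair w))).*2.

Section Quotient.
Variables (X : topologicalType) (q : Z -> X).
Hypotheses (q_cts : continuous q) (q_open : forall O : set Z, open O -> open (q @` O)).
Hypothesis q_onto : forall x, exists U, q U = x.
Variable Phi : 'S_n -> M -> M.
Hypothesis Phi_cell : forall w g, g \is unitarymx -> big_cell g -> hess h (conj_diag (wlam w) g) ->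
  cell_space (wlam w) h (Phi w g).
Hypothesis Phi_section : forall w N, cell_space (wlam w) h N -> Phi w (csection (wlam w) N) = N.
Hypothesis Phi_cts : forall w (T : topologicalType) (f : T -> M), continuous f ->
  (forall x, big_cell (f x)) -> continuous (fun x => Phi w (f x)).
Hypothesis q_cell : forall w U U', q U = q U' -> zcell w U ->
  zcell w U' /\ Phi w (row_perm w (val U)) = Phi w (row_perm w (val U')).
Hypothesis q_section : forall w U, zcell w U ->
  q (zsection w (Phi w (row_perm w (val U)))) = q U.

Let V w := q @` zcell w.
Let r := projT1 (choice q_onto).
Let rK x : q (r x) = x := projT2 (choice q_onto) x.
Let phi w x := Phi w (row_perm w (val (r x))).
Let psi w N := q (zsection w N).

Let phiE w U : zcell w U -> phi w (q U) = Phi w (row_perm w (val U)).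
Proof. by move=> cU; have [_ ->] := q_cell (esym (rK (q U))) cU. Qed.

(** The chart goes through an arbitrary choice of representatives, made harmless by [q_cell].
    Continuity is checked on [zcell w] and descends because q is open. *)
Let phi_cts w x : V w x -> {for x, continuous (phi w)}.
Proof.
move=> [U0 cU0 <-] A; rewrite phiE// => nA.
pose f (u : zcell w) := Phi w (row_perm w (val (val u))).
have cf : continuous f.
  apply: Phi_cts; first exact: (@cts_row_perm R n (zcell w) w _ (cts_comp cts_val cts_val)).
  by move=> u; exact: (set_mem (valP u)).
pose u0 : zcell w := exist (fun u => u \in zcell w) U0 (mem_set cU0).
have [_ [[O oO <-] /= OU OA]] := cf u0 A nA.
apply: (@filterS _ _ _ (q @` (O `&` zcell w))).
  move=> _ [U [OU' cU] <-]; rewrite /= phiE//.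
  exact: (OA (exist (fun u => u \in zcell w) U (mem_set cU)) OU').
apply: open_nbhs_nbhs; split; last by exists U0.
by apply: q_open; apply: openI => //; exact: zcell_open.
Qed.

Let zcell_section w N : zcell w (zsection w N).
Proof.
rewrite /zcell /= row_perm_section.
have [_ [B H] _ _ _] := csectionP (@wlam_inj w) h_mono (retract_cell w N).
exact: lu_big_cell H.
Qed.

Let V_psi v w N : V v (psi w N) <-> zcell v (zsection w N).
Proof.
split=> [[U cU E]|c]; last by exists (zsection w N).
by have [] := q_cell E cU.
Qed.

Let V_phi w x : V w x -> cell_space (wlam w) h (phi w x).
Proof.
move=> [U cU <-]; rewrite phiE//; have [uU hU] := set_mem (valP U).
by apply: Phi_cell; [rewrite row_perm_unitary|exact: cU|rewrite -conj_diag_row_perm].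
Qed.

Lemma cell_meets w v (N : M) : cell_space (wlam w) h N ->
  let L := eigen_rows (fun i => (wlam w i)%:C) N in
  zcell v (zsection w N) <-> forall k : 'I_n.+1, \det (lead k (row_perm (v * w^-1)%g L)) != 0.
Proof.
move=> KN L; rewrite /zcell /= /cell_section -row_permM (retract_id KN).
have [_ [B H] _ _ _] := csectionP (@wlam_inj w) h_mono KN.
exact: (big_cell_lu_rows _ H).
Qed.

(** Of the earlier cells it matters that all higher ones are among them ([lead_cover]), and that
    none is lower than w or equal to w ([lead_disjoint]). Their trace on the cell is then the locus
    of nonzero bad coordinates. *)
Lemma cell_pair w (s : seq 'S_n) k :
  (forall v, v \in s -> (height w <= height v)%N /\ v != w) ->
  (forall v, (height w < height v)%N -> v \in s) ->
  rel_free (@lands R X (V w)) (lands (\big[setU/set0]_(j <- s) V j `&` V w)) k (k == cell_dim w)%N.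
Proof.
move=> s_le s_gt; rewrite -bigcup_seq.
pose B := cell_space (wlam w) h `&`
  [set N : M | exists p, bad_pair w p /\ N p.1 p.2 != 0].
have dC : injective (fun i => (wlam w i)%:C : C) by move=> i j /complexI/wlam_inj.
refine (@chart_free R X M (V w) _ (cell_space (wlam w) h) B (phi w) (psi w) 0
  _ _ _ _ _ _ _ _ _ k _ _).
- exact: (cts_comp (@zsection_cts w) q_cts).
- exact: phi_cts.
- by move=> x [U cU <-]; rewrite phiE// /psi q_section.
- move=> N KN; rewrite /psi phiE; last exact: zcell_section.
  by rewrite row_perm_section (retract_id KN) Phi_section.
- exact: V_phi.
- by move=> N KN; apply/V_psi; exact: zcell_section.
- by move=> x [].
- by move=> N [].
- move=> N KN; have [lN dN hN] := KN; have [lL LN] := eigen_rowsP dC lN dN.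
  have nz (p : 'I_n * 'I_n) : (p.2 < p.1)%N -> N p.1 p.2 != 0 -> (p.1 <= h p.2)%N.
    by move=> _; rewrite leqNgt; apply: contra => /hN ->.
  split=> [[[v /= vs Vv] _]|[_ [p [/and3P[p21 ph wp] Np]]]].
    split=> //; apply: contrapT => nb.
    have [hwv] := s_le v vs; move/V_psi/(cell_meets _ KN) : Vv => dL /eqP; apply.
    apply: (lead_disjoint dC lL lN dN LN _ dL hwv) => i j ji Nij.
    rewrite ltnNge leq_eqVlt; apply/negP => /orP[/eqP/val_inj/perm_inj E|wji].
      by rewrite E ltnn in ji.
    by apply: nb; exists (i, j); split=> //; apply/and3P; split=> //; exact: (nz (i, j)).
  have [|v [hv dL]] := lead_cover dC lL lN dN LN (w := w); first by exists p.1, p.2.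
  split; last by apply/V_psi; exact: zcell_section.
  exists v; first exact: s_gt.
  by apply/V_psi/(cell_meets _ KN).
- apply: cell_pair_free => //.
  by move=> p /and3P[].
Qed.

Definition cell_order := sort (fun v w => height w <= height v)%N (enum {: 'S_n}).

Lemma quotient_even_free :
  @even_free R X setT (fun k => count (fun w => k == cell_dim w)%N cell_order).
Proof.
have mem v : v \in cell_order by rewrite mem_sort mem_enum.
have -> : [set: X] = \big[setU/set0]_(w <- cell_order) V w.
  rewrite -bigcup_seq; apply/seteqP; split=> // x _; have [U <-] := q_onto x.
  have [uU _] := set_mem (valP U).
  have [w cw] := exists_big_cell (unitarymx_unit uU).
  by exists w; [exact: mem|exists U].
apply: even_free_cells.
- by move=> w; apply: q_open; exact: zcell_open.
- by move=> w; rewrite /cell_dim odd_double.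
move=> w1 w w2 E k.
have tr : transitive (fun v w : 'S_n => height w <= height v)%N.
  by move=> a b c ba ac; exact: leq_trans ac ba.
have tot : total (fun v w : 'S_n => height w <= height v)%N by move=> a b; exact: leq_total.
have := sort_sorted tot (enum {: 'S_n}); rewrite -/cell_order E (sorted_pairwise tr).
rewrite pairwise_cat pairwise_cons => /and3P[/allrelP a12 _ /andP[/allP aw _]].
have := enum_uniq {: 'S_n}; rewrite -(sort_uniq (fun v w => height w <= height v)%N) -/cell_order E.
rewrite cat_uniq => /and3P[_ /hasPn nw _].
apply: cell_pair => v.
  move=> vw1; split; first by apply: a12 => //; rewrite mem_head.
  by apply/eqP => vw; have := nw w (mem_head _ _); rewrite /= -vw vw1.
move=> hv; have := mem v; rewrite E mem_cat => /orP[//|].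
rewrite in_cons => /orP[/eqP vw|/aw]; first by rewrite vw ltnn in hv.
by rewrite leqNgt hv.
Qed.

End Quotient.
End Cells.

(** * The Hessenberg set of unitary matrices *)

Section HessUnitary.
Variables (R : realType) (n : nat).
Local Notation C := R[i].
Local Notation M := 'M[C]_n.
Local Notation torus := (torus R n).
Variables (h : 'I_n -> 'I_n) (lam : 'I_n -> R).
Hypotheses (lam_inj : injective lam) (h_ge : forall i : 'I_n, (i <= h i)%N).
Hypothesis h_mono : forall i j : 'I_n, (i <= j)%N -> (h i <= h j)%N.
Local Notation Z := (hess_unitary h lam).

Lemma conj_diag_right d (t : torus) U : conj_diag d (U *m torus_mx t) = mx_gact t^-1%g (conj_diag d U).
Proof.
have e : invmx (torus_mx t^-1%g) = torus_mx t := congr1 (@torus_mx R n) (invgK t).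
by rewrite /conj_diag /mx_gact adjointM torus_adjoint e !mulmxA.
Qed.

Lemma hess_biinvariant : biinvariant Z.
Proof.
split=> [U []//||t U [uU hU]|t U [uU hU]].
- apply: closedI; first exact: closed_unitary.
  apply: closed_forall => i; apply: closed_forall => j; apply: closed_imply.
  have cE : continuous (fun U : M => conj_diag lam U i j) := cts_entry i j (@cts_conj_diag R n lam).
  apply: (@cts_closed _ _ (fun U : M => conj_diag lam U i j) [set 0] cE).
  by apply: accessible_closed_set1; apply: hausdorff_accessible; exact: norm_hausdorff.
- have [_ ut] := andP (torusP t); split; first exact: mul_unitarymx ut uU.
  by rewrite conj_diag_left.
have [_ ut] := andP (torusP t); split; first exact: mul_unitarymx uU ut.
by move=> i j hij; rewrite conj_diag_right mx_gactE hU// mulr0 mul0r.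
Qed.
Local Notation bZ := hess_biinvariant.

Lemma pmx_unitary (s : 'S_n) : pmx R s \is unitarymx.
Proof.
apply/unitarymxP; rewrite pmx_adjoint; apply/matrixP => i j; rewrite !mxE.
rewrite (bigD1 ((s^-1)%g j))//= big1 ?addr0 => [|k kj]; last first.
  by rewrite !mxE (negPf kj) mulr0.
by rewrite !mxE permKV eqxx mulr1.
Qed.

Lemma conj_diag_blk d (s : 'S_n) i j (U : M) k l : blk s i j U -> k != l -> conj_diag d U k l != 0 ->
  ((k == i) && (l == j)) || ((k == j) && (l == i)).
Proof.
move=> bU kl; rewrite conj_diagE => A0.
have [m Umk Uml] : exists2 m, U m k != 0 & U m l != 0.
  apply: contrapT => hm; move/eqP: A0; apply; rewrite big1// => m _.
  have [->|Umk] := eqVneq (U m k) 0; first by rewrite rmorph0 !mul0r.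
  have [->|Uml] := eqVneq (U m l) 0; first by rewrite mulr0.
  by case: hm; exists m.
have E : k = tperm i j l.
  by case: (bU _ _ Umk) (bU _ _ Uml) => -> [] /perm_inj; [move/eqP; rewrite (negPf kl)
    | | move=> <-; rewrite tpermK | move/perm_inj/eqP; rewrite (negPf kl)].
move: kl; rewrite {}E; case: tpermP => [->|->|_ _]; rewrite ?eqxx ?orbT//.
Qed.

Lemma conj_diag_conj d (U : M) i j : conj_diag d U j i = Num.conj (conj_diag d U i j).
Proof.
have cr (r : R) : Num.conj (r%:C : C) = r%:C by rewrite /Num.conj /= oppr0.
rewrite !conj_diagE rmorph_sum; apply: eq_bigr => k _.
rewrite [RHS](_ : _ = Num.conj (Num.conj (U k i)) * Num.conj (d k)%:C * Num.conj (U k j));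
  last by rewrite !rmorphM.
by rewrite conjCK cr; ring.
Qed.

Lemma conj_diag_full d (s : 'S_n) i j (U : M) : injective d -> U \is unitarymx -> i != j ->
  blk s i j U -> full_blk s i j U -> conj_diag d U i j != 0.
Proof.
move=> d_inj uU ij bU [u1 u2 u3 u4]; rewrite conj_diagE (blk_sum (fun k => (d k)%:C) ij bU).
have := blk_sum (fun=> 1) ij bU; rewrite !mulr1.
under eq_bigr do rewrite mulr1; rewrite (column_orthogonal uU) (negPf ij) => /esym/eqP.
rewrite addr_eq0 => /eqP E; rewrite mulrAC E [Num.conj (U (s j) i) * _ * _]mulrAC mulNr -mulrN -mulrDr.
rewrite !mulf_neq0 ?conjC_eq0// addrC subr_eq0; apply/eqP => /complexI/d_inj/perm_inj/eqP.
by rewrite eq_sym (negPf ij).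
Qed.

(** A full block makes A_ij and A_ji nonzero, so h allows both positions; another unitary with the
    same block pattern has off-diagonal entries of A at these positions only. *)
Lemma hess_saturated : saturated Z.
Proof.
split=> [s|s i j U ij [uU hU] bU fU U' uU' bU'].
  split=> [|i j hij]; first exact: pmx_unitary.
  have ij : i != j by apply/eqP => E; have := h_ge j; rewrite -{1}E leqNgt hij.
  rewrite conj_diagE big1// => k _; rewrite !mxE.
  have [kj|] := eqVneq k (s j); last by rewrite mulr0.
  by rewrite kj (inj_eq perm_inj) eq_sym (negPf ij) rmorph0 !mul0r.
have Aij := conj_diag_full lam_inj uU ij bU fU.
have Aji : conj_diag lam U j i != 0 by rewrite conj_diag_conj conjC_eq0.
split=> // k l hkl; apply/eqP; apply: contraT => Akl.
have kl : k != l by apply/eqP => E; have := h_ge l; rewrite -{1}E leqNgt hkl.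
case/orP: (conj_diag_blk bU' kl Akl) => /andP[/eqP kE /eqP lE].
  by move: Aij; rewrite -kE -lE hU ?eqxx.
by move: Aji; rewrite -kE -lE hU ?eqxx.
Qed.

Lemma torus_perm_subproof (w : 'S_n) (t : torus) :
  let D : M := \matrix_(i, j) torus_mx t (w i) (w j) in is_diag_mx D && (D \is unitarymx).
Proof.
apply/andP; split.
  by apply/is_diag_mxP => i j ij; rewrite mxE torus_offdiag// (inj_eq perm_inj).
have [_ /adjointMV ut] := andP (torusP t); apply/unitarymxP/matrixP => i j.
have /matrixP/(_ (w i) (w j)) := ut; rewrite !mxE (inj_eq perm_inj) => <-.
rewrite [RHS](reindex_inj (@perm_inj _ w)); by apply: eq_bigr => k _; rewrite !mxE.
Qed.
Definition torus_perm w t : torus := Torus (torus_perm_subproof w t).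

Lemma row_perm_torus (w : 'S_n) (t : torus) (U : M) :
  row_perm w (torus_mx t *m U) = torus_mx (torus_perm w t) *m row_perm w U.
Proof.
apply/matrixP => i j; rewrite !mxE (reindex_inj (@perm_inj _ w)).
by apply: eq_bigr => k _; rewrite !mxE.
Qed.

Lemma row_permV (w : 'S_n) (U : M) : row_perm w^-1%g (row_perm w U) = U.
Proof. by rewrite -row_permM mulVg row_perm1. Qed.

Lemma row_perm_mul (w : 'S_n) (A B : M) : row_perm w (A *m B) = row_perm w A *m B.
Proof. by rewrite !row_permE mulmxA. Qed.

Section Left.
Variables (X : gspace torus) (mX : model Z lam X).

Lemma left_even_free :
  @even_free R X setT (fun k => count (fun w => k == cell_dim h w)%N (cell_order n)).
Proof.
refine (@quotient_even_free R n h lam lam_inj h_ge h_mono X (mpi mX) _ _ _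
  (fun w => xchart (wlam lam w)) _ _ _ _ _).
- exact: mpi_cts.
- by move=> O oO; exact: (@mpi_open _ _ _ _ _ bZ lam_inj mX _ oO).
- exact: mpi_onto.
- by move=> w g ug cg hg; have [] := xchart_cell (wlam_inj lam_inj (w := w)) h_mono ug cg hg.
- by move=> w N KN; have [_ _ _ _ E] := csectionP (wlam_inj lam_inj (w := w)) h_mono KN.
- by move=> w T f cf bf; exact: cts_xchart.
- move=> w U U' /(model_fiber bZ lam_inj mX)[t <-] cU.
  have uU : row_perm w (val U) \is unitarymx by rewrite row_perm_unitary; exact: (zsub_unitary bZ U).
  have [c E] := xchart_left (wlam lam w) (torus_perm w t) uU cU.
  rewrite -row_perm_torus in c E; split; first exact: c.
  exact: esym E.
move=> w U cU; apply/esym/(model_fiber bZ lam_inj mX).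
have uU : row_perm w (val U) \is unitarymx by rewrite row_perm_unitary; exact: (zsub_unitary bZ U).
have [_ hU] := set_mem (valP U); rewrite (conj_diag_row_perm lam w) in hU.
have [K [t tE]] := xchart_cell (wlam_inj lam_inj (w := w)) h_mono uU cU hU.
exists (torus_perm w^-1%g t); apply/val_inj.
change (torus_mx (torus_perm w^-1%g t) *m val U = cell_section h lam w (xchart (wlam lam w) (row_perm w (val U)))).
by rewrite /cell_section (retract_id K) tE row_perm_torus row_permV.
Qed.

End Left.

Section Right.
Variables (d : 'I_n -> R) (d_inj : injective d).
Variables (Y : gspace torus) (mY : model (adjoint_set Z) d Y).
Let bZ' := biinvariant_adjoint bZ.

Let q (U : Z) := mpi mY (zadj U).

Let q_fiber U U' : q U = q U' <-> exists t : torus, val U *m torus_mx t = val U'.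
Proof.
rewrite /q (model_fiber bZ' d_inj mY); split=> -[t E]; exists t^-1%g.
  have {}E : torus_mx t *m (val U)^t* = (val U')^t* := congr1 val E.
  by rewrite -[val U']trmxCK -E adjointM trmxCK torus_adjoint.
apply/val_inj; change (torus_mx t^-1%g *m (val U)^t* = (val U')^t*).
by rewrite -E adjointM torus_adjoint.
Qed.

Lemma right_even_free :
  @even_free R Y setT (fun k => count (fun w => k == cell_dim h w)%N (cell_order n)).
Proof.
refine (@quotient_even_free R n h lam lam_inj h_ge h_mono Y q _ _ _
  (fun w => mchart (wlam lam w)) _ _ _ _ _).
- exact: (cts_comp (@zadj_cts _ _ Z) (mpi_cts mY)).
- move=> O oO; rewrite (_ : q @` O = mpi mY @` (@zadj _ _ Z @` O)); last by rewrite image_comp.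
  exact: (@mpi_open _ _ _ _ _ bZ' d_inj mY _ (zadj_open oO)).
- by move=> y; have [U <-] := mpi_onto mY y; exists (zadj_inv U); rewrite /q zadj_invK.
- by move=> w g ug cg hg; exact: (mchart_cell h_mono ug cg hg).
- by move=> w N KN; have [_ _ _ E _] := csectionP (wlam_inj lam_inj (w := w)) h_mono KN.
- by move=> w T f cf bf; exact: cts_mchart.
- move=> w U U' /q_fiber[t tE] cU; have [c E] := mchart_right (wlam lam w) t cU.
  rewrite -row_perm_mul tE in c E; split; first exact: c.
  exact: esym E.
move=> w U cU; apply/q_fiber.
have uU : row_perm w (val U) \is unitarymx by rewrite row_perm_unitary; exact: (zsub_unitary bZ U).
have [_ hU] := set_mem (valP U); rewrite (conj_diag_row_perm lam w) in hU.
have K := mchart_cell h_mono uU cU hU.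
have [t [_ tE]] := tchart_torus uU cU; exists t.
change (cell_section h lam w (mchart (wlam lam w) (row_perm w (val U))) *m torus_mx t = val U).
rewrite /cell_section (retract_id K) (csection_mchart (wlam_inj lam_inj (w := w)) h_mono uU cU hU).
by rewrite -row_perm_mul tE row_permV.
Qed.

End Right.

Lemma betti_iso (d : 'I_n -> R) (X Y : gspace torus) :
  injective d -> model Z lam X -> model (adjoint_set Z) d Y ->
  forall k, exists phi : {additive cohomology R X k -> cohomology R Y k}, bijective phi.
Proof.
move=> d_inj mX mY k.
have [_ /(_ k) fX] := left_even_free mX; have [_ /(_ k) fY] := right_even_free d_inj mY.
exact: free_iso fX fY.
Qed.

End HessUnitary.

(** * The isospectral and Hessenberg varieties *)

Section StaircaseModel.
Variables (R : realType) (n : nat).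
Local Notation C := R[i].
Local Notation M := 'M[C]_n.
Local Notation torus := (torus R n).
Variables (h : 'I_n -> 'I_n) (lam : 'I_n -> R).
Hypotheses (lam_inj : injective lam).
Local Notation Z := (hess_unitary h lam).
Local Notation X := (isospectral_staircase h lam).

Lemma conj_diag_hermitian (U : M) : conj_diag lam U \is hermsymmx.
Proof.
rewrite is_hermitianmxE expr0 scale1r; apply/eqP/matrixP => i j.
by rewrite adjointE -conj_diag_conj.
Qed.

Lemma conj_diag_eigenvalue (U : M) (a : C) : U \is unitarymx ->
  eigenvalue (conj_diag lam U) a <-> exists i, a = (lam i)%:C.
Proof.
move=> uU; have UV := adjointMV uU; have VU := adjointVM uU; split.
  move=> /eigenvalueP[v vA v0].
  have uE : v *m U^t* *m real_diag lam = a *: (v *m U^t*).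
    by rewrite scalemxAl -vA /conj_diag -!mulmxA UV mulmx1.
  have [i ui] : exists i, (v *m U^t*) ord0 i != 0.
    apply: contrapT => nu; move/eqP: v0; apply.
    rewrite -[v]mulmx1 -VU mulmxA (_ : v *m U^t* = 0) ?mul0mx//.
    apply/rowP => i; rewrite [RHS]mxE; apply/eqP; apply: contraT => ui; case: nu; by exists i.
  exists i; have /rowP/(_ i) := uE; rewrite mul_mx_diag [LHS]mxE [RHS]mxE [X in _ * X = _]mxE.
  by rewrite [RHS]mulrC => /(mulfI ui).
move=> [i ->]; apply/eigenvalueP; exists (row i U).
  rewrite -row_mul /conj_diag !mulmxA UV mul1mx; apply/rowP => j.
  by rewrite mul_diag_mx !mxE.
apply/eqP => r0; have /matrixP/(_ i i) := UV; rewrite !mxE eqxx big1 => [/esym/eqP|k _].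
  by rewrite oner_eq0.
by have /rowP/(_ k) := r0; rewrite !mxE => ->; rewrite mul0r.
Qed.

Lemma staircase_subproof (U : Z) : conj_diag lam (val U) \in staircase_set h lam.
Proof.
have [uU hU] := set_mem (valP U); have hA := conj_diag_hermitian (val U).
apply/mem_set; split; split=> //; last by move=> a; exact: conj_diag_eigenvalue.
move=> i j /orP[hij|]; last exact: hU.
by rewrite conj_diag_conj hU// rmorph0.
Qed.
Definition staircase_pi (U : Z) : X :=
  exist (fun A => A \in staircase_set h lam) _ (staircase_subproof U).

(** The spectral theorem lists the eigenvalues in some order. The n distinct [lam i] all occur among
    its n entries, so the matching [tau] is a permutation of rows. *)
Lemma staircase_diagonalisable (A : M) : A \is hermsymmx ->
  (forall a : C, eigenvalue A a <-> exists i, a = (lam i)%:C) ->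
  exists2 U : M, U \is unitarymx & conj_diag lam U = A.
Proof.
move=> hA sA; have nA := hermitian_normalmx hA; have /orthomx_spectralP AE := nA.
have uP := spectral_unitarymx A; set P := spectralmx A in AE uP; set sp := spectral_diag A in AE.
rewrite (invmx_unitary uP) in AE.
have AE' i j : A i j = \sum_k Num.conj (P k i) * sp ord0 k * P k j.
  rewrite AE mxE; apply: eq_bigr => k _; by rewrite mul_mx_diag [X in X * _]mxE adjointE.
have spE i : exists k, sp ord0 k = (lam i)%:C.
  have /eigenvalueP[v vA v0] : eigenvalue A (lam i)%:C by apply/sA; exists i.
  have UV := adjointMV uP; have VU := adjointVM uP.
  have uE : v *m P^t* *m diag_mx sp = (lam i)%:C *: (v *m P^t*).
    by rewrite scalemxAl -vA AE -!mulmxA UV mulmx1.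
  have [k uk] : exists k, (v *m P^t*) ord0 k != 0.
    apply: contrapT => nu; move/eqP: v0; apply.
    rewrite -[v]mulmx1 -VU mulmxA (_ : v *m P^t* = 0) ?mul0mx//.
    apply/rowP => k; rewrite [RHS]mxE; apply/eqP; apply: contraT => uk; case: nu; by exists k.
  exists k; have /rowP/(_ k) := uE; rewrite mul_mx_diag [LHS]mxE [RHS]mxE.
  by rewrite [RHS]mulrC => /(mulfI uk).
have [tau tauE] := choice spE.
have tau_inj : injective tau by move=> i j ij; apply/lam_inj/complexI; rewrite -!tauE ij.
exists (row_perm (perm tau_inj) P); first by rewrite row_perm_unitary.
apply/matrixP => i j; rewrite conj_diagE AE' [RHS](reindex_inj (@perm_inj _ (perm tau_inj))).
by apply: eq_bigr => k _; rewrite !mxE permE tauE.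
Qed.

Definition staircase_model : model Z lam X.
Proof.
exists staircase_pi (fun x : X => val x).
- refine (@sub_cts _ _ _ staircase_pi _).
  exact: (cts_comp cts_val (@cts_conj_diag R n lam)).
- move=> x; have [[hA zA] [_ sA]] := set_mem (valP x).
  have [U uU UE] := staircase_diagonalisable hA sA.
  have ZU : U \in Z.
    by apply/mem_set; split=> // i j hij; rewrite UE zA// hij orbT.
  by exists (exist (fun U => U \in Z) U ZU); apply/val_inj.
- exact: cts_val.
- by move=> x y; exact: val_inj.
- by [].
- by [].
Defined.

End StaircaseModel.

(** * Flags as hermitian matrices *)

Section FlagModel.
Variables (R : realType) (n : nat).
Local Notation C := R[i].
Local Notation M := 'M[C]_n.
Local Notation torus := (torus R n).
Local Notation flag := (flag R n).
Local Notation GL := (@GL R n).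

Definition mkGL (g : M) (ug : g \in unitmx) : GL :=
  exist (fun g => g \in GL) g (mem_set ug).

Lemma GL_unit (g : GL) : val g \in unitmx.
Proof. exact: (set_mem (valP g)). Qed.

Lemma mem_flag_of (g : GL) (i : 'I_n.+1) (x : 'cV[C]_n) :
  x \in flag_of g i <-> forall a : 'I_n, (i <= a)%N -> (invmx (val g) *m x) a ord0 = 0.
Proof.
have ug := GL_unit g; rewrite /flag_of /= ffunE; split=> [|h].
  (* The projection onto the coordinates from i on; the first i columns of g span a subspace of the
     kernel of P g^-1. *)
  pose P : M := \matrix_(a, b) ((a == b) && (i <= a)%N)%:R.
  have PE y a : (P *m y) a ord0 = (i <= a)%N%:R * (y : 'cV[C]_n) a ord0.
    rewrite mxE (bigD1 a)//= big1 ?addr0 => [|b ba]; first by rewrite mxE eqxx.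
    by rewrite mxE eq_sym (negPf ba) mul0r.
  pose f := linfun (mulmx (P *m invmx (val g)) : 'cV[C]_n -> 'cV[C]_n).
  have fE y : f y = P *m (invmx (val g) *m y) by rewrite lfunE /= mulmxA.
  have sub : (<<[seq col j (val g) | j : 'I_n <- enum 'I_n & (j < i)%N]>> <= lker f)%VS.
    apply/span_subvP => _ /mapP[j + ->]; rewrite mem_filter => /andP[ji _].
    rewrite memv_ker fE; apply/eqP/colP => a; rewrite PE [RHS]mxE.
    have -> : invmx (val g) *m col j (val g) = col j 1%:M by rewrite colE mulmxA mulVmx// -colE.
    rewrite !mxE; have [->|aj] := eqVneq a j; last by rewrite mulr0.
    by rewrite leqNgt ji mul0r.
  move=> /(subvP sub); rewrite memv_ker fE => /eqP fx a ia.
  by have /colP/(_ a) := fx; rewrite PE ia mul1r [RHS]mxE.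
rewrite -(mulKVmx ug x); set w := invmx _ *m x in h *.
have -> : val g *m w = \sum_j w j ord0 *: col j (val g).
  by apply/colP => a; rewrite mxE summxE; apply: eq_bigr => j _; rewrite !mxE mulrC.
apply: memv_suml => j _; have [ij|ji] := leqP i j; first by rewrite h// scale0r mem0v.
by apply/memvZ/memv_span/map_f; rewrite mem_filter ji mem_enum.
Qed.

Lemma eq_flag (V V' : flag) : (forall i x, x \in V i <-> x \in V' i) -> V = V'.
Proof.
move=> h; apply/val_inj/ffunP => i; apply/vspaceP => x.
by apply/idP/idP => /h.
Qed.

Lemma flag_of_upper (g g' : GL) (B : M) : upper B -> B \in unitmx ->
  val g *m B = val g' -> flag_of g = flag_of g'.
Proof.
move=> uB Bu E; have ug := GL_unit g; have ug' := GL_unit g'.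
have /forallP B0 : [forall i, B i i != 0] by rewrite -upper_unit.
have VE (x : 'cV[C]_n) : invmx (val g) *m x = B *m (invmx (val g') *m x).
  by rewrite -{1}[x](mulKVmx ug') -E -!mulmxA mulKmx.
apply: eq_flag => i x; rewrite !mem_flag_of; split=> hx.
  by apply: (upper_solve uB B0) => a ia; rewrite -VE hx.
move=> a ia; rewrite VE mxE big1// => b _; have [ba|ab] := ltnP b a; first by rewrite uB ?mul0r.
by rewrite hx ?mulr0//; exact: leq_trans ab.
Qed.

Lemma flag_of_eq (g g' : GL) : flag_of g = flag_of g' -> upper (invmx (val g) *m val g').
Proof.
move=> E a j ja; have ug' := GL_unit g'.
have : col j (val g') \in flag_of g' (lift ord0 j).
  apply/mem_flag_of => b; rewrite /= /bump add1n => jb.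
  have -> : invmx (val g') *m col j (val g') = col j 1%:M by rewrite colE mulmxA mulVmx// -colE.
  by rewrite !mxE; case: eqP => // bj; rewrite bj ltnn in jb.
rewrite -E => /mem_flag_of/(_ a); rewrite /= /bump add1n => /(_ ja).
by rewrite -mulmx_col.
Qed.

Lemma qmx_unit (g : M) : g \in unitmx -> qmx g \in unitmx.
Proof. by move=> ug; apply: unitarymx_unit; case: (qmx_qr ug). Qed.

Lemma flag_of_qmx (g : GL) : flag_of (mkGL (qmx_unit (GL_unit g))) = flag_of g.
Proof.
have [_ uB B0 E] := qmx_qr (GL_unit g).
have Bu : gram_mx (val g) *m norm_mx (val g) \in unitmx.
  by rewrite upper_unit//; apply/forallP => i; rewrite gt_eqF.
exact: esym (flag_of_upper (g' := mkGL (qmx_unit (GL_unit g))) uB Bu E).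
Qed.

Lemma unitary_flag (U U' : GL) : val U \is unitarymx -> val U' \is unitarymx ->
  flag_of U = flag_of U' -> exists t : torus, val U *m torus_mx t = val U'.
Proof.
move=> uU uU' E; have uW := flag_of_eq E; have uW' := flag_of_eq (esym E).
have VE := invmx_unitary uU; have VE' := invmx_unitary uU'.
rewrite VE in uW; rewrite VE' in uW'; set W := (val U)^t* *m val U' in uW.
have dW : is_diag_mx W.
  apply/is_diag_mxP => i j; rewrite neq_ltn => /orP[ij|]; last exact: uW.
  have := uW' j i ij; rewrite -[val U]trmxCK -adjointM adjointE -/W => /eqP.
  by rewrite conjC_eq0 => /eqP.
have UW : W \is unitarymx := mul_unitarymx (etrans (trmxC_unitary _) uU) uU'.
have WP : is_diag_mx W && (W \is unitarymx) by rewrite dW.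
by exists (Torus WP); rewrite /= /W mulmxA (adjointMV uU) mul1mx.
Qed.

Lemma flag_of_torus (U U' : GL) (t : torus) : val U *m torus_mx t = val U' -> flag_of U = flag_of U'.
Proof.
apply: flag_of_upper (torus_unit t) => i j ji.
by rewrite torus_offdiag//; apply/eqP => E; rewrite E ltnn in ji.
Qed.

(** The columns are vectors chosen in each step of the flag outside the preceding one; dimension
    counting shows that they span. *)
Lemma flag_basis (V : flag) : exists g : GL, flag_of g = V.
Proof.
case: (andP (flagP V)) => /forallP dV /forallP sV.
have ex (i : 'I_n) : exists b, b \in V (lift ord0 i) /\ b \notin V (widen_ord (leqnSn n) i).
  apply: contrapT => nb; have : (V (lift ord0 i) <= V (widen_ord (leqnSn n) i))%VS.
    by apply/subvP => b bV; apply: contrapT => /negP nbV; apply: nb; exists b.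
  by move=> /dimvS; rewrite (eqP (dV _)) (eqP (dV _)) /= /bump add1n ltnn.
have [b bP] := choice ex; pose g : M := \matrix_(k, i) b i k ord0.
have gcol i : col i g = b i by apply/colP => k; rewrite !mxE.
pose S k := [seq col j g | j : 'I_n <- enum 'I_n & (j < k)%N].
have SV k (kn : (k < n.+1)%N) : (<<S k>> = V (Ordinal kn))%VS.
  elim: k kn => [|k IH] kn.
    rewrite /S (eq_filter (a2 := pred0)) ?filter_pred0 /= ?span_nil//.
    by apply/esym/eqP; rewrite -dimv_eq0 dV.
  have kn' : (k < n)%N by []. pose i := Ordinal kn'.
  have wi : widen_ord (leqnSn n) i = Ordinal (ltnW kn) by exact: val_inj.
  have li : lift ord0 i = Ordinal kn by apply: val_inj.
  have [bV nbV] := bP i; rewrite wi -IH in nbV; rewrite li in bV.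
  have sub : (<<S k>> + <[b i]> <= <<S k.+1>>)%VS.
    rewrite subv_add; apply/andP; split.
      apply: sub_span => _ /mapP[j + ->]; rewrite mem_filter => /andP[jk _].
      by apply: map_f; rewrite mem_filter mem_enum ltnS ltnW.
    by rewrite -memvE; apply: memv_span; rewrite -gcol; apply: map_f; rewrite mem_filter mem_enum ltnSn.
  have sub2 : (<<S k.+1>> <= V (Ordinal kn))%VS.
    apply/span_subvP => _ /mapP[j + ->]; rewrite mem_filter ltnS leq_eqVlt => /andP[/orP[/eqP jk|jk] _].
      by rewrite gcol (_ : j = i)//; apply: val_inj.
    have : col j g \in <<S k>>%VS by apply: memv_span; apply: map_f; rewrite mem_filter jk mem_enum.
    rewrite (IH (ltnW kn)); apply: subvP; have := sV i; by rewrite wi li.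
  apply/eqP; rewrite eqEdim sub2 (eqP (dV _)) /=.
  apply: leq_trans (dimvS sub); rewrite dimv_disjoint_sum.
    rewrite (IH (ltnW kn)) (eqP (dV _)) dim_vline; case: eqP => [b0|]; last by rewrite addn1.
    by move: nbV; rewrite b0 mem0v.
  apply/eqP; rewrite -subv0; apply/subvP => x; rewrite memv_cap => /andP[xS /vlineP[c xE]].
  have [c0|c0] := eqVneq c 0; first by rewrite xE c0 scale0r mem0v.
  by move: nbV; rewrite -[b i](scalerK c0) -xE memvZ.
have ug : g \in unitmx.
  have full : (<<S n>> = fullv)%VS.
    apply/eqP; rewrite eqEdim subvf (SV n (ltnSn n)) (eqP (dV _)) /= dimvf /dim /= muln1.
    by [].
  apply: contraT; rewrite unitmxE unitfE negbK => /det0P[v v0 vg]; move/eqP: v0; case.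
  pose f := linfun (mulmx v : 'cV[C]_n -> 'cV[C]_1).
  have sub : (<<S n>> <= lker f)%VS.
    apply/span_subvP => _ /mapP[j _ ->]; rewrite memv_ker lfunE /=.
    by rewrite colE mulmxA vg mul0mx.
  apply/rowP => i; have : delta_mx i ord0 \in lker f by apply: (subvP sub); rewrite full memvf.
  rewrite memv_ker lfunE /= -colE => /eqP/colP/(_ ord0).
  by rewrite !mxE.
exists (mkGL ug); apply/val_inj/ffunP => i; rewrite /= ffunE.
by have := SV i (ltn_ord i); rewrite (_ : Ordinal _ = i)//; exact: val_inj.
Qed.

Lemma mem_flag_gact (t : torus) (V : flag) i x :
  x \in flag_gact t V i <-> torus_mx t^-1%g *m x \in V i.
Proof.
rewrite /flag_gact /= ffunE; split=> [/memv_imgP[u uV ->]|xV].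
  by rewrite lfunE /= mulKmx ?torus_unit.
apply/memv_imgP; exists (torus_mx t^-1%g *m x) => //.
by rewrite lfunE /= mulKVmx ?torus_unit.
Qed.

Lemma flag_gact_of (t : torus) (g g' : GL) : torus_mx t *m val g = val g' ->
  flag_gact t (flag_of g) = flag_of g'.
Proof.
move=> E; apply: eq_flag => i x; rewrite mem_flag_gact !mem_flag_of.
have ug := GL_unit g; have ut := torus_unit t.
suff -> : invmx (val g') *m x = invmx (val g) *m (torus_mx t^-1%g *m x) by [].
have ug' := GL_unit g'; rewrite -E in ug' *.
have : torus_mx t *m val g *m (invmx (val g) *m (torus_mx t^-1%g *m x)) = x.
  by rewrite -mulmxA mulKVmx// mulKVmx.
by move=> {1}<-; rewrite mulKmx.
Qed.

Lemma flag_of_cts : continuous (@flag_of R n : GL -> flag).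
Proof. by apply/continuousP => A. Qed.

Variable d : 'I_n -> R.
Hypothesis d_inj : injective d.

(** The matrix U d U^* for a unitary basis U of the flag. The chosen basis does not matter, since
    another unitary basis differs by a torus element, which commutes with d ([unitary_flag_mx]). *)
Definition flag_mx (V : flag) : M :=
  conj_diag d ((qmx (val (projT1 (cid (flag_basis V)))))^t*).

Lemma unitary_flag_mx (U U' : GL) : val U \is unitarymx -> val U' \is unitarymx ->
  flag_of U = flag_of U' -> conj_diag d ((val U)^t*) = conj_diag d ((val U')^t*).
Proof.
move=> uU uU' /(unitary_flag uU uU')[t <-].
by rewrite adjointM torus_adjoint conj_diag_left.
Qed.

Lemma qmx_unitary (g : M) : g \in unitmx -> qmx g \is unitarymx.
Proof. by move=> /qmx_qr[]. Qed.

Lemma flag_mx_of (g : GL) : flag_mx (flag_of g) = conj_diag d ((qmx (val g))^t*).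
Proof.
rewrite /flag_mx; case: cid => g' /= E.
have u := qmx_unitary (GL_unit g); have u' := qmx_unitary (GL_unit g').
apply: (@unitary_flag_mx (mkGL (qmx_unit (GL_unit g'))) (mkGL (qmx_unit (GL_unit g))) u' u).
by rewrite !flag_of_qmx.
Qed.

Lemma flag_mx_unitary (U : GL) : val U \is unitarymx ->
  flag_mx (flag_of U) = conj_diag d ((val U)^t*).
Proof.
move=> uU; rewrite flag_mx_of; have u := qmx_unitary (GL_unit U).
apply: (@unitary_flag_mx (mkGL (qmx_unit (GL_unit U))) U u uU).
exact: flag_of_qmx.
Qed.

(** Flags carry the quotient topology of the invertible matrices, so continuity is that of the
    Gram-Schmidt formula upstairs. *)
Lemma flag_mx_cts : continuous flag_mx.
Proof.
apply/continuousP => O oO.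
suff H : flag_open (flag_mx @^-1` O) by exact H.
rewrite /flag_open.
have cF : continuous (fun g : GL => conj_diag d ((qmx (val g))^t*)).
  refine (cts_comp (cts_adjoint _) (@cts_conj_diag R n d)).
  by apply: cts_qmx; [exact: cts_val|move=> g; exact: GL_unit].
have -> : @flag_of R n @^-1` (flag_mx @^-1` O) =
    (fun g : GL => conj_diag d ((qmx (val g))^t*)) @^-1` O.
  by apply/seteqP; split=> g; rewrite /preimage /= flag_mx_of.
exact: (cts_open cF oO).
Qed.

Lemma unitary_basis (V : flag) : exists U : GL, val U \is unitarymx /\ flag_of U = V.
Proof.
have [g <-] := flag_basis V; exists (mkGL (qmx_unit (GL_unit g))); split.
  exact: qmx_unitary (GL_unit g).
exact: flag_of_qmx.
Qed.

Lemma flag_mx_inj : injective flag_mx.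
Proof.
move=> V V'; have [U [uU <-]] := unitary_basis V; have [U' [uU' <-]] := unitary_basis V'.
rewrite !flag_mx_unitary// /conj_diag !trmxCK => E.
have VU := adjointVM uU; have VU' := adjointVM uU'; have UV := adjointMV uU.
pose W := (val U)^t* *m val U'.
have dW : is_diag_mx W.
  apply: (real_diag_comm d_inj); rewrite /W.
  have := congr1 (fun A => (val U)^t* *m A *m val U') E.
  by rewrite !mulmxA VU mul1mx -!mulmxA VU' mulmx1 !mulmxA => ->.
have UW : W \is unitarymx := mul_unitarymx (etrans (trmxC_unitary _) uU) uU'.
have WP : is_diag_mx W && (W \is unitarymx) by rewrite dW.
by apply: (@flag_of_torus _ _ (Torus WP)); rewrite /= /W mulmxA UV mul1mx.
Qed.

Lemma flag_mx_gact (t : torus) V : flag_mx (flag_gact t V) = mx_gact t (flag_mx V).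
Proof.
have [U [uU <-]] := unitary_basis V; have [_ ut] := andP (torusP t).
have utU : torus_mx t *m val U \is unitarymx := mul_unitarymx ut uU.
rewrite (@flag_gact_of t U (mkGL (unitarymx_unit utU)) erefl) !flag_mx_unitary//.
by rewrite [in LHS]adjointM torus_adjoint conj_diag_right invgK.
Qed.

Section Hessenberg.
Variables (h : 'I_n -> 'I_n) (lam : 'I_n -> R).
Hypothesis h_mono : forall i j : 'I_n, (i <= j)%N -> (h i <= h j)%N.
Local Notation Z := (hess_unitary h lam).
Local Notation Y := (hessenberg_variety h lam).

Lemma flag_hess (U : GL) : val U \is unitarymx ->
  hessenberg_set h lam (flag_of U) <-> hess h (conj_diag lam (val U)).
Proof.
move=> uU; have uU' := GL_unit U; have VE := invmx_unitary uU.
have AE (x : 'cV[C]_n) : invmx (val U) *m (real_diag lam *m x) =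
    conj_diag lam (val U) *m (invmx (val U) *m x).
  by rewrite VE /conj_diag -!mulmxA [val U *m _]mulmxA (adjointMV uU) mul1mx.
split=> [H i j hij|hU j].
  have jV : col j (val U) \in flag_of U (lift ord0 j).
    apply/mem_flag_of => b; rewrite /= /bump add1n => jb.
    have -> : invmx (val U) *m col j (val U) = col j 1%:M by rewrite colE mulmxA mulVmx// -colE.
    by rewrite !mxE; case: eqP => // bj; rewrite bj ltnn in jb.
  have := subvP (H j) _ (memv_img _ jV); rewrite lfunE /= => /mem_flag_of/(_ i).
  rewrite /= /bump add1n => /(_ hij); rewrite AE.
  have -> : invmx (val U) *m col j (val U) = col j 1%:M by rewrite colE mulmxA mulVmx// -colE.
  by rewrite -mulmx_col mulmx1.
apply/subvP => _ /memv_imgP[x xV ->]; rewrite lfunE /=; apply/mem_flag_of => a.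
rewrite /= /bump add1n => ha; rewrite AE mxE big1// => b _.
have [bj|jb] := leqP b j.
  by rewrite hU ?mul0r//; exact: leq_ltn_trans (h_mono bj) ha.
by move/mem_flag_of: xV => /(_ b) ->; rewrite ?mulr0//= /bump add1n.
Qed.

Lemma adjoint_unitary (V : adjoint_set Z) : (val V)^t* \is unitarymx.
Proof. by have [] := set_mem (valP V). Qed.

Definition frame (V : adjoint_set Z) : GL := mkGL (unitarymx_unit (adjoint_unitary V)).

Lemma flag_pi_subproof (V : adjoint_set Z) : flag_of (frame V) \in hessenberg_set h lam.
Proof.
apply/mem_set/flag_hess; first exact: adjoint_unitary.
by have [] := set_mem (valP V).
Qed.
Definition flag_pi (V : adjoint_set Z) : Y :=
  exist (fun V => V \in hessenberg_set h lam) _ (flag_pi_subproof V).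

Definition hessenberg_model : model (adjoint_set Z) d Y.
Proof.
exists flag_pi (fun y : Y => flag_mx (val y)).
- refine (@sub_cts _ _ _ flag_pi _).
  have cf : continuous frame by refine (@sub_cts _ _ _ frame _); exact: (cts_adjoint cts_val).
  exact: (cts_comp cf flag_of_cts).
- move=> y; have [U [uU UE]] := unitary_basis (val y).
  have hU : hess h (conj_diag lam (val U)).
    by apply/(flag_hess uU); rewrite UE; exact: set_mem (valP y).
  have ZU : (val U)^t* \in adjoint_set Z by apply/mem_set; rewrite /adjoint_set /= trmxCK.
  exists (exist (fun V => V \in adjoint_set Z) _ ZU); apply/val_inj; rewrite /= -UE.
  by congr flag_of; apply/val_inj; rewrite /= trmxCK.
- exact: (cts_comp cts_val flag_mx_cts).
- by move=> y y' /flag_mx_inj/val_inj.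
- move=> V; rewrite -[val (flag_pi V)]/(flag_of (frame V)) flag_mx_unitary; last exact: adjoint_unitary.
  by rewrite -[val (frame V)]/((val V)^t*) trmxCK.
- by move=> t y; exact: flag_mx_gact.
Defined.

End Hessenberg.
End FlagModel.

Theorem theorem11 (R : realType) (n : nat) (h : 'I_n -> 'I_n)
    (hess_h : hessenberg h) (lam : 'I_n -> R)
    (lam_incr : forall i j : 'I_n, (i < j)%N -> lam i < lam j) :
  let X := isospectral_staircase h lam in
  let Y := hessenberg_variety h lam in
  [/\ exists f : orbit_space X -> orbit_space Y,
        homeomorphism f /\
        forall k, f @` orbit_filtration X k = orbit_filtration Y k,
      exists f : gkm_vertex X -> gkm_vertex Y,
        bijective f /\ forall p q, gkm_edge p q <-> gkm_edge (f p) (f q),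
      exists phi : forall k, {additive cohomology R (borel_construction X) k ->
                                       cohomology R (borel_construction Y) k},
        graded_ring_iso phi &
      forall i, exists phi : {additive cohomology R X i.*2 ->
                                       cohomology R Y i.*2},
        bijective phi].
Proof.
have [h_ge h_succ] := hess_h.
have h_mono (i j : 'I_n) : (i <= j)%N -> (h i <= h j)%N.
  move=> ij; have [m jE] : exists m, j = (i + m)%N :> nat by exists (j - i)%N; rewrite subnKC.
  elim: m j {ij} jE => [|m IH] j jE; first by have -> : j = i by apply: ord_inj; rewrite jE addn0.
  have mn : (i + m < n)%N by have := ltn_ord j; rewrite jE addnS; exact: ltnW.
  apply: leq_trans (IH (Ordinal mn) erefl) (h_succ _ _ _).
  by rewrite jE addnS.
have lam_inj : injective lam.
  move=> i j lij; have [ij|ji|/ord_inj //] := ltngtP i j.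
    by have := lam_incr i j ij; rewrite lij ltxx.
  by have := lam_incr j i ji; rewrite lij ltxx.
(* Any distinct real numbers would serve: this spectrum only embeds flags in hermitian matrices and
   is independent of Lambda. *)
pose d (i : 'I_n) : R := (i : nat)%:R.
have d_inj : injective d by move=> i j /eqP; rewrite eqr_nat => /eqP/ord_inj.
move=> X Y; have mX : model (hess_unitary h lam) lam X := staircase_model h lam_inj.
have mY : model (adjoint_set (hess_unitary h lam)) d Y := hessenberg_model d_inj lam h_mono.
have bZ := hess_biinvariant h lam; have sZ := hess_saturated lam_inj h_ge.
split.
- exact: (orbit_spaces_homeo bZ lam_inj d_inj mX mY).
- exact: (gkm_graph_iso bZ sZ lam_inj d_inj mX mY).
- exact: (borel_cohomology_iso bZ lam_inj d_inj mX mY).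
by move=> i; exact: (betti_iso lam_inj h_ge h_mono d_inj mX mY).
Qed.
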